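(* Let $k\ge7$ and $v(x,y,\lambda)\in\mathfrak S_{c,k}$. Then there exists a unique solution $\Psi(x,y,\cdot)$ of the Riemann–Hilbert problem $(\lambda\in\mathbb R,\,v(x,y,\lambda))$ such that $$\Psi-1,\ \partial_x\Psi,\ \partial_y\Psi\ \text{ are uniformly (in }x,y)\text{ bounded in }L_2(\mathbb R,d\lambda).$$ Moreover, for each fixed $\lambda\notin\mathbb R$ and all $i+j\le k-4$, $$\partial_x^i\partial_y^j\Psi\in L_\infty(dxdy),\qquad \partial_x^i\partial_y^j(\Psi-1)\to0\ \text{ in }L_\infty(dxdy)\text{ as }x\text{ or }y\to\infty.$$
   Context: Fix $n\ge1$; matrices are complex $n\times n$, $1$ is the identity matrix, $f^*$ is the conjugate transpose, $\mathbb C^\pm$ are the open upper/lower half planes, $\mathcal L_\lambda=\partial_y-\lambda\partial_x$. $\mathfrak S_{c,k}$ ($k\ge7$) is the set of matrix-valued functions $v(x,y,\lambda)$, $x,y,\lambda\in\mathbb R$, such that $\det v\equiv1$; $v=v^*>0$; and for all $i+j\le k-4$: (a) $\mathcal L_\lambda v=0$ and $v(x,y,\lambda)=v(x+\lambda y,\lambda)$ (i.e. $v$ depends only on $x+\lambda y$ and $\lambda$) for all $x,y\in\mathbb R$; (b) $\partial_x^i\partial_y^j(v-1)$ are uniformly (in $x,y$) bounded in $L_\infty\cap L_2(\mathbb R,d\lambda)\cap L_1(\mathbb R,d\lambda)$; (c) $\partial_x^i\partial_y^j(v-1)\to0$ uniformly in $L_\infty\cap L_2(\mathbb R,d\lambda)\cap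 L_1(\mathbb R,d\lambda)$ as $|x|$ or $|y|\to\infty$; (d) $\partial_\lambda v\in L_2(\mathbb R,d\lambda)$ with norm depending continuously on $x,y$. For $v(\lambda)$ defined on $\mathbb R$, a function $\Psi(\lambda)$ is a solution of the Riemann–Hilbert problem $(\lambda\in\mathbb R,v)$ if $$\Psi(\lambda)=1+\frac1{2\pi i}\int_{\mathbb R}\frac{\Psi_-(t)(v(t)-1)}{t-\lambda}\,dt,\qquad\lambda\in\mathbb C\setminus\mathbb R,$$ where $\Psi_\pm(\lambda)=\lim_{\tilde\lambda\to\lambda,\ \tilde\lambda\in\mathbb C^\pm}\Psi(\tilde\lambda)$ for $\lambda\in\mathbb R$ (so $\Psi$ is holomorphic off $\mathbb R$ and $\Psi_+=\Psi_-v$ on $\mathbb R$). $L_2(\mathbb R,d\lambda)$ bounds on $\Psi$ refer to its boundary values $\Psi_\pm$ on $\mathbb R$. *)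

(* Defs.v *)
From HB Require Import structures.
From mathcomp Require Import all_boot all_order all_algebra.
From mathcomp Require Import complex.
From mathcomp Require Import all_classical all_reals all_analysis.

Set Implicit Arguments.
Unset Strict Implicit.
Unset Printing Implicit Defensive.

Import Order.TTheory GRing.Theory Num.Theory.
Import numFieldNormedType.Exports.

Local Open Scope classical_set_scope.
Local Open Scope ring_scope.
Local Open Scope complex_scope.

Definition mxRe (R : realType) (n : nat) (T : Type) (f : T -> 'M[R[i]]_n)
  (a b : 'I_n) : T -> R := fun t => complex.Re (f t a b).

Definition mxIm (R : realType) (n : nat) (T : Type) (f : T -> 'M[R[i]]_n)
  (a b : 'I_n) : T -> R := fun t => complex.Im (f t a b).

(* Frobenius norm, with values in R rather than in R[i]. *)
Definition mxfrob (R : realType) (n : nat) (A : 'M[R[i]]_n) : R :=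
  Num.sqrt (\sum_a \sum_b (complex.Re (A a b) ^+ 2 + complex.Im (A a b) ^+ 2)).

Definition posdefmx (R : realType) (n : nat) (A : 'M[R[i]]_n) : Prop :=
  A \is hermsymmx /\
  forall u : 'cV[R[i]]_n, u != 0 ->
    0 < ((map_mx conjc u)^T *m A *m u) 0 0.

Definition mx_measurable (R : realType) (n : nat) (d : measure_display)
  (T : measurableType d) (f : T -> 'M[R[i]]_n) : Prop :=
  forall a b, measurable_fun setT (mxRe f a b) /\
              measurable_fun setT (mxIm f a b).

Definition mxLnorm (R : realType) (n : nat) (d : measure_display)
  (T : measurableType d) (mu : {measure set T -> \bar R}) (p : \bar R)
  (f : T -> 'M[R[i]]_n) : \bar R :=
  'N[mu]_p[EFin \o (@mxfrob R n \o f)].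

Definition mx_in_Lp (R : realType) (n : nat) (d : measure_display)
  (T : measurableType d) (mu : {measure set T -> \bar R}) (p : \bar R)
  (f : T -> 'M[R[i]]_n) : Prop :=
  mx_measurable f /\ (mxLnorm mu p f < +oo)%E.

Definition mx_Lp_le (R : realType) (n : nat) (d : measure_display)
  (T : measurableType d) (mu : {measure set T -> \bar R}) (p : \bar R)
  (M : R) (f : T -> 'M[R[i]]_n) : Prop :=
  mx_measurable f /\ (mxLnorm mu p f <= M%:E)%E.

Definition unif_bounded_Lp (R : realType) (n : nat) (p : \bar R)
  (f : R -> R -> R -> 'M[R[i]]_n) : Prop :=
  exists M : R, forall x y : R, mx_Lp_le (@lebesgue_measure R) p M (f x y).

Definition unif_vanish_Lp (R : realType) (n : nat) (p : \bar R)
  (f : R -> R -> R -> 'M[R[i]]_n) : Prop :=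
  forall e : R, 0 < e -> exists r : R, forall x y : R,
    r <= `|x| \/ r <= `|y| ->
    (mxLnorm (@lebesgue_measure R) p (f x y) <= e%:E)%E.

Definition vanish_Lp (R : realType) (n : nat) (p : \bar R)
  (f : R -> R -> R -> 'M[R[i]]_n) : Prop :=
  forall e : R, 0 < e ->
    (forall y : R, exists r : R, forall x : R, r <= `|x| ->
       (mxLnorm (@lebesgue_measure R) p (f x y) <= e%:E)%E) /\
    (forall x : R, exists r : R, forall y : R, r <= `|y| ->
       (mxLnorm (@lebesgue_measure R) p (f x y) <= e%:E)%E).

Definition mx_integrable (R : realType) (n : nat) (D : set R)
  (f : R -> 'M[R[i]]_n) : Prop :=
  forall a b,
    (@lebesgue_measure R).-integrable D (EFin \o mxRe f a b) /\
    (@lebesgue_measure R).-integrable D (EFin \o mxIm f a b).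

Definition mx_integral (R : realType) (n : nat) (D : set R)
  (f : R -> 'M[R[i]]_n) : 'M[R[i]]_n :=
  \matrix_(a, b)
    (Rintegral (@lebesgue_measure R) D (mxRe f a b) +i*
     Rintegral (@lebesgue_measure R) D (mxIm f a b)).

Definition mx_derivable (R : realType) (n : nat) (f : R -> 'M[R[i]]_n)
  (x : R) : Prop :=
  forall a b, derivable (mxRe f a b) x 1 /\ derivable (mxIm f a b) x 1.

Definition mx_derive (R : realType) (n : nat) (f : R -> 'M[R[i]]_n)
  (x : R) : 'M[R[i]]_n :=
  \matrix_(a, b) (derive1 (mxRe f a b) x +i* derive1 (mxIm f a b) x).

Definition partial_x (R : realType) (n : nat) (f : R -> R -> 'M[R[i]]_n)
  : R -> R -> 'M[R[i]]_n := fun x y => mx_derive (fun s => f s y) x.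

Definition partial_y (R : realType) (n : nat) (f : R -> R -> 'M[R[i]]_n)
  : R -> R -> 'M[R[i]]_n := fun x y => mx_derive (fun s => f x s) y.

Definition partial (R : realType) (n : nat) (i j : nat)
  (f : R -> R -> 'M[R[i]]_n) : R -> R -> 'M[R[i]]_n :=
  iter i (@partial_x R n) (iter j (@partial_y R n) f).

(* [partial] is a total operator with junk values; this says that each
   derivative taken along the way exists at every point of the plane. *)
Definition has_partial (R : realType) (n : nat) (i j : nat)
  (f : R -> R -> 'M[R[i]]_n) : Prop :=
  (forall l, (l < j)%N -> forall x y,
     mx_derivable (fun s => partial 0 l f x s) y) /\
  (forall l, (l < i)%N -> forall x y,
     mx_derivable (fun s => partial l j f s y) x).

(* f is locally absolutely continuous with derivative g; g is determined
   almost everywhere.  This is the meaning of "f' = g in L2". *)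
Definition ac_deriv (R : realType) (n : nat) (f g : R -> 'M[R[i]]_n) : Prop :=
  forall a b : R, a <= b ->
    mx_integrable `[a, b] g /\ f b - f a = mx_integral `[a, b] g.

Record scattering_data (R : realType) (n k : nat)
    (v : R -> R -> R -> 'M[R[i]]_n) : Prop := ScatteringData {
  sd_det : forall x y l, \det (v x y l) = 1 ;
  sd_pos : forall x y l, posdefmx (v x y l) ;
  sd_diff : forall i j, (i + j <= k - 4)%N ->
    forall l, has_partial i j (fun x y => v x y l - 1%:M) ;
  sd_L : forall x y l,
    partial_y (fun x y => v x y l) x y -
      l%:C *: partial_x (fun x y => v x y l) x y = 0 ;
  sd_transl : exists w : R -> R -> 'M[R[i]]_n,
    forall x y l, v x y l = w (x + l * y) l ;
  sd_bounded : forall i j, (i + j <= k - 4)%N ->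
    let f := fun x y l => partial i j (fun x y => v x y l - 1%:M) x y in
    [/\ unif_bounded_Lp +oo f, unif_bounded_Lp 2%:E f
      & unif_bounded_Lp 1%:E f] ;
  (* The L2 and L1 limits are uniform in the other variable.  The Loo limit is
     taken with the other variable fixed: along x = s - l * y the value
     v x y l = w s l does not change, so a uniform Loo limit would force
     v = 1 identically, and the weaker requirement is the one that leaves a
     nontrivial class. *)
  sd_vanish : forall i j, (i + j <= k - 4)%N ->
    let f := fun x y l => partial i j (fun x y => v x y l - 1%:M) x y in
    [/\ vanish_Lp +oo f, unif_vanish_Lp 2%:E f & unif_vanish_Lp 1%:E f] ;
  sd_lambda : exists dv : R -> R -> R -> 'M[R[i]]_n,
    [/\ forall x y, ac_deriv (v x y) (dv x y),
        forall x y, mx_in_Lp (@lebesgue_measure R) 2%:E (dv x y)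
      & continuous (fun p : R * R =>
          fine (mxLnorm (@lebesgue_measure R) 2%:E (dv p.1 p.2)))]
}.

(* Convergence is that of R[i], which carries its topology as R[i]^o; the
   approach region is the whole open half plane. *)
Definition boundary_values (R : realType) (n : nat) (F : R[i] -> 'M[R[i]]_n)
  (Fp Fm : R -> 'M[R[i]]_n) : Prop :=
  forall (l : R) (a b : 'I_n),
    ((fun z : (R[i])^o => F z a b : (R[i])^o) @
       within [set z : (R[i])^o | 0 < complex.Im z] (nbhs (l%:C : (R[i])^o))
     --> (Fp l a b : (R[i])^o)) /\
    ((fun z : (R[i])^o => F z a b : (R[i])^o) @
       within [set z : (R[i])^o | complex.Im z < 0] (nbhs (l%:C : (R[i])^o))
     --> (Fm l a b : (R[i])^o)).

Definition rh_integrand (R : realType) (n : nat) (v Pm : R -> 'M[R[i]]_n)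
  (z : R[i]) : R -> 'M[R[i]]_n :=
  fun t => (t%:C - z)^-1 *: (Pm t *m (v t - 1%:M)).

Definition rh_solution (R : realType) (n : nat) (v : R -> 'M[R[i]]_n)
  (Psi : R[i] -> 'M[R[i]]_n) : Prop :=
  exists Pp Pm : R -> 'M[R[i]]_n,
    boundary_values Psi Pp Pm /\
    forall z : R[i], complex.Im z != 0 ->
      mx_integrable setT (rh_integrand v Pm z) /\
      Psi z = 1%:M + (0 +i* (2 * pi))^-1 *:
                       mx_integral setT (rh_integrand v Pm z).

Definition boundary_bounded_L2 (R : realType) (n : nat)
  (F : R -> R -> R[i] -> 'M[R[i]]_n) : Prop :=
  exists Fp Fm : R -> R -> R -> 'M[R[i]]_n,
    [/\ forall x y, boundary_values (F x y) (Fp x y) (Fm x y),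
        unif_bounded_Lp 2%:E Fp & unif_bounded_Lp 2%:E Fm].

Definition bounded_rh_family (R : realType) (n : nat)
  (v : R -> R -> R -> 'M[R[i]]_n) (Psi : R -> R -> R[i] -> 'M[R[i]]_n)
  : Prop :=
  [/\ forall x y, rh_solution (v x y) (Psi x y),
      forall z, complex.Im z != 0 ->
        has_partial 1 0 (fun x y => Psi x y z) /\
        has_partial 0 1 (fun x y => Psi x y z),
      boundary_bounded_L2 (fun x y z => Psi x y z - 1%:M),
      boundary_bounded_L2 (fun x y z => partial_x (fun x y => Psi x y z) x y)
    & boundary_bounded_L2 (fun x y z => partial_y (fun x y => Psi x y z) x y)].

Definition in_Loo_plane (R : realType) (n : nat) (f : R -> R -> 'M[R[i]]_n)
  : Prop :=
  mx_in_Lp (@lebesgue_measure R \x @lebesgue_measure R)%E +oo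
    (fun p : R * R => f p.1 p.2).

(* The Loo norm of f over { |x| >= r or |y| >= r } tends to 0. *)
Definition vanish_Loo_plane (R : realType) (n : nat)
  (f : R -> R -> 'M[R[i]]_n) : Prop :=
  forall e : R, 0 < e -> exists r : R,
    let far := [set p : R * R | r <= `|p.1| \/ r <= `|p.2|] in
    let g := patch (fun=> 0) far (fun p => f p.1 p.2) in
    (mxLnorm (@lebesgue_measure R \x @lebesgue_measure R) +oo g <= e%:E)%E.

(* Main.v *)
(* Let H- be the space of boundary values in L2 of functions holomorphic in the lower half plane.
   Writing Psi_- = 1 + m with m in H-, the problem becomes: m v + (v - 1) is orthogonal to H-.
   As v is bounded and positive definite with det v = 1, the form Re tr (m v m'^* ) is coercive
   on H-, so m exists, is unique and is bounded in L2 uniformly in x, y. Differentiating the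
   equation in x or y gives equations of the same kind for the derivatives of m, and applying it
   to difference quotients shows that m is weakly differentiable; pairing with the Cauchy kernel
   then yields classical derivatives of Psi(x, y, z), their bounds and their decay.

   The problem asks for boundary values at every real point. The translates of m in lambda solve
   the translated problem, so v_lambda in L2 gives m a modulus of continuity in L2; once its
   exponent is above 1/2, the averages of m converge uniformly and m is continuous. The Cauchy
   integral of the density is, on each side of the line, the Poisson integral of m or of
   m v + (v - 1), and so converges to it. Conversely the boundary values of a solution of the
   family are identified by their Poisson integrals, whence uniqueness. *)
From HB Require Import structures.
Require Import Defs.
From mathcomp Require Import all_boot all_order all_algebra.
From mathcomp Require Import perm complex.
From mathcomp Require Import all_classical all_reals all_analysis.
From mathcomp Require Import measurable_realfun ess_sup_inf.
From mathcomp Require Import ring lra.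

Set Implicit Arguments.
Unset Strict Implicit.
Unset Printing Implicit Defensive.

Import Order.TTheory GRing.Theory Num.Theory.
Import numFieldNormedType.Exports.

Local Open Scope classical_set_scope.
Local Open Scope ring_scope.
Local Open Scope complex_scope.

(** * Square-integrable functions and the Riesz representation *)

(** Two obstacles shape the estimates. Derivatives are bounded only almost everywhere in [l] for
    each [(x, y)], while differentiability holds at every point; hence a mean value inequality for
    everywhere differentiable functions under an almost everywhere bound, and Tonelli to exchange
    exceptional sets. The second is the exponent. In the increment equation the term m(l + h) (v(l +
    h) - v(l)) multiplies two functions with L2 control only; as v is Hoelder 1/2 in the supremum
    norm, m gets exponent exactly 1/2, the critical value. Replacing the first factor by its average
    over a window lets the L2 Lipschitz bound of v act on the second and gives 2/3. In the equations
    differentiated in x or y the source has no lambda derivative among the hypotheses, so its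
    modulus comes from Landau interpolation: a step S costs |h| / S from v and S^2 from third
    derivatives, and S = |h|^(1/3) again gives 2/3. Third derivatives are what k - 4 >= 3 supplies.
    All pairings are real; the complex entries of a Cauchy integral are recovered through a scalar
    in the test kernel. *)

Section almost_everywhere_filter.
Context d (T : measurableType d) (R : realType).
Variable mu : {measure set T -> \bar R}.

Lemma ae_imp (P Q : T -> Prop) : (forall x, P x -> Q x) ->
  {ae mu, forall x, P x} -> {ae mu, forall x, Q x}.
Proof. by move=> PQ; apply: filterS. Qed.

Lemma ae_imp2 (P Q S : T -> Prop) : (forall x, P x -> Q x -> S x) ->
  {ae mu, forall x, P x} -> {ae mu, forall x, Q x} -> {ae mu, forall x, S x}.
Proof. by move=> PQ; apply: filterS2. Qed.

Lemma ae_all (P : T -> Prop) : (forall x, P x) -> {ae mu, forall x, P x}.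
Proof. exact: aeW. Qed.

End almost_everywhere_filter.

Section square_integrable.
Context d (T : measurableType d) (R : realType).
Variable mu : {measure set T -> \bar R}.
Implicit Types f g : T -> R.

Definition sqint f : \bar R := (\int[mu]_x (f x ^+ 2)%:E)%E.

Definition sqintegrable f := measurable_fun setT f /\ (sqint f < +oo)%E.

Definition dotL2 f g : R := \int[mu]_x (f x * g x).

Lemma sqint_ge0 f : (0 <= sqint f)%E.
Proof. by apply: integral_ge0 => x _; rewrite lee_fin sqr_ge0. Qed.

Lemma measurable_sq f : measurable_fun setT f ->
  measurable_fun setT (fun x => (f x ^+ 2)%:E).
Proof. by move=> mf; apply/measurable_EFinP; apply: measurable_funX. Qed.

Lemma sqint_le f g : measurable_fun setT f -> measurable_fun setT g ->
  {ae mu, forall x, `|f x| <= `|g x|} -> (sqint f <= sqint g)%E.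
Proof.
move=> mf mg fg; apply: ae_ge0_le_integral => //.
- by move=> x _; rewrite lee_fin sqr_ge0.
- exact: measurable_sq.
- by move=> x _; rewrite lee_fin sqr_ge0.
- exact: measurable_sq.
apply: filterS fg => x fg _.
by rewrite lee_fin -(real_normK (num_real (f x))) -(real_normK (num_real (g x))) lerXn2r.
Qed.

Lemma sqintegrable_le f g : measurable_fun setT f -> sqintegrable g ->
  {ae mu, forall x, `|f x| <= `|g x|} -> sqintegrable f.
Proof.
by move=> mf [mg g2] fg; split => //; apply: le_lt_trans g2; apply: sqint_le.
Qed.

Lemma sqintZ f c : measurable_fun setT f ->
  sqint (fun x => c * f x) = ((c ^+ 2)%:E * sqint f)%E.
Proof.
move=> mf; rewrite /sqint -ge0_integralZl_EFin//.
- by apply: eq_integral => x _; rewrite exprMn EFinM.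
- by move=> x _; rewrite lee_fin sqr_ge0.
- exact: measurable_sq.
- by rewrite sqr_ge0.
Qed.

Lemma sqintegrableZ f c : sqintegrable f -> sqintegrable (fun x => c * f x).
Proof.
move=> [mf f2]; split; first exact: measurable_funM.
by rewrite sqintZ// lte_mul_pinfty// lee_fin sqr_ge0.
Qed.

Lemma sqintD_le f g : measurable_fun setT f -> measurable_fun setT g ->
  (sqint (fun x => f x + g x)%R <= 2%:E * (sqint f + sqint g))%E.
Proof.
move=> mf mg; rewrite /sqint -ge0_integralD//; last 4 first.
- by move=> x _; rewrite lee_fin sqr_ge0.
- exact: measurable_sq.
- by move=> x _; rewrite lee_fin sqr_ge0.
- exact: measurable_sq.
rewrite -ge0_integralZl_EFin//; last 2 first.
- by move=> x _; rewrite -EFinD lee_fin addr_ge0 ?sqr_ge0.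
- by apply: emeasurable_funD; exact: measurable_sq.
apply: ge0_le_integral => //.
- by move=> x _; rewrite lee_fin sqr_ge0.
- by apply: measurable_sq; exact: measurable_funD.
- by apply: emeasurable_funM => //; apply: emeasurable_funD; exact: measurable_sq.
move=> x _; rewrite -EFinD -EFinM lee_fin.
have := sqr_ge0 (f x - g x); nra.
Qed.

Lemma sqintegrableD f g : sqintegrable f -> sqintegrable g ->
  sqintegrable (fun x => f x + g x).
Proof.
move=> [mf f2] [mg g2]; split; first exact: measurable_funD.
apply: le_lt_trans (sqintD_le mf mg) _.
by apply: lte_mul_pinfty => //; exact: lte_add_pinfty.
Qed.

Lemma sqintegrable0 : sqintegrable (fun _ => 0).
Proof.
split; first exact: measurable_cst.
by rewrite /sqint integral0_eq// => x _; rewrite expr0n.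
Qed.

Lemma sqintegrableN f : sqintegrable f -> sqintegrable (fun x => - f x).
Proof.
move=> hf; have := sqintegrableZ (-1) hf.
by under [X in sqintegrable X -> _]eq_fun do rewrite mulN1r.
Qed.

Lemma sqintegrableB f g : sqintegrable f -> sqintegrable g ->
  sqintegrable (fun x => f x - g x).
Proof. by move=> hf hg; apply: sqintegrableD => //; exact: sqintegrableN. Qed.

Lemma sqintegrable_mul f g : sqintegrable f -> sqintegrable g ->
  mu.-integrable setT (EFin \o (fun x => f x * g x)).
Proof.
move=> [mf f2] [mg g2].
apply: (@le_integrable _ _ _ _ _ measurableT _ (fun x => (f x ^+ 2)%:E + (g x ^+ 2)%:E)%E).
- by apply/measurable_EFinP; exact: measurable_funM.
- move=> x _; rewrite -EFinD /= !lee_fin [leRHS]ger0_norm ?addr_ge0 ?sqr_ge0//.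
  rewrite normrM -(real_normK (num_real (f x))) -(real_normK (num_real (g x))).
  by have := sqr_ge0 (`|f x| - `|g x|); have := normr_ge0 (f x); have := normr_ge0 (g x); nra.
apply: integrableD => //; apply/integrableP; split; try exact: measurable_sq.
- by under eq_integral do rewrite abse_EFin ger0_norm ?sqr_ge0//.
- by under eq_integral do rewrite abse_EFin ger0_norm ?sqr_ge0//.
Qed.

Lemma dotL2Dl f1 f2 g : sqintegrable f1 -> sqintegrable f2 -> sqintegrable g ->
  dotL2 (fun x => f1 x + f2 x) g = dotL2 f1 g + dotL2 f2 g.
Proof.
move=> h1 h2 hg; rewrite /dotL2 -RintegralD//; try exact: sqintegrable_mul.
by apply: eq_Rintegral => x _; rewrite mulrDl.
Qed.

Lemma dotL2_ae f1 f2 g1 g2 :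
  sqintegrable f1 -> sqintegrable f2 -> sqintegrable g1 -> sqintegrable g2 ->
  {ae mu, forall x, f1 x = f2 x} -> {ae mu, forall x, g1 x = g2 x} ->
  dotL2 f1 g1 = dotL2 f2 g2.
Proof.
move=> [h1 _] [h2 _] [h3 _] [h4 _] ef eg; rewrite /dotL2 /Rintegral; congr fine.
apply: ae_eq_integral => //.
- by apply/measurable_EFinP; exact: measurable_funM.
- by apply/measurable_EFinP; exact: measurable_funM.
by apply: filterS2 ef eg => x /= -> ->.
Qed.

(** Fatou's lemma for squares. The bound is asked only eventually, so that it applies to tails of
    sequences. *)
Lemma sqint_liminf (u : nat -> T -> R) f (B : \bar R) :
  (forall m, measurable_fun setT (u m)) -> measurable_fun setT f ->
  {ae mu, forall x, u ^~ x @ \oo --> f x} ->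
  (\forall m \near \oo, (sqint (u m) <= B)%E) -> (sqint f <= B)%E.
Proof.
move=> mum mf uf hB.
pose F m x := (u m x ^+ 2)%:E.
have mF m : measurable_fun setT (F m) by exact: measurable_sq.
have F0 m x : setT x -> (0 <= F m x)%E by move=> _; rewrite lee_fin sqr_ge0.
have -> : sqint f = (\int[mu]_x limn_einf (F^~ x))%E.
  apply: ae_eq_integral => //; first exact: measurable_sq.
  - have -> : (fun x => limn_einf (F^~ x)) = (fun x => - limn_esup (fun m => - F m x))%E.
      apply/funext => x; rewrite -[LHS]oppeK -limn_esupN; congr (- limn_esup _)%E.
    apply: (@measurableT_comp _ _ _ _ _ _ oppe) => //; apply: measurable_fun_limn_esup => m.
    exact: (@measurableT_comp _ _ _ _ _ _ oppe).
  apply: filterS uf => x ufx _; rewrite is_cvg_limn_einfE.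
    apply/esym/cvg_lim => //; apply: cvg_EFin; first exact: nearW.
    by rewrite /comp /=; rewrite expr2; under eq_fun do rewrite expr2; exact: cvgM.
  apply/cvg_ex; exists (f x ^+ 2)%:E; apply: cvg_EFin; first exact: nearW.
  by rewrite /comp /=; rewrite expr2; under eq_fun do rewrite expr2; exact: cvgM.
apply: le_trans (fatou mu measurableT mF F0) _.
rewrite limn_einf_lim.
apply: lime_le; first exact: is_cvg_einfs.
near=> m.
apply: le_trans (_ : _ <= sqint (u m))%E _; last by near: m.
by apply: ereal_inf_lbound; exists m => /=.
Unshelve. all: end_near. Qed.

End square_integrable.

(** * Riesz-Fischer for geometrically convergent sequences *)

Section square_integrable_complete.
Context d (T : measurableType d) (R : realType).
Variable mu : {measure set T -> \bar R}.
Local Notation sqint := (sqint mu).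
Local Notation sqintegrable := (sqintegrable mu).

(** Squared increments of ratio 1/4 are increments of ratio 1/2, a summable majorant. *)
Lemma cvg_of_geometric_increments (u : nat -> R) (C : R) :
  (forall m, (u m.+1 - u m) ^+ 2 <= C * (4^-1) ^+ m) -> cvgn u.
Proof.
move=> hu.
have C0 : 0 <= C by have := le_trans (sqr_ge0 _) (hu 0%N); rewrite expr0 mulr1.
pose dd m := u m.+1 - u m.
have hd : cvgn (series dd).
  apply: normed_cvg; apply: (@series_le_cvg _ _ (geometric (Num.sqrt C) 2^-1)).
  - by move=> m; exact: normr_ge0.
  - by move=> m; apply: mulr_ge0; rewrite ?sqrtr_ge0 ?exprn_ge0 ?invr_ge0.
  - move=> m; rewrite /geometric /= -(@ler_pXn2r _ 2)// ?nnegrE ?normr_ge0//.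
    rewrite real_normK ?num_real// exprMn sqr_sqrtr// -exprM mulnC exprM.
    by have -> : (2^-1 : R) ^+ 2 = 4^-1; [field|exact: hu].
  - by apply: is_cvg_geometric_series; rewrite ger0_norm ?invf_lt1// ?invr_ge0// ltr1n.
have -> : u = (fun m => series dd m + u 0%N).
  by apply/funext => m; rewrite /series /= telescope_sumr// subrK.
by apply: is_cvgD => //; exact: is_cvg_cst.
Qed.

Section geometric_sequence.
Variables (u : nat -> T -> R) (B : R).
Hypothesis u2 : forall m, sqintegrable (u m).
Hypothesis uB : forall m, (sqint (fun x => (u m.+1 x - u m x)%R) <= (B * (16^-1) ^+ m)%:E)%E.

(** The constant 4 is stable under the recursion: the first increment and the tail from [m.+1]
    together cost 2 (B + 4 B / 16), which is at most 4 B. *)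
Lemma geometric_sqint_le m p :
  (sqint (fun x => (u (m + p)%N x - u m x)%R) <= (4 * B * (16^-1) ^+ m)%:E)%E.
Proof.
have B0 : 0 <= B.
  have := le_trans (sqint_ge0 mu _) (uB 0%N); by rewrite lee_fin expr0 mulr1.
have p0 k : 0 <= (16^-1 : R) ^+ k by rewrite exprn_ge0// invr_ge0.
elim: p m => [|p ih] m.
  rewrite addn0 /sqint integral0_eq ?lee_fin ?mulr_ge0//.
  by move=> x _; rewrite subrr expr0n.
have -> : (fun x => u (m + p.+1)%N x - u m x) =
    (fun x => (u (m.+1 + p)%N x - u m.+1 x) + (u m.+1 x - u m x)).
  by apply/funext => x; rewrite addnS -addSn addrA subrK.
have mB k l : measurable_fun setT (fun x => u k x - u l x).
  by apply: measurable_funB; [exact: (u2 k).1|exact: (u2 l).1].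
apply: le_trans (sqintD_le mu (mB _ _) (mB _ _)) _.
apply: (@le_trans _ _ (2%:E * ((4 * B * (16^-1) ^+ m.+1)%:E + (B * (16^-1) ^+ m)%:E))%E).
  by apply: lee_wpmul2l; rewrite ?lee_fin//; apply: leeD.
rewrite -EFinD -EFinM lee_fin exprS.
have := p0 m; have := mulr_ge0 B0 (p0 m); nra.
Qed.

(** Weighting the squared increments by 4^m leaves integrals of size B 4^-m. Their sum is finite, so
    the weighted series is finite almost everywhere, and its sum bounds each of its terms. *)
Lemma geometric_ae_bounded :
  {ae mu, forall x, exists C, forall m, (u m.+1 x - u m x) ^+ 2 <= C * (4^-1) ^+ m}.
Proof.
have B0 : 0 <= B.
  have := le_trans (sqint_ge0 mu _) (uB 0%N); by rewrite lee_fin expr0 mulr1.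
pose F m x := ((4 ^+ m * (u m.+1 x - u m x) ^+ 2)%:E : \bar R).
have mF m : measurable_fun setT (F m).
  apply/measurable_EFinP; apply: measurable_funM => //; apply: measurable_funX.
  by apply: measurable_funB; [exact: (u2 _).1|exact: (u2 _).1].
have F0 m x : (0 <= F m x)%E by rewrite lee_fin mulr_ge0 ?sqr_ge0 ?exprn_ge0.
have hF : (\int[mu]_x (\sum_(m <oo) F m x) < +oo)%E.
  rewrite integral_nneseries//.
  apply: (@le_lt_trans _ _ (\sum_(m <oo) (B * (4^-1) ^+ m)%:E)%E).
    apply: lee_nneseries => m; first by move=> _ _; exact: integral_ge0.
    move=> _.
    rewrite /F; under eq_integral do rewrite EFinM.
    rewrite ge0_integralZl_EFin//; last 2 first.
    - by move=> x _; rewrite lee_fin sqr_ge0.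
    - apply: measurable_sq.
      by apply: measurable_funB; [exact: (u2 _).1|exact: (u2 _).1].
    apply: (@le_trans _ _ ((4 ^+ m)%:E * (B * 16^-1 ^+ m)%:E)%E).
      by apply: lee_wpmul2l; [rewrite lee_fin exprn_ge0|exact: uB].
    rewrite -EFinM lee_fin mulrCA ler_wpM2l// -exprMn.
    by have -> : (4 : R) / 16 = 4^-1 by field.
  have hc : cvgn (series (geometric B (4^-1 : R))).
    by apply: is_cvg_geometric_series; rewrite ger0_norm ?invf_lt1// ?invr_ge0// ltr1n.
  rewrite (_ : (\sum_(m <oo) _)%E = (limn (series (geometric B (4^-1 : R))))%:E) ?ltry//.
  rewrite -EFin_lim//; congr (limn _); apply/funext => m /=.
  by rewrite /series /= sumEFin.
have iF : mu.-integrable setT (fun x => \sum_(m <oo) F m x)%E.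
  apply/integrableP; split.
    exact: ge0_emeasurable_sum.
  by under eq_integral do rewrite gee0_abs ?nneseries_ge0//.
have := integrable_ae measurableT iF; apply: filterS => x /(_ I) fx.
exists (fine (\sum_(m <oo) F m x)%E) => m.
have h : (F m x <= \sum_(m <oo) F m x)%E.
  apply: le_trans (nneseries_lim_ge m.+1 _) => //.
  by rewrite big_mkord big_ord_recr/= leeDr// sume_ge0.
move: h; rewrite -(fineK fx) lee_fin => h.
have h4 : (4 : R) ^+ m * 4^-1 ^+ m = 1 by rewrite -exprMn divff ?expr1n.
have -> : (u m.+1 x - u m x) ^+ 2 = 4 ^+ m * (u m.+1 x - u m x) ^+ 2 * 4^-1 ^+ m.
  by rewrite mulrAC h4 mul1r.
by rewrite ler_wpM2r.
Qed.

Lemma geometric_sqint_cvg : exists l, sqintegrable l /\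
  forall m, (sqint (fun x => (u m x - l x)%R) <= (4 * B * (16^-1) ^+ m)%:E)%E.
Proof.
have [N [mN N0 hN]] := geometric_ae_bounded.
have mA : measurable (~` N) by exact: measurableC.
(* Killed on the exceptional null set, the sequence converges at every point, which makes its limit
   measurable. *)
pose w m x := u m x * \1_(~` N) x.
have mw m : measurable_fun setT (w m).
  by apply: measurable_funM; [exact: (u2 m).1|exact: measurable_indic].
have cw x : cvgn (w^~ x).
  have [xN|xN] := pselect (N x).
    apply/cvg_ex; exists 0; rewrite (_ : w^~ x = cst 0); first exact: cvg_cst.
    by apply/funext => m; rewrite /w indicE memNset ?mulr0//= => /(_ xN).
  have [C hC] : exists C, forall m, (u m.+1 x - u m x) ^+ 2 <= C * (4^-1) ^+ m.
    by apply: contrapT => h; apply: xN; exact: hN.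
  apply: (cvg_of_geometric_increments (C := C)) => m.
  by rewrite /w indicE mem_set//= !mulr1.
pose l x := limn (w^~ x).
have ml : measurable_fun setT l.
  by apply: (measurable_fun_cvg (h := w)) => // x _; exact: cw.
have ul : {ae mu, forall x, u ^~ x @ \oo --> l x}.
  exists N; split => // x /= h; apply: contrapT => xN; apply: h.
  have -> : u^~ x = w^~ x by apply/funext => m; rewrite /w indicE mem_set//= mulr1.
  exact: cw.
have hl m : (sqint (fun x => (u m x - l x)%R) <= (4 * B * (16^-1) ^+ m)%:E)%E.
  apply: (@sqint_liminf _ _ _ _ (fun k x => u m x - u k x)).
  - by move=> k; apply: measurable_funB; [exact: (u2 _).1|exact: (u2 _).1].
  - by apply: measurable_funB => //; exact: (u2 _).1.
  - by apply: filterS ul => x ux; apply: cvgB => //; exact: cvg_cst.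
  exists m => // k /= mk; apply: le_trans (geometric_sqint_le m (k - m)).
  rewrite subnKC//; apply: sqint_le.
  - by apply: measurable_funB; [exact: (u2 _).1|exact: (u2 _).1].
  - by apply: measurable_funB; [exact: (u2 _).1|exact: (u2 _).1].
  by apply: aeW => x; rewrite distrC.
exists l; split => //; split => //.
have h0 := sqintegrableN (u2 0%N).
apply: (@le_lt_trans _ _ (sqint (fun x => (u 0%N x - (u 0%N x - l x))%R))).
  by under [X in (_ <= sqint X)%E]eq_fun do rewrite subKr.
apply: (proj2 (_ : sqintegrable _)).
apply: sqintegrableB => //; split; first by apply: measurable_funB => //; exact: (u2 _).1.
by apply: le_lt_trans (hl 0%N) _; exact: ltry.
Qed.

End geometric_sequence.
End square_integrable_complete.

(** * Cauchy-Schwarz and Riesz representation for a semi-inner product on a predicate *)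

Section semi_inner_product.
Context (R : realType) (V : Type) (add : V -> V -> V) (sc : R -> V -> V).
Variables (H : V -> Prop) (q : V -> V -> R).
Hypothesis HD : forall u v, H u -> H v -> H (add u v).
Hypothesis HZ : forall a u, H u -> H (sc a u).
Hypothesis qC : forall u v, H u -> H v -> q u v = q v u.
Hypothesis qD : forall u v w, H u -> H v -> H w -> q (add u v) w = q u w + q v w.
Hypothesis qZ : forall a u w, H u -> H w -> q (sc a u) w = a * q u w.
Hypothesis q0 : forall u, H u -> 0 <= q u u.
Local Notation sub u v := (add u (sc (-1) v)).

Let qDr u v w : H u -> H v -> H w -> q w (add u v) = q w u + q w v.
Proof. by move=> hu hv hw; rewrite qC ?qD 1?(qC hu hw) 1?(qC hv hw)//; exact: HD. Qed.

Let qZr a u w : H u -> H w -> q w (sc a u) = a * q w u.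
Proof. by move=> hu hw; rewrite qC ?qZ 1?(qC hu hw)//; exact: HZ. Qed.

Lemma semi_inner_CS u v : H u -> H v -> (q u v) ^+ 2 <= q u u * q v v.
Proof.
move=> hu hv.
have P t : 0 <= q u u + 2 * t * q u v + t ^+ 2 * q v v.
  have hw : H (add u (sc t v)) by apply: HD => //; exact: HZ.
  have := q0 hw; rewrite qD ?qDr ?qZ ?qZr//; try exact: HZ.
  by rewrite (qC hv hu) => h; apply: le_trans h _; rewrite le_eqVlt; apply/orP; left; apply/eqP; ring.
have Qv := q0 hv; have Qu := q0 hu.
have [v0|v0] := eqVneq (q v v) 0.
  have h t : 0 <= q u u + 2 * t * q u v by have := P t; rewrite v0; nra.
  rewrite v0 mulr0; have [->|uv] := eqVneq (q u v) 0; first by rewrite expr0n.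
  (* At this [t] the affine function of [t], supposed nonnegative everywhere, equals -1. *)
  have := h (- (q u u + 1) / (2 * q u v)).
  have -> : 2 * (- (q u u + 1) / (2 * q u v)) * q u v = - (q u u + 1) by field.
  by lra.
have vp : 0 < q v v by rewrite lt_def v0.
have := P (- q u v / q v v).
have -> : q u u + 2 * (- q u v / q v v) * q u v + (- q u v / q v v) ^+ 2 * q v v =
  (q u u * q v v - q u v ^+ 2) / q v v by field.
by rewrite pmulr_lge0 ?invr_gt0// subr_ge0.
Qed.

Variable Hne : exists u, H u.
Hypothesis complete : forall (u : nat -> V) , (forall m, H (u m)) ->
  (forall m, q (sub (u m.+1) (u m)) (sub (u m.+1) (u m)) <= (16^-1) ^+ m) ->
  exists l C, H l /\ forall m, q (sub (u m) l) (sub (u m) l) <= C * (16^-1) ^+ m.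
Variables (f : V -> R) (K : R).
Hypothesis fD : forall u v, H u -> H v -> f (add u v) = f u + f v.
Hypothesis fZ : forall a u, H u -> f (sc a u) = a * f u.
Hypothesis fK : forall u, H u -> f u ^+ 2 <= K * q u u.

(* The representing vector minimizes J u = q u u - 2 f u; by the parallelogram
   law a minimizing sequence is Cauchy. *)
Lemma riesz_representation : exists2 l, H l & forall w, H w -> q l w = f w.
Proof.
pose J u := q u u - 2 * f u.
have K0 : 0 <= Num.max K 0 by rewrite le_max lexx orbT.
have JK u : H u -> - Num.max K 0 <= J u.
  move=> hu; rewrite /J; have := fK hu; have := q0 hu.
  have := le_max K K 0; rewrite lexx /= => hK.
  set a := q u u; set b := f u; set M := Num.max K 0 => a0 h.
  have h1 : b ^+ 2 <= M * a by apply: le_trans h _; rewrite ler_wpM2r.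
  have h2 : 0 <= (a - M) ^+ 2 by exact: sqr_ge0.
  have : (2 * b) ^+ 2 <= (a + M) ^+ 2 by nra.
  have h3 : 0 <= a + M by rewrite addr_ge0.
  move=> h4; have : 2 * b <= a + M.
    by rewrite leNgt; apply/negP => h5; nra.
  by lra.
pose E := [set J u | u in [set u | H u]].
have hE : has_inf E.
  split; first by have [u hu] := Hne; exists (J u), u.
  by exists (- Num.max K 0) => _ [u hu <-]; exact: JK.
pose j := inf E.
have jJ u : H u -> j <= J u by move=> hu; apply: (ge_inf hE.2); exists u.
(* The tolerance is divided by 4 so that the parallelogram bound 2 (J a + J b) - 4 j for consecutive
   terms stays below 16^-m. *)
have /choice [u hu] : forall m : nat, exists u, H u /\ J u <= j + (16^-1) ^+ m / 4.
  move=> m; have e0 : 0 < (16^-1 : R) ^+ m / 4.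
    by rewrite divr_gt0// exprn_gt0// invr_gt0.
  have [_ [u hu <-] h] := inf_adherent e0 hE.
  by exists u; split => //; exact: ltW.
have hJ a b : H a -> H b -> q (sub a b) (sub a b) <= 2 * (J a + J b) - 4 * j.
  move=> ha hb.
  have hw : H (sc (2^-1) (add a b)) by apply: HZ; apply: HD.
  have hb' : H (sc (-1) b) by exact: HZ.
  have := jJ _ hw; rewrite /J qZ ?qZr ?qD ?qDr ?fZ ?fD ?qZ ?qZr//; try exact: HD.
  rewrite (qC hb ha); lra.
have [|l [C [hl hC]]] := complete (fun m => (hu m).1).
  move=> m; apply: le_trans (hJ _ _ (hu _).1 (hu _).1) _.
  have := (hu m).2; have := (hu m.+1).2; rewrite exprS.
  have : 0 <= (16^-1 : R) ^+ m by rewrite exprn_ge0// invr_ge0.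
  lra.
exists l => // w hw.
have Q0 := q0 hw.
(* First variation at an almost minimizer: moving by [t w] cannot lower [J] by more than the
   tolerance, so a quadratic in [t] is nonnegative and its discriminant bounds the defect in the
   equation. *)
have h1 m : (q (u m) w - f w) ^+ 2 <= (16^-1) ^+ m / 4 * q w w.
  set a := q (u m) w - f w; set e := _ / 4.
  have e0 : 0 < e by rewrite divr_gt0// exprn_gt0// invr_gt0.
  have P t : 0 <= e + 2 * t * a + t ^+ 2 * q w w.
    have hm := (hu m).1.
    have := jJ _ (HD hm (HZ t hw)).
    rewrite /J qD ?qDr ?fD ?fZ ?qZ ?qZr//; try exact: HZ; last exact: HD hm (HZ t hw).
    by rewrite (qC hw hm); have := (hu m).2; rewrite /J /a -/e; nra.
  have [w0|w0] := eqVneq (q w w) 0.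
    have h t : 0 <= e + 2 * t * a by have := P t; rewrite w0; nra.
    rewrite w0 mulr0; have [->|uv] := eqVneq a 0; first by rewrite expr0n.
    have := h (- (e + 1) / (2 * a)).
    have -> : 2 * (- (e + 1) / (2 * a)) * a = - (e + 1) by field.
    by lra.
  have wp : 0 < q w w by rewrite lt_def w0.
  have := P (- a / q w w).
  have -> : e + 2 * (- a / q w w) * a + (- a / q w w) ^+ 2 * q w w =
    (e * q w w - a ^+ 2) / q w w by field.
  by rewrite pmulr_lge0 ?invr_gt0// subr_ge0.
have h2 m : (q (sub (u m) l) w) ^+ 2 <= C * (16^-1) ^+ m * q w w.
  have hs : H (sub (u m) l) by apply: HD; [exact: (hu m).1|exact: HZ].
  by apply: le_trans (semi_inner_CS hs hw) _; rewrite ler_wpM2r.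
have h3 m : (q l w - f w) ^+ 2 <= 2 * (1 + C) * q w w * (16^-1) ^+ m.
  have := h1 m; have := h2 m; rewrite qD ?qZ//; [|exact: (hu m).1|exact: HZ].
  have : 0 <= (16^-1 : R) ^+ m by rewrite exprn_ge0// invr_ge0.
  set p := _ ^+ m; set A := q (u m) w; set L := q l w; set F := f w => p0 k2 k1.
  have : (L - F) ^+ 2 <= 2 * ((A + -1 * L) ^+ 2 + (A - F) ^+ 2).
    by have := sqr_ge0 ((A - L) + (A - F)); nra.
  have := mulr_ge0 p0 Q0; nra.
apply/eqP; rewrite -subr_eq0 -sqrf_eq0 eq_le sqr_ge0 andbT.
have cv : (fun m => 2 * (1 + C) * q w w * (16^-1 : R) ^+ m) @ \oo --> 2 * (1 + C) * q w w * 0.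
  apply: cvgM; first exact: cvg_cst.
  by apply: cvg_expr; rewrite ger0_norm ?invf_lt1// ?invr_ge0// ltr1n.
rewrite mulr0 in cv.
by apply: (cvgr_to_ge cv); apply: nearW.
Qed.

End semi_inner_product.

(** * Increments of everywhere differentiable functions *)

Section derivatives.
Context (R : realType).
Implicit Types f g : R -> R.

(** First-order approximation without division: no case [y = x] has to be excluded. *)
Lemma is_derive1P f x d : is_derive x (1 : R) f d <->
  forall e, 0 < e -> exists2 r, 0 < r &
    forall y, `|y - x| < r -> `|f y - f x - d * (y - x)| <= e * `|y - x|.
Proof.
have key : (h^-1 *: ((f \o shift x) (h *: (1 : R)) - f x) @[h --> 0^'] --> d) <->
  forall e, 0 < e -> exists2 r, 0 < r &
    forall y, `|y - x| < r -> `|f y - f x - d * (y - x)| <= e * `|y - x|.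
  split.
    move=> /cvgrPdist_le h e e0; have /= := h e e0.
    rewrite near_withinE near_simpl => /nbhs_ballP[r /= r0 hr].
    exists r => // y yx; have [->|yx0] := eqVneq y x.
      by rewrite !subrr mulr0 subrr normr0 mulr0.
    have h0 : y - x != 0 by rewrite subr_eq0.
    have := hr (y - x); rewrite /ball /= sub0r normrN => /(_ yx h0).
    rewrite /GRing.scale /= mulr1 subrK distrC => h1.
    have -> : f y - f x - d * (y - x) = ((y - x)^-1 * (f y - f x) - d) * (y - x).
      by rewrite mulrBl mulrAC mulVf// mul1r.
    by rewrite normrM ler_wpM2r.
  move=> h; apply/cvgrPdist_le => e e0; have [r r0 hr] := h e e0.
  rewrite near_withinE near_simpl; apply/nbhs_ballP; exists r => //= z.
  rewrite /ball /= sub0r normrN => zr z0.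
  have := hr (z + x); rewrite addrK => /(_ zr).
  rewrite /GRing.scale /= mulr1 => h1; rewrite distrC.
  have -> : z^-1 * (f (z + x) - f x) - d = z^-1 * (f (z + x) - f x - d * z).
    by rewrite [RHS]mulrBr mulrCA mulVf// mulr1.
  by rewrite normrM normfV ler_pdivrMl ?normr_gt0// [leRHS]mulrC.
split.
  move=> [hd hv]; apply/key; rewrite -hv /derive; exact: hd.
move=> /key h; have hd : derivable f x 1 by apply/cvg_ex; exists d.
by split => //; apply/cvg_lim.
Qed.

Lemma is_derive_continuous f x (d : R) : is_derive x (1 : R) f d -> {for x, continuous f}.
Proof. by move=> fd; apply: differentiable_continuous; apply/derivable1_diffP; exact: ex_derive. Qed.

Lemma is_derive_affine f (x c s d : R) : is_derive (c + s * x) (1 : R) f d ->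
  is_derive x (1 : R) (fun t => f (c + s * t)) (s * d).
Proof.
move=> /is_derive1P h; apply/is_derive1P => e e0.
have s0 : 0 < `|s| + 1 by rewrite ltr_wpDl.
have [r r0 hr] := h _ (divr_gt0 e0 s0).
exists (r / (`|s| + 1)); first exact: divr_gt0.
move=> y yx; have := hr (c + s * y).
have -> : c + s * y - (c + s * x) = s * (y - x) by ring.
rewrite normrM => h1.
have h2 : `|s| * `|y - x| <= (`|s| + 1) * `|y - x| by rewrite ler_wpM2r// lerDl.
have := h1 (le_lt_trans h2 _); rewrite mulrC -ltr_pdivlMr// => /(_ yx).
have -> : s * d * (y - x) = d * (s * (y - x)) by ring.
move=> /le_trans; apply.
apply: (@le_trans _ _ (e / (`|s| + 1) * ((`|s| + 1) * `|y - x|))).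
  by rewrite ler_wpM2l// ltW// divr_gt0.
by rewrite mulrA divfK ?gt_eqF.
Qed.

(** Take the supremum of the points where [F] is at least [F a]. The hypothesis to its left shows
    that it is such a point; the hypothesis to its right would give a larger one if it were not
    [b]. *)
Lemma locally_nondecreasing_le (F : R -> R) a b : a <= b ->
  (forall x, a <= x <= b -> exists2 e, 0 < e &
     forall y, `|y - x| < e -> 0 <= (y - x) * (F y - F x)) ->
  F a <= F b.
Proof.
move=> ab hF.
pose S := [set x | a <= x <= b /\ F a <= F x].
have Sa : S a by split; rewrite lexx.
have hS : has_sup S by split; [exists a|exists b => x [/andP[]]].
set s := sup S.
have as_ : a <= s by apply: ub_le_sup => //; exact: hS.2.
have sb : s <= b by apply: ge_sup; [exists a|move=> x [/andP[]]].
have [e e0 he] := hF s (introT andP (conj as_ sb)).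
have [z Sz zs] : exists2 z, S z & s - e < z by apply: sup_adherent.
have zls : z <= s by apply: ub_le_sup => //; exact: hS.2.
have Fas : F a <= F s.
  apply: le_trans Sz.2 _.
  move: zls; rewrite le_eqVlt => /predU1P[->//|h2].
  have := he z; rewrite ltr0_norm ?subr_lt0// opprB ltrBlDr -ltrBlDl => /(_ zs).
  by rewrite nmulr_rge0 ?subr_lt0// subr_le0.
have [bs|sb'] := leP b s; first by have -> : b = s by apply/eqP; rewrite eq_le bs sb.
pose y := Num.min b (s + e / 2).
have sy : s < y by rewrite lt_min sb' ltrDl divr_gt0.
have yb : y <= b by rewrite ge_min lexx.
have ye : y < s + e by rewrite gt_min; apply/orP; right; rewrite ltrD2l ltr_pdivrMr// ltr_pMr// ltr1n.
have : y <= s.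
  apply: ub_le_sup; first exact: hS.2.
  split; first by rewrite yb (le_trans as_ (ltW sy)).
  apply: le_trans Fas _.
  have := he y; rewrite gtr0_norm ?subr_gt0// ltrBlDr addrC => /(_ ye).
  by rewrite pmulr_rge0 ?subr_gt0// subr_ge0.
by rewrite leNgt sy.
Qed.

End derivatives.

Section everywhere_differentiable.
Context (R : realType).
Local Notation mu := (@lebesgue_measure R).

Lemma null_set_open_cover (N : set R) (e : R) : measurable N -> mu N = 0%E -> 0 < e ->
  exists U : nat -> set R, [/\ forall k, open (U k), forall k, N `<=` U k &
    (\sum_(k <oo) mu (U k) <= e%:E)%E].
Proof.
move=> mN N0 e0.
have /choice [U hU] : forall k : nat, exists U : set R,
    [/\ open U, N `<=` U & (mu (U `\` N) < (e / (2 ^ k.+1)%:R)%:E)%E].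
  move=> k; apply: lebesgue_regularity_outer => //; first by rewrite [X in (X < _)%E]N0.
  by rewrite divr_gt0// ltr0n expn_gt0.
exists U; split; try by move=> k; have [] := hU k.
apply: le_trans (epsilon_trick0 xpredT (ltW e0)).
apply: lee_nneseries => k; first by move=> _ _; exact: measure_ge0.
move=> _; have [oU NU hm] := hU k.
have mU : measurable (U k) by exact: open_measurable.
have -> : U k = (U k `\` N) `|` N by rewrite setUC setDUK.
rewrite measureU//; last 2 first.
- exact: measurableD.
- by rewrite setDKI.
by rewrite [X in (_ + X)%E]N0 adde0; exact: ltW.
Qed.

(* [phi] is increasing with small total variation, but has infinite derivative
   on the null set: adding it absorbs the points where the derivative of [g] is
   not controlled. *)
Lemma null_set_infinite_derivative (N : set R) (c e : R) :
  measurable N -> mu N = 0%E -> 0 < e ->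
  exists phi : R -> R, [/\ forall x y, c <= x -> x <= y -> phi x <= phi y,
    forall x, 0 <= phi x <= e
  & forall x (m : nat), c < x -> N x -> exists2 r, 0 < r & forall y, `|y - x| < r ->
     m%:R * (y - x) ^+ 2 <= (y - x) * (phi y - phi x)].
Proof.
move=> mN N0 e0; have [U [oU NU Ue]] := null_set_open_cover mN N0 e0.
have mU k : measurable (U k) by exact: open_measurable.
pose S (A : set R) := (\sum_(k <oo) mu (U k `&` A))%E.
have S0 A : (0 <= S A)%E by apply: nneseries_ge0 => k _ _; exact: measure_ge0.
have Se A : measurable A -> (S A <= e%:E)%E.
  move=> mA; apply: le_trans Ue; apply: lee_nneseries => k; first by move=> _ _; exact: measure_ge0.
  by move=> _; apply: le_measure; rewrite ?inE; [exact: (measurableI _ _ (mU k) mA)|exact: mU|exact: subIsetl].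
have Sfin A : measurable A -> S A \is a fin_num.
  by move=> mA; rewrite ge0_fin_numE//; apply: le_lt_trans (Se _ mA) _; exact: ltry.
(* The total length, over all the covers, of what lies between [c] and [x]. Near a point of [N] the
   first [m] open covers all contain a common neighbourhood, so [phi] grows there with slope at
   least [m]. *)
pose phi x := fine (S `]c, x]%classic).
have phiD x y : c <= x -> x <= y -> phi y = phi x + fine (S `]x, y]%classic).
  move=> cx xy; rewrite /phi -fineD; [|exact: Sfin|exact: Sfin].
  congr fine; rewrite /S -nneseriesD; try by move=> *; exact: measure_ge0.
  apply: eq_eseriesr => k _; rewrite -measureU; try by apply: measurableI; [exact: mU|exact: measurable_itv].
    by rewrite -setIUr -itv_bndbnd_setU// bnd_simp.
  rewrite setIACA; apply/seteqP; split => // t [_] /=.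
  by rewrite !in_itv/= => -[/andP[_ tx] /andP[xt _]]; move: xt; rewrite ltNge tx.
exists phi; split.
- by move=> x y cx xy; rewrite (phiD x y)// lerDl fine_ge0.
- move=> x; rewrite fine_ge0//= -lee_fin fineK ?Se//; exact: Sfin.
move=> x m cx Nx.
have [r r0 hr] : exists2 r, 0 < r & forall y k, `|y - x| < r -> (k < m)%N -> U k y.
  elim: m => [|m [r r0 hr]]; first by exists 1.
  have /nbhs_ballP[r' /= r'0 hr'] := open_nbhs_nbhs (conj (oU m) (NU m _ Nx)).
  exists (Num.min r r'); first by rewrite lt_min r0.
  move=> y k; rewrite lt_min => /andP[h1 h2]; rewrite ltnS leq_eqVlt => /predU1P[->|]; last exact: hr.
  by apply: hr'; rewrite /ball /= distrC.
have Sm y z : c <= y -> y <= z -> (forall t, y < t <= z -> `|t - x| < r) ->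
    m%:R * (z - y) <= fine (S `]y, z]%classic).
  move=> cy yz h; rewrite -lee_fin fineK; last exact: Sfin.
  apply: le_trans (nneseries_lim_ge m _); last by move=> *; exact: measure_ge0.
  rewrite (@eq_big_nat _ _ _ 0 m _ (fun=> (z - y)%:E)); last first.
    move=> k /andP[_ km]; rewrite (_ : U k `&` `]y, z]%classic = `]y, z]%classic); last first.
      apply/setIidr => t; rewrite /= in_itv /= => yt; apply: hr => //; exact: h.
    rewrite lebesgue_measure_itv /= lte_fin EFinB.
    by case: ltP => // zy; have -> : y = z; [apply/eqP; rewrite eq_le yz zy|rewrite subee].
  by rewrite sumEFin sumr_const_nat subn0 mulr_natl.
exists (Num.min r (x - c)); first by rewrite lt_min r0 subr_gt0.
move=> y; rewrite lt_min => /andP[yr yc].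
have cy : c < y by move: yc; rewrite ltr_norml => /andP[h _]; lra.
have [xy|yx] := leP x y.
  rewrite (phiD x y)//; last exact: ltW.
  rewrite [phi x + _]addrC addrK expr2 mulrCA ler_wpM2l ?subr_ge0//; apply: Sm => //; first exact: ltW.
  move=> t /andP[xt ty]; rewrite ger0_norm ?subr_ge0 ?(ltW xt)//.
  by apply: le_lt_trans yr; rewrite ger0_norm ?subr_ge0// lerD2r.
rewrite (phiD y x) ?(ltW yx)//; last exact: ltW.
rewrite opprD addrA subrr add0r mulrN -mulNr opprB.
have -> : m%:R * (y - x) ^+ 2 = (x - y) * (m%:R * (x - y)) by ring.
rewrite ler_wpM2l ?subr_ge0 ?(ltW yx)//; apply: Sm; try exact: ltW.
move=> t /andP[yt tx]; rewrite ler0_norm ?subr_le0// opprB.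
apply: le_lt_trans yr; rewrite ltr0_norm ?subr_lt0// opprB lerD2l lerN2; exact: ltW.
Qed.

(** With the slope [M + e] and [phi] added, [g] is locally nondecreasing at every point: outside the
    null set because of the bound on [g'], on it because [phi] increases faster than any multiple of
    the distance. Letting [e] tend to 0 removes both corrections. *)
Lemma ae_derive_ge_increment (g g' : R -> R) M a b : a <= b -> 0 <= M ->
  (forall x, is_derive x (1 : R) g (g' x)) -> {ae mu, forall x, - M <= g' x} ->
  - (M * (b - a)) <= g b - g a.
Proof.
move=> ab M0 dg [N [mN N0 hN]].
suff h e : 0 < e -> - ((M + e) * (b - a) + e) <= g b - g a.
  apply/ler_addgt0Pl => e e0.
  have d0 : 0 < e / (b - a + 1) by rewrite divr_gt0// ltr_wpDl// subr_ge0.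
  have := h _ d0; set d := e / _ in d0 *.
  have : d * (b - a + 1) = e by rewrite /d divfK// gt_eqF// ltr_wpDl// subr_ge0.
  lra.
move=> e0.
(* The base point lies strictly left of [a], so that [a] itself is covered when it belongs to the
   null set. *)
have [phi [phim phie hphi]] := null_set_infinite_derivative (a - 1) mN N0 e0.

pose F x := g x + (M + e) * x + phi x.
have : F a <= F b.
  apply: locally_nondecreasing_le => // x /andP[ax xb].
  have cx : a - 1 < x by lra.
  have [Nx|Nx] := pselect (N x).
    (* The slope must beat both the derivative at [x] and the approximation error, taken with
       tolerance 1. *)
    pose m := Num.bound (`|g' x| + 1).
    have [r r0 hr] := hphi x m cx Nx.
    have [r' r'0 hr'] := (is_derive1P _ _ _).1 (dg x) 1 ltr01.
    exists (Num.min r r'); first by rewrite lt_min r0.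
    move=> y; rewrite lt_min => /andP[/hr h1 /hr' h2].
    have hm : `|g' x| + 1 < m%:R by apply: archi_boundP; rewrite addr_ge0.
    rewrite /F.
    have -> : (y - x) * (g y + (M + e) * y + phi y - (g x + (M + e) * x + phi x)) =
      (y - x) * (g y - g x - g' x * (y - x)) + g' x * (y - x) ^+ 2 + (M + e) * (y - x) ^+ 2
      + (y - x) * (phi y - phi x) by ring.
    have h3 : - (y - x) ^+ 2 <= (y - x) * (g y - g x - g' x * (y - x)).
      rewrite lerNl; apply: le_trans (ler_norm _) _; rewrite normrN normrM.
      by apply: le_trans (ler_wpM2l (normr_ge0 _) h2) _; rewrite mul1r -normrM -expr2 ger0_norm ?sqr_ge0.
    have := ler_norm (- g' x); rewrite normrN => h4.
    have h5 := sqr_ge0 (y - x); nra.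
  have gx : - M <= g' x by apply: contrapT => h; apply: Nx; exact: hN.
  have [r r0 hr] := (is_derive1P _ _ _).1 (dg x) e e0.
  exists (Num.min r 1); first by rewrite lt_min r0 ltr01.
  move=> y; rewrite lt_min => /andP[/hr h2 h1].
  have h1' : a - 1 < y by move: h1; rewrite ltr_norml => /andP[]; lra.
  have h6 : 0 <= (y - x) * (phi y - phi x).
    have [xy|yx] := leP x y.
      by rewrite mulr_ge0 ?subr_ge0// phim// ltW.
    by rewrite mulr_le0 ?subr_le0 ?(ltW yx)// phim ?(ltW yx)// ltW.
  rewrite /F.
  have -> : (y - x) * (g y + (M + e) * y + phi y - (g x + (M + e) * x + phi x)) =
      (y - x) * (g y - g x - g' x * (y - x)) + g' x * (y - x) ^+ 2 + (M + e) * (y - x) ^+ 2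
      + (y - x) * (phi y - phi x) by ring.
  have h3 : - (e * (y - x) ^+ 2) <= (y - x) * (g y - g x - g' x * (y - x)).
    rewrite lerNl; apply: le_trans (ler_norm _) _; rewrite normrN normrM.
    apply: le_trans (ler_wpM2l (normr_ge0 _) h2) _; rewrite mulrCA -normrM -expr2.
    by rewrite (ger0_norm (sqr_ge0 _)).
  have h5 := sqr_ge0 (y - x); nra.
rewrite /F; have /andP[p1 p2] := phie a; have /andP[p3 p4] := phie b; lra.
Qed.

(** An L-infinity bound says nothing about [g'] on a null set; differentiability at every point is
    what excludes behaviour of the Cantor function kind there. *)
Lemma ae_derive_le_lipschitz (g g' : R -> R) M a b :
  (forall x, is_derive x (1 : R) g (g' x)) -> {ae mu, forall x, `|g' x| <= M} ->
  `|g b - g a| <= M * `|b - a|.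
Proof.
move=> dg gM.
wlog ab : a b / a <= b.
  by move=> h; have [/h//|/ltW/h] := leP a b; rewrite distrC (distrC a).
have M0 : 0 <= M.
  have [N [mN N0 hN]] := gM.
  have [x hx] : exists x, ~ N x.
    apply: contrapT => h; pose J := `]0 : R, 1]%classic; have : (mu J <= mu N)%E.
      apply: le_measure; rewrite ?inE; [exact: measurable_itv|exact: mN|].
      by move=> x _; apply: contrapT => nx; apply: h; exists x.
    rewrite [X in (_ <= X)%E]N0 /J lebesgue_measure_itv /= lte_fin ltr01.
    by rewrite oppr0 adde0 lee_fin ler10.
  have : `|g' x| <= M by apply: contrapT => nx; apply: hx; exact: hN.
  exact: le_trans.
rewrite (ger0_norm (x := b - a)) ?subr_ge0// ler_norml; apply/andP; split.
  apply: (ae_derive_ge_increment ab M0 dg); apply: ae_imp gM => x.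
  by rewrite ler_norml => /andP[].
have dN x : is_derive x (1 : R) (- g) ((- g') x) by exact: is_deriveN.
have h : - (M * (b - a)) <= (- g) b - (- g) a.
  apply: (ae_derive_ge_increment ab M0 dN); apply: ae_imp gM => x.
  by rewrite ler_norml => /andP[_]; rewrite /GRing.opp /= lerN2.
by move: h; have hN x : (- g) x = - g x by []; rewrite !hN; lra.
Qed.

End everywhere_differentiable.

(** * Translation invariance of Lebesgue integrals *)

Section lebesgue_translation.
Context (R : realType).
Local Notation mu := (@lebesgue_measure R).
Implicit Types f g : R -> R.

Lemma measurable_shift (h : R) : measurable_fun [set: R] (fun x : R => x + h).
Proof. by apply: measurable_funD. Qed.

Section fixed_shift.
Variable h : R.
Let sh (x : R) : measurableTypeR R := x + h.
Let msh : measurable_fun [set: measurableTypeR R] sh := measurable_shift h.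
Let sh_mixin := isMeasurableFun.Build _ _ _ _ _ msh.
Let sh_pack : {mfun measurableTypeR R >-> measurableTypeR R} := HB.pack sh sh_mixin.

Lemma lebesgue_measure_shift (A : set (measurableTypeR R)) : measurable A ->
  pushforward mu sh_pack A = mu A.
Proof.
move=> mA; apply/esym/lebesgue_measure_unique => //= X [[a b] _ <-] /=.
rewrite /pushforward /=.
have -> : sh @^-1` `]a, b]%classic = `]a - h, b - h]%classic.
  by apply/seteqP; split => x /=; rewrite !in_itv/= ltrBlDr lerBrDr.
rewrite !lebesgue_measure_itv /= !lte_fin ltrD2r; case: ifP => // _.
by rewrite -!EFinD; congr (_%:E); ring.
Qed.

Lemma ge0_integral_shift (f : R -> \bar R) : measurable_fun setT f ->
  (forall x, (0 <= f x)%E) -> (\int[mu]_x f (x + h)%R = \int[mu]_x f x)%E.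
Proof.
move=> mf f0; transitivity (\int[pushforward mu sh_pack]_x f x)%E.
  by rewrite ge0_integral_pushforward.
by apply: eq_measure_integral => A mA _; exact: lebesgue_measure_shift.
Qed.

End fixed_shift.

Lemma integral_shift (f : R -> \bar R) h : measurable_fun setT f ->
  (\int[mu]_x f (x + h)%R = \int[mu]_x f x)%E.
Proof.
move=> mf; rewrite [LHS]integralE [RHS]integralE.
have h1 := ge0_integral_shift h (measurable_funepos mf) (funepos_ge0 f).
have h2 := ge0_integral_shift h (measurable_funeneg mf) (funeneg_ge0 f).
by rewrite -h1 -h2 !funepos.unlock !funeneg.unlock.
Qed.

Lemma Rintegral_shift f h : measurable_fun setT f ->
  \int[mu]_x f (x + h) = \int[mu]_x f x.
Proof.
by move=> mf; rewrite /Rintegral (integral_shift h (measurableT_comp (@EFin_measurable R setT) mf)).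
Qed.

Lemma sqint_shift f h : measurable_fun setT f ->
  sqint mu (fun x => f (x + h)) = sqint mu f.
Proof.
move=> mf; apply: (@ge0_integral_shift h (fun x => (f x ^+ 2)%:E)); first exact: measurable_sq.
by move=> x; rewrite lee_fin sqr_ge0.
Qed.

Lemma measurable_comp_shift f (h : R) : measurable_fun setT f ->
  measurable_fun setT (fun x : R => f (x + h)).
Proof. by move=> mf; apply: (measurableT_comp mf); exact: measurable_shift. Qed.

Lemma sqintegrable_shift f (h : R) : sqintegrable mu f ->
  sqintegrable mu (fun x : R => f (x + h)).
Proof. by move=> [mf f2]; split; [exact: measurable_comp_shift|rewrite sqint_shift]. Qed.

Lemma dotL2_shift f g (h : R) : sqintegrable mu f -> sqintegrable mu g ->
  dotL2 mu (fun x : R => f (x + h)) (fun x : R => g (x + h)) = dotL2 mu f g.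
Proof.
move=> [mf _] [mg _]; apply: (@Rintegral_shift (fun x => f x * g x)).
exact: measurable_funM.
Qed.

End lebesgue_translation.

(** * Integral inequalities and measurability for functions of two variables *)

Section parametric.
Context (R : realType).
Local Notation mu := (@lebesgue_measure R).

(* With t = |X| / h, the inequality |k| <= (t + k^2 / t) / 2 gives X^2 <= h * int k^2. *)
Lemma sqr_le_integral_sqr (k : R -> R) (h X : R) : 0 < h ->
  measurable_fun setT k -> (`|X|%:E <= \int[mu]_(s in `[0%R, h]) `|k s|%:E)%E ->
  ((X ^+ 2)%:E <= h%:E * \int[mu]_(s in `[0%R, h]) (k s ^+ 2)%:E)%E.
Proof.
move=> h0 mk hX.
have mJ : measurable (`[0%R, h]%classic : set R) by exact: measurable_itv.
have muJ : mu `[0%R, h]%classic = h%:E.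
  by rewrite lebesgue_measure_itv /= lte_fin h0 oppr0 adde0.
have I0 : (0 <= \int[mu]_(s in `[0%R, h]) (k s ^+ 2)%:E)%E.
  by apply: integral_ge0 => s _; rewrite lee_fin sqr_ge0.
have mk2 : measurable_fun `[0%R, h] (fun s => (k s ^+ 2)%:E).
  by apply: measurable_funTS; exact: measurable_sq.
have [->|X0] := eqVneq X 0; first by rewrite expr0n mule_ge0// lee_fin ltW.
have X1 : 0 < `|X| by rewrite normr_gt0.
pose t := `|X| / h; have t0 : 0 < t by rewrite divr_gt0.
have h1 : (`|X|%:E <= (t / 2 * h)%:E + (1 / (2 * t))%:E * \int[mu]_(s in `[0%R, h]) (k s ^+ 2)%:E)%E.
  apply: le_trans hX _.
  have -> : ((t / 2 * h)%:E = \int[mu]_(s in `[0%R, h]) (cst (t / 2)%R%:E) s)%E.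
    by rewrite integral_cst// [X in (_ * X)%E]muJ EFinM.
  have c0 : 0 <= 1 / (2 * t) by rewrite divr_ge0// mulr_ge0// ltW.
  rewrite -ge0_integralZl_EFin//; last by move=> s _; rewrite lee_fin sqr_ge0.
  rewrite -ge0_integralD//; last 3 first.
  - by move=> s _; rewrite lee_fin divr_ge0// ltW.
  - by move=> s _; rewrite -EFinM lee_fin mulr_ge0// sqr_ge0.
  - by apply: emeasurable_funM => //; exact: measurable_cst.
  apply: ge0_le_integral => //.
  - by apply: measurable_funTS; apply/measurable_EFinP; exact: measurableT_comp.
  - by apply: emeasurable_funD => //; exact: emeasurable_funM.
  move=> s _; rewrite /cst -EFinM -EFinD lee_fin.
  have := sqr_ge0 (`|k s| - t); rewrite -(real_normK (num_real (k s))).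
  set a := `|k s| => h2.
  have -> : t / 2 + 1 / (2 * t) * a ^+ 2 = a + (a - t) ^+ 2 / (2 * t).
    by field; rewrite gt_eqF.
  by rewrite lerDl divr_ge0 ?sqr_ge0// mulr_ge0// ltW.
move: h1 I0; case: (\int[mu]_(s in `[0%R, h]) (k s ^+ 2)%:E)%E => [A| |] //.
- rewrite -EFinM -EFinD -EFinM !lee_fin => h1 A0.
  rewrite -(real_normK (num_real X)).
  have e1 : t / 2 * h = `|X| / 2 by rewrite /t; field; rewrite gt_eqF.
  have e2 : 1 / (2 * t) * A = h * A / (2 * `|X|) by rewrite /t; field; rewrite !gt_eqF.
  have : `|X| / 2 <= h * A / (2 * `|X|) by lra.
  rewrite ler_pdivlMr ?mulr_gt0//; lra.
- by move=> _ _; rewrite gt0_muley ?lte_fin// leey.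
Qed.

(** Minkowski's integral inequality for the parameter interval: Cauchy-Schwarz in [s] for each [l],
    then Tonelli. Each of the two contributes one factor [h]. *)
Lemma sqint_le_of_integral_bound (k : R -> R -> R) (G : R -> R) (h B : R) : 0 < h ->
  measurable_fun setT (fun p : R * R => k p.1 p.2) -> measurable_fun setT G ->
  (forall s, 0 <= s <= h -> (sqint mu (k s) <= B%:E)%E) ->
  {ae mu, forall l, (`|G l|%:E <= \int[mu]_(s in `[0%R, h]) `|k s l|%:E)%E} ->
  (sqint mu G <= (h ^+ 2 * B)%:E)%E.
Proof.
move=> h0 mk mG hB hG.
have mkl l : measurable_fun setT (fun s => k s l).
  exact: (measurable_fun_pair1 (f := fun p : R * R => k p.1 p.2) l).
have mks s : measurable_fun setT (k s).
  exact: (measurable_fun_pair2 (f := fun p : R * R => k p.1 p.2) s).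
have B0 : 0 <= B.
  have := le_trans (sqint_ge0 mu (k 0)) (hB 0 _); rewrite lee_fin; apply.
  by rewrite lexx ltW.
have muJ : mu `[0%R, h]%classic = h%:E.
  by rewrite lebesgue_measure_itv /= lte_fin h0 oppr0 adde0.
pose F (p : R * R) := ((k p.1 p.2 ^+ 2 * \1_(`[0%R, h]%classic : set R) p.1)%:E : \bar R).
have mJ : measurable (`[0%R, h]%classic : set R) by exact: measurable_itv.
have mF : measurable_fun setT F.
  apply/measurable_EFinP; apply: measurable_funM; first exact: measurable_funX.
  have mi : measurable_fun [set: R] (\1_(`[0%R, h]%classic : set R) : R -> R) by exact: measurable_indic.
  exact: (measurableT_comp mi measurable_fst).
have F0 p : (0 <= F p)%E by rewrite lee_fin mulr_ge0 ?sqr_ge0// indicE ler0n.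
have FE l : (\int[mu]_(s in `[0%R, h]) (k s l ^+ 2)%:E = \int[mu]_s F (s, l))%E.
  rewrite [LHS]integral_mkcond; apply: eq_integral => s _.
  rewrite /F /= patchE indicE; case: ifP => _; first by rewrite mulr1.
  by rewrite mulr0.
have mFl : measurable_fun setT (fun l => \int[mu]_s F (s, l))%E.
  exact: (@measurable_fun_fubini_tonelli_G _ _ _ _ _ mu F mF F0).
apply: (@le_trans _ _ (\int[mu]_l (h%:E * \int[mu]_s F (s, l)))%E).
  apply: ae_ge0_le_integral => //.
  - by move=> l _; rewrite lee_fin sqr_ge0.
  - exact: measurable_sq.
  - by move=> l _; apply: mule_ge0; [rewrite lee_fin ltW|exact: integral_ge0].
  - by apply: emeasurable_funM => //; exact: measurable_cst.
  by apply: ae_imp hG => l hl _; rewrite -FE; exact: sqr_le_integral_sqr.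
rewrite ge0_integralZl_EFin//; [|by move=> l _; exact: integral_ge0|exact: ltW].
rewrite expr2 -mulrA EFinM; apply: lee_wpmul2l; first by rewrite lee_fin ltW.
rewrite -(@fubini_tonelli _ _ _ _ _ mu mu F mF F0) /=.
apply: (@le_trans _ _ (\int[mu]_(s in `[0%R, h]) (cst B%:E) s)%E); last first.
  by rewrite integral_cst// [X in (_ * X <= _)%E]muJ mulrC EFinM.
rewrite [leRHS]integral_mkcond; apply: ge0_le_integral => //.
- by move=> s _; exact: integral_ge0.
- exact: (@measurable_fun_fubini_tonelli_F _ _ _ _ _ mu F mF F0).
- by apply/(measurable_restrictT _ _).1 => //; exact: measurable_cst.
move=> s _; rewrite patchE; case: ifPn => sJ.
  rewrite /F /= indicE sJ; under eq_integral do rewrite mulr1.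
  by apply: hB; move: sJ; rewrite inE /= in_itv.
rewrite /F /= indicE (negbTE sJ); under eq_integral do rewrite mulr0.
by rewrite integral0.
Qed.

(** Rounding the first variable down to a multiple of 1 / (m + 1) gives a function which on each of
    countably many strips depends on the second variable only; continuity in the first variable
    recovers [u] in the limit. *)
Lemma caratheodory_measurable (u : R -> R -> R) :
  (forall l, continuous (u ^~ l)) -> (forall s, measurable_fun setT (u s)) ->
  measurable_fun setT (fun p : R * R => u p.1 p.2).
Proof.
move=> cu mu_.
pose un (m : nat) (p : R * R) := u ((Num.floor (m.+1%:R * p.1))%:~R / m.+1%:R) p.2.
apply: (measurable_fun_cvg (h := un)).
  move=> m _ B mB; rewrite setTI.
  have -> : un m @^-1` B = \bigcup_(z : int)
     ((fun p : R * R => p.1) @^-1` `[z%:~R / m.+1%:R, (z + 1)%:~R / m.+1%:R[%classic `&`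
      (fun p : R * R => p.2) @^-1` (u (z%:~R / m.+1%:R) @^-1` B)).
    have m0 : 0 < (m.+1%:R : R) by rewrite ltr0n.
    have hfl (z : int) (x : R) : (z%:~R / m.+1%:R <= x < (z + 1)%:~R / m.+1%:R) = (Num.floor (m.+1%:R * x) == z).
      rewrite ler_pdivrMr// ltr_pdivlMr// [x * _]mulrC.
      apply/idP/eqP => [h|<-]; first by apply/floor_def; rewrite h.
      by have := floor_itv (m.+1%:R * x); rewrite /= .
    apply/seteqP; split => [[x y]|[x y] [z _]] /=.
      move=> h; exists (Num.floor (m.+1%:R * x)) => //=; split => //.
      by rewrite in_itv /= hfl.
    by rewrite in_itv /= hfl => -[/eqP <-].
  apply: countable_bigcupT_measurable => // z; apply: measurableI.
    by rewrite -[X in measurable X]setTI; apply: measurable_fst => //; exact: measurable_itv.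
  rewrite -[X in measurable X]setTI; apply: measurable_snd => //.
  by rewrite -[X in measurable X]setTI; exact: mu_.
move=> [x y] _; rewrite /un /=.
apply: (cvg_comp _ (u ^~ y) _ (cu y x)).
apply/cvgrPdist_le => e e0.
near=> m.
have m0 : 0 < (m.+1%:R : R) by rewrite ltr0n.
have hm : m.+1%:R^-1 <= e.
  near: m; have := @cvg_harmonic R => /cvgrPdist_le /(_ e e0); apply: filterS => m.
  by rewrite /harmonic /= sub0r normrN ger0_norm// invr_ge0.
apply: le_trans hm; have /andP[h1 h2] := floor_itv (m.+1%:R * x).
have -> : x - (Num.floor (m.+1%:R * x))%:~R / m.+1%:R =
  (m.+1%:R * x - (Num.floor (m.+1%:R * x))%:~R) / m.+1%:R by field; rewrite gt_eqF.
have mi : 0 <= m.+1%:R^-1 :> R by rewrite invr_ge0 ltW.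
rewrite normrM (ger0_norm mi) ler_piMl//.
rewrite ger0_norm ?subr_ge0// lerBlDr; move: h2; rewrite intrD1 addrC; exact: ltW.
Unshelve. all: end_near. Qed.

End parametric.

Section difference_quotients.
Context (R : realType).
Local Notation mu := (@lebesgue_measure R).

Lemma cvg_difference_quotient (f : R -> R) (x d : R) : is_derive x (1 : R) f d ->
  (fun m => (f (x + harmonic m) - f x) / harmonic m) @ \oo --> d.
Proof.
move=> /is_derive1P h; apply/cvgrPdist_le => e e0; have [r r0 hr] := h e e0.
have := @cvg_harmonic R => /cvgrPdist_lt /(_ r r0); apply: filterS => m.
rewrite sub0r normrN => hm; have := hr (x + harmonic m); rewrite addrAC subrr add0r => /(_ hm).
have h0 : 0 < harmonic m :> R by exact: harmonic_gt0.
set y := harmonic m in h0 *.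
move=> h1; rewrite distrC.
have -> : (f (x + y) - f x) / y - d = (f (x + y) - f x - d * y) / y by field; rewrite gt_eqF.
by rewrite normrM normfV ler_pdivrMr ?normr_gt0 ?gt_eqF.
Qed.

(** The derivative is not assumed continuous. Difference quotients of [g] converge to it and are
    dominated by [M] through the Lipschitz bound; their integrals are increments of difference
    quotients of a primitive of the continuous function [g], which tend to [g b - g a]. *)
Lemma ae_bounded_derive_integral (g g' : R -> R) (M a b : R) : a < b ->
  (forall x, is_derive x (1 : R) g (g' x)) -> {ae mu, forall x, `|g' x| <= M} ->
  (\int[mu]_(x in `[a, b]) (g' x)%:E = (g b - g a)%:E)%E.
Proof.
move=> ab dg gM.
have cg : continuous g by move=> x; exact: is_derive_continuous (dg x).
have lip x y : `|g y - g x| <= M * `|y - x| by exact: ae_derive_le_lipschitz dg gM.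
pose e m : R := harmonic m.
have e0 m : 0 < e m by exact: harmonic_gt0.
have e1 m : e m <= 1 by rewrite /e /harmonic /= invf_le1 ?ltr0n// ler1n.
pose u m x := (g (x + e m) - g x) / e m.
have cu m : continuous (u m).
  move=> x; apply: cvgM; last exact: cvg_cst.
  apply: cvgB; last exact: cg.
  apply: (@continuous_comp _ _ _ (fun x => x + e m) g); last exact: cg.
  by apply: cvgD; [exact: cvg_id|exact: cvg_cst].
have mg' : measurable_fun setT g'.
  apply: (measurable_fun_cvg (h := u)); first by move=> m; exact: continuous_measurable_fun.
  by move=> x _; exact: cvg_difference_quotient.
have mJ : measurable (`[a, b]%classic : set R) by exact: measurable_itv.
have := @dominated_convergence _ _ R mu `[a, b]%classic mJ (fun m x => (u m x)%:E)
  (fun x => (g' x)%:E) (fun=> M%:E).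
case.
- by move=> m; apply/measurable_EFinP/measurable_funTS; exact: continuous_measurable_fun.
- by apply/measurable_EFinP/measurable_funTS.
- apply: ae_all => x _; apply: cvg_EFin; first exact: nearW.
  exact: cvg_difference_quotient.
- apply/integrableP; split; first exact: measurable_cst.
  rewrite integral_cst// [X in (_ * X)%E]lebesgue_measure_itv /= lte_fin ab -!EFinD.
  by rewrite -EFinM ltry.
- apply: ae_all => x m _; rewrite abse_EFin lee_fin /u normrM normfV ler_pdivrMr ?normr_gt0 ?gt_eqF//.
  by apply: le_trans (lip _ _) _; rewrite [x + _]addrC addrK.
move=> _ _ cvI.
(* The primitive starts left of [a], so that it is differentiable at [a] from both sides. *)
pose c := a - 1.
pose G x := \int[mu]_(t in `[c, x]) g t.
have dG x : c < x -> is_derive x (1 : R) G (g x).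
  move=> cx; have xx : x < x + 1 by rewrite ltrDl.
  have ig : mu.-integrable `[c, x + 1] (EFin \o g).
    apply: continuous_compact_integrable; first exact: segment_compact.
    by apply: continuous_subspaceT.
  have [d1 d2] := continuous_FTC1_closed xx ig cx (cg x).
  apply: DeriveDef; first exact: d1.
  by rewrite -derive1E; exact: d2.
pose H m x := (G (x + e m) - G x) / e m.
have dH m x : c < x -> is_derive x (1 : R) (H m) (u m x).
  move=> cx.
  have h1 : is_derive x (1 : R) (fun t => G (e m + 1 * t)) (1 * g (x + e m)).
    apply: is_derive_affine; rewrite mul1r addrC; apply: dG.
    by rewrite (lt_le_trans cx)// lerDl ltW.
  have h2 := is_deriveZ (e m)^-1 (is_deriveB h1 (dG x cx)).
  have -> : H m = (e m)^-1 \*: ((fun t => G (e m + 1 * t)) - G).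
    apply/funext => t; rewrite -[RHS]/((e m)^-1 * (G (e m + 1 * t) - G t)).
    by rewrite mul1r [e m + t]addrC mulrC.
  have -> : u m x = (e m)^-1 *: (1 * g (x + e m) - g x).
    by rewrite mul1r /u mulrC.
  exact: h2.
have ca : c < a by rewrite /c ltrBlDr ltrDl.
have HI m : (\int[mu]_(x in `[a, b]) (u m x)%:E = (H m b)%:E - (H m a)%:E)%E.
  apply: (@continuous_FTC2 R (u m) (H m) a b ab); first by apply: continuous_subspaceT.
    split.
    - by move=> x; rewrite in_itv/= => /andP[ax _]; case: (dH m x (lt_trans ca ax)).
    - by apply: cvg_at_right_filter; exact: is_derive_continuous (dH m a ca).
    - apply: cvg_at_left_filter; exact: is_derive_continuous (dH m b (lt_trans ca ab)).
  move=> x; rewrite in_itv/= => /andP[ax _].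
  by rewrite derive1E; case: (dH m x (lt_trans ca ax)).
have cvH : ((H m b)%:E - (H m a)%:E)%E @[m --> \oo] --> (g b - g a)%:E.
  under eq_fun do rewrite -EFinB.
  apply: cvg_EFin; first exact: nearW.
  by apply: cvgB; apply: cvg_difference_quotient; apply: dG => //; exact: lt_trans ab.
have cvH' : [sequence (\int[mu]_(x in `[a, b]) (u m x)%:E)%E]_m @ \oo --> (g b - g a)%:E.
  by rewrite (_ : [sequence _]_m = (fun m => (H m b)%:E - (H m a)%:E)%E)//; apply/funext => m; exact: HI.
exact: (cvg_unique _ cvI cvH').
Qed.

Section family.
Variables (u u' : R -> R -> R) (M N S : R).
Hypothesis S0 : 0 < S.
Hypothesis du : forall s l, is_derive s (1 : R) (u ^~ l) (u' s l).
Hypothesis mu_ : forall s, measurable_fun setT (u s).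
Hypothesis uM : forall s, {ae mu, forall l, `|u' s l| <= M}.

Let mu2 : measurable_fun setT (fun p : R * R => u' p.1 p.2).
Proof.
have mu2 : measurable_fun setT (fun p : R * R => u p.1 p.2).
  by apply: caratheodory_measurable => // l s; exact: is_derive_continuous (du s l).
apply: (measurable_fun_cvg (h := fun m (p : R * R) => (u (p.1 + harmonic m) p.2 - u p.1 p.2) / harmonic m)).
  move=> m; apply: measurable_funM => //; apply: measurable_funB => //.
  have ms : measurable_fun setT (fun p : R * R => (p.1 + harmonic m, p.2)).
    apply: measurable_fun_pair => //; apply: measurable_funD => //.
  exact: (measurableT_comp mu2 ms).
by move=> p _; exact: cvg_difference_quotient (du p.1 p.2).
Qed.

(** The exceptional set of [l] depends on [s]. The excess of [|u'|] over [M] is jointly measurable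
    with zero double integral, and Tonelli lets the two quantifiers be exchanged. *)
Lemma family_ae_bounded : {ae mu, forall l, {ae mu, forall s, `|u' s l| <= M}}.
Proof.
pose F (p : R * R) := ((Num.max (`|u' p.1 p.2| - M) 0)%:E : \bar R).
have mF : measurable_fun setT F.
  apply/measurable_EFinP; apply: measurable_maxr => //; apply: measurable_funB => //.
  exact: measurableT_comp.
have F0 p : (0 <= F p)%E by rewrite lee_fin le_max lexx orbT.
have FE s l : F (s, l) = 0%E -> `|u' s l| <= M.
  by rewrite /F /= => -[] /max_idPr; rewrite subr_le0.
have h1 : (\int[mu]_s \int[mu]_l F (s, l) = 0)%E.
  apply: integral0_eq => s _.
  rewrite (ae_eq_integral (cst 0%E)) ?integral0//.
    exact: (measurable_fun_pair2 (f := F) s).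
  by apply: ae_imp (uM s) => l hl _; rewrite /F /= max_r// subr_le0.
move: h1; rewrite (@fubini_tonelli _ _ _ _ _ mu mu F mF F0) => h2.
have mG : measurable_fun setT (fun l => \int[mu]_s F (s, l))%E.
  exact: (@measurable_fun_fubini_tonelli_G _ _ _ _ _ mu F mF F0).
have G0 l : (0 <= \int[mu]_s F (s, l))%E by exact: integral_ge0.
have h3 : (\int[mu]_l `|\int[mu]_s F (s, l)| = 0)%E.
  by rewrite -[RHS]h2; apply: eq_integral => l _; rewrite gee0_abs.
have := (ae_eq_integral_abs mu measurableT mG).1 h3.
apply: ae_imp => l /(_ I) hl.
have mFl : measurable_fun setT (fun s => F (s, l)) by exact: (measurable_fun_pair1 (f := F) l).
have h4 : (\int[mu]_s `|F (s, l)| = 0)%E.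
  by rewrite -[RHS]hl; apply: eq_integral => s _; rewrite gee0_abs.
have := (ae_eq_integral_abs mu measurableT mFl).1 h4.
by apply: ae_imp => s /(_ I); exact: FE.
Qed.

Lemma family_increment_bounded a b : {ae mu, forall l, `|u b l - u a l| <= M * `|b - a|}.
Proof.
apply: ae_imp family_ae_bounded => l hl.
by apply: (ae_derive_le_lipschitz (g := u ^~ l) (g' := u' ^~ l)).
Qed.

Lemma family_increment_sqint : (forall s, 0 <= s <= S -> (sqint mu (u' s) <= N%:E)%E) ->
  (sqint mu (fun l => (u S l - u 0 l)%R) <= (S ^+ 2 * N)%:E)%E.
Proof.
move=> hN; apply: (sqint_le_of_integral_bound S0 mu2 _ hN).
  by apply: measurable_funB.
apply: ae_imp family_ae_bounded => l hl.
rewrite -abse_EFin -(ae_bounded_derive_integral (g := u ^~ l) (g' := u' ^~ l) S0 _ hl)//.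
apply: le_trans (le_abse_integral _ _ _) _ => //.
apply/measurable_EFinP/measurable_funTS.
exact: (measurable_fun_pair1 (f := fun p : R * R => u' p.1 p.2) l).
Qed.

End family.
End difference_quotients.

(** * Matrix-valued L2 *)

Section matrix_frobenius.
Context (R : realType) (n : nat).
Local Notation C := R[i].
Local Notation MM := 'M[R[i]]_n.
Implicit Types A B V W : MM.

Lemma ReM (x y : C) : complex.Re (x * y) =
  complex.Re x * complex.Re y - complex.Im x * complex.Im y.
Proof. by case: x y => a b [c d]. Qed.

Lemma ImM (x y : C) : complex.Im (x * y) =
  complex.Re x * complex.Im y + complex.Im x * complex.Re y.
Proof. by case: x y => a b [c d]. Qed.

Lemma ReD (x y : C) : complex.Re (x + y) = complex.Re x + complex.Re y.
Proof. by case: x y => a b [c d]. Qed.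

Lemma ImD (x y : C) : complex.Im (x + y) = complex.Im x + complex.Im y.
Proof. by case: x y => a b [c d]. Qed.

Lemma ReN (x : C) : complex.Re (- x) = - complex.Re x.
Proof. by case: x. Qed.

Lemma ImN (x : C) : complex.Im (- x) = - complex.Im x.
Proof. by case: x. Qed.

Lemma ReB (x y : C) : complex.Re (x - y) = complex.Re x - complex.Re y.
Proof. by case: x y => a b [c d]. Qed.

Lemma ImB (x y : C) : complex.Im (x - y) = complex.Im x - complex.Im y.
Proof. by case: x y => a b [c d]. Qed.

Lemma Re_sum (I : Type) (r : seq I) (P : pred I) (F : I -> C) :
  complex.Re (\sum_(i <- r | P i) F i) = \sum_(i <- r | P i) complex.Re (F i).
Proof. by apply: (big_morph (@complex.Re R) ReD). Qed.

Lemma Im_sum (I : Type) (r : seq I) (P : pred I) (F : I -> C) :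
  complex.Im (\sum_(i <- r | P i) F i) = \sum_(i <- r | P i) complex.Im (F i).
Proof. by apply: (big_morph (@complex.Im R) ImD). Qed.

Lemma complex_ext (x y : C) :
  complex.Re x = complex.Re y -> complex.Im x = complex.Im y -> x = y.
Proof. by case: x y => a b [c d] /= -> ->. Qed.

Definition adjmx A : MM := map_mx conjc A^T.

Lemma adjmxE A i j : adjmx A i j = conjc (A j i).
Proof. by rewrite !mxE. Qed.

Lemma adjmxK A : adjmx (adjmx A) = A.
Proof. by apply/matrixP => i j; rewrite !adjmxE conjcK. Qed.

Lemma adjmxM A B : adjmx (A *m B) = adjmx B *m adjmx A.
Proof. by rewrite /adjmx trmx_mul map_mxM. Qed.

Lemma adjmx1 : adjmx 1%:M = 1%:M.
Proof. by rewrite /adjmx trmx1 map_mx1. Qed.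

(** The Frobenius inner product of matrices regarded as a real vector space. *)
Definition rdot A B : R := complex.Re (\tr (A *m adjmx B)).

Lemma rdotE A B : rdot A B = \sum_i \sum_j
  (complex.Re (A i j) * complex.Re (B i j) + complex.Im (A i j) * complex.Im (B i j)).
Proof.
rewrite /rdot /mxtrace Re_sum; apply: eq_bigr => i _.
rewrite mxE Re_sum; apply: eq_bigr => j _.
by rewrite adjmxE ReM; case: (B i j) => a b /=; rewrite mulrN opprK.
Qed.

Lemma rdotC A B : rdot A B = rdot B A.
Proof. by rewrite !rdotE; do 2 (apply: eq_bigr => ? _); ring. Qed.

Lemma rdotDl A B V : rdot (A + B) V = rdot A V + rdot B V.
Proof. by rewrite /rdot mulmxDl mxtraceD ReD. Qed.

Lemma rdotDr A B V : rdot V (A + B) = rdot V A + rdot V B.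
Proof. by rewrite rdotC rdotDl !(rdotC V). Qed.

Lemma rdotBl A B V : rdot (A - B) V = rdot A V - rdot B V.
Proof. by rewrite /rdot mulmxBl raddfB ReB. Qed.

Lemma rdotZl (c : R) A V : rdot (c%:C *: A) V = c * rdot A V.
Proof. by rewrite /rdot -scalemxAl mxtraceZ ReM /= mul0r subr0. Qed.

Lemma rdot0l V : rdot 0 V = 0.
Proof. by rewrite /rdot mul0mx mxtrace0. Qed.

Lemma rdot_mull A V B : rdot (A *m V) B = rdot A (B *m adjmx V).
Proof. by rewrite /rdot adjmxM adjmxK mulmxA. Qed.

Lemma rdot_frob A : rdot A A = mxfrob A ^+ 2.
Proof.
rewrite sqr_sqrtr ?rdotE//.
  by do 2 (apply: sumr_ge0 => ? _); rewrite addr_ge0 ?sqr_ge0.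
Qed.

Lemma mxfrob_ge0 A : 0 <= mxfrob A.
Proof. exact: sqrtr_ge0. Qed.

Lemma rdot_ge0 A : 0 <= rdot A A.
Proof. by rewrite rdot_frob sqr_ge0. Qed.

Lemma rdot_CS A B : `|rdot A B| <= mxfrob A * mxfrob B.
Proof.
have h : rdot A B ^+ 2 <= rdot A A * rdot B B.
  apply: (@semi_inner_CS R MM (fun a b => a + b) (fun c a => c%:C *: a) (fun=> True)) => //.
  - by move=> *; exact: rdotC.
  - by move=> *; exact: rdotDl.
  - by move=> *; exact: rdotZl.
  - by move=> *; exact: rdot_ge0.
rewrite -(@ler_pXn2r _ 2)// ?nnegrE ?normr_ge0 ?mulr_ge0 ?mxfrob_ge0//.
by rewrite real_normK ?num_real// exprMn -!rdot_frob.
Qed.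

Lemma mxfrob_sqr A :
  mxfrob A ^+ 2 = \sum_i \sum_j (complex.Re (A i j) ^+ 2 + complex.Im (A i j) ^+ 2).
Proof. by rewrite -rdot_frob rdotE; do 2 (apply: eq_bigr => ? _); rewrite !expr2. Qed.

Lemma sqr_entry_le A i j :
  complex.Re (A i j) ^+ 2 + complex.Im (A i j) ^+ 2 <= mxfrob A ^+ 2.
Proof.
rewrite mxfrob_sqr (bigD1 i)//= (bigD1 j)//= -addrA lerDl addr_ge0//.
  by apply: sumr_ge0 => ? _; rewrite addr_ge0 ?sqr_ge0.
by do 2 (apply: sumr_ge0 => ? _); rewrite addr_ge0 ?sqr_ge0.
Qed.

Lemma Re_entry_le A i j : `|complex.Re (A i j)| <= mxfrob A.
Proof.
rewrite -(@ler_pXn2r _ 2)// ?nnegrE ?normr_ge0 ?mxfrob_ge0// real_normK ?num_real//.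
by apply: le_trans (sqr_entry_le A i j); rewrite lerDl sqr_ge0.
Qed.

Lemma Im_entry_le A i j : `|complex.Im (A i j)| <= mxfrob A.
Proof.
rewrite -(@ler_pXn2r _ 2)// ?nnegrE ?normr_ge0 ?mxfrob_ge0// real_normK ?num_real//.
by apply: le_trans (sqr_entry_le A i j); rewrite lerDr sqr_ge0.
Qed.

Lemma normc_entry_le A i j : `|A i j| <= (mxfrob A)%:C.
Proof.
rewrite normc_def lecR -(@ler_pXn2r _ 2)// ?nnegrE ?sqrtr_ge0 ?mxfrob_ge0//.
by rewrite sqr_sqrtr ?sqr_entry_le// addr_ge0 ?sqr_ge0.
Qed.

Lemma mxfrob_le_entries A K : 0 <= K -> (forall i j, `|A i j| <= K%:C) ->
  mxfrob A <= n%:R * K.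
Proof.
move=> K0 h; rewrite -(@ler_pXn2r _ 2)// ?nnegrE ?mulr_ge0 ?mxfrob_ge0//.
rewrite mxfrob_sqr.
apply: (@le_trans _ _ (\sum_(i < n) \sum_(j < n) K ^+ 2)).
  apply: ler_sum => i _; apply: ler_sum => j _.
  have := h i j; rewrite normc_def lecR => h1.
  rewrite -[leLHS]sqr_sqrtr ?addr_ge0 ?sqr_ge0//.
  by rewrite (@ler_pXn2r _ 2)// ?nnegrE ?sqrtr_ge0.
by rewrite !sumr_const !card_ord exprMn -mulrnA -[leLHS]mulr_natl natrM -expr2.
Qed.

Lemma mxfrobD A B : mxfrob (A + B) <= mxfrob A + mxfrob B.
Proof.
rewrite -(@ler_pXn2r _ 2)// ?nnegrE ?addr_ge0 ?mxfrob_ge0//.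
rewrite -rdot_frob rdotDl !rdotDr !rdot_frob (rdotC B A).
by have := rdot_CS A B; have := ler_norm (rdot A B); nra.
Qed.

Lemma mxfrobN A : mxfrob (- A) = mxfrob A.
Proof.
rewrite /mxfrob; congr Num.sqrt; do 2 (apply: eq_bigr => ? _).
by rewrite mxE ReN ImN !sqrrN.
Qed.

Lemma mxfrob0 : mxfrob (0 : MM) = 0.
Proof. by apply/eqP; rewrite -sqrf_eq0 -rdot_frob rdot0l. Qed.

Lemma mxfrob_eq0 A : mxfrob A = 0 -> A = 0.
Proof.
move=> h; apply/matrixP => i j; rewrite mxE.
have := Re_entry_le A i j; have := Im_entry_le A i j; rewrite h !normr_le0 => /eqP h1 /eqP h2.
exact: complex_ext.
Qed.

Lemma mxfrobZ (c : R) A : mxfrob (c%:C *: A) = `|c| * mxfrob A.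
Proof.
apply/eqP; rewrite -(@eqrXn2 _ 2)// ?mulr_ge0 ?mxfrob_ge0//.
by rewrite -rdot_frob rdotZl rdotC rdotZl rdot_frob exprMn real_normK ?num_real// mulrA -expr2.
Qed.

Lemma mxfrob_adj A : mxfrob (adjmx A) = mxfrob A.
Proof.
apply/eqP; rewrite -(@eqrXn2 _ 2)// ?mxfrob_ge0// !mxfrob_sqr exchange_big /=; apply/eqP.
by do 2 (apply: eq_bigr => ? _); rewrite adjmxE; case: (A _ _) => a b /=; rewrite sqrrN.
Qed.

Lemma mxfrobM A B : mxfrob (A *m B) <= n%:R ^+ 2 * (mxfrob A * mxfrob B).
Proof.
rewrite expr2 -mulrA; apply: mxfrob_le_entries.
  by rewrite !mulr_ge0 ?mxfrob_ge0.
move=> i j; rewrite mxE; apply: le_trans (ler_norm_sum _ _ _) _.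
apply: (@le_trans _ _ (\sum_(k < n) (mxfrob A * mxfrob B)%:C)).
  apply: ler_sum => k _; rewrite normrM rmorphM.
  by apply: ler_pM => //; exact: normc_entry_le.
by rewrite sumr_const card_ord mulr_natl rmorphMn.
Qed.

Lemma det_entries_le m (A : 'M[C]_m) K : 0 <= K -> (forall i j, `|A i j| <= K%:C) ->
  `|\det A| <= (m`!%:R * K ^+ m)%:C.
Proof.
move=> K0 h; apply: le_trans (ler_norm_sum _ _ _) _.
apply: (@le_trans _ _ (\sum_(s : 'S_m) (K ^+ m)%:C)).
  apply: ler_sum => s _; rewrite normrM normrX normrN1 expr1n mul1r normr_prod.
  rewrite rmorphXn -[X in _ ^+ X]card_ord -prodr_const.
  by apply: ler_prod => i _; rewrite normr_ge0 h.
by rewrite sumr_const card_Sn mulr_natl rmorphMn.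
Qed.

Lemma adjugate_frob_le A K : 0 <= K -> mxfrob A <= K ->
  mxfrob (\adj A) <= n%:R * (n.-1`!%:R * K ^+ n.-1).
Proof.
move=> K0 AK; apply: mxfrob_le_entries; first by rewrite mulr_ge0// exprn_ge0.
move=> i j; rewrite mxE /cofactor normrM normrX normrN1 expr1n mul1r.
apply: det_entries_le => // k l; rewrite !mxE.
by apply: le_trans (normc_entry_le _ _ _) _; rewrite lecR.
Qed.

Lemma posdef_hermitian V : posdefmx V -> adjmx V = V.
Proof.
move=> [h _]; move: h; rewrite qualifE => /eqP h.
apply/matrixP => i j; rewrite adjmxE [in RHS]h expr0 scale1r !mxE; reflexivity.
Qed.

(** Each diagonal entry of A V A^* is the quadratic form of [V] at a conjugated row of [A]. *)
Lemma posdef_rdot_ge0 V A : posdefmx V -> 0 <= rdot (A *m V) A.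
Proof.
move=> [_ h]; rewrite /rdot /mxtrace Re_sum; apply: sumr_ge0 => i _.
pose u : 'cV[C]_n := \col_j conjc (A i j).
have -> : (A *m V *m adjmx A) i i = ((map_mx conjc u)^T *m V *m u) 0 0.
  rewrite !mxE; apply: eq_bigr => j _; rewrite !mxE; congr (_ * _).
  by apply: eq_bigr => k _; rewrite !mxE conjcK.
have [->|u0] := eqVneq u 0; first by rewrite mulmx0 mxE.
by have := h u u0; rewrite ltcE => /andP[_]; exact: ltW.
Qed.

(** The reciprocal of a bound for right multiplication by the adjugate, whose entries are minors of
    size n - 1. The added 1 keeps the denominator positive. *)
Definition coercivity (K : R) : R :=
  (n%:R ^+ 2 * (n%:R * (n.-1`!%:R * K ^+ n.-1)) + 1)^-1.

Lemma coercivity_gt0 K : 0 <= K -> 0 < coercivity K.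
Proof. by move=> K0; rewrite invr_gt0 ltr_wpDl// !mulr_ge0// exprn_ge0. Qed.

(* Cauchy-Schwarz for the inner product rdot (A V) B, applied to A V^-1 and A;
   as det V = 1, the inverse of V is its adjugate. *)
Lemma posdef_coercive V A K : posdefmx V -> \det V = 1 -> 0 <= K -> mxfrob V <= K ->
  coercivity K * mxfrob A ^+ 2 <= rdot (A *m V) A.
Proof.
move=> pV dV K0 VK; have hV := posdef_hermitian pV.
have CS B1 B2 : rdot (B1 *m V) B2 ^+ 2 <= rdot (B1 *m V) B1 * rdot (B2 *m V) B2.
  apply: (@semi_inner_CS R MM (fun a b => a + b) (fun c a => c%:C *: a) (fun=> True)
    (fun a b => rdot (a *m V) b)) => //.
  - by move=> a b _ _; rewrite rdot_mull hV rdotC.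
  - by move=> *; rewrite mulmxDl rdotDl.
  - by move=> *; rewrite -scalemxAl rdotZl.
  - by move=> *; exact: posdef_rdot_ge0.
pose W := \adj V.
have WV : W *m V = 1%:M by rewrite mul_adj_mx dV.
have := CS (A *m W) A; rewrite -mulmxA WV mulmx1 rdot_frob.
set Q := rdot (A *m V) A; set F := mxfrob A.
have Q0 : 0 <= Q by exact: posdef_rdot_ge0.
have F0 : 0 <= F by exact: mxfrob_ge0.
set T := n%:R ^+ 2 * (n%:R * (n.-1`!%:R * K ^+ n.-1)).
have T0 : 0 <= T by rewrite !mulr_ge0// exprn_ge0.
have hAW : rdot A (A *m W) <= T * F ^+ 2.
  apply: le_trans (ler_norm _) _; apply: le_trans (rdot_CS _ _) _; rewrite -/F.
  have -> : T * F ^+ 2 = F * (n%:R ^+ 2 * (F * (n%:R * (n.-1`!%:R * K ^+ n.-1)))).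
    by rewrite /T; ring.
  rewrite ler_wpM2l//; apply: le_trans (mxfrobM _ _) _.
  by rewrite !ler_wpM2l ?exprn_ge0//; exact: adjugate_frob_le.
move=> h; have h2 : (F ^+ 2) ^+ 2 <= T * F ^+ 2 * Q.
  by apply: le_trans h _; rewrite ler_wpM2r.
rewrite /coercivity -/T mulrC ler_pdivrMr ?ltr_wpDl//.
have [F20|F20] := eqVneq F 0; first by rewrite F20 expr0n mulr_ge0// addr_ge0.
have Fp : 0 < F ^+ 2 by rewrite exprn_gt0// lt_def F20.
have : F ^+ 2 <= T * Q.
  by rewrite -(ler_pM2l Fp) -expr2 mulrCA mulrA.
nra.
Qed.

End matrix_frobenius.

HB.lock Definition ip (R : realType) (n : nat) (f g : R -> 'M[R[i]]_n) : R :=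
  \int[@lebesgue_measure R]_t rdot (f t) (g t).
Arguments ip {R n} f g.

Section matrix_L2.
Context (R : realType) (n : nat).
Local Notation C := R[i].
Local Notation MM := 'M[R[i]]_n.
Local Notation mu := (@lebesgue_measure R).
Implicit Types f g v : R -> MM.

Lemma mx_measurable_cst (A : MM) : mx_measurable (fun _ : R => A).
Proof. by move=> a b; split; exact: measurable_cst. Qed.

Lemma mx_measurableD f g : mx_measurable f -> mx_measurable g ->
  mx_measurable (fun t => f t + g t).
Proof.
move=> mf mg a b; have [h1 h2] := mf a b; have [h3 h4] := mg a b; split.
  have -> : mxRe (fun t => f t + g t) a b = mxRe f a b \+ mxRe g a b.
    by apply/funext => t; rewrite /mxRe mxE ReD.
  exact: measurable_funD.
have -> : mxIm (fun t => f t + g t) a b = mxIm f a b \+ mxIm g a b.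
  by apply/funext => t; rewrite /mxIm mxE ImD.
exact: measurable_funD.
Qed.

Lemma mx_measurable_mul f g : mx_measurable f -> mx_measurable g ->
  mx_measurable (fun t => f t *m g t).
Proof.
move=> mf mg a b; split.
  have -> : mxRe (fun t => f t *m g t) a b = (fun t => \sum_(k < n)
      (mxRe f a k t * mxRe g k b t - mxIm f a k t * mxIm g k b t)).
    by apply/funext => t; rewrite /mxRe mxE Re_sum; apply: eq_bigr => k _; rewrite ReM.
  apply: measurable_sum => k; apply: measurable_funB; apply: measurable_funM;
    by [exact: (mf _ _).1|exact: (mg _ _).1|exact: (mf _ _).2|exact: (mg _ _).2].
have -> : mxIm (fun t => f t *m g t) a b = (fun t => \sum_(k < n)
    (mxRe f a k t * mxIm g k b t + mxIm f a k t * mxRe g k b t)).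
  by apply/funext => t; rewrite /mxIm mxE Im_sum; apply: eq_bigr => k _; rewrite ImM.
apply: measurable_sum => k; apply: measurable_funD; apply: measurable_funM;
  by [exact: (mf _ _).1|exact: (mg _ _).1|exact: (mf _ _).2|exact: (mg _ _).2].
Qed.

Lemma mx_measurableZ (c : C) f : mx_measurable f -> mx_measurable (fun t => c *: f t).
Proof.
move=> mf; have -> : (fun t => c *: f t) = (fun t => f t *m c%:M).
  by apply/funext => t; rewrite scalar_mxC mul_scalar_mx.
by apply: mx_measurable_mul => //; exact: mx_measurable_cst.
Qed.

Lemma mx_measurableB f g : mx_measurable f -> mx_measurable g ->
  mx_measurable (fun t => f t - g t).
Proof.
move=> mf mg; have -> : (fun t => f t - g t) = (fun t => f t + (-1) *: g t).
  by apply/funext => t; rewrite scaleN1r.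
by apply: mx_measurableD => //; exact: mx_measurableZ.
Qed.

Lemma mx_measurable_adj f : mx_measurable f -> mx_measurable (fun t => adjmx (f t)).
Proof.
move=> mf a b; split.
  have -> : mxRe (fun t => adjmx (f t)) a b = mxRe f b a.
    by apply/funext => t; rewrite /mxRe adjmxE; case: (f t b a).
  exact: (mf _ _).1.
have -> : mxIm (fun t => adjmx (f t)) a b = \- mxIm f b a.
  by apply/funext => t; rewrite /mxIm adjmxE /=; case: (f t b a).
by apply: measurable_funN; exact: (mf _ _).2.
Qed.

Lemma measurable_rdot f g : mx_measurable f -> mx_measurable g ->
  measurable_fun setT (fun t => rdot (f t) (g t)).
Proof.
move=> mf mg; under eq_fun do rewrite rdotE.
apply: measurable_sum => a; apply: measurable_sum => b.
have [h1 h2] := mf a b; have [h3 h4] := mg a b.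
by apply: measurable_funD; exact: measurable_funM.
Qed.

Lemma measurable_mxfrob f : mx_measurable f -> measurable_fun setT (fun t => mxfrob (f t)).
Proof.
move=> mf; rewrite (_ : (fun _ => _) = Num.sqrt \o (fun t => rdot (f t) (f t))); last first.
  by apply/funext => t /=; rewrite rdot_frob sqrtr_sqr ger0_norm ?mxfrob_ge0.
apply: measurableT_comp; last exact: measurable_rdot.
by apply: continuous_measurable_fun; exact: sqrt_continuous.
Qed.

Definition mL2 f := mx_measurable f /\ (sqint mu (fun t => mxfrob (f t)) < +oo)%E.

Lemma ipE f g : ip f g = \int[mu]_t rdot (f t) (g t).
Proof. by rewrite ip.unlock. Qed.

Definition nrm f : R := Num.sqrt (ip f f).

Lemma mL2_frob f : mL2 f -> sqintegrable mu (fun t => mxfrob (f t)).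
Proof. by move=> [mf f2]; split => //; exact: measurable_mxfrob. Qed.

Lemma mL2_le f (h : R -> R) : mx_measurable f -> sqintegrable mu h ->
  {ae mu, forall t, mxfrob (f t) <= `|h t|} -> mL2 f.
Proof.
move=> mf [mh h2] fh; split => //; apply: le_lt_trans h2; apply: sqint_le => //.
  exact: measurable_mxfrob.
by apply: ae_imp fh => t h1; rewrite ger0_norm ?mxfrob_ge0.
Qed.

Lemma mL2_Re f a b : mL2 f -> sqintegrable mu (mxRe f a b).
Proof.
move=> hf; apply: (sqintegrable_le _ (mL2_frob hf)); first exact: (hf.1 a b).1.
by apply: ae_all => t; rewrite [leRHS]ger0_norm ?mxfrob_ge0 ?Re_entry_le.
Qed.

Lemma mL2_Im f a b : mL2 f -> sqintegrable mu (mxIm f a b).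
Proof.
move=> hf; apply: (sqintegrable_le _ (mL2_frob hf)); first exact: (hf.1 a b).2.
by apply: ae_all => t; rewrite [leRHS]ger0_norm ?mxfrob_ge0 ?Im_entry_le.
Qed.

Lemma sqint_frobE f : mx_measurable f -> sqint mu (fun t => mxfrob (f t)) =
  (\sum_a \sum_b (sqint mu (mxRe f a b) + sqint mu (mxIm f a b)))%E.
Proof.
move=> mf; have m2 a b : measurable_fun setT
    (fun t => (mxRe f a b t ^+ 2)%:E + (mxIm f a b t ^+ 2)%:E)%E.
  by apply: emeasurable_funD; apply: measurable_sq; [exact: (mf _ _).1|exact: (mf _ _).2].
transitivity (\int[mu]_t (\sum_a \sum_b ((mxRe f a b t ^+ 2)%:E + (mxIm f a b t ^+ 2)%:E)))%E.
  apply: eq_integral => t _; rewrite mxfrob_sqr -sumEFin; apply: eq_bigr => a _.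
  by rewrite -sumEFin; apply: eq_bigr => b _; rewrite EFinD.
have p0 a b t : (0 <= (mxRe f a b t ^+ 2)%:E + (mxIm f a b t ^+ 2)%:E)%E.
  by rewrite -EFinD lee_fin addr_ge0 ?sqr_ge0.
rewrite ge0_integral_sum//; last 2 first.
- by move=> a; apply: emeasurable_sum => b; exact: m2.
- by move=> a t _; apply: sume_ge0 => b _.
apply: eq_bigr => a _; rewrite ge0_integral_sum//; try by move=> b; exact: m2.
apply: eq_bigr => b _; rewrite ge0_integralD//.
- by move=> t _; rewrite lee_fin sqr_ge0.
- by apply: measurable_sq; exact: (mf _ _).1.
- by move=> t _; rewrite lee_fin sqr_ge0.
- by apply: measurable_sq; exact: (mf _ _).2.
Qed.

Lemma mL2_entries f : (forall a b, sqintegrable mu (mxRe f a b)) ->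
  (forall a b, sqintegrable mu (mxIm f a b)) -> mL2 f.
Proof.
move=> h1 h2; have mf : mx_measurable f by move=> a b; split; [exact: (h1 a b).1|exact: (h2 a b).1].
split => //; rewrite sqint_frobE//.
apply: lte_sum_pinfty => a _; apply: lte_sum_pinfty => b _.
by apply: lte_add_pinfty; [exact: (h1 a b).2|exact: (h2 a b).2].
Qed.

Lemma sqint_frob_le f (B : R) : mx_measurable f ->
  (forall a b, (sqint mu (mxRe f a b) <= B%:E)%E) ->
  (forall a b, (sqint mu (mxIm f a b) <= B%:E)%E) ->
  (sqint mu (fun t => mxfrob (f t)) <= (n%:R ^+ 2 * (2 * B))%:E)%E.
Proof.
move=> mf h1 h2; rewrite sqint_frobE//.
apply: (@le_trans _ _ (\sum_(a < n) \sum_(b < n) (B%:E + B%:E))%E).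
  by do 2 (apply: lee_sum => ? _); apply: leeD.
rewrite -EFinD.
under eq_bigr do rewrite sumEFin; rewrite sumEFin lee_fin !sumr_const !card_ord.
by rewrite -mulrnA -[leLHS]mulr_natl natrM -expr2 mulr2n mulrDl mul1r.
Qed.

Lemma mL2D f g : mL2 f -> mL2 g -> mL2 (fun t => f t + g t).
Proof.
move=> hf hg; apply: (mL2_le _ (sqintegrableD (mL2_frob hf) (mL2_frob hg))).
  by apply: mx_measurableD; [exact: hf.1|exact: hg.1].
apply: ae_all => t; apply: le_trans (mxfrobD _ _) _.
by rewrite ger0_norm ?addr_ge0 ?mxfrob_ge0.
Qed.

Lemma mL2_0 : mL2 (fun=> 0).
Proof.
apply: mL2_entries => a b.
  have -> : mxRe (fun _ : R => 0 : MM) a b = (fun=> 0) by apply/funext => t; rewrite /mxRe mxE.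
  exact: sqintegrable0.
have -> : mxIm (fun _ : R => 0 : MM) a b = (fun=> 0) by apply/funext => t; rewrite /mxIm mxE.
exact: sqintegrable0.
Qed.

(** The bound is almost everywhere because that is what a finite L-infinity norm gives. *)
Definition multiplier (K : R) v := mx_measurable v /\ {ae mu, forall t, mxfrob (v t) <= K}.

Lemma multiplier_ge0 K v : multiplier K v -> 0 <= K.
Proof.
move=> [_ [N [mN N0 hN]]]; apply: contrapT => K0.
have h : N = [set: R].
  apply/seteqP; split => // t _; apply: hN => /= h; apply: K0.
  exact: le_trans (mxfrob_ge0 _) h.
pose J := `]0 : R, 1]%classic; have : (mu J <= mu N)%E.
  by apply: le_measure; rewrite ?inE; [exact: measurable_itv|exact: mN|rewrite h].
rewrite [X in (_ <= X)%E]N0 /J lebesgue_measure_itv /= lte_fin ltr01.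
by rewrite oppr0 adde0 lee_fin ler10.
Qed.

Lemma multiplier_cst (A : MM) : multiplier (mxfrob A) (fun=> A).
Proof. by split; [exact: mx_measurable_cst|exact: ae_all]. Qed.

Lemma multiplier_adj K v : multiplier K v -> multiplier K (fun t => adjmx (v t)).
Proof.
move=> [mv vK]; split; first exact: mx_measurable_adj.
by apply: ae_imp vK => t; rewrite mxfrob_adj.
Qed.

Lemma multiplierW K L v : K <= L -> multiplier K v -> multiplier L v.
Proof. by move=> KL [mv vK]; split => //; apply: ae_imp vK => t /le_trans; apply. Qed.

Lemma mL2_mul K f v : mL2 f -> multiplier K v -> mL2 (fun t => f t *m v t).
Proof.
move=> hf hv; have K0 := multiplier_ge0 hv.
apply: (mL2_le _ (sqintegrableZ (n%:R ^+ 2 * K) (mL2_frob hf))).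
  by apply: mx_measurable_mul; [exact: hf.1|exact: hv.1].
apply: ae_imp hv.2 => t vK; apply: le_trans (mxfrobM _ _) _.
rewrite ger0_norm ?mulr_ge0 ?mxfrob_ge0 ?exprn_ge0//.
by rewrite -mulrA ler_wpM2l ?exprn_ge0// mulrC ler_wpM2r// mxfrob_ge0.
Qed.

Lemma mL2Z (c : C) f : mL2 f -> mL2 (fun t => c *: f t).
Proof.
move=> hf; have -> : (fun t => c *: f t) = (fun t => f t *m c%:M).
  by apply/funext => t; rewrite scalar_mxC mul_scalar_mx.
exact: mL2_mul hf (multiplier_cst _).
Qed.

Lemma mL2B f g : mL2 f -> mL2 g -> mL2 (fun t => f t - g t).
Proof.
move=> hf hg; have -> : (fun t => f t - g t) = (fun t => f t + (-1) *: g t).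
  by apply/funext => t; rewrite scaleN1r.
by apply: mL2D => //; exact: mL2Z.
Qed.

Lemma mL2_shift f (h : R) : mL2 f -> mL2 (fun t : R => f (t + h)).
Proof.
by move=> hf; apply: mL2_entries => a b;
  [exact: (sqintegrable_shift h (mL2_Re a b hf))|exact: (sqintegrable_shift h (mL2_Im a b hf))].
Qed.

Lemma mL2_ae f g : mL2 f -> mx_measurable g -> {ae mu, forall t, f t = g t} -> mL2 g.
Proof.
move=> hf mg fg; apply: (mL2_le mg (mL2_frob hf)).
by apply: ae_imp fg => t ->; rewrite ger0_norm ?mxfrob_ge0.
Qed.

Lemma integrable_rdot f g : mL2 f -> mL2 g ->
  mu.-integrable setT (EFin \o (fun t => rdot (f t) (g t))).
Proof.
move=> hf hg; apply: (le_integrable measurableT _ _ (sqintegrable_mul (mL2_frob hf) (mL2_frob hg))).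
  by apply/measurable_EFinP; apply: measurable_rdot; [exact: hf.1|exact: hg.1].
move=> t _ /=; rewrite lee_fin; apply: le_trans (rdot_CS _ _) _; exact: ler_norm.
Qed.

Lemma ipC f g : ip f g = ip g f.
Proof. by rewrite !ipE; apply: eq_Rintegral => t _; exact: rdotC. Qed.

Lemma ipDl f1 f2 g : mL2 f1 -> mL2 f2 -> mL2 g ->
  ip (fun t => f1 t + f2 t) g = ip f1 g + ip f2 g.
Proof.
move=> h1 h2 hg; rewrite !ipE -RintegralD//; try exact: integrable_rdot.
by apply: eq_Rintegral => t _; rewrite rdotDl.
Qed.

Lemma ipDr f1 f2 g : mL2 f1 -> mL2 f2 -> mL2 g ->
  ip g (fun t => f1 t + f2 t) = ip g f1 + ip g f2.
Proof. by move=> h1 h2 hg; rewrite ipC (ipDl h1 h2 hg) (ipC f1) (ipC f2). Qed.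

Lemma ipZl (c : R) f g : mL2 f -> mL2 g -> ip (fun t => c%:C *: f t) g = c * ip f g.
Proof.
move=> hf hg; rewrite !ipE -RintegralZl//; last exact: integrable_rdot.
by apply: eq_Rintegral => t _; rewrite rdotZl.
Qed.

Lemma ipBl f1 f2 g : mL2 f1 -> mL2 f2 -> mL2 g ->
  ip (fun t => f1 t - f2 t) g = ip f1 g - ip f2 g.
Proof.
move=> h1 h2 hg; rewrite !ipE -RintegralB//; try exact: integrable_rdot.
by apply: eq_Rintegral => t _; rewrite rdotBl.
Qed.

Lemma ipBr f1 f2 g : mL2 f1 -> mL2 f2 -> mL2 g ->
  ip g (fun t => f1 t - f2 t) = ip g f1 - ip g f2.
Proof. by move=> h1 h2 hg; rewrite ipC (ipBl h1 h2 hg) (ipC f1) (ipC f2). Qed.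

Lemma ip0l g : ip (fun=> 0) g = 0.
Proof. by rewrite ipE; under eq_Rintegral do rewrite rdot0l; rewrite Rintegral_cst// mul0r. Qed.

Lemma ip_ge0 f : 0 <= ip f f.
Proof. by rewrite ipE; apply: Rintegral_ge0 => t _; exact: rdot_ge0. Qed.

Lemma ip_mull K f g v : mL2 f -> mL2 g -> multiplier K v ->
  ip (fun t => f t *m v t) g = ip f (fun t => g t *m adjmx (v t)).
Proof. by move=> hf hg hv; rewrite !ipE; apply: eq_Rintegral => t _; rewrite rdot_mull. Qed.

Lemma ip_shift f g (h : R) : mL2 f -> mL2 g ->
  ip (fun t : R => f (t + h)) (fun t : R => g (t + h)) = ip f g.
Proof.
move=> hf hg; rewrite !ipE; apply: (@Rintegral_shift _ (fun t => rdot (f t) (g t))).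
by apply: measurable_rdot; [exact: hf.1|exact: hg.1].
Qed.

Lemma ip_ae f1 f2 g : mL2 f1 -> mL2 f2 -> mL2 g ->
  {ae mu, forall t, f1 t = f2 t} -> ip f1 g = ip f2 g.
Proof.
move=> h1 h2 hg e; rewrite !ipE /Rintegral; congr fine; apply: ae_eq_integral => //.
- by apply/measurable_EFinP; apply: measurable_rdot; [exact: h1.1|exact: hg.1].
- by apply/measurable_EFinP; apply: measurable_rdot; [exact: h2.1|exact: hg.1].
by apply: ae_imp e => t /= ->.
Qed.

Lemma nrm_ge0 f : 0 <= nrm f.
Proof. exact: sqrtr_ge0. Qed.

Lemma nrm_sqr f : nrm f ^+ 2 = ip f f.
Proof. by rewrite sqr_sqrtr// ip_ge0. Qed.

Lemma nrm_sqint f : mL2 f -> (nrm f ^+ 2)%:E = sqint mu (fun t => mxfrob (f t)).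
Proof.
move=> hf; rewrite nrm_sqr ipE /Rintegral fineK.
  by apply: eq_integral => t _; rewrite rdot_frob.
exact: (integrable_fin_num measurableT (integrable_rdot hf hf)).
Qed.

Lemma nrm_le_sqint f (B : R) : 0 <= B -> mL2 f ->
  (sqint mu (fun t => mxfrob (f t)) <= (B ^+ 2)%:E)%E -> nrm f <= B.
Proof.
move=> B0 hf; rewrite -nrm_sqint// lee_fin.
by rewrite (@ler_pXn2r _ 2)// ?nnegrE ?nrm_ge0.
Qed.

Lemma ip_CS f g : mL2 f -> mL2 g -> `|ip f g| <= nrm f * nrm g.
Proof.
move=> hf hg; have h : ip f g ^+ 2 <= ip f f * ip g g.
  apply: (@semi_inner_CS R (R -> MM) (fun a b => fun t => a t + b t) (fun c a => fun t => c%:C *: a t) mL2 ip _ _ _ _ _ _ f g hf hg).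
  - by move=> *; exact: mL2D.
  - by move=> *; exact: mL2Z.
  - by move=> *; exact: ipC.
  - by move=> *; exact: ipDl.
  - by move=> *; exact: ipZl.
  - by move=> *; exact: ip_ge0.
rewrite -(@ler_pXn2r _ 2)// ?nnegrE ?normr_ge0 ?mulr_ge0 ?nrm_ge0//.
by rewrite real_normK ?num_real// exprMn !nrm_sqr.
Qed.

Lemma nrmD f g : mL2 f -> mL2 g -> nrm (fun t => f t + g t) <= nrm f + nrm g.
Proof.
move=> hf hg; rewrite -(@ler_pXn2r _ 2)// ?nnegrE ?addr_ge0 ?nrm_ge0//.
have hD := mL2D hf hg.
rewrite nrm_sqr ipDl// !ipDr// (ipC g f) -!nrm_sqr.
by have := ip_CS hf hg; have := ler_norm (ip f g); nra.
Qed.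

Lemma nrmZ (c : R) f : mL2 f -> nrm (fun t => c%:C *: f t) = `|c| * nrm f.
Proof.
move=> hf; apply/eqP; rewrite -(@eqrXn2 _ 2)// ?mulr_ge0 ?nrm_ge0//.
have hZ := mL2Z c%:C hf.
by rewrite nrm_sqr ipZl// ipC ipZl// exprMn real_normK ?num_real// nrm_sqr mulrA -expr2.
Qed.

Lemma nrmBC f g : nrm (fun t => f t - g t) = nrm (fun t => g t - f t).
Proof.
have E : (fun t => rdot (f t - g t) (f t - g t)) = fun t => rdot (g t - f t) (g t - f t).
  by apply/funext => t; rewrite !rdot_frob -mxfrobN opprB.
by rewrite /nrm !ipE E.
Qed.

Lemma nrmB f g : mL2 f -> mL2 g -> nrm (fun t => f t - g t) <= nrm f + nrm g.
Proof.
move=> hf hg; have -> : (fun t => f t - g t) = (fun t => f t + (-1)%:C *: g t).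
  by apply/funext => t; rewrite rmorphN1 scaleN1r.
apply: le_trans (nrmD hf (mL2Z _ hg)) _.
by rewrite nrmZ// normrN1 mul1r.
Qed.

Lemma nrm_mul K f v : mL2 f -> multiplier K v ->
  nrm (fun t => f t *m v t) <= n%:R ^+ 2 * K * nrm f.
Proof.
move=> hf hv; have K0 := multiplier_ge0 hv.
have c0 : 0 <= n%:R ^+ 2 * K by rewrite mulr_ge0// exprn_ge0.
apply: nrm_le_sqint; [by rewrite mulr_ge0 ?nrm_ge0|exact: mL2_mul hv|].
rewrite exprMn EFinM nrm_sqint// -sqintZ; last exact: measurable_mxfrob hf.1.
apply: sqint_le.
- by apply: measurable_mxfrob; exact: (mL2_mul hf hv).1.
- by apply: measurable_funM => //; exact: measurable_mxfrob hf.1.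
apply: ae_imp hv.2 => t vK; rewrite !ger0_norm ?mulr_ge0 ?mxfrob_ge0//.
apply: le_trans (mxfrobM _ _) _.
by rewrite -mulrA ler_wpM2l ?exprn_ge0// mulrC ler_wpM2r// mxfrob_ge0.
Qed.

Lemma nrm_shift f (h : R) : mL2 f -> nrm (fun t : R => f (t + h)) = nrm f.
Proof. by move=> hf; rewrite /nrm ip_shift. Qed.

Lemma nrm0_ae f : mL2 f -> nrm f = 0 -> {ae mu, forall t, f t = 0}.
Proof.
move=> hf f0; have mf := measurable_mxfrob hf.1.
have : (\int[mu]_t `|(mxfrob (f t) ^+ 2)%:E| = 0)%E.
  rewrite (_ : (0 = (nrm f ^+ 2)%:E)%E); last by rewrite f0 expr0n.
  by rewrite nrm_sqint//; apply: eq_integral => t _; rewrite gee0_abs// lee_fin sqr_ge0.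
move=> /(ae_eq_integral_abs mu measurableT (measurable_sq mf)).
apply: ae_imp => t /(_ I) [] /eqP; rewrite sqrf_eq0 => /eqP; exact: mxfrob_eq0.
Qed.

Lemma nrm_ae f g : mL2 f -> mL2 g -> {ae mu, forall t, f t = g t} -> nrm f = nrm g.
Proof.
move=> hf hg e; rewrite /nrm (ip_ae hf hg hf e) ipC (ip_ae hf hg hg e)//.
Qed.

(** The limit is assembled from the limits of the real and imaginary parts of the entries; the rate
    survives up to a factor counting them. *)
Lemma mL2_complete (u : nat -> R -> MM) (B : R) : (forall m, mL2 (u m)) ->
  (forall m, nrm (fun t => u m.+1 t - u m t) ^+ 2 <= B * (16^-1) ^+ m) ->
  exists2 l, mL2 l & exists K, forall m, nrm (fun t => u m t - l t) ^+ 2 <= K * (16^-1) ^+ m.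
Proof.
move=> hu hB.
have hd m : mL2 (fun t => u m.+1 t - u m t) by exact: mL2B.
have entry (w : R -> R) m : measurable_fun setT w ->
    (forall t, `|w t| <= mxfrob (u m.+1 t - u m t)) -> (sqint mu w <= (B * (16^-1) ^+ m)%:E)%E.
  move=> mw hw; apply: le_trans (_ : _ <= (nrm (fun t => u m.+1 t - u m t) ^+ 2)%:E)%E _; last first.
    by rewrite lee_fin.
  rewrite nrm_sqint//; apply: sqint_le => //; first exact: measurable_mxfrob (hd m).1.
  by apply: ae_all => t; rewrite [leRHS]ger0_norm ?mxfrob_ge0.
have /choice [lre hre] : forall p : 'I_n * 'I_n, exists l, sqintegrable mu l /\
    forall m, (sqint mu (fun x => (mxRe (u m) p.1 p.2 x - l x)%R) <= (4 * B * (16^-1) ^+ m)%:E)%E.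
  move=> [a b]; apply: geometric_sqint_cvg => m; first exact: mL2_Re.
  apply: entry; first by apply: measurable_funB; exact: ((hu _).1 a b).1.
  move=> t; have -> : mxRe (u m.+1) a b t - mxRe (u m) a b t = complex.Re ((u m.+1 t - u m t) a b).
    by rewrite !mxE ReB.
  exact: Re_entry_le.
have /choice [lim him] : forall p : 'I_n * 'I_n, exists l, sqintegrable mu l /\
    forall m, (sqint mu (fun x => (mxIm (u m) p.1 p.2 x - l x)%R) <= (4 * B * (16^-1) ^+ m)%:E)%E.
  move=> [a b]; apply: geometric_sqint_cvg => m; first exact: mL2_Im.
  apply: entry; first by apply: measurable_funB; exact: ((hu _).1 a b).2.
  move=> t; have -> : mxIm (u m.+1) a b t - mxIm (u m) a b t = complex.Im ((u m.+1 t - u m t) a b).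
    by rewrite !mxE ImB.
  exact: Im_entry_le.
pose l t : MM := \matrix_(a, b) (lre (a, b) t +i* lim (a, b) t).
have lR a b : mxRe l a b = lre (a, b) by apply/funext => t; rewrite /mxRe mxE.
have lI a b : mxIm l a b = lim (a, b) by apply/funext => t; rewrite /mxIm mxE.
have hl : mL2 l.
  by apply: mL2_entries => a b; rewrite ?lR ?lI; [exact: (hre (a, b)).1|exact: (him (a, b)).1].
exists l => //; exists (n%:R ^+ 2 * (2 * (4 * B))) => m.
have hml : mL2 (fun t => u m t - l t) by exact: mL2B.
rewrite -lee_fin nrm_sqint//.
have -> : n%:R ^+ 2 * (2 * (4 * B)) * 16^-1 ^+ m = n%:R ^+ 2 * (2 * (4 * B * 16^-1 ^+ m)) by ring.
apply: sqint_frob_le; first exact: hml.1.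
  move=> a b; have := (hre (a, b)).2 m; rewrite /= -lR.
  by congr (sqint mu _ <= _)%E; apply/funext => t; rewrite /mxRe !mxE ReB.
move=> a b; have := (him (a, b)).2 m; rewrite /= -lI.
by congr (sqint mu _ <= _)%E; apply/funext => t; rewrite /mxIm !mxE ImB.
Qed.

End matrix_L2.

(** * The Cauchy kernel and the space H- *)

Section real_line_integrals.
Context (R : realType).
Local Notation mu := (@lebesgue_measure R).

Lemma integral_sym_itv (F f : R -> R) (r : R) : 0 < r -> continuous f ->
  (forall x, is_derive x (1 : R) F (f x)) ->
  (\int[mu]_(x in `[(- r)%R, r]) (f x)%:E = (F r - F (- r)%R)%:E)%E.
Proof.
move=> r0 cf dF; rewrite EFinB; apply: continuous_FTC2.
- by rewrite gtrN.
- by apply: continuous_subspaceT.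
- split.
  + by move=> x _; case: (dF x).
  + by apply: cvg_at_right_filter; exact: is_derive_continuous (dF _).
  + by apply: cvg_at_left_filter; exact: is_derive_continuous (dF _).
- by move=> x _; rewrite derive1E; case: (dF x).
Qed.

Let J m : set R := `[- m.+1%:R, m.+1%:R]%classic.

Let bigcupJ : \bigcup_m J m = [set: R].
Proof.
apply/seteqP; split => // x _; exists (Num.bound `|x|) => //=.
have h := archi_boundP (normr_ge0 x).
have h2 : `|x| <= (Num.bound `|x|).+1%:R by apply: le_trans (ltW h) _; rewrite ler_nat.
by rewrite /J /= in_itv /=; rewrite ler_norml in h2.
Qed.

Lemma ge0_integral_real_line (F f : R -> R) (A B : R) : continuous f -> (forall x, 0 <= f x) ->
  (forall x, is_derive x (1 : R) F (f x)) ->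
  F m.+1%:R @[m --> \oo] --> A -> F (- m.+1%:R) @[m --> \oo] --> B ->
  (\int[mu]_x (f x)%:E = (A - B)%:E)%E.
Proof.
move=> cf f0 dF FA FB.
have := @ge0_nondecreasing_set_cvg_integral _ (measurableTypeR R) R J (fun x => (f x)%:E) mu.
rewrite bigcupJ => h.
have {}h : (\int[mu]_(x in J m) (f x)%:E)%E @[m --> \oo] --> (\int[mu]_x (f x)%:E)%E.
  apply: h.
  - move=> m1 m2 m12; apply/subsetPset => x; rewrite /J /= !in_itv /= => /andP[h1 h2].
    have h3 : (m1.+1%:R : R) <= m2.+1%:R by rewrite ler_nat.
    by rewrite (le_trans h2 h3) andbT (le_trans _ h1)// lerN2.
  - by move=> m; exact: measurable_itv.
  - by move=> m; apply/measurable_EFinP; apply: measurable_funTS; exact: continuous_measurable_fun.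
  - by move=> m x _; rewrite lee_fin.
apply: (cvg_unique _ h) => //.
rewrite (_ : (fun m => _) = (fun m => (F m.+1%:R - F (- m.+1%:R))%:E)); last first.
  by apply/funext => m; rewrite (integral_sym_itv _ cf dF).
by apply: cvg_EFin; [exact: nearW|exact: cvgB].
Qed.

(** Without a sign on [f], the truncations to symmetric intervals with integer ends are dominated by
    [|f|]; hence limits of the primitive along the integers suffice. *)
Lemma Rintegral_real_line (F f : R -> R) (A B : R) : continuous f ->
  mu.-integrable setT (EFin \o f) ->
  (forall x, is_derive x (1 : R) F (f x)) ->
  F m.+1%:R @[m --> \oo] --> A -> F (- m.+1%:R) @[m --> \oo] --> B ->
  \int[mu]_x f x = A - B.
Proof.
move=> cf fi dF FA FB.
have mf : measurable_fun [set: R] f by exact: continuous_measurable_fun.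
have mJ m : measurable (J m) by exact: measurable_itv.
have := @dominated_convergence _ _ R mu setT measurableT
  (fun m => (EFin \o f) \_ (J m)) (EFin \o f) (fun x => `|(f x)%:E|%E).
case.
- move=> m; apply/(measurable_restrictT (EFin \o f) (mJ m)); apply: measurable_funTS.
  exact/measurable_EFinP.
- exact/measurable_EFinP.
- apply: ae_all => x _; apply: cvg_near_cst.
  exists (Num.bound `|x|) => // m /= hm; rewrite patchE mem_set//= /J /= in_itv /= -ler_norml.
  apply: le_trans (ltW (archi_boundP (normr_ge0 x))) _.
  by rewrite ler_nat (leq_trans hm).
- exact: integrable_abse.
- apply: ae_all => x m _; rewrite patchE; case: ifP => _ //; rewrite abse0; exact: abse_ge0.
move=> _ _ h.
have E : (\int[mu]_x (EFin \o f) x = (A - B)%:E)%E.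
  apply: (cvg_unique _ h) => //.
  rewrite (_ : [sequence _]_m = (fun m => (F m.+1%:R - F (- m.+1%:R))%:E)); last first.
    by apply/funext => m /=; rewrite -integral_mkcond (integral_sym_itv _ cf dF).
  by apply: cvg_EFin; [exact: nearW|exact: cvgB].
by rewrite /Rintegral E.
Qed.

End real_line_integrals.

(** * The Cauchy and Poisson kernels and their explicit primitives *)

Section cauchy_kernel.
Context (R : realType).
Local Notation C := R[i].
Local Notation mu := (@lebesgue_measure R).

(** The Poisson kernel of the half plane without its factor 1 / pi; it is the imaginary part of the
    Cauchy kernel. *)
Definition pk (y s : R) : R := y / (s ^+ 2 + y ^+ 2).

Lemma pk_den_gt0 (y s : R) : y != 0 -> 0 < s ^+ 2 + y ^+ 2.
Proof. by move=> y0; rewrite ltr_wpDl ?sqr_ge0// lt_def sqr_ge0 sqrf_eq0 y0. Qed.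

Lemma pk_ge0 y s : 0 <= y -> 0 <= pk y s.
Proof. by move=> y0; rewrite divr_ge0// addr_ge0 ?sqr_ge0. Qed.

Lemma continuous_pk y (x : R) : y != 0 -> continuous (fun t => pk y (t - x)).
Proof.
move=> y0 t; apply: cvgM; first exact: cvg_cst.
apply: cvgV; first by rewrite gt_eqF// pk_den_gt0.
apply: cvgD; last exact: cvg_cst.
rewrite expr2; under eq_fun do rewrite expr2.
by apply: cvgM; apply: cvgB; (exact: cvg_id || exact: cvg_cst).
Qed.

Lemma is_derive_atan_pk (y x t : R) : y != 0 ->
  is_derive t (1 : R) (fun t => atan (- (x / y) + y^-1 * t)) (pk y (t - x)).
Proof.
move=> y0.
have -> : pk y (t - x) = y^-1 * (1 + (- (x / y) + y^-1 * t) ^+ 2)^-1.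
  rewrite /pk; have := pk_den_gt0 (t - x) y0 => h.
  have -> : 1 + (- (x / y) + y^-1 * t) ^+ 2 = ((t - x) ^+ 2 + y ^+ 2) / y ^+ 2 by field.
  by rewrite invf_div; field; rewrite y0 gt_eqF.
exact: is_derive_affine (is_derive1_atan _).
Qed.

Lemma cvg_atan_affine (c a : R) : 0 < a ->
  atan (c + a * m.+1%:R) @[m --> \oo] --> (pi / 2 : R).
Proof.
move=> a0; apply: (cvg_comp (fun m : nat => c + a * m.+1%:R) (@atan R) _ (@cvgy_atan R)).
apply/cvgryPge => M; near=> m.
rewrite -lerBlDl mulrC -ler_pdivrMr//.
apply: (@le_trans _ _ `|(M - c) / a|); first exact: ler_norm.
apply: le_trans (ltW (archi_boundP (normr_ge0 _))) _.
rewrite ler_nat; apply: leqW; near: m; exact: nbhs_infty_ge.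
Unshelve. all: end_near. Qed.

Lemma cvg_atan_affineN (c a : R) : 0 < a ->
  atan (c + a * - m.+1%:R) @[m --> \oo] --> (- (pi / 2) : R).
Proof.
move=> a0; have h := @cvg_atan_affine (- c) a a0.
have -> : (fun m : nat => atan (c + a * - m.+1%:R)) = (fun m => - atan (- c + a * m.+1%:R)).
  by apply/funext => m; rewrite -atanN opprD opprK mulrN.
exact: cvgN.
Qed.

Lemma integral_pk (y x : R) : 0 < y -> (\int[mu]_t (pk y (t - x))%:E = (pi : R)%:E)%E.
Proof.
move=> y0; have yn : y != 0 by rewrite gt_eqF.
have -> : (pi : R) = pi / 2 - (- (pi / 2)) by field.
apply: (@ge0_integral_real_line _ (fun t => atan (- (x / y) + y^-1 * t))).
- exact: continuous_pk.
- by move=> t; apply: pk_ge0; exact: ltW.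
- by move=> t; exact: is_derive_atan_pk.
- by apply: cvg_atan_affine; rewrite invr_gt0.
- by apply: cvg_atan_affineN; rewrite invr_gt0.
Qed.

Definition kr (z : C) (t : R) : C := (t%:C - z)^-1.

Lemma krE (z : C) t : kr z t =
  ((t - complex.Re z) / ((t - complex.Re z) ^+ 2 + complex.Im z ^+ 2)) +i*
  (complex.Im z / ((t - complex.Re z) ^+ 2 + complex.Im z ^+ 2)).
Proof.
case: z => x y /=; rewrite /kr.
have -> : t%:C - (x +i* y) = (t - x) +i* (- y) by apply: complex_ext; rewrite /= ?sub0r.
have [E|E] := eqVneq ((t - x) ^+ 2 + y ^+ 2) 0.
  rewrite E invr0 !mulr0; move: E => /eqP; rewrite paddr_eq0 ?sqr_ge0// !sqrf_eq0 => /andP[/eqP -> /eqP ->].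
  by rewrite oppr0 [X in X^-1](_ : _ = 0) ?invr0.
apply/esym/(mulfI (x := (t - x) +i* (- y))).
  apply: contra E => /eqP [] -> /eqP; rewrite oppr_eq0 => /eqP ->.
  by rewrite expr0n addr0.
rewrite mulfV; last first.
  apply: contra E => /eqP [] -> /eqP; rewrite oppr_eq0 => /eqP ->.
  by rewrite expr0n addr0.
apply: complex_ext; rewrite ?ReM ?ImM /=; by field.
Qed.

Lemma kr_re z t : complex.Re (kr z t) =
  (t - complex.Re z) / ((t - complex.Re z) ^+ 2 + complex.Im z ^+ 2).
Proof. by rewrite krE. Qed.

Lemma kr_im z t : complex.Im (kr z t) = pk (complex.Im z) (t - complex.Re z).
Proof. by rewrite krE. Qed.

Lemma kr_conj z t : conjc (kr z t) = kr (conjc z) t.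
Proof. by rewrite !krE; case: z => x y /=; rewrite sqrrN mulNr. Qed.

Lemma kr_shift z t h : kr z (t + h) = kr (z - h%:C) t.
Proof. by rewrite /kr; congr (_^-1); rewrite rmorphD /= opprB addrA addrAC. Qed.

Lemma continuous_kr_re z : complex.Im z != 0 -> continuous (fun t => complex.Re (kr z t)).
Proof.
move=> z0; under eq_fun do rewrite kr_re; move=> t.
apply: cvgM; first by apply: cvgB; [exact: cvg_id|exact: cvg_cst].
apply: cvgV; first by rewrite gt_eqF// pk_den_gt0.
apply: cvgD; last exact: cvg_cst.
rewrite expr2; under eq_fun do rewrite expr2.
by apply: cvgM; apply: cvgB; (exact: cvg_id || exact: cvg_cst).
Qed.

Lemma continuous_kr_im z : complex.Im z != 0 -> continuous (fun t => complex.Im (kr z t)).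
Proof. by move=> z0; under eq_fun do rewrite kr_im; exact: continuous_pk. Qed.

Lemma kr_norm_sqr z t : complex.Im z != 0 ->
  complex.Re (kr z t) ^+ 2 + complex.Im (kr z t) ^+ 2 =
  pk (complex.Im z) (t - complex.Re z) / complex.Im z.
Proof.
move=> z0; rewrite kr_re kr_im /pk; have := pk_den_gt0 (t - complex.Re z) z0 => h.
by field; rewrite z0 gt_eqF.
Qed.

Lemma pk_div_even (y s : R) : y != 0 -> pk y s / y = pk `|y| s / `|y|.
Proof.
move=> y0; rewrite /pk (real_normK (num_real y)).
have := pk_den_gt0 s y0 => h; field.
by rewrite y0 normr_eq0 y0 gt_eqF.
Qed.

Lemma sqint_kr z (f : R -> R) : complex.Im z != 0 -> continuous f ->
  (forall t, f t ^+ 2 <= complex.Re (kr z t) ^+ 2 + complex.Im (kr z t) ^+ 2) ->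
  sqintegrable mu f.
Proof.
move=> z0 cf hf; have mf : measurable_fun [set: R] f by exact: continuous_measurable_fun.
split => //; have y0 : 0 < `|complex.Im z| by rewrite normr_gt0.
apply: (@le_lt_trans _ _ (\int[mu]_t (`|complex.Im z|^-1%:E * (pk `|complex.Im z| (t - complex.Re z))%:E))%E).
  apply: ge0_le_integral => //.
  - by move=> t _; rewrite lee_fin sqr_ge0.
  - exact: measurable_sq.
  - apply: emeasurable_funM => //.
    apply/measurable_EFinP; apply: continuous_measurable_fun; apply: continuous_pk.
    by rewrite normr_eq0.
  move=> t _; rewrite -EFinM lee_fin; apply: le_trans (hf t) _.
  by rewrite kr_norm_sqr// pk_div_even// mulrC.
rewrite ge0_integralZl_EFin//.
- by rewrite integral_pk// -EFinM ltry.
- by move=> t _; rewrite lee_fin pk_ge0.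
- apply/measurable_EFinP; apply: continuous_measurable_fun; apply: continuous_pk.
  by rewrite normr_eq0.
Qed.

Lemma sqint_kr_re z : complex.Im z != 0 -> sqintegrable mu (fun t => complex.Re (kr z t)).
Proof.
move=> z0; apply: (sqint_kr z0); first exact: continuous_kr_re.
by move=> t; rewrite lerDl sqr_ge0.
Qed.

Lemma sqint_kr_im z : complex.Im z != 0 -> sqintegrable mu (fun t => complex.Im (kr z t)).
Proof.
move=> z0; apply: (sqint_kr z0); first exact: continuous_kr_im.
by move=> t; rewrite lerDr sqr_ge0.
Qed.

(* A primitive of kr z, defined up to the branch of the logarithm. *)
Definition kr_primitive (z : C) (t : R) : C :=
  (ln ((t - complex.Re z) ^+ 2 + complex.Im z ^+ 2) / 2) +i*
  atan (- (complex.Re z / complex.Im z) + (complex.Im z)^-1 * t).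

Lemma is_derive_kr_primitive_re z t : complex.Im z != 0 ->
  is_derive t (1 : R) (fun t => complex.Re (kr_primitive z t)) (complex.Re (kr z t)).
Proof.
move=> z0; rewrite /= kr_re; set x := complex.Re z; set y := complex.Im z.
have q0 := pk_den_gt0 (t - x) z0.
have d1 : is_derive t (1 : R) (fun s : R => (s - x) ^+ 2 + y ^+ 2) (2 * (t - x)).
  apply/is_derive1P => e e0; exists e => // s hs.
  have -> : (s - x) ^+ 2 + y ^+ 2 - ((t - x) ^+ 2 + y ^+ 2) - 2 * (t - x) * (s - t) =
    (s - t) * (s - t) by ring.
  by rewrite normrM ler_wpM2r// ltW.
have d2 := @is_derive1_ln R _ q0.
have d3 : is_derive t (1 : R) (fun s : R => ln ((s - x) ^+ 2 + y ^+ 2))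
    (((t - x) ^+ 2 + y ^+ 2)^-1 * (2 * (t - x))).
  exact: (@is_derive1_comp _ (@ln R) (fun s : R => (s - x) ^+ 2 + y ^+ 2) t _ _ d2 d1).
have d4 := is_deriveZ (2^-1 : R) d3.
have -> : (fun s : R => ln ((s - x) ^+ 2 + y ^+ 2) / 2) =
  2^-1 \*: (fun s : R => ln ((s - x) ^+ 2 + y ^+ 2)).
  by apply/funext => s; rewrite mulrC.
have -> : (t - x) / ((t - x) ^+ 2 + y ^+ 2) = 2^-1 *: (((t - x) ^+ 2 + y ^+ 2)^-1 * (2 * (t - x))).
  by rewrite /GRing.scale /=; field; rewrite gt_eqF.
exact: d4.
Qed.

Lemma is_derive_kr_primitive_im z t : complex.Im z != 0 ->
  is_derive t (1 : R) (fun t => complex.Im (kr_primitive z t)) (complex.Im (kr z t)).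
Proof. by move=> z0; rewrite kr_im; exact: is_derive_atan_pk. Qed.

Lemma ln_diff_le (a b : R) : 0 < a -> 0 < b -> ln a - ln b <= `|a - b| / b.
Proof.
move=> a0 b0; rewrite -ln_div ?posrE//.
have := @le_ln1Dx R (a / b - 1).
have -> : 1 + (a / b - 1) = a / b by ring.
rewrite ltrBrDr addNr divr_gt0// => /(_ isT).
move=> /le_trans; apply; have -> : a / b - 1 = (a - b) / b by field; rewrite gt_eqF.
by rewrite ler_wpM2r ?ler_norm// invr_ge0 ltW.
Qed.

(** Each logarithm diverges. The two quadratics differ by an affine function of [s], so relative to
    their size the difference is of order 1 / m. *)
Lemma ln_quadratic_diff_cvg (x y x' y' : R) (s : nat -> R) : y != 0 -> y' != 0 ->
  (forall m, `|s m| = m.+1%:R) ->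
  ln ((s m - x) ^+ 2 + y ^+ 2) - ln ((s m - x') ^+ 2 + y' ^+ 2) @[m --> \oo] --> 0.
Proof.
move=> y0 y'0 hs.
pose K := `|2 * (x' - x)| + `|x ^+ 2 + y ^+ 2 - x' ^+ 2 - y' ^+ 2|.
have hK m : `|(s m - x) ^+ 2 + y ^+ 2 - ((s m - x') ^+ 2 + y' ^+ 2)| <= K * m.+1%:R.
  have -> : (s m - x) ^+ 2 + y ^+ 2 - ((s m - x') ^+ 2 + y' ^+ 2) =
    2 * (x' - x) * s m + (x ^+ 2 + y ^+ 2 - x' ^+ 2 - y' ^+ 2) by ring.
  apply: le_trans (ler_normD _ _) _; rewrite normrM hs /K.
  set A := `|2 * _|; set B := `|_ - y' ^+ 2|.
  have : B <= B * m.+1%:R by rewrite ler_peMr// ?normr_ge0// ler1n.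
  lra.
have hq (a c : R) m : 2 * `|a| <= m.+1%:R -> m.+1%:R ^+ 2 / 4 <= (s m - a) ^+ 2 + c ^+ 2.
  move=> h; have h1 : m.+1%:R - `|a| <= `|s m - a| by rewrite -(hs m) lerB_dist.
  have h2 : m.+1%:R / 2 <= `|s m - a| by lra.
  have h3 : (m.+1%:R / 2) ^+ 2 <= `|s m - a| ^+ 2 by rewrite ler_pXn2r// ?nnegrE ?divr_ge0.
  rewrite -[(s m - a) ^+ 2](real_normK (num_real _)); have := sqr_ge0 c.
  have -> : m.+1%:R ^+ 2 / 4 = (m.+1%:R / 2) ^+ 2 :> R by field.
  lra.
have cv : (4 * K) * harmonic m @[m --> \oo] --> 4 * K * 0 by apply: cvgM; [exact: cvg_cst|exact: cvg_harmonic].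
apply/norm_cvg0P; rewrite mulr0 in cv; apply: (squeeze_cvgr _ (@cvg_cst R 0 _ \oo _) cv).
near=> m; rewrite normr_ge0 /=.
have ha : 2 * `|x| <= m.+1%:R.
  apply: le_trans (ltW (archi_boundP _)) _; first by rewrite mulr_ge0.
  by rewrite ler_nat leqW//; near: m; exact: nbhs_infty_ge.
have hb : 2 * `|x'| <= m.+1%:R.
  apply: le_trans (ltW (archi_boundP _)) _; first by rewrite mulr_ge0.
  by rewrite ler_nat leqW//; near: m; exact: nbhs_infty_ge.
have main a b : 0 < a -> m.+1%:R ^+ 2 / 4 <= b -> `|a - b| <= K * m.+1%:R -> ln a - ln b <= 4 * K * harmonic m.
  move=> a0 hb1 hab; have m0 : 0 < m.+1%:R ^+ 2 / 4 :> R by rewrite divr_gt0// exprn_gt0.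
  have b0 : 0 < b by exact: lt_le_trans hb1.
  apply: le_trans (ln_diff_le a0 b0) _.
  rewrite ler_pdivrMr//; apply: le_trans hab _.
  have -> : 4 * K * harmonic m * b = K * m.+1%:R * (b / (m.+1%:R ^+ 2 / 4)).
    rewrite /harmonic /=; have : m.+1%:R != 0 :> R by rewrite pnatr_eq0.
    by move: (m.+1%:R : R) => N0 hN0; field.
  rewrite ler_peMr ?mulr_ge0 ?addr_ge0//.
  by rewrite ler_pdivlMr// mul1r.
rewrite ler_norml lerNl opprB; apply/andP; split; apply: main; rewrite ?pk_den_gt0 ?hq// ?hK//.
by rewrite distrC hK.
Unshelve. all: end_near. Qed.

Lemma is_derive_Re_mul (c : C) (F : R -> C) (f : C) t :
  is_derive t (1 : R) (fun s => complex.Re (F s)) (complex.Re f) ->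
  is_derive t (1 : R) (fun s => complex.Im (F s)) (complex.Im f) ->
  is_derive t (1 : R) (fun s => complex.Re (c * F s)) (complex.Re (c * f)).
Proof.
move=> d1 d2; have := is_deriveB (is_deriveZ (complex.Re c) d1) (is_deriveZ (complex.Im c) d2).
rewrite ReM; congr (is_derive _ _ _ _); apply/funext => s; rewrite ReM.
by rewrite -[LHS]/(complex.Re c * complex.Re (F s) - complex.Im c * complex.Im (F s)).
Qed.

Lemma kr_diff (u : C) s t : complex.Im u != 0 ->
  kr u s - kr u t = - (s - t)%:C * (kr u s * kr u t).
Proof.
move=> u0; have nz r : r%:C - u != 0.
  by apply: contra u0; case: u => a b /eqP [] _; rewrite sub0r => /eqP; rewrite oppr_eq0.
rewrite /kr rmorphB /=; have := nz s; have := nz t; set a := s%:C; set b := t%:C => h1 h2.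
by field; rewrite h1 h2.
Qed.

Lemma continuous_Re_mul_kr (c u : C) : complex.Im u != 0 ->
  continuous (fun t => complex.Re (c * kr u t)).
Proof.
move=> u0; under eq_fun do rewrite ReM; move=> t.
by apply: cvgB; apply: cvgM; try exact: cvg_cst; [exact: continuous_kr_re|exact: continuous_kr_im].
Qed.

(** The square of the Cauchy kernel has the rational primitive [- kr u]; this is the double pole
    case of the product integral below. *)
Lemma is_derive_kr (c u : C) t : complex.Im u != 0 ->
  is_derive t (1 : R) (fun s => complex.Re (- c * kr u s)) (complex.Re (c * (kr u t * kr u t))).
Proof.
move=> u0; apply/is_derive1P => e e0.
have := @continuous_Re_mul_kr (c * kr u t) u u0 t => /cvgrPdist_le /(_ e e0) /nbhs_ballP[r /= r0 hr].
exists r => // s hs; have := hr s; rewrite /ball /= distrC => /(_ hs).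
have -> : complex.Re (- c * kr u s) - complex.Re (- c * kr u t) -
    complex.Re (c * (kr u t * kr u t)) * (s - t) =
  (complex.Re (c * kr u t * kr u s) - complex.Re (c * kr u t * kr u t)) * (s - t).
  rewrite -!ReB -!mulrBr.
  have h (w : C) (r' : R) : complex.Re w * r' = complex.Re (w * r'%:C).
    by rewrite ReM /= mulr0 subr0.
  rewrite !h -ReB; congr complex.Re.
  have -> : - c * (kr u s - kr u t) = c * (s - t)%:C * (kr u s * kr u t).
    by rewrite kr_diff//; ring.
  ring.
by rewrite distrC => h; rewrite normrM ler_wpM2r.
Qed.

Lemma cvg_kr_infty (s : nat -> R) (c u : C) : complex.Im u != 0 -> (forall m, `|s m| = m.+1%:R) ->
  complex.Re (c * kr u (s m)) @[m --> \oo] --> 0.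
Proof.
move=> u0 hs.
have cv : (4 * (`|complex.Re c| + `|complex.Im c|)) * harmonic m @[m --> \oo] -->
    4 * (`|complex.Re c| + `|complex.Im c|) * 0 by apply: cvgM; [exact: cvg_cst|exact: cvg_harmonic].
apply/norm_cvg0P; rewrite mulr0 in cv; apply: (squeeze_cvgr _ (@cvg_cst R 0 _ \oo _) cv).
near=> m; rewrite normr_ge0 /= ReM.
set x := complex.Re u; set y := complex.Im u.
have ha : 2 * `|x| <= m.+1%:R.
  apply: le_trans (ltW (archi_boundP _)) _; first by rewrite mulr_ge0.
  by rewrite ler_nat leqW//; near: m; exact: nbhs_infty_ge.
have h1 : m.+1%:R - `|x| <= `|s m - x| by rewrite -(hs m) lerB_dist.
have h2 : m.+1%:R / 2 <= `|s m - x| by lra.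
have m0 : 0 < m.+1%:R :> R by rewrite ltr0n.
have hN : complex.Re (kr u (s m)) ^+ 2 + complex.Im (kr u (s m)) ^+ 2 <= (2 * harmonic m) ^+ 2.
  rewrite kr_norm_sqr// /pk -/x -/y -(real_normK (num_real (s m - x))).
  have q0 := pk_den_gt0 `|s m - x| u0.
  have -> : y / (`|s m - x| ^+ 2 + y ^+ 2) / y = (`|s m - x| ^+ 2 + y ^+ 2)^-1.
    by field; rewrite u0 gt_eqF.
  have -> : (2 * harmonic m) ^+ 2 = ((m.+1%:R / 2) ^+ 2)^-1 :> R.
    rewrite /harmonic /=; have : m.+1%:R != 0 :> R by rewrite pnatr_eq0.
    by move: (m.+1%:R : R) => N0 hN0; field.
  rewrite lef_pV2 ?posrE ?exprn_gt0 ?divr_gt0//.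
  apply: (@le_trans _ _ (`|s m - x| ^+ 2)); last by rewrite lerDl sqr_ge0.
  by rewrite ler_pXn2r// ?nnegrE ?divr_ge0.
have hh : 0 <= 2 * harmonic m :> R by rewrite mulr_ge0// harmonic_ge0.
have hR : `|complex.Re (kr u (s m))| <= 2 * harmonic m.
  rewrite -(@ler_pXn2r _ 2)// ?nnegrE ?normr_ge0// real_normK ?num_real//.
  by apply: le_trans hN; rewrite lerDl sqr_ge0.
have hI : `|complex.Im (kr u (s m))| <= 2 * harmonic m.
  rewrite -(@ler_pXn2r _ 2)// ?nnegrE ?normr_ge0// real_normK ?num_real//.
  by apply: le_trans hN; rewrite lerDr sqr_ge0.
apply: le_trans (ler_normB _ _) _; rewrite !normrM.
have E1 := ler_wpM2l (normr_ge0 (complex.Re c)) hR.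
have E2 := ler_wpM2l (normr_ge0 (complex.Im c)) hI.
have E3 := mulr_ge0 (normr_ge0 (complex.Re c)) (@harmonic_ge0 R m).
have E4 := mulr_ge0 (normr_ge0 (complex.Im c)) (@harmonic_ge0 R m).
apply: le_trans (lerD E1 E2) _.
move: E3 E4; rewrite /harmonic /=; set a := `|complex.Re c|; set b := `|complex.Im c|.
by move: (m.+1%:R^-1 : R) => h E3 E4; lra.
Unshelve. all: end_near. Qed.

(** Both poles lie above the real line, so the contour can be closed below. This is done with
    explicit primitives: partial fractions for distinct poles, where the logarithms cancel at
    infinity and the arctangents have the same limits because both imaginary parts are positive. *)
Lemma integral_kr_mul (u w c : C) : 0 < complex.Im u -> 0 < complex.Im w ->
  mu.-integrable setT (EFin \o (fun t => complex.Re (c * (kr u t * kr w t)))) ->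
  \int[mu]_t complex.Re (c * (kr u t * kr w t)) = 0.
Proof.
move=> u0 w0 hi.
have un : complex.Im u != 0 by rewrite gt_eqF.
have wn : complex.Im w != 0 by rewrite gt_eqF.
have cc : continuous (fun t => complex.Re (c * (kr u t * kr w t))).
  under eq_fun do rewrite ReM ReM ImM; move=> t.
  move: (continuous_kr_re un) (continuous_kr_im un) => /(_ t) h1 /(_ t) h2.
  move: (continuous_kr_re wn) (continuous_kr_im wn) => /(_ t) h3 /(_ t) h4.
  apply: cvgB; apply: cvgM; try exact: cvg_cst.
    by apply: cvgB; exact: cvgM.
  by apply: cvgD; exact: cvgM.
have sp m : `|m.+1%:R| = m.+1%:R :> R by rewrite ger0_norm.
have sn m : `|- m.+1%:R| = m.+1%:R :> R by rewrite normrN ger0_norm.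
rewrite -[RHS](subr0 (0 : R)).
have [E|uw] := eqVneq u w.
  apply: (@Rintegral_real_line _ (fun t => complex.Re (- c * kr u t))) => //.
  - by rewrite -E => t; exact: is_derive_kr.
  - exact: cvg_kr_infty.
  - exact: cvg_kr_infty.
pose e := c / (u - w).
have uw0 : u - w != 0 by rewrite subr_eq0.
have nz (z : C) (t : R) : complex.Im z != 0 -> t%:C - z != 0.
  by move=> z0; apply: contra z0; case: z => a b /eqP [] _; rewrite sub0r => /eqP; rewrite oppr_eq0.
pose P t := ln ((t - complex.Re u) ^+ 2 + complex.Im u ^+ 2) -
  ln ((t - complex.Re w) ^+ 2 + complex.Im w ^+ 2).
pose Q t := atan (- (complex.Re u / complex.Im u) + (complex.Im u)^-1 * t) -
  atan (- (complex.Re w / complex.Im w) + (complex.Im w)^-1 * t).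
have TE t : complex.Re (e * (kr_primitive u t - kr_primitive w t)) =
    complex.Re e * (P t / 2) - complex.Im e * Q t.
  by rewrite ReM ReB ImB /= /P mulrBl.
have cvT (s : nat -> R) : P (s m) @[m --> \oo] --> 0 -> Q (s m) @[m --> \oo] --> 0 ->
    complex.Re (e * (kr_primitive u (s m) - kr_primitive w (s m))) @[m --> \oo] --> 0.
  move=> hP hQ; under eq_fun do rewrite TE.
  rewrite (_ : 0 = complex.Re e * (0 / 2) - complex.Im e * 0); last by rewrite mul0r !mulr0 subrr.
  apply: cvgB; apply: cvgM; try exact: cvg_cst; last exact: hQ.
  by apply: cvgM; [exact: hP|exact: cvg_cst].
have ui : 0 < (complex.Im u)^-1 by rewrite invr_gt0.
have wi : 0 < (complex.Im w)^-1 by rewrite invr_gt0.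
apply: (@Rintegral_real_line _ (fun t => complex.Re (e * (kr_primitive u t - kr_primitive w t)))) => //.
- move=> t.
  have -> : c * (kr u t * kr w t) = e * (kr u t - kr w t).
    by rewrite /e /kr; have := nz u t un; have := nz w t wn; set a := t%:C => h1 h2;
      field; rewrite uw0 h1 h2.
  have d1 := is_deriveB (is_derive_kr_primitive_re t un) (is_derive_kr_primitive_re t wn).
  have d2 := is_deriveB (is_derive_kr_primitive_im t un) (is_derive_kr_primitive_im t wn).
  apply: is_derive_Re_mul; rewrite ?ReB ?ImB.
    by under eq_fun do rewrite ReB; exact: d1.
  by under eq_fun do rewrite ImB; exact: d2.
- apply: cvT; first exact: ln_quadratic_diff_cvg.
  rewrite -[X in _ --> X](subrr (pi / 2 : R)).
  by apply: cvgB; exact: cvg_atan_affine.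
- apply: (cvT (fun m => - m.+1%:R)); first exact: ln_quadratic_diff_cvg.
  rewrite -[X in _ --> X](subrr (- (pi / 2) : R)).
  by apply: cvgB; exact: cvg_atan_affineN.
Qed.

End cauchy_kernel.

(** * The space H- and the weighted orthogonality problem *)

Section hardy_space.
Context (R : realType) (n : nat).
Local Notation C := R[i].
Local Notation MM := 'M[R[i]]_n.
Local Notation mu := (@lebesgue_measure R).
Implicit Types f g v : R -> MM.

(** Test functions: the real pairing of [f] with [kk z a b c] is the real part of the conjugate of
    [c] times the integral of the entry [(a, b)] of [f] against the Cauchy kernel. Varying [c]
    recovers the complex value. *)
Definition kk (z : C) (a b : 'I_n) (c : C) (t : R) : MM := (c * conjc (kr z t)) *: delta_mx a b.

Lemma rdot_delta (A : MM) (w : C) a b : rdot A (w *: delta_mx a b) = complex.Re (A a b * conjc w).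
Proof.
rewrite rdotE (bigD1 a)//= (bigD1 b)//= [X in _ + X + _]big1; last first.
  by move=> j jb; rewrite !mxE eqxx (negbTE jb) /= mulr0 /= !mulr0 addr0.
rewrite [X in _ + _ + X]big1; last first.
  move=> i ia; apply: big1 => j _.
  by rewrite !mxE (negbTE ia) /= mulr0 /= !mulr0 addr0.
rewrite !addr0 !mxE !eqxx /= mulr1 ReM; case: w => p q /=; by rewrite mulrN opprK.
Qed.

Lemma rdot_kk (A : MM) z a b c t :
  rdot A (kk z a b c t) = complex.Re (A a b * (conjc c * kr z t)).
Proof.
rewrite rdot_delta; congr complex.Re; congr (_ * _).
by rewrite -[X in _ = _ * X]conjcK -rmorphM.
Qed.

Lemma mL2_kk z a b c : complex.Im z != 0 -> mL2 (kk z a b c).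
Proof.
move=> z0; have h1 := sqint_kr_re z0; have h2 := sqint_kr_im z0.
apply: mL2_entries => i j; pose d := c * (delta_mx a b : MM) i j.
  have -> : mxRe (kk z a b c) i j = (fun t => complex.Re d * complex.Re (kr z t) +
      complex.Im d * complex.Im (kr z t)).
    apply/funext => t; rewrite /mxRe /kk mxE mulrAC -/d ReM.
    by case: (kr z t) => p q /=; rewrite mulrN opprK.
  by apply: sqintegrableD; exact: sqintegrableZ.
have -> : mxIm (kk z a b c) i j = (fun t => complex.Im d * complex.Re (kr z t) +
    (- complex.Re d) * complex.Im (kr z t)).
  apply/funext => t; rewrite /mxIm /kk mxE mulrAC -/d ImM.
  by case: (kr z t) => p q /=; rewrite mulrN mulNr addrC.
by apply: sqintegrableD; exact: sqintegrableZ.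
Qed.

(* Boundary values of functions holomorphic in the lower half plane: those
   whose Cauchy integral vanishes in the upper one. *)
Definition Hm f := mL2 f /\
  forall z a b c, 0 < complex.Im z -> ip f (kk z a b c) = 0.

(** Conjugating the kernel moves its pole to the upper half plane; the pairing is then an integral
    of two Cauchy kernels with poles on the same side. *)
Lemma Hm_kk w a b c : complex.Im w < 0 -> Hm (kk w a b c).
Proof.
move=> w0; have wn : complex.Im w != 0 by rewrite lt_eqF.
split; first exact: mL2_kk.
move=> z a' b' c' z0; have zn : complex.Im z != 0 by rewrite gt_eqF.
have w'0 : 0 < complex.Im (conjc w) by move: w0; case: (w) => p q /=; rewrite oppr_gt0.
have hi := integrable_rdot (mL2_kk a b c wn) (mL2_kk a' b' c' zn).
have E t : rdot (kk w a b c t) (kk z a' b' c' t) =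
    complex.Re ((c * (delta_mx a b : MM) a' b' * conjc c') * (kr (conjc w) t * kr z t)).
  by rewrite rdot_kk /kk mxE kr_conj; congr complex.Re; ring.
rewrite ipE; under eq_Rintegral do rewrite E.
apply: integral_kr_mul => //.
by move: hi; congr (mu.-integrable setT _); apply/funext => t /=; rewrite E.
Qed.

Lemma HmD f g : Hm f -> Hm g -> Hm (fun t => f t + g t).
Proof.
move=> [hf f0] [hg g0]; split; first exact: mL2D.
move=> z a b c z0; rewrite ipDl ?f0 ?g0 ?addr0//.
by apply: mL2_kk; rewrite gt_eqF.
Qed.

Lemma HmZ (r : R) f : Hm f -> Hm (fun t => r%:C *: f t).
Proof.
move=> [hf f0]; split; first exact: mL2Z.
move=> z a b c z0; rewrite ipZl ?f0 ?mulr0//.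
by apply: mL2_kk; rewrite gt_eqF.
Qed.

Lemma HmB f g : Hm f -> Hm g -> Hm (fun t => f t - g t).
Proof.
move=> [hf f0] [hg g0]; split; first exact: mL2B.
move=> z a b c z0; rewrite ipBl ?f0 ?g0 ?subr0//.
by apply: mL2_kk; rewrite gt_eqF.
Qed.

Lemma kk_shift z a b c (h t : R) : kk z a b c (t + h) = kk (z - h%:C) a b c t.
Proof. by rewrite /kk kr_shift. Qed.

Lemma Hm_shift f (h : R) : Hm f -> Hm (fun t : R => f (t + h)).
Proof.
move=> [hf f0]; split; first exact: mL2_shift.
move=> z a b c z0.
have E : kk z a b c = (fun t => kk (z + h%:C) a b c (t + h)).
  by apply/funext => t; rewrite kk_shift addrK.
have z0' : 0 < complex.Im (z + h%:C) by rewrite ImD /= addr0.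
rewrite E ip_shift//; first exact: f0.
by apply: mL2_kk; rewrite gt_eqF.
Qed.

Lemma Hm_ae f g : Hm f -> mx_measurable g -> {ae mu, forall t, f t = g t} -> Hm g.
Proof.
move=> [hf f0] mg e; have hg := mL2_ae hf mg e; split => // z a b c z0.
rewrite -(ip_ae hf hg _ e) ?f0//.
by apply: mL2_kk; rewrite gt_eqF.
Qed.

(** The conditions that make the pairing of [f v] with [g] a symmetric form whose norm is equivalent
    to the L2 norm. *)
Definition weight (K c : R) v := [/\ multiplier K v, forall t, adjmx (v t) = v t, 0 < c &
  {ae mu, forall t, forall A : MM, c * mxfrob A ^+ 2 <= rdot (A *m v t) A}].

(** Weak form of the jump relation. For [g = v - 1] and [m] the lower boundary value of Psi - 1, the
    function [m v + g] is the upper boundary value of Psi - 1. A general source [g] also covers the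
    differentiated equations. *)
Definition solves v g (m : R -> MM) := Hm m /\
  forall p, Hm p -> ip (fun t => m t *m v t + g t) p = 0.

Section weighted.
Variables (K c : R) (v : R -> MM).
Hypothesis wv : weight K c v.

Let vK : multiplier K v. Proof. by case: wv. Qed.
Let vh t : adjmx (v t) = v t. Proof. by case: wv. Qed.
Let c0 : 0 < c. Proof. by case: wv. Qed.

Lemma weight_sym f g : mL2 f -> mL2 g ->
  ip (fun t => f t *m v t) g = ip f (fun t => g t *m v t).
Proof. by move=> hf hg; rewrite (ip_mull hf hg vK) !ipE; apply: eq_Rintegral => t _; rewrite vh. Qed.

Lemma weight_coercive f : mL2 f -> c * nrm f ^+ 2 <= ip (fun t => f t *m v t) f.
Proof.
move=> hf; have hv := mL2_mul hf vK.
rewrite nrm_sqr !ipE -RintegralZl//; last exact: integrable_rdot.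
rewrite /Rintegral fine_le//.
- apply: integrable_fin_num => //; rewrite (_ : (fun x => _) = (fun x => c%:E * (rdot (f x) (f x))%:E)%E)//.
  by apply: integrableZl => //; exact: integrable_rdot.
- by apply: integrable_fin_num => //; exact: integrable_rdot.
case: wv => _ _ _ hc.
have h0 t : 0 <= rdot (f t) (f t) by exact: rdot_ge0.
have m1 : measurable_fun setT (fun t => rdot (f t) (f t)) by apply: measurable_rdot; exact: hf.1.
have m2 : measurable_fun setT (fun t => rdot (f t *m v t) (f t)).
  by apply: measurable_rdot; [exact: hv.1|exact: hf.1].
(* Coercivity holds almost everywhere only; cutting the integrand at 0 makes it nonnegative
   everywhere without changing its integral. *)
have e : {ae mu, forall t, rdot (f t *m v t) (f t) = Num.max (rdot (f t *m v t) (f t)) 0}.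
  apply: ae_imp hc => t /(_ (f t)) h; rewrite max_l//; apply: le_trans h.
  by rewrite mulr_ge0 ?sqr_ge0// ltW.
rewrite [leRHS](_ : _ = \int[mu]_t (Num.max (rdot (f t *m v t) (f t)) 0)%:E)%E; last first.
  apply: ae_eq_integral => //.
  - exact/measurable_EFinP.
  - by apply/measurable_EFinP; exact: measurable_maxr.
  - by apply: ae_imp e => t /= <-.
apply: ae_ge0_le_integral => //.
- by move=> t _; rewrite lee_fin mulr_ge0// ltW.
- by apply/measurable_EFinP; exact: measurable_funM.
- by move=> t _; rewrite lee_fin le_max lexx orbT.
- by apply/measurable_EFinP; exact: measurable_maxr.
apply: ae_imp hc => t /(_ (f t)) h _; rewrite lee_fin le_max; apply/orP; left.
by rewrite rdot_frob.
Qed.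

(** Test the equation with [m] itself and compare coercivity with Cauchy-Schwarz. *)
Lemma solves_nrm g m : mL2 g -> solves v g m -> nrm m <= nrm g / c.
Proof.
move=> hg [hm e]; have := e m hm; have [hm2 _] := hm.
rewrite ipDl//; last exact: mL2_mul vK.
have := weight_coercive hm2; have := ip_CS hg hm2; have := ler_norm (- ip g m); rewrite normrN.
set N := nrm m; set G := nrm g => h1 h2 h3 h4.
have N0 : 0 <= N by exact: nrm_ge0.
have G0 : 0 <= G by exact: nrm_ge0.
rewrite ler_pdivlMr//.
have [->|Nn] := eqVneq N 0; first by rewrite mul0r.
have Np : 0 < N by rewrite lt_def Nn.
rewrite -(ler_pM2r Np); nra.
Qed.

Lemma solvesB g1 g2 m1 m2 : mL2 g1 -> mL2 g2 -> solves v g1 m1 -> solves v g2 m2 ->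
  solves v (fun t => g1 t - g2 t) (fun t => m1 t - m2 t).
Proof.
move=> h1 h2 [k1 e1] [k2 e2]; split; first exact: HmB.
move=> p hp; have [hp2 _] := hp; have [k1' _] := k1; have [k2' _] := k2.
have hv1 := mL2_mul k1' vK; have hv2 := mL2_mul k2' vK.
have -> : (fun t => (m1 t - m2 t) *m v t + (g1 t - g2 t)) =
    (fun t => (m1 t *m v t + g1 t) - (m2 t *m v t + g2 t)).
  by apply/funext => t; rewrite mulmxBl opprD addrACA.
by rewrite (ipBl (mL2D hv1 h1) (mL2D hv2 h2) hp2) (e1 p hp) (e2 p hp) subrr.
Qed.

Lemma solves_unique g m1 m2 : mL2 g -> solves v g m1 -> solves v g m2 ->
  {ae mu, forall t, m1 t = m2 t}.
Proof.
move=> hg s1 s2; have s := solvesB hg hg s1 s2.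
have h0 : mL2 (fun t => g t - g t) by exact: mL2B.
have := solves_nrm h0 s.
have -> : (fun t => g t - g t) = fun=> 0 by apply/funext => t; rewrite subrr.
rewrite /nrm ip0l sqrtr0 mul0r => h.
have E : nrm (fun t => m1 t - m2 t) = 0 by apply/eqP; rewrite eq_le h nrm_ge0.
have [hs _] := s.1; have := nrm0_ae hs E.
by apply: ae_imp => t /eqP; rewrite subr_eq0 => /eqP.
Qed.

(** Riesz representation on H- of the functional given by [- g], for the weighted form. Coercivity
    turns a sequence that is Cauchy for this form into one that is Cauchy in L2. *)
Lemma solves_exists g : mL2 g -> exists m, solves v g m.
Proof.
move=> hg.
pose q f1 f2 := ip (fun t => f1 t *m v t) f2.
have qle f : mL2 f -> q f f <= n%:R ^+ 2 * K * nrm f ^+ 2.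
  move=> hf; apply: le_trans (ler_norm _) _; apply: le_trans (ip_CS (mL2_mul hf vK) hf) _.
  by rewrite expr2 mulrA ler_wpM2r ?nrm_ge0//; exact: nrm_mul.
have vL f : mL2 f -> mL2 (fun t => f t *m v t) by move=> hf; exact: mL2_mul vK.
have [l hl Hl] : exists2 l, Hm l & forall p, Hm p -> q l p = - ip g p.
  apply: (@riesz_representation R (R -> MM) (fun a b => fun t => a t + b t)
    (fun r a => fun t => r%:C *: a t) Hm q HmD HmZ _ _ _ _ _ _ (fun p => - ip g p) (nrm g ^+ 2 / c)).
  - by move=> a b [ha _] [hb _]; rewrite /q weight_sym// ipC.
  - move=> a b p [ha _] [hb _] [hp _]; rewrite /q -ipDl; try exact: vL; last exact: hp.
    by rewrite !ipE; apply: eq_Rintegral => t _; rewrite mulmxDl.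
  - move=> r a p [ha _] [hp _]; rewrite /q -ipZl//; last exact: vL.
    by rewrite !ipE; apply: eq_Rintegral => t _; rewrite -scalemxAl.
  - move=> a [ha _]; apply: le_trans (weight_coercive ha).
    by rewrite mulr_ge0 ?sqr_ge0// ltW.
  - exists (fun=> 0); split; first exact: mL2_0.
    by move=> z a b d _; rewrite ip0l.
  - move=> u hu hq.
    have sE (f1 f2 : R -> MM) : (fun t => f1 t + (-1)%:C *: f2 t) = (fun t => f1 t - f2 t).
      by apply/funext => t; rewrite rmorphN1 scaleN1r.
    have hu2 m : mL2 (u m) by case: (hu m).
    have [|l hl [L hL]] := @mL2_complete R n u c^-1 hu2.
      move=> m; have := hq m; rewrite sE; set d := fun t => _ - _ => hd.
      have d2 : mL2 d by exact: mL2B.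
      rewrite mulrC ler_pdivlMr// mulrC; exact: le_trans (weight_coercive d2) hd.
    exists l, (n%:R ^+ 2 * K * L); split.
      (* H- is closed: the pairing with a fixed kernel is continuous in L2, so it vanishes in the
         limit. *)
      split => // z a b d z0.
      have hk : mL2 (kk z a b d) by apply: mL2_kk; rewrite gt_eqF.
      have h m : ip l (kk z a b d) ^+ 2 <= nrm (kk z a b d) ^+ 2 * L * (16^-1) ^+ m.
        have := ip_CS (mL2B (hu2 m) hl) hk.
        rewrite ipBl// (hu m).2// sub0r normrN => h1.
        rewrite -(real_normK (num_real (ip l _))).
        apply: (@le_trans _ _ ((nrm (fun t => u m t - l t) * nrm (kk z a b d)) ^+ 2)).
          by rewrite ler_pXn2r ?nnegrE ?mulr_ge0 ?nrm_ge0.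
        by rewrite exprMn mulrC -mulrA ler_wpM2l ?sqr_ge0.
      apply/eqP; rewrite -sqrf_eq0 eq_le sqr_ge0 andbT.
      have cv : (fun m => nrm (kk z a b d) ^+ 2 * L * (16^-1 : R) ^+ m) @ \oo -->
          nrm (kk z a b d) ^+ 2 * L * 0.
        apply: cvgM; first exact: cvg_cst.
        by apply: cvg_expr; rewrite ger0_norm ?invf_lt1// ?invr_ge0// ltr1n.
      rewrite mulr0 in cv.
      by apply: (cvgr_to_ge cv); apply: nearW.
    move=> m; rewrite sE; apply: le_trans (qle _ (mL2B (hu2 m) hl)) _.
    by rewrite -[leRHS]mulrA ler_wpM2l// mulr_ge0 ?exprn_ge0// (multiplier_ge0 vK).
  - by move=> a b [ha _] [hb _]; rewrite ipDr// opprD.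
  - by move=> r a [ha _]; rewrite ipC ipZl// ipC mulrN.
  - move=> a [ha _]; rewrite sqrrN -(real_normK (num_real (ip g a))).
    apply: (@le_trans _ _ ((nrm g * nrm a) ^+ 2)).
      by rewrite ler_pXn2r ?nnegrE ?mulr_ge0 ?nrm_ge0//; exact: ip_CS.
    rewrite exprMn -mulrA ler_wpM2l ?sqr_ge0// mulrC ler_pdivlMr// mulrC.
    exact: weight_coercive.
exists l; split => // p hp; rewrite ipDl//; [|exact: vL hl.1|exact: hp.1].
by have := Hl p hp; rewrite /q => ->; rewrite addNr.
Qed.

End weighted.

(** With this weight [solves] yields minus the orthogonal projection of the source on H-; the
    uniqueness proof decomposes a density in this way. *)
Lemma weight1 : weight (mxfrob (1%:M : MM)) 1 (fun=> 1%:M).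
Proof.
split => //; first exact: multiplier_cst.
  by move=> t; exact: adjmx1.
by apply: ae_all => t A; rewrite mulmx1 mul1r rdot_frob.
Qed.

End hardy_space.

(** * Cauchy and Poisson integrals *)

Section poisson_integral.
Context (R : realType).
Local Notation mu := (@lebesgue_measure R).

Definition poisson (y : R) (f : R -> R) (x : R) : R := pi^-1 * \int[mu]_t (f t * pk y (t - x)).

Lemma sqint_pk (y x : R) : y != 0 -> sqintegrable mu (fun t => pk y (t - x)).
Proof. by move=> y0; have := sqint_kr_im (z := x +i* y) y0; under eq_fun do rewrite kr_im. Qed.

Lemma poissonE (y x : R) (f : R -> R) : y != 0 -> sqintegrable mu f ->
  poisson y f x = \int[mu]_t (pi^-1 * f t * pk y (t - x)).
Proof.
move=> y0 hf; rewrite /poisson -RintegralZl//; last first.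
  by apply: sqintegrable_mul => //; exact: sqint_pk.
by apply: eq_Rintegral => t _; rewrite mulrA.
Qed.

End poisson_integral.

Section cauchy_integral.
Context (R : realType) (n : nat).
Local Notation C := R[i].
Local Notation MM := 'M[R[i]]_n.
Local Notation mu := (@lebesgue_measure R).
Implicit Types f g F G m : R -> MM.

Definition Cau F (z : C) : MM :=
  (0 +i* (2 * pi))^-1 *: mx_integral setT (fun t => kr z t *: F t).

Lemma inv_2pii : (0 +i* (2 * pi))^-1 = 0 +i* (- (2 * pi)^-1) :> C.
Proof.
have p0 : (2 * pi : R) != 0 by rewrite gt_eqF// mulr_gt0// pi_gt0.
have h0 : 0 +i* (2 * pi) != 0 :> C by rewrite eq_complex /= eqxx.
apply: (mulfI h0); rewrite mulfV//.
by apply: complex_ext; rewrite ?ReM ?ImM /= ?(mul0r, mulr0, sub0r, addr0)// mulrN opprK mulfV.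
Qed.

Lemma mx_integrable_kr F z : mL2 F -> complex.Im z != 0 ->
  mx_integrable setT (fun t => kr z t *: F t).
Proof.
move=> hF z0 a b; have h1 := sqint_kr_re z0; have h2 := sqint_kr_im z0.
have h3 := mL2_Re a b hF; have h4 := mL2_Im a b hF.
split.
  have -> : EFin \o mxRe (fun t => kr z t *: F t) a b =
    ((EFin \o (fun t => complex.Re (kr z t) * mxRe F a b t)%R) \-
    (EFin \o (fun t => complex.Im (kr z t) * mxIm F a b t)%R))%E.
    by apply/funext => t /=; rewrite /mxRe mxE ReM EFinB.
  by apply: integrableB => //; exact: sqintegrable_mul.
have -> : EFin \o mxIm (fun t => kr z t *: F t) a b =
  ((EFin \o (fun t => complex.Re (kr z t) * mxIm F a b t)%R) \+
  (EFin \o (fun t => complex.Im (kr z t) * mxRe F a b t)%R))%E.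
  by apply/funext => t /=; rewrite /mxIm mxE ImM EFinD.
by apply: integrableD => //; exact: sqintegrable_mul.
Qed.

(** The conjugate of 1 / (2 pi i), so that pairing with [kk] gives the real part of the Cauchy
    integral; [c_im] is [c_re] multiplied by i and gives the imaginary part. *)
Definition c_re : C := 0 +i* (2 * pi)^-1.
Definition c_im : C := (- (2 * pi)^-1)%:C.

Lemma Cau_re F z a b : mL2 F -> complex.Im z != 0 ->
  complex.Re (Cau F z a b) = ip F (kk z a b c_re).
Proof.
move=> hF z0; rewrite /Cau inv_2pii !mxE ReM /= mul0r sub0r mulNr opprK ipE.
rewrite -RintegralZl//; last exact: (mx_integrable_kr hF z0 a b).2.
apply: eq_Rintegral => t _; rewrite rdot_kk /mxIm mxE; case: (F t a b) (kr z t) => p q [r s] /=.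
by ring.
Qed.

Lemma Cau_im F z a b : mL2 F -> complex.Im z != 0 ->
  complex.Im (Cau F z a b) = ip F (kk z a b c_im).
Proof.
move=> hF z0; rewrite /Cau inv_2pii !mxE ImM /= mul0r add0r ipE.
rewrite -RintegralZl//; last exact: (mx_integrable_kr hF z0 a b).1.
apply: eq_Rintegral => t _; rewrite rdot_kk /mxRe mxE; case: (F t a b) (kr z t) => p q [r s] /=.
by ring.
Qed.

(** The Cauchy kernels at conjugate points differ by 2 i times the Poisson kernel. *)
Lemma ip_kk_conj_diff G (x y : R) a b c : mL2 G -> y != 0 ->
  ip G (kk (x +i* y) a b c) - ip G (kk (x +i* (- y)) a b c) =
  \int[mu]_t (2 * complex.Re (G t a b * (conjc c * 'i)) * pk y (t - x)).
Proof.
move=> hG y0.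
have h1 : mL2 (kk (x +i* y) a b c) by exact: mL2_kk.
have h2 : mL2 (kk (x +i* (- y)) a b c) by apply: mL2_kk; rewrite /= oppr_eq0.
rewrite -ipBr// ipE; apply: eq_Rintegral => t _.
rewrite rdotC rdotBl !(rdotC _ (G t)) !rdot_kk -ReB -!mulrBr !krE /= sqrrN /pk.
case: (G t a b) => p q; case: c {h1 h2} => r s /=; set d := _ ^+ 2 + _ ^+ 2; ring.
Qed.

(** Above the line the part [m] does not contribute and [G] is orthogonal to the kernel at the
    conjugate point, so that kernel may be subtracted; this leaves a Poisson integral of [G]. Below
    the line the roles are exchanged and the sign is absorbed by F = G - m. *)
Lemma Cau_poisson F G m (x y : R) a b : 0 < y -> mL2 G -> Hm m ->
  (forall p, Hm p -> ip G p = 0) -> (forall t, F t = G t - m t) ->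
  [/\ complex.Re (Cau F (x +i* y) a b) = poisson y (mxRe G a b) x,
      complex.Im (Cau F (x +i* y) a b) = poisson y (mxIm G a b) x,
      complex.Re (Cau F (x +i* (- y)) a b) = poisson y (mxRe m a b) x
    & complex.Im (Cau F (x +i* (- y)) a b) = poisson y (mxIm m a b) x].
Proof.
move=> y0 hG hm Gp FE; have [hm2 hm0] := hm.
have yn : y != 0 by rewrite gt_eqF.
have yn0 : complex.Im (x +i* y) != 0 by [].
have yn' : complex.Im (x +i* (- y)) != 0 by rewrite /= oppr_eq0.
have -> : F = (fun t => G t - m t) by apply/funext.
have hF : mL2 (fun t => G t - m t) by exact: mL2B.
have up c : ip (fun t => G t - m t) (kk (x +i* y) a b c) =
    \int[mu]_t (2 * complex.Re (G t a b * (conjc c * 'i)) * pk y (t - x)).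
  rewrite (ipBl hG hm2 (mL2_kk _ _ _ yn0)) hm0// subr0 -ip_kk_conj_diff// [X in _ - X]Gp ?subr0//.
  by apply: Hm_kk; rewrite /= oppr_lt0.
have dn c : ip (fun t => G t - m t) (kk (x +i* (- y)) a b c) =
    \int[mu]_t (2 * complex.Re (m t a b * (conjc c * 'i)) * pk y (t - x)).
  rewrite (ipBl hG hm2 (mL2_kk _ _ _ yn')) Gp ?sub0r; last by apply: Hm_kk; rewrite /= oppr_lt0.
  by rewrite -ip_kk_conj_diff// [ip m (kk (x +i* y) a b c)]hm0// sub0r.
have p0 : (pi : R) != 0 by rewrite gt_eqF// pi_gt0.
have eR (w : C) : 2 * complex.Re (w * (conjc c_re * 'i)) = pi^-1 * complex.Re w.
  by case: w => p q; rewrite /c_re /= invfM; move: (pi : R) p0 => P P0; field.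
have eI (w : C) : 2 * complex.Re (w * (conjc c_im * 'i)) = pi^-1 * complex.Im w.
  by case: w => p q; rewrite /c_im /= invfM; move: (pi : R) p0 => P P0; field.
split.
- rewrite (@Cau_re _ (x +i* y) a b hF yn) (up c_re) (poissonE _ yn (mL2_Re a b hG)).
  by apply: eq_Rintegral => t _; rewrite eR.
- rewrite (@Cau_im _ (x +i* y) a b hF yn) (up c_im) (poissonE _ yn (mL2_Im a b hG)).
  by apply: eq_Rintegral => t _; rewrite eI.
- rewrite (@Cau_re _ (x +i* (- y)) a b hF yn') (dn c_re) (poissonE _ yn (mL2_Re a b hm2)).
  by apply: eq_Rintegral => t _; rewrite eR.
- rewrite (@Cau_im _ (x +i* (- y)) a b hF yn') (dn c_im) (poissonE _ yn (mL2_Im a b hm2)).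
  by apply: eq_Rintegral => t _; rewrite eI.
Qed.

End cauchy_integral.

(** * Poisson integrals of bounded continuous functions at the boundary *)

Section poisson_limit.
Context (R : realType).
Local Notation mu := (@lebesgue_measure R).
Implicit Types f g : R -> R.

Lemma integrable_pk (y x : R) : 0 < y -> mu.-integrable setT (EFin \o (fun t => pk y (t - x))).
Proof.
move=> y0; apply/integrableP; split.
  by apply/measurable_EFinP; apply: continuous_measurable_fun; apply: continuous_pk; rewrite gt_eqF.
under eq_integral do rewrite abse_EFin ger0_norm ?pk_ge0 ?(ltW y0)//.
by rewrite integral_pk// ltry.
Qed.

Lemma Rintegral_pk (y x : R) : 0 < y -> \int[mu]_t (pk y (t - x)) = pi.
Proof. by move=> y0; rewrite /Rintegral integral_pk. Qed.

(** Away from 0 the kernel is at most a multiple of [y] times the kernel of height 1, whose integral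
    does not depend on [y]. *)
Lemma pk_tail_le (y r s : R) : 0 < y -> 0 < r -> r <= `|s| ->
  pk y s <= y * (1 + r^-2) * pk 1 s.
Proof.
move=> y0 r0 rs; rewrite /pk expr1n -mulrA; apply: ler_wpM2l; first exact: ltW.
have s2 : r ^+ 2 <= s ^+ 2 by rewrite -(real_normK (num_real s)) ler_pXn2r// ?nnegrE// ltW.
have r2 : 0 < r ^+ 2 by rewrite exprn_gt0.
have q1 : 0 < s ^+ 2 + y ^+ 2 by rewrite pk_den_gt0 ?gt_eqF.
have q2 : 0 < s ^+ 2 + 1 by rewrite ltr_wpDl ?sqr_ge0.
rewrite mul1r -[leLHS]mul1r ler_pdivrMr// mulrAC ler_pdivlMr// mul1r.
have h1 : 1 <= r^-2 * s ^+ 2 by rewrite mulrC ler_pdivlMr// mul1r.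
have ri : 0 < r ^- 2 by rewrite invr_gt0.
have := sqr_ge0 y; have := mulr_ge0 (ltW ri) (sqr_ge0 y); nra.
Qed.

Lemma poisson_ae (y x : R) f g : 0 < y -> sqintegrable mu f -> sqintegrable mu g ->
  {ae mu, forall t, f t = g t} -> poisson y f x = poisson y g x.
Proof.
move=> y0 hf hg e; congr (_ * _).
apply: dotL2_ae => //; try by apply: sqint_pk; rewrite gt_eqF.
exact: ae_all.
Qed.

Lemma poisson_cvg f x0 (B : R) : continuous f -> (forall t, `|f t| <= B) ->
  forall e, 0 < e -> exists2 r, 0 < r & forall x y, `|x - x0| < r -> 0 < y -> y < r ->
    `|poisson y f x - f x0| <= e.
Proof.
move=> cf fB e e0; have B0 : 0 <= B by exact: le_trans (normr_ge0 _) (fB 0).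
have /cvgrPdist_lt/(_ (e / 2)) := cf x0; rewrite divr_gt0// => /(_ isT) /nbhs_ballP[r /= r0 hr].
(* For [x] within [r / 2] of [x0], a point [t] at distance at least [r] from [x0] is at distance at
   least [r / 2] from [x]. There the integrand is at most [K y] times the kernel of height 1, and
   [y] is chosen with [K y <= e / 2]. *)
pose K := 2 * B * (1 + (r / 2) ^- 2).
have K0 : 0 <= K by rewrite !mulr_ge0// addr_ge0// invr_ge0 exprn_ge0// divr_ge0// ltW.
exists (Num.min (r / 2) (e / (2 * (K + 1)))).
  by rewrite lt_min !divr_gt0// mulr_gt0// ltr_wpDl.
move=> x y; rewrite !lt_min => /andP[xr _] y0 /andP[_ ye].
have mf : measurable_fun [set: R] f by exact: continuous_measurable_fun.
have ip1 := integrable_pk x y0; have ip2 := integrable_pk x (@ltr01 R).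
have ifp : mu.-integrable setT (EFin \o (fun t => (f t - f x0) * pk y (t - x))).
  apply: (le_integrable measurableT _ _ (integrableZl measurableT (2 * B) ip1)).
    apply/measurable_EFinP; apply: measurable_funM; first exact: measurable_funB.
    by apply: continuous_measurable_fun; apply: continuous_pk; rewrite gt_eqF.
  move=> t _; change (`|(f t - f x0) * pk y (t - x)|%:E <= `|2 * B * pk y (t - x)|%:E)%E.
  rewrite lee_fin !normrM; apply: ler_wpM2r => //.
  rewrite [`|2|]ger0_norm//; apply: le_trans (ler_normB _ _) _.
  by rewrite [`|B|]ger0_norm// mulr_natl mulr2n lerD.
have E : poisson y f x - f x0 = pi^-1 * \int[mu]_t ((f t - f x0) * pk y (t - x)).
  have i3 : mu.-integrable setT (EFin \o (fun t => f x0 * pk y (t - x))).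
    rewrite (_ : _ \o _ = (fun t => (f x0)%:E * (pk y (t - x))%:E)%E)//; exact: integrableZl.
  have i4 : mu.-integrable setT (EFin \o (fun t => f t * pk y (t - x))).
    rewrite (_ : _ \o _ = ((EFin \o (fun t => (f t - f x0) * pk y (t - x))%R) \+
      (EFin \o (fun t => f x0 * pk y (t - x))%R))%E); first exact: integrableD.
    by apply/funext => t /=; rewrite -EFinD -mulrDl subrK.
  have -> : \int[mu]_t ((f t - f x0) * pk y (t - x)) =
      \int[mu]_t (f t * pk y (t - x)) - \int[mu]_t (f x0 * pk y (t - x)).
    by rewrite -RintegralB//; apply: eq_Rintegral => t _; rewrite mulrBl.
  by rewrite RintegralZl// Rintegral_pk// mulrBr mulrCA mulVf ?mulr1// gt_eqF// pi_gt0.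
rewrite E normrM ger0_norm ?invr_ge0 ?pi_ge0// ler_pdivrMl ?pi_gt0//.
apply: le_trans (le_normr_Rintegral measurableT ifp) _.
have i5 : mu.-integrable setT (EFin \o (fun t => e / 2 * pk y (t - x))).
  rewrite (_ : _ \o _ = (fun t => (e / 2)%:E * (pk y (t - x))%:E)%E)//; exact: integrableZl.
have i6 : mu.-integrable setT (EFin \o (fun t => K * y * pk 1 (t - x))).
  rewrite (_ : _ \o _ = (fun t => (K * y)%:E * (pk 1 (t - x))%:E)%E)//; exact: integrableZl.
apply: (@le_trans _ _ (\int[mu]_t (e / 2 * pk y (t - x) + K * y * pk 1 (t - x)))).
  apply: le_Rintegral => //.
  - exact: (integrable_norm ifp).
  - rewrite (_ : _ \o _ = ((EFin \o (fun t => e / 2 * pk y (t - x))%R) \+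
      (EFin \o (fun t => K * y * pk 1 (t - x))%R))%E)//; exact: integrableD.
  move=> t _; rewrite normrM (ger0_norm (pk_ge0 _ (ltW y0))).
  have P0 := pk_ge0 (t - x) (ltW y0); have P1 := pk_ge0 (t - x) (@ler01 R).
  have [tr|tr] := ltP `|t - x0| r.
    apply: (@le_trans _ _ (e / 2 * pk y (t - x))).
      by rewrite ler_wpM2r// distrC ltW//; apply: hr; rewrite /ball /= distrC.
    by rewrite lerDl mulr_ge0// mulr_ge0// ltW.
  have ts : r / 2 <= `|t - x|.
    have : `|t - x0| <= `|t - x| + `|x - x0| by apply: le_trans (ler_normD _ _); rewrite addrA subrK.
    lra.
  apply: (@le_trans _ _ (K * y * pk 1 (t - x))); last first.
    by rewrite lerDr mulr_ge0// divr_ge0// ltW.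
  have h1 : `|f t - f x0| <= 2 * B.
    by apply: le_trans (ler_normB _ _) _; rewrite mulr_natl mulr2n lerD.
  have r20 : 0 < r / 2 by rewrite divr_gt0.
  have h2 := pk_tail_le y0 r20 ts.
  apply: le_trans (ler_pM _ _ h1 h2) _ => //.
  have -> : K * y * pk 1 (t - x) = 2 * B * (y * (1 + (r / 2) ^- 2) * pk 1 (t - x)).
    by rewrite /K; ring.
  by [].
have z c s : 0 < s -> \int[mu]_t (c * pk s (t - x)) = c * pi.
  by move=> s0; rewrite RintegralZl ?Rintegral_pk//; exact: integrable_pk.
rewrite (RintegralD measurableT i5 i6) (z _ y)// (z _ 1)//.
have : K * y <= e / 2.
  have h : y * (2 * (K + 1)) <= e by rewrite -ler_pdivlMr ?mulr_gt0 ?ltr_wpDl// ltW.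
  have := mulr_ge0 K0 (ltW y0); lra.
move: (pi : R) (@pi_gt0 R) => P P0; nra.
Qed.

End poisson_limit.

Lemma Rintegral_dominated d (T : measurableType d) (R : realType) (mu : {measure set T -> \bar R})
    (u : nat -> T -> R) (f g : T -> R) :
  (forall m, measurable_fun setT (u m)) -> measurable_fun setT f ->
  {ae mu, forall x, u ^~ x @ \oo --> f x} -> mu.-integrable setT (EFin \o g) ->
  {ae mu, forall x m, `|u m x| <= g x} ->
  \int[mu]_x u m x @[m --> \oo] --> \int[mu]_x f x.
Proof.
move=> mu_ mf uf ig ug.
have := @dominated_convergence _ _ R mu setT measurableT (fun m x => (u m x)%:E)
  (fun x => (f x)%:E) (fun x => (g x)%:E); case.
- by move=> m; apply/measurable_EFinP.
- exact/measurable_EFinP.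
- by apply: ae_imp uf => x h _; apply: cvg_EFin; first exact: nearW.
- exact: ig.
- by apply: ae_imp ug => x h m _; rewrite abse_EFin lee_fin.
move=> i1 _ h; rewrite /Rintegral.
apply: fine_cvg; rewrite fineK//; exact: integrable_fin_num.
Qed.

(** * An L2 function is the everywhere limit of its Poisson integrals *)

Section poisson_identification.
Context (R : realType).
Local Notation mu := (@lebesgue_measure R).
Implicit Types (f A : R -> R).

Lemma pk_sym (y s : R) : pk y (- s) = pk y s.
Proof. by rewrite /pk sqrrN. Qed.

Lemma integrable_pk_sym (y t : R) : 0 < y ->
  mu.-integrable setT (EFin \o (fun x => pk y (t - x))).
Proof.
move=> y0; rewrite (_ : (fun x => _) = (fun x => pk y (x - t))); first exact: integrable_pk.
by apply/funext => x; rewrite -pk_sym opprB.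
Qed.

Lemma Rintegral_pk_sym (y t : R) : 0 < y -> \int[mu]_x (pk y (t - x)) = pi.
Proof.
move=> y0; rewrite -(Rintegral_pk t y0); apply: eq_Rintegral => x _.
by rewrite -pk_sym opprB.
Qed.

(** What the Poisson operator becomes on the other side of Fubini; applied to an indicator it is the
    harmonic measure of the set seen from height [y]. *)
Definition poisson_mass (A : R -> R) (y t : R) : R := pi^-1 * \int[mu]_x (A x * pk y (t - x)).

Lemma integrable_mass A y t : 0 < y -> measurable_fun setT A -> (forall x, 0 <= A x <= 1) ->
  mu.-integrable setT (EFin \o (fun x => A x * pk y (t - x))).
Proof.
move=> y0 mA A01; have ip := integrable_pk_sym t y0.
apply: (le_integrable measurableT _ _ ip).
  apply/measurable_EFinP; apply: measurable_funM => //.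
  by have /integrableP[/measurable_EFinP] := ip.
move=> x _; change (`|A x * pk y (t - x)|%:E <= `|pk y (t - x)|%:E)%E.
have /andP[a0 a1] := A01 x; rewrite lee_fin normrM (ger0_norm a0) ler_piMl//.
Qed.

Lemma poisson_mass_ge0 A y t : 0 < y -> (forall x, 0 <= A x <= 1) -> 0 <= poisson_mass A y t.
Proof.
move=> y0 A01; rewrite mulr_ge0 ?invr_ge0 ?pi_ge0//; apply: Rintegral_ge0 => x _.
by have /andP[a0 _] := A01 x; rewrite mulr_ge0// pk_ge0// ltW.
Qed.

Lemma poisson_mass_le1 A y t : 0 < y -> measurable_fun setT A -> (forall x, 0 <= A x <= 1) ->
  poisson_mass A y t <= 1.
Proof.
move=> y0 mA A01; rewrite /poisson_mass ler_pdivrMl ?pi_gt0// mulr1 -(Rintegral_pk_sym t y0).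
apply: le_Rintegral => //; [exact: integrable_mass|exact: integrable_pk_sym|move=> x _].
by have /andP[a0 a1] := A01 x; rewrite ler_piMl// pk_ge0// ltW.
Qed.

Lemma poisson_mass_far A y t r : 0 < y -> 0 < r -> measurable_fun setT A ->
  (forall x, 0 <= A x <= 1) -> (forall x, A x != 0 -> r <= `|t - x|) ->
  poisson_mass A y t <= y * (1 + r^-2) * poisson_mass A 1 t.
Proof.
move=> y0 r0 mA A01 Ar; rewrite /poisson_mass mulrCA ler_wpM2l ?invr_ge0 ?pi_ge0//.
have i1 := integrable_mass t (@ltr01 R) mA A01.
rewrite -RintegralZl//; apply: le_Rintegral => //; first exact: integrable_mass.
  rewrite (_ : _ \o _ = (fun x => (y * (1 + r^-2))%:E * (A x * pk 1 (t - x))%:E)%E)//.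
  exact: integrableZl.
move=> x _; have /andP[a0 _] := A01 x.
have [->|Ax] := eqVneq (A x) 0; first by rewrite !mul0r mulr0.
by rewrite [leRHS]mulrCA ler_wpM2l// pk_tail_le// Ar.
Qed.

Lemma poisson_massC A y t : 0 < y -> measurable_fun setT A -> (forall x, 0 <= A x <= 1) ->
  poisson_mass (fun x => 1 - A x) y t = 1 - poisson_mass A y t.
Proof.
move=> y0 mA A01; rewrite /poisson_mass.
have -> : \int[mu]_x ((1 - A x) * pk y (t - x)) =
    \int[mu]_x (pk y (t - x)) - \int[mu]_x (A x * pk y (t - x)).
  rewrite -RintegralB//; [|exact: integrable_pk_sym|exact: integrable_mass].
  by apply: eq_Rintegral => x _; rewrite mulrBl mul1r.
by rewrite Rintegral_pk_sym// mulrBr mulVf// gt_eqF// pi_gt0.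
Qed.

Lemma indic01 (J : set R) x : 0 <= (\1_J x : R) <= 1.
Proof. by rewrite indicE; case: (x \in J); rewrite ?lexx ?ler01. Qed.

(** At an endpoint of a nondegenerate interval the limit would be 1/2. The endpoints form a null
    set, so they do no harm under the integral. *)
Lemma poisson_mass_cvg (c e t : R) : t != c -> t != e ->
  poisson_mass \1_(`[c, e]) (harmonic m) t @[m --> \oo] --> (\1_(`[c, e]) t : R).
Proof.
move=> tc te; set A : R -> R := \1_(`[c, e]).
have mA : measurable_fun setT A by exact: measurable_indic.
have A01 x : 0 <= A x <= 1 by exact: indic01.
(* Points where the indicator takes the other value stay at distance [r]; the tail estimate is
   applied to [A] outside the interval and to [1 - A] inside. *)
have [r r0 tr] : exists2 r : R, 0 < r & forall x, A x != A t -> r <= `|t - x|.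
  have c0 : 0 < `|t - c| by rewrite normr_gt0 subr_eq0.
  have e0 : 0 < `|t - e| by rewrite normr_gt0 subr_eq0.
  exists (Num.min `|t - c| `|t - e|); first by rewrite lt_min c0 e0.
  have E s : (s \in `[c, e]%classic) = (c <= s <= e) by rewrite mem_setE in_itv.
  move=> x; rewrite /A !indicE !E => h.
  have : (c <= x <= e) != (c <= t <= e) by apply: contra_neq h => ->.
  rewrite ge_min; have [cx|xc] := leP c x; have [ct|tc'] := leP c t;
    have [xe|ex] := leP x e; have [te'|et] := leP t e => //= _;
    rewrite !ler_norml; apply/orP;
    first [left; rewrite -!ler_norml; case: (ler0P (t - c)); case: (ler0P (t - x)); lra
          |right; rewrite -!ler_norml; case: (ler0P (t - e)); case: (ler0P (t - x)); lra].
apply/cvgrPdist_le => eps eps0.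
have := @cvg_harmonic R => /cvgrPdist_lt /(_ (eps / (1 + r^-2))).
have r2 : 0 < 1 + r^-2 by rewrite ltr_wpDr// invr_ge0 exprn_ge0// ltW.
rewrite divr_gt0// => /(_ isT); apply: filterS => m.
have h0 : 0 < harmonic m :> R by exact: harmonic_gt0.
rewrite sub0r normrN (ger0_norm (ltW h0)); move: (harmonic m : R) h0 => y y0 hy.
have {}hy : y * (1 + r^-2) <= eps by rewrite -ler_pdivlMr// ltW.
have far (B : R -> R) : measurable_fun setT B -> (forall x, 0 <= B x <= 1) ->
    (forall x, B x != 0 -> r <= `|t - x|) -> poisson_mass B y t <= eps.
  move=> mB B01 hB; apply: le_trans (poisson_mass_far y0 r0 mB B01 hB) _.
  apply: le_trans hy; rewrite ler_piMr// ?poisson_mass_le1// mulr_ge0// ltW//.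
have P0 := poisson_mass_ge0 t y0 A01.
have P1 := poisson_mass_le1 t y0 mA A01.
have [At|At] : A t = 1 \/ A t = 0 by rewrite /A indicE; case: (t \in _); [left|right].
  rewrite At in tr *; rewrite ger0_norm ?subr_ge0// -poisson_massC//; apply: far => //.
  - exact: measurable_funB.
  - by move=> x; have /andP[a0 a1] := A01 x; rewrite subr_ge0 a1 gerBl.
  - by move=> x h; apply: tr; apply: contra_neq h => ->; rewrite subrr.
rewrite At in tr *; rewrite sub0r normrN ger0_norm//; exact: far.
Qed.

Section interval.
Context (f : R -> R) (hf : sqintegrable mu f) (c e : R).
Let J : set R := `[c, e]%classic.
Let A : R -> R := \1_J.
Let mJ : measurable (J : set (measurableTypeR R)). Proof. exact: measurable_itv. Qed.
Let mA : measurable_fun setT A. Proof. exact: measurable_indic. Qed.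
Let A01 x : 0 <= A x <= 1. Proof. exact: indic01. Qed.
Let mf : measurable_fun setT f := hf.1.
Let G y (p : R * R) : \bar R := (A p.1 * (f p.2 * pk y (p.2 - p.1)))%:E.

Let mG y : 0 < y -> measurable_fun setT (G y).
Proof.
move=> y0; apply/measurable_EFinP; apply: measurable_funM.
  by apply: measurableT_comp => //; exact: measurable_fst.
apply: measurable_funM.
  by apply: (measurableT_comp mf); exact: measurable_snd.
apply: (@measurableT_comp _ _ _ _ _ _ (pk y) _ (fun p : R * R => p.2 - p.1)).
  have := @continuous_pk _ y 0 (lt0r_neq0 y0); under eq_fun do rewrite subr0.
  exact: continuous_measurable_fun.
by apply: measurable_funB; [exact: measurable_snd|exact: measurable_fst].
Qed.

Let iG y : 0 < y -> (mu \x mu)%E.-integrable setT (G y).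
Proof.
move=> y0; apply/(@integrable12ltyP _ _ _ _ _ mu mu _ (mG y0)).
(* Since |f pk| is at most f^2 + pk^2 and the kernel is translated, [B] bounds the inner integral
   for every [x]; the outer integral runs over a bounded interval. *)
pose B := (sqint mu f + sqint mu (pk y))%E.
have spk : sqintegrable mu (pk y).
  by have := sqint_pk 0 (lt0r_neq0 y0); under eq_fun do rewrite subr0.
have B1 : (B < +oo)%E by rewrite lte_add_pinfty//; [exact: hf.2|exact: spk.2].
have B0 : (0 <= B)%E by rewrite adde_ge0// sqint_ge0.
apply: (@le_lt_trans _ _ (\int[mu]_x ((A x)%:E * B))%E).
  apply: ge0_le_integral => //.
  - by move=> x _; exact: integral_ge0.
  - apply: (@measurable_fun_fubini_tonelli_F _ _ _ _ _ mu (fun p => `|G y p|%E)) => //.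
    by apply: measurableT_comp; [exact: abse_measurable|exact: mG].
  - apply: emeasurable_funM; [exact/measurable_EFinP|exact: measurable_cst].
  move=> x _; have /andP[a0 a1] := A01 x.
  rewrite (_ : (fun t => _) = (fun t => (A x)%:E * `|f t * pk y (t - x)|%:E)%E); last first.
    by apply/funext => t; rewrite /G /= normrM ger0_norm// -EFinM.
  have mfp : measurable_fun setT (fun t => f t * pk y (t - x)).
    by apply: measurable_funM => //; have [] := sqint_pk x (lt0r_neq0 y0).
  rewrite ge0_integralZl//; last by apply/measurable_EFinP; exact: measurableT_comp.
  rewrite lee_wpmul2l ?lee_fin//.
  rewrite /B; have <- : sqint mu (fun t => pk y (t - x)) = sqint mu (pk y) by exact: sqint_shift spk.1.
  rewrite /sqint -ge0_integralD//; last 4 first.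
  - by move=> t _; rewrite lee_fin sqr_ge0.
  - exact: measurable_sq.
  - by move=> t _; rewrite lee_fin sqr_ge0.
  - by apply: measurable_sq; have [] := sqint_pk x (lt0r_neq0 y0).
  apply: ge0_le_integral => //.
  - by apply/measurable_EFinP; exact: measurableT_comp.
  - apply: emeasurable_funD; apply: measurable_sq => //.
    by have [] := sqint_pk x (lt0r_neq0 y0).
  move=> t _; rewrite -EFinD lee_fin normrM.
  rewrite -(real_normK (num_real (f t))) -(real_normK (num_real (pk y (t - x)))).
  have := sqr_ge0 (`|f t| - `|pk y (t - x)|).
  have := sqr_ge0 `|f t|; have := sqr_ge0 `|pk y (t - x)|; nra.
rewrite ge0_integralZr//; last 2 first.
- exact/measurable_EFinP.
- by move=> x _; rewrite lee_fin; have /andP[] := A01 x.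
rewrite lte_mul_pinfty//.
- by apply: integral_ge0 => x _; rewrite lee_fin; have /andP[] := A01 x.
- rewrite integral_indic// setIT ge0_fin_numE//.
  by rewrite [X in (X < _)%E]lebesgue_measure_itv; case: ifP => _; rewrite ?ltry// -EFinB ltry.
Qed.

Let FG y x : 0 < y -> (\int[mu]_t G y (x, t) = (pi * (A x * poisson y f x))%:E)%E.
Proof.
move=> y0; have i1 := sqintegrable_mul hf (sqint_pk x (lt0r_neq0 y0)).
rewrite (_ : (fun t => _) = (fun t => (A x)%:E * (f t * pk y (t - x))%:E)%E)//.
rewrite integralZl// /poisson.
rewrite mulrCA (mulrA pi) mulfV ?mul1r ?gt_eqF ?pi_gt0// EFinM /Rintegral fineK//.
exact: integrable_fin_num.
Qed.

Let GG y t : 0 < y -> (\int[mu]_x G y (x, t) = (pi * (f t * poisson_mass A y t))%:E)%E.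
Proof.
move=> y0; have i1 := integrable_mass t y0 mA A01.
rewrite (_ : (fun x => _) = (fun x => (f t)%:E * (A x * pk y (t - x))%:E)%E); last first.
  by apply/funext => x; rewrite /G /= -EFinM mulrCA.
rewrite integralZl// /poisson_mass.
rewrite mulrCA (mulrA pi) mulfV ?mul1r ?gt_eqF ?pi_gt0// EFinM /Rintegral fineK//.
exact: integrable_fin_num.
Qed.

Let unpi (g : R -> R) : mu.-integrable setT (fun x => (pi * g x)%:E) ->
  mu.-integrable setT (EFin \o g).
Proof.
move=> h; rewrite (_ : _ \o _ = (fun x => (pi^-1)%:E * (pi * g x)%:E)%E).
  exact: integrableZl.
by apply/funext => x; rewrite -EFinM mulKf// gt_eqF// pi_gt0.
Qed.

Lemma integrable_poisson_interval y : 0 < y ->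
  mu.-integrable setT (EFin \o (fun x => A x * poisson y f x)).
Proof.
move=> y0; apply: unpi; have := integrable_fubini_F (iG y0).
by congr (integrable _ _ _); apply/funext => x; rewrite /fubini_F FG.
Qed.

(** A majorant independent of the height and in L2: its product with [f] is integrable and serves
    for dominated convergence. *)
Lemma poisson_mass_dom : exists2 C, 0 <= C &
  forall y t, 0 < y -> y <= 1 -> poisson_mass A y t <= C * pk 1 (t - c).
Proof.
pose L := `|e - c|; have L0 : 0 <= L by exact: normr_ge0.
(* For [x] in the interval, (t - c)^2 is at most 2 (t - x)^2 + 2 L^2, so moving the centre of the
   kernel from [x] to [c] costs at most the factor [C0]. *)
pose C0 := 2 + 2 * L ^+ 2; have C00 : 0 <= C0 by rewrite addr_ge0 ?mulr_ge0 ?sqr_ge0.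
have iA : mu.-integrable setT (EFin \o A).
  apply/integrableP; split; first exact/measurable_EFinP.
  under eq_integral do rewrite /= ger0_norm ?(andP (A01 _)).1//.
  by rewrite integral_indic// setIT [X in (X < _)%E]lebesgue_measure_itv; case: ifP => _; rewrite ?ltry// -EFinB ltry.
pose K := \int[mu]_x A x.
have K0 : 0 <= K by apply: Rintegral_ge0 => x _; have /andP[] := A01 x.
have Ax x : A x != 0 -> c <= x <= e.
  rewrite /A indicE; case: (boolP (x \in J)) => [|_]; last by rewrite eqxx.
  by rewrite mem_setE in_itv.
have d1 t : 0 < (t - c) ^+ 2 + 1 by rewrite ltr_wpDl ?sqr_ge0.
have h1 t : poisson_mass A 1 t <= pi^-1 * (K * (C0 * pk 1 (t - c))).
  rewrite /poisson_mass ler_wpM2l ?invr_ge0 ?pi_ge0// mulrC -RintegralZl//.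
  apply: le_Rintegral => //; first exact: integrable_mass.
    rewrite (_ : _ \o _ = (fun x => (C0 * pk 1 (t - c))%:E * (A x)%:E)%E)//.
    exact: integrableZl.
  move=> x _; have /andP[a0 _] := A01 x.
  have [->|/Ax /andP[cx xe]] := eqVneq (A x) 0; first by rewrite mul0r mulr0.
  rewrite mulrC; apply: ler_wpM2r => //.
  have d2 : 0 < (t - x) ^+ 2 + 1 by rewrite ltr_wpDl ?sqr_ge0.
  rewrite /pk !expr1n !div1r ler_pdivlMr// mulrC ler_pdivrMr//.
  have xc : (x - c) ^+ 2 <= L ^+ 2.
    rewrite /L real_normK ?num_real// ler_pXn2r// ?nnegrE ?subr_ge0 ?lerD2r//.
    exact: le_trans cx xe.
  rewrite /C0; have := sqr_ge0 (t - x - (x - c)); have := sqr_ge0 L; have := sqr_ge0 (t - x); nra.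
have P0 : 0 <= pi^-1 :> R by rewrite invr_ge0 pi_ge0.
have W0 : 0 <= 2 * (pi^-1 * (K * C0)) by rewrite !mulr_ge0.
have N0 : 0 <= 1 + (L + 1) ^+ 2 by rewrite addr_ge0 ?sqr_ge0.
(* The first summand serves the points at distance at least 1 from the interval, where the tail
   factor is 2; the second makes the majorant at least 1 at the remaining ones, where the mass is at
   most 1. *)
exists (2 * (pi^-1 * (K * C0)) + (1 + (L + 1) ^+ 2)); first exact: addr_ge0.
move=> y t y0 y1; have k0 : 0 <= pk 1 (t - c) by rewrite pk_ge0.
rewrite mulrDl; have [tL|tL] := ltP `|t - c| (L + 1).
  apply: (le_trans (poisson_mass_le1 t y0 mA A01)).
  apply: ler_wpDl; first exact: mulr_ge0.
  rewrite /pk expr1n div1r ler_pdivlMr// mul1r addrC lerD2l.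
  by rewrite -(real_normK (num_real (t - c))) ler_pXn2r// ?nnegrE ?addr_ge0// ltW.
apply: ler_wpDr; first exact: mulr_ge0.
apply: (le_trans (poisson_mass_far y0 ltr01 mA A01 _)).
  move=> x /Ax /andP[cx xe].
  have : `|t - c| <= `|t - x| + `|x - c| by apply: le_trans (ler_normD _ _); rewrite addrA subrK.
  have : `|x - c| <= L by rewrite /L !ger0_norm ?subr_ge0 ?lerD2r//; exact: le_trans cx xe.
  lra.
have Q0 := poisson_mass_ge0 t (@ltr01 R) A01.
apply: (@le_trans _ _ (2 * poisson_mass A 1 t)); last first.
  by rewrite -!mulrA ler_wpM2l// h1.
by rewrite expr1n invr1 ler_wpM2r// -[leRHS]mul1r ler_wpM2r.
Qed.

Lemma integrable_mass_mul y : 0 < y -> y <= 1 ->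
  mu.-integrable setT (EFin \o (fun t => f t * poisson_mass A y t)).
Proof.
move=> y0 y1; have [C C0 hC] := poisson_mass_dom.
have i1 := sqintegrable_mul hf (sqintegrableZ C (sqint_pk c (oner_neq0 R))).
apply: (le_integrable measurableT _ _ i1).
  have := @measurable_fubini_G _ _ _ _ _ mu mu _ (iG y0).
  move=> h0; have /measurable_EFinP h :
      measurable_fun setT (EFin \o (fun t => pi * (f t * poisson_mass A y t))).
    by refine (eq_measurable_fun (fubini_G mu (G y)) _ h0) => t _; rewrite /fubini_G GG.
  apply/measurable_EFinP.
  rewrite (_ : (fun t => _) = (fun t => pi^-1 * (pi * (f t * poisson_mass A y t)))).
    exact: measurable_funM.
  by apply/funext => t; rewrite mulKf// gt_eqF// pi_gt0.
move=> t _; change (`|f t * poisson_mass A y t|%:E <= `|f t * (C * pk 1 (t - c))|%:E)%E.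
rewrite lee_fin normrM [leRHS]normrM ler_wpM2l// ger0_norm ?poisson_mass_ge0//.
by apply: le_trans (hC _ _ y0 y1) _; exact: ler_norm.
Qed.

Lemma poisson_interval y : 0 < y -> y <= 1 ->
  \int[mu]_x (A x * poisson y f x) = \int[mu]_t (f t * poisson_mass A y t).
Proof.
move=> y0 y1; have E g : mu.-integrable setT (EFin \o g) ->
    (\int[mu]_x (pi * g x)%:E = (pi * \int[mu]_x g x)%:E)%E.
  move=> ig; under eq_integral do rewrite EFinM.
  rewrite integralZl// [RHS]EFinM /Rintegral fineK//; exact: integrable_fin_num.
have := Fubini (iG y0).
under eq_integral do rewrite FG//; under [RHS]eq_integral do rewrite GG//.
rewrite !E; [|exact: integrable_mass_mul|exact: integrable_poisson_interval].
have p0 : (pi : R) != 0 by rewrite gt_eqF// pi_gt0.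
move=> h; apply: (mulfI p0); exact: EFin_inj h.
Qed.

(** Pass to the limit along heights 1 / (m + 1) on both sides of the Fubini identity, skipping the
    heights that are not below [r]. *)
Lemma poisson_interval_limit (d : R -> R) (M r : R) : 0 < r -> measurable_fun setT d ->
  (forall x y, c <= x <= e -> 0 < y -> y < r -> `|poisson y f x| <= M) ->
  (forall x, c <= x <= e -> poisson (harmonic m) f x @[m --> \oo] --> d x) ->
  \int[mu]_x (A x * d x) = \int[mu]_x (f x * A x).
Proof.
move=> r0 md pM pd; have M0 : 0 <= `|M| := normr_ge0 _.
have [C C0 hC] := poisson_mass_dom.
have [N _ hN] : \forall m \near \oo, harmonic m < r :> R.
  have := @cvg_harmonic R => /cvgrPdist_lt /(_ r r0); apply: filterS => m.
  by rewrite sub0r normrN; apply: le_lt_trans; exact: ler_norm.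
pose y m : R := harmonic (m + N)%N.
have y0 m : 0 < y m by exact: harmonic_gt0.
have y1 m : y m <= 1 by rewrite /y /harmonic /= invf_le1 ?ltr0n// ler1n.
have yr m : y m < r by apply: hN; rewrite /= leq_addl.
have AJ x : A x != 0 -> c <= x <= e.
  rewrite /A indicE; case: (boolP (x \in J)) => [|_]; last by rewrite eqxx.
  by rewrite mem_setE in_itv.
have iA : mu.-integrable setT (EFin \o A).
  apply/integrableP; split; first exact/measurable_EFinP.
  under eq_integral do rewrite /= ger0_norm ?(andP (A01 _)).1//.
  by rewrite integral_indic// setIT [X in (X < _)%E]lebesgue_measure_itv; case: ifP => _; rewrite ?ltry// -EFinB ltry.
have lim1 : \int[mu]_x (A x * poisson (y m) f x) @[m --> \oo] --> \int[mu]_x (A x * d x).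
  apply: (@Rintegral_dominated _ _ _ mu (fun m x => A x * poisson (y m) f x) _
    (fun x => `|M| * A x)).
  - by move=> m; have /integrableP[/measurable_EFinP] := integrable_poisson_interval (y0 m).
  - exact: measurable_funM.
  - apply: ae_all => x; have [->|/AJ Jx] := eqVneq (A x) 0.
      by under eq_fun do rewrite mul0r; rewrite mul0r; exact: cvg_cst.
    by apply: cvgMr; have := pd x Jx; rewrite -(cvg_shiftn N).
  - rewrite (_ : _ \o _ = (fun x => `|M|%:E * (A x)%:E)%E)//; exact: integrableZl.
  apply: ae_all => x m; have /andP[a0 _] := A01 x; rewrite normrM (ger0_norm a0) mulrC.
  have [->|/AJ Jx] := eqVneq (A x) 0; first by rewrite !mulr0.
  by rewrite ler_wpM2r// (le_trans (pM _ _ Jx (y0 m) (yr m)))// ler_norm.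
have lim2 : \int[mu]_t (f t * poisson_mass A (y m) t) @[m --> \oo] --> \int[mu]_t (f t * A t).
  apply: (@Rintegral_dominated _ _ _ mu (fun m t => f t * poisson_mass A (y m) t) _
    (fun t => `|f t| * (C * pk 1 (t - c)))).
  - by move=> m; have /integrableP[/measurable_EFinP] := integrable_mass_mul (y0 m) (y1 m).
  - exact: measurable_funM.
  - have h z : {ae mu, forall t : R, t != z}.
      exists [set z]; split => //; first exact: lebesgue_measure_set1.
      by move=> t /= /negP; rewrite negbK => /eqP.
    apply: ae_imp2 (h c) (h e) => t tc te; apply: cvgMr.
    by have := poisson_mass_cvg tc te; rewrite -(cvg_shiftn N).
  - have i1 := sqintegrable_mul hf (sqintegrableZ C (sqint_pk c (oner_neq0 R))).
    have := integrable_norm i1; congr (integrable _ _ _); apply/funext => t /=.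
    by rewrite normrM [`|C * _|]ger0_norm// mulr_ge0// pk_ge0.
  apply: ae_all => t m; rewrite normrM ler_wpM2l// ger0_norm ?poisson_mass_ge0//.
  exact: hC.
have E m : \int[mu]_x (A x * poisson (y m) f x) = \int[mu]_t (f t * poisson_mass A (y m) t).
  exact: poisson_interval.
move: lim1; under eq_fun do rewrite E; move=> lim1.
exact: (cvg_unique _ lim1 lim2).
Qed.

End interval.

(** The integrals of [f] and of its boundary limit agree over all short intervals near a given
    point, so their primitives have the same derivative at each Lebesgue point of [f]. *)
Lemma poisson_identification f (d : R -> R) : sqintegrable mu f ->
  (forall x0 e, 0 < e -> exists2 r, 0 < r & forall x y, `|x - x0| < r -> 0 < y -> y < r ->
    `|poisson y f x - d x0| <= e) ->
  {ae mu, forall x, f x = d x}.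
Proof.
move=> hf fd; have mf := hf.1.
have pd x : poisson (harmonic m) f x @[m --> \oo] --> d x.
  apply/cvgrPdist_le => e e0; have [r r0 hr] := fd x e e0.
  have := @cvg_harmonic R => /cvgrPdist_lt /(_ r r0); apply: filterS => m.
  have h0 : 0 < harmonic m :> R by exact: harmonic_gt0.
  rewrite sub0r normrN => h; rewrite distrC; apply: hr; rewrite ?subrr ?normr0//.
  by apply: le_lt_trans h; exact: ler_norm.
(* Convergence in a full half neighbourhood, not only along verticals, forces continuity: at a
   nearby point the same Poisson value is close to both limits. *)
have cd : continuous d.
  move=> x0; apply/cvgrPdist_le => e e0; have e20 : 0 < e / 2 by rewrite divr_gt0.
  have [r r0 hr] := fd x0 _ e20; near=> x.
  have xr : `|x - x0| < r.
    by rewrite distrC; near: x; apply/nbhs_ballP; exists r.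
  have [r' r'0 hr'] := fd x _ e20.
  pose y := Num.min r r' / 2; have m0 : 0 < Num.min r r' by rewrite lt_min r0.
  have y0 : 0 < y by rewrite divr_gt0.
  have : y < Num.min r r' by rewrite /y; lra.
  rewrite lt_min => /andP[yr yr'].
  have h1 := hr _ _ xr y0 yr; have := hr' x y; rewrite subrr normr0 => /(_ r'0 y0 yr') h2.
  have : `|d x0 - d x| <= `|poisson y f x - d x0| + `|poisson y f x - d x|.
    by rewrite (distrC _ (d x0)); apply: le_trans (ler_normD _ _); rewrite addrA subrK.
  lra.
have md : measurable_fun setT d by exact: continuous_measurable_fun.
have ilf (a b : R) : mu.-integrable `[a, b] (EFin \o f).
  have h1 : sqintegrable mu (\1_(`[a, b]%classic) : R -> R).
    split; first exact: measurable_indic.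
    rewrite /sqint (_ : (fun x => _) = (fun x => (\1_(`[a, b]%classic) x)%:E)); last first.
      by apply/funext => x; rewrite indicE; case: (x \in _); rewrite ?expr1n ?expr0n.
    by rewrite integral_indic// setIT [X in (X < _)%E]lebesgue_measure_itv; case: ifP => _; rewrite ?ltry// -EFinB ltry.
  have : mu.-integrable `[a, b] (EFin \o (fun x => f x * \1_(`[a, b]%classic) x)).
    by apply: (integrableS _ _ _ (sqintegrable_mul hf h1)) => //; exact: measurable_itv.
  apply: eq_integrable => // x; rewrite mem_setE => xab /=.
  by rewrite indicE mem_setE xab mulr1.
have lf : locally_integrable setT f.
  split => //; first exact: openT.
  move=> K _ cK; have [M [_ hM]] := compact_bounded cK.
  have KJ : K `<=` `[- (M + 1), M + 1]%classic.
    by move=> x Kx /=; rewrite in_itv /= -ler_norml; apply: hM => //; rewrite ltrDl.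
  have : mu.-integrable K (EFin \o f).
    apply: (integrableS _ _ _ (ilf (- (M + 1)) (M + 1))); first exact: measurable_itv.
      exact: compact_measurable.
    exact: KJ.
  by move=> /integrableP[_] /=.
apply: ae_imp (lebesgue_differentiation lf) => x0 Lx.
have [r r0 hr] := fd x0 1 ltr01.
pose a := x0 - r / 2; pose b := x0 + r / 2.
have ax : a < x0 by rewrite /a; lra.
have xb : x0 < b by rewrite /b; lra.
(* The interval lies within [r] of [x0], where the Poisson integrals are bounded by [|d x0| + 1], as
   dominated convergence requires. *)
have E x : x <= b -> \int[mu]_(t in `[a, x]) f t = \int[mu]_(t in `[a, x]) d t.
  move=> xb'; have near_x0 z : a <= z <= x -> `|z - x0| < r.
    by rewrite /a ltr_norml => /andP[h1 h2]; move: xb'; rewrite /b; lra.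
  have := @poisson_interval_limit f hf a x d (`|d x0| + 1) r r0 md.
  have rI (g : R -> R) : \int[mu]_(t in `[a, x]) g t = \int[mu]_t (\1_(`[a, x]%classic) t * g t).
    rewrite Rintegral_mkcond; apply: eq_Rintegral => t _; rewrite patchE indicE.
    by case: (t \in _); rewrite ?mul1r ?mul0r.
  rewrite !rI => -> //.
  - by apply: eq_Rintegral => t _; rewrite mulrC.
  - move=> z y /near_x0 zr y0 yr; have := hr z y zr y0 yr.
    have := ler_normD (poisson y f z - d x0) (d x0); rewrite subrK; lra.
have [df1 df2] := FTC1_lebesgue_pt xb (ilf a b) ax Lx.
have id : mu.-integrable `[a, b] (EFin \o d).
  apply: continuous_compact_integrable; first exact: segment_compact.
  exact: continuous_subspaceT.
have [dd1 dd2] := continuous_FTC1 xb id ax (cd x0).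
rewrite -df2 -dd2 !derive1E; apply: near_eq_derive.
near=> x; apply: E; apply: ltW; near: x; exact: lt_nbhsl.
Unshelve. all: by end_near.
Qed.

End poisson_identification.

(** * Families in L2 depending on two parameters *)

Lemma cvg_sumr (R : realType) (I : Type) (r : seq I) (u : I -> nat -> R) (w : I -> R) :
  (forall i, u i @ \oo --> w i) -> \sum_(i <- r) u i m @[m --> \oo] --> \sum_(i <- r) w i.
Proof.
move=> h; elim: r => [|i r ih].
  by under eq_fun do rewrite big_nil; rewrite big_nil; exact: cvg_cst.
under eq_fun do rewrite big_cons; rewrite big_cons; apply: cvgD => //; exact: h.
Qed.

Section one_parameter.
Context (R : realType) (n : nat).
Local Notation MM := 'M[R[i]]_n.
Local Notation mu := (@lebesgue_measure R).

Definition mx_is_derive (f : R -> MM) (x : R) (d : MM) := forall a b,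
  is_derive x (1 : R) (mxRe f a b) (complex.Re (d a b)) /\
  is_derive x (1 : R) (mxIm f a b) (complex.Im (d a b)).

(** Testing against fixed elements of L2 is enough for Cauchy integrals, which are pairings with
    [kk], and this notion passes to solutions by duality. *)
Definition weak_derive (f f' : R -> R -> MM) := forall phi, mL2 phi ->
  forall s, is_derive s (1 : R) (fun s => ip (f s) phi) (ip (f' s) phi).

Lemma mx_increment_bounded (a a' : R -> R -> MM) K :
  (forall s, mx_measurable (a s)) -> (forall s l, mx_is_derive (a ^~ l) s (a' s l)) ->
  (forall s, multiplier K (a' s)) ->
  forall s t, multiplier (n%:R * (2 * K) * `|t - s|) (fun l => a t l - a s l).
Proof.
move=> ma da a'K s t; have K0 : 0 <= K := multiplier_ge0 (a'K 0).
split; first exact: mx_measurableB.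
have K1 : 0 <= 2 * K * `|t - s| by rewrite !mulr_ge0.
have hR i j : {ae mu, forall l, `|complex.Re (a t l i j) - complex.Re (a s l i j)| <= K * `|t - s|}.
  apply: (@family_increment_bounded _ (fun s l => complex.Re (a s l i j))
    (fun s l => complex.Re (a' s l i j)) K).
  - by move=> r l; have [] := da r l i j.
  - by move=> r; have [] := ma r i j.
  - by move=> r; apply: ae_imp (a'K r).2 => l; apply: le_trans; exact: Re_entry_le.
have hI i j : {ae mu, forall l, `|complex.Im (a t l i j) - complex.Im (a s l i j)| <= K * `|t - s|}.
  apply: (@family_increment_bounded _ (fun s l => complex.Im (a s l i j))
    (fun s l => complex.Im (a' s l i j)) K).
  - by move=> r l; have [] := da r l i j.
  - by move=> r; have [] := ma r i j.
  - by move=> r; apply: ae_imp (a'K r).2 => l; apply: le_trans; exact: Im_entry_le.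
have h : {ae mu, forall l, forall i j, `|(a t l - a s l) i j| <= (2 * K * `|t - s|)%:C}.
  apply: filter_forall => i; apply: filter_forall => j.
  apply: ae_imp2 (hR i j) (hI i j) => l; rewrite -ReB -ImB !mxE.
  case: (a t l i j - a s l i j) => p q /= hp hq; rewrite lecR.
  rewrite -[leRHS]ger0_norm// -sqrtr_sqr ler_wsqrtr//.
  rewrite -(real_normK (num_real p)) -(real_normK (num_real q)).
  have := normr_ge0 p; have := normr_ge0 q; nra.
by apply: ae_imp h => l hl; rewrite -mulrA; exact: mxfrob_le_entries.
Qed.

(** The reduction to sequences gives access to dominated convergence. *)
Lemma is_derive_seqP (f : R -> R) x d :
  (forall u : nat -> R, (forall m, u m != 0) -> u @ \oo --> 0 ->
    (fun m => (f (x + u m) - f x) / u m) @ \oo --> d) -> is_derive x (1 : R) f d.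
Proof.
move=> h; have c : h0^-1 *: (f (h0 *: (1 : R) + x) - f x) @[h0 --> 0^'] --> d.
  apply/cvgr_dnbhsP => u [u0 uc]; have := h u u0 uc.
  rewrite (_ : (fun m => (f (x + u m) - f x) / u m) =
    fun m => (u m)^-1 *: (f (u m *: (1 : R) + x) - f x))//.
  by apply/funext => m; rewrite /GRing.scale /= mulr1 mulrC [x + _]addrC.
apply: DeriveDef; first by apply/cvg_ex; exists d.
exact: cvg_lim.
Qed.

Lemma cvgD0 (u w : nat -> R) (l : R) : u @ \oo --> l -> w @ \oo --> 0 ->
  (fun m => u m + w m) @ \oo --> l.
Proof. by move=> ul w0; rewrite -[X in _ --> X]addr0; exact: cvgD. Qed.

Lemma continuous_shift_seq (F : R -> R) (s : R) : {for s, continuous F} ->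
  forall u : nat -> R, u @ \oo --> 0 -> F (s + u m) @[m --> \oo] --> F s.
Proof.
move=> cF u uc; apply: (cvg_comp (fun m => s + u m) F _ cF).
by apply: cvgD0 => //; exact: cvg_cst.
Qed.

Lemma is_derive_quotient (f : R -> R) x d (u : nat -> R) : is_derive x (1 : R) f d ->
  (forall m, u m != 0) -> u @ \oo --> 0 -> (fun m => (f (x + u m) - f x) / u m) @ \oo --> d.
Proof.
move=> /is_derive1P h u0 uc; apply/cvgrPdist_le => e e0; have [r r0 hr] := h e e0.
move/cvgrPdist_lt: uc => /(_ r r0); apply: filterS => m; rewrite sub0r normrN => hm.
have := hr (x + u m); rewrite addrAC subrr add0r => /(_ hm) h1; rewrite distrC.
have -> : (f (x + u m) - f x) / u m - d = (f (x + u m) - f x - d * u m) / u m by field.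
by rewrite normrM normfV ler_pdivrMr ?normr_gt0.
Qed.

(** Bounded multipliers that converge pointwise converge strongly as operators: the squared norms
    are dominated by a constant multiple of |psi|^2. *)
Lemma multiplier_seq_cvg (a : nat -> R -> MM) (a0 : R -> MM) K psi : mL2 psi ->
  (forall m, multiplier K (a m)) -> multiplier K a0 ->
  (forall l i j, complex.Re (a m l i j) @[m --> \oo] --> complex.Re (a0 l i j)) ->
  (forall l i j, complex.Im (a m l i j) @[m --> \oo] --> complex.Im (a0 l i j)) ->
  nrm (fun l => psi l *m (a m l - a0 l)) @[m --> \oo] --> 0.
Proof.
move=> hp aK a0K cR cI.
have mB m : mx_measurable (fun l => a m l - a0 l) by apply: mx_measurableB; [exact: (aK m).1|exact: a0K.1].
have fK0 : 0 <= K := multiplier_ge0 a0K.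
have bK m : {ae mu, forall l, mxfrob (a m l - a0 l) <= 2 * K}.
  apply: ae_imp2 (aK m).2 a0K.2 => l h1 h2; apply: le_trans (mxfrobD _ _) _.
  by rewrite mxfrobN; lra.
have BK m : multiplier (2 * K) (fun l => a m l - a0 l) by split.
have hm m : mL2 (fun l => psi l *m (a m l - a0 l)) by exact: mL2_mul hp (BK m).
have c0 l : mxfrob (psi l *m (a m l - a0 l)) @[m --> \oo] --> 0.
  have c1 : mxfrob (a m l - a0 l) @[m --> \oo] --> 0.
    rewrite -[X in _ --> X](@sqrtr0 R); apply: continuous_cvg; first exact: sqrt_continuous.
    rewrite [X in _ --> X](_ : 0 = \sum_(i < n) \sum_(j < n) 0 :> R); last by rewrite big1// => i _; rewrite big1.
    apply: cvg_sumr => i; apply: cvg_sumr => j; rewrite -[X in _ --> X](addr0 0).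
    have h (u : nat -> R) w : u @ \oo --> w -> (u m - w) ^+ 2 @[m --> \oo] --> 0.
      move=> uw; rewrite -(mulr0 0) ; under eq_fun do rewrite expr2.
      by apply: cvgM; rewrite -(subrr w); apply: cvgB => //; exact: cvg_cst.
    by apply: cvgD; under eq_fun do rewrite !mxE ?ReB ?ImB; exact: h.
  apply: (@squeeze_cvgr _ _ _ _ (fun=> 0) (fun m => n%:R ^+ 2 * (mxfrob (psi l) * mxfrob (a m l - a0 l)))).
  - by apply: nearW => m; rewrite mxfrob_ge0 mxfrobM.
  - exact: cvg_cst.
  - rewrite -(mulr0 (n%:R ^+ 2)); apply: cvgMr; rewrite -(mulr0 (mxfrob (psi l))); exact: cvgMr.
rewrite -[X in _ --> X](@sqrtr0 R) /nrm; apply: continuous_cvg; first exact: sqrt_continuous.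
have -> : (fun m => ip (fun l => psi l *m (a m l - a0 l)) (fun l => psi l *m (a m l - a0 l))) =
    fun m => \int[mu]_l (mxfrob (psi l *m (a m l - a0 l)) ^+ 2).
  by apply/funext => m; rewrite ipE; apply: eq_Rintegral => l _; rewrite rdot_frob.
have Z : \int[mu]_l (fun _ : R => 0 : R) l = 0 :> R by rewrite Rintegral_cst// mul0r.
rewrite -[X in _ --> X]Z.
apply: (@Rintegral_dominated _ _ _ mu (fun m l => mxfrob (psi l *m (a m l - a0 l)) ^+ 2) _
    (fun l => (n%:R ^+ 2 * (2 * K)) ^+ 2 * (mxfrob (psi l) * mxfrob (psi l)))).
- by move=> m; apply: measurable_funX; apply: measurable_mxfrob; case: (hm m).
- exact: measurable_cst.
- apply: ae_all => l; rewrite -(mulr0 0); under eq_fun do rewrite expr2.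
  by apply: cvgM; exact: c0.
- rewrite (_ : _ \o _ = (fun l => ((n%:R ^+ 2 * (2 * K)) ^+ 2)%:E * (mxfrob (psi l) * mxfrob (psi l))%:E)%E)//.
  by apply: integrableZl => //; apply: sqintegrable_mul; exact: mL2_frob.
have : {ae mu, forall l, forall m, mxfrob (a m l - a0 l) <= 2 * K} by exact: ae_foralln.
apply: ae_imp => l hl m; rewrite ger0_norm ?exprn_ge0 ?mxfrob_ge0// -expr2 -exprMn.
rewrite ler_pXn2r ?nnegrE ?mxfrob_ge0 ?mulr_ge0 ?exprn_ge0 ?mxfrob_ge0//.
apply: le_trans (mxfrobM _ _) _; rewrite -[leRHS]mulrA; apply: ler_wpM2l; first exact: exprn_ge0.
by rewrite mulrC ler_wpM2r ?mxfrob_ge0.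
Qed.

(** The multiplier quotient is moved to the fixed factor [psi], where it converges strongly; against
    it a bounded, weakly convergent [f] suffices. *)
Lemma cvg_product_quotient (f a a' : R -> R -> MM) psi s M K (u : nat -> R) :
  mL2 psi -> (forall t, mL2 (f t)) -> (forall t, nrm (f t) <= M) ->
  (forall phi, mL2 phi -> ip (f (s + u m)) phi @[m --> \oo] --> ip (f s) phi) ->
  (forall t, mx_measurable (a t)) -> (forall t l, mx_is_derive (a ^~ l) t (a' t l)) ->
  (forall t, multiplier K (a' t)) ->
  (forall m, u m != 0) -> u @ \oo --> 0 ->
  ip (fun l => f (s + u m) l *m (a (s + u m) l - a s l)) psi / u m @[m --> \oo] -->
  ip (fun l => f s l *m a' s l) psi.
Proof.
move=> hpsi hf fM fc ma da a'K u0 uc; have K0 : 0 <= K := multiplier_ge0 (a'K 0).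
pose b m l := (u m)^-1%:C *: (a (s + u m) l - a s l).
(* One constant that bounds both the quotients, through the increment estimate, and the derivative
   itself. *)
pose L := n%:R * (2 * K) + K.
have bL m : multiplier L (b m).
  split; first by apply: mx_measurableZ; exact: mx_measurableB.
  apply: ae_imp (mx_increment_bounded ma da a'K s (s + u m)).2 => l.
  rewrite [s + _]addrC addrK /b mxfrobZ normfV => h; rewrite ler_pdivrMl ?normr_gt0//.
  by rewrite [s + _]addrC; apply: le_trans h _; rewrite mulrC ler_wpM2l// lerDl.
have a'L : multiplier L (a' s) by apply: multiplierW (a'K s); rewrite lerDr !mulr_ge0.
have E m : ip (fun l => f (s + u m) l *m (a (s + u m) l - a s l)) psi / u m =
    ip (f (s + u m)) (fun l => psi l *m adjmx (b m l)).
  rewrite -(ip_mull (hf _) hpsi (bL m)) mulrC -ipZl//; last first.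
    by apply: mL2_mul; [exact: hf|exact: mx_increment_bounded ma da a'K s (s + u m)].
  by congr ip; apply/funext => l; rewrite /b -scalemxAr.
under eq_fun do rewrite E.
rewrite (ip_mull (hf s) hpsi a'L).
have hq : mL2 (fun l => psi l *m adjmx (a' s l)) by exact: mL2_mul hpsi (multiplier_adj a'L).
have hb m : mL2 (fun l => psi l *m adjmx (b m l)) by exact: mL2_mul hpsi (multiplier_adj (bL m)).
have S : nrm (fun l => psi l *m (adjmx (b m l) - adjmx (a' s l))) @[m --> \oo] --> 0.
  apply: (multiplier_seq_cvg hpsi (fun m => multiplier_adj (bL m)) (multiplier_adj a'L)) => l i j.
    rewrite adjmxE; have [/is_derive_quotient d _] := da s l j i; have := d u u0 uc.
    rewrite (_ : (fun m => complex.Re (adjmx (b m l) i j)) =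
      fun m => (mxRe (a ^~ l) j i (s + u m) - mxRe (a ^~ l) j i s) / u m).
      by rewrite /conjc; case: (a' s l j i).
    apply/funext => m; rewrite adjmxE /b /mxRe !mxE.
    by case: (a _ _ _ _) => p q; case: (a _ _ _ _) => p' q' /=; rewrite mul0r subr0 mulrC.
  rewrite adjmxE; have [_ /is_derive_quotient d] := da s l j i; have := d u u0 uc.
  move=> /cvgN; rewrite (_ : (fun m => complex.Im (adjmx (b m l) i j)) =
      (- (fun m => (mxIm (a ^~ l) j i (s + u m) - mxIm (a ^~ l) j i s) / u m))).
    by rewrite /conjc; case: (a' s l j i).
  apply/funext => m; rewrite adjmxE /b /mxIm [RHS]/= !mxE.
  change ((- (fun m0 : nat => (complex.Im (a (s + u m0) l j i) - complex.Im (a s l j i)) / u m0)) m)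
    with (- ((complex.Im (a (s + u m) l j i) - complex.Im (a s l j i)) / u m)).
  by case: (a _ _ _ _) => p q; case: (a _ _ _ _) => p' q' /=; rewrite mul0r addr0 mulrC.
have hd m : mL2 (fun l => psi l *m (adjmx (b m l) - adjmx (a' s l))).
  rewrite (_ : (fun l => _) = fun l => psi l *m adjmx (b m l) - psi l *m adjmx (a' s l)).
    exact: mL2B (hb m) hq.
  by apply/funext => l; rewrite mulmxBr.
have -> : (fun m => ip (f (s + u m)) (fun l => psi l *m adjmx (b m l))) =
    (fun m => ip (f (s + u m)) (fun l => psi l *m adjmx (a' s l))) \+
    (fun m => ip (f (s + u m)) (fun l => psi l *m (adjmx (b m l) - adjmx (a' s l)))).
  apply/funext => m /=; rewrite -(ipDr hq (hd m) (hf (s + u m))).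
  by congr ip; apply/funext => l; rewrite mulmxBr addrC subrK.
apply: cvgD0; first exact: fc.
apply: norm_cvg0; apply: (@squeeze_cvgr _ _ _ _ (fun=> 0)
  (fun m => M * nrm (fun l => psi l *m (adjmx (b m l) - adjmx (a' s l))))).
- apply: nearW => m; rewrite normr_ge0 /=.
  by apply: le_trans (ip_CS (hf _) (hd m)) _; rewrite ler_wpM2r ?nrm_ge0.
- exact: cvg_cst.
- by rewrite -(mulr0 M); apply: cvgMr.
Qed.

Lemma weak_derive_mul (f f' a a' : R -> R -> MM) M K :
  (forall t, mL2 (f t)) -> (forall t, mL2 (f' t)) -> (forall t, nrm (f t) <= M) -> weak_derive f f' ->
  (forall t, multiplier K (a t)) -> (forall t l, mx_is_derive (a ^~ l) t (a' t l)) ->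
  (forall t, multiplier K (a' t)) ->
  weak_derive (fun s l => f s l *m a s l) (fun s l => f' s l *m a s l + f s l *m a' s l).
Proof.
move=> hf hf' fM df aK da a'K phi hphi s; apply: is_derive_seqP => u u0 uc.
have fa t r : mL2 (fun l => f t l *m a r l) by exact: mL2_mul (hf t) (aK r).
have hq : mL2 (fun l => phi l *m adjmx (a s l)) by exact: mL2_mul hphi (multiplier_adj (aK s)).
rewrite (ipDl (mL2_mul (hf' s) (aK s)) (mL2_mul (hf s) (a'K s)) hphi).
rewrite (ip_mull (hf' s) hphi (aK s)).
have -> : (fun m => (ip (fun l => f (s + u m) l *m a (s + u m) l) phi - ip (fun l => f s l *m a s l) phi) / u m) =
  (fun m => (ip (f (s + u m)) (fun l => phi l *m adjmx (a s l)) - ip (f s) (fun l => phi l *m adjmx (a s l))) / u m) \+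
  (fun m => ip (fun l => f (s + u m) l *m (a (s + u m) l - a s l)) phi / u m).
  apply/funext => m /=; rewrite -mulrDl -!(ip_mull (hf _) hphi (aK s)).
  have -> : (fun l => f (s + u m) l *m (a (s + u m) l - a s l)) =
      fun l => f (s + u m) l *m a (s + u m) l - f (s + u m) l *m a s l.
    by apply/funext => l; rewrite mulmxBr.
  by rewrite (ipBl (fa _ _) (fa _ _) hphi); congr (_ / _); ring.
apply: cvgD; first exact: (is_derive_quotient (df _ hq s)).
apply: (cvg_product_quotient (M := M) (K := K)) => //.
  move=> psi hpsi; have := is_derive_continuous (df psi hpsi s).
  by move/continuous_shift_seq; apply.
by move=> t; case: (aK t).
Qed.

(** Each test function is replaced by the solution [nu] of the problem at the fixed parameter [s]
    with that function as source. By symmetry of the form, increments of [m] become increments of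
    the data [g] and [v] paired with [nu]. *)
Lemma weak_derive_solves (v v' g g' m m' : R -> R -> MM) M K c :
  (forall s, weight K c (v s)) -> (forall s l, mx_is_derive (v ^~ l) s (v' s l)) ->
  (forall s, multiplier K (v' s)) ->
  (forall s, mL2 (g s)) -> (forall s, mL2 (g' s)) -> (forall s, nrm (g s) <= M) -> weak_derive g g' ->
  (forall s, solves (v s) (g s) (m s)) ->
  (forall s, solves (v s) (fun l => g' s l + m s l *m v' s l) (m' s)) ->
  weak_derive m m'.
Proof.
move=> wv dv v'K hg hg' gM dg sm sm' phi hphi s.
have vK t : multiplier K (v t) by case: (wv t).
have c0 : 0 < c by case: (wv 0).
have hm t : mL2 (m t) by case: (sm t) => -[].
have hm' t : mL2 (m' t) by case: (sm' t) => -[].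
have mM t : nrm (m t) <= M / c.
  by apply: le_trans (solves_nrm (wv t) (hg t) (sm t)) _; rewrite ler_pM2r ?invr_gt0.
have mv r t : mL2 (fun l => m r l *m v t l) by exact: mL2_mul (hm r) (vK t).
have dual t psi nu p : mL2 psi -> solves (v t) psi nu -> Hm p ->
    ip p psi = - ip (fun l => p l *m v t l) nu.
  move=> hpsi [[hnu _] sn] hp; have := sn p hp; have [hp2 _] := hp.
  rewrite (ipDl (mL2_mul hnu (vK t)) hpsi hp2).
  by rewrite (weight_sym (wv t) hnu hp2) ipC (ipC psi) => /eqP; rewrite addrC addr_eq0 => /eqP.
have incr psi nu r : mL2 psi -> solves (v s) psi nu ->
    ip (m r) psi - ip (m s) psi = (ip (g r) nu - ip (g s) nu) +
      ip (fun l => m r l *m (v r l - v s l)) nu.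
  move=> hpsi sn; have [hnu Hnu] := sn.1.
  rewrite (dual s _ _ _ hpsi sn (sm r).1) (dual s _ _ _ hpsi sn (sm s).1).
  have e t : ip (fun l => m t l *m v t l) nu = - ip (g t) nu.
    have := (sm t).2 nu sn.1; by rewrite (ipDl (mv t t) (hg t) hnu) => /eqP; rewrite addr_eq0 => /eqP.
  have -> : (fun l => m r l *m (v r l - v s l)) = fun l => m r l *m v r l - m r l *m v s l.
    by apply/funext => l; rewrite mulmxBr.
  by rewrite (ipBl (mv r r) (mv r s) hnu) !e; ring.
pose L := n%:R * (2 * K).
have K0 : 0 <= K := multiplier_ge0 (v'K 0).
have Lr r : multiplier (L * `|r - s|) (fun l => v r l - v s l).
  exact: (mx_increment_bounded (fun t => (vK t).1) dv v'K s r).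
(* Weak continuity comes first: the quotient of the product of [m] and the increment of [v] contains
   [m] at the moving parameter. *)
have mc psi (u : nat -> R) : mL2 psi -> u @ \oo --> 0 -> ip (m (s + u k)) psi @[k --> \oo] --> ip (m s) psi.
  move=> hpsi uc; have [nu sn] := solves_exists (wv s) hpsi; have [hnu _] := sn.1.
  have -> : (fun k => ip (m (s + u k)) psi) = (fun k => ip (m s) psi +
      (ip (g (s + u k)) nu - ip (g s) nu + ip (fun l => m (s + u k) l *m (v (s + u k) l - v s l)) nu)).
    by apply/funext => k; rewrite -(incr _ _ _ hpsi sn) [RHS]addrC subrK.
  apply: cvgD0; first exact: cvg_cst.
  apply: cvgD0.
    rewrite -[X in _ --> X](subrr (ip (g s) nu)); apply: cvgB; last exact: cvg_cst.
    by have := is_derive_continuous (dg nu hnu s); move/continuous_shift_seq; apply.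
  apply: norm_cvg0; apply: (@squeeze_cvgr _ _ _ _ (fun=> 0)
    (fun k => n%:R ^+ 2 * L * (M / c) * nrm nu * `|u k|)).
  - apply: nearW => k; rewrite normr_ge0 /=.
    have := Lr (s + u k); rewrite [s + _]addrC addrK => h.
    apply: le_trans (ip_CS (mL2_mul (hm _) h) hnu) _.
    rewrite -2!mulrA [nrm nu * _]mulrC 2!mulrA ler_wpM2r ?nrm_ge0//.
    apply: le_trans (nrm_mul (hm _) h) _.
    rewrite [leRHS](_ : _ = n%:R ^+ 2 * (L * `|u k|) * (M / c)); last by ring.
    by rewrite ler_wpM2l// !mulr_ge0// exprn_ge0.
  - exact: cvg_cst.
  - rewrite -(mulr0 (n%:R ^+ 2 * L * (M / c) * nrm nu)); apply: cvgMr.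
    by rewrite -(@normr0 _ R); exact: cvg_norm.
have [nu sn] := solves_exists (wv s) hphi; have [hnu _] := sn.1.
apply: is_derive_seqP => u u0 uc; under eq_fun do rewrite (incr _ _ _ hphi sn) mulrDl.
have hmv : mL2 (fun l => m s l *m v' s l) by exact: mL2_mul (hm s) (v'K s).
have -> : ip (m' s) phi = ip (g' s) nu + ip (fun l => m s l *m v' s l) nu.
  rewrite (dual s _ _ _ hphi sn (sm' s).1) -ipDl//.
  have := (sm' s).2 nu sn.1; rewrite (ipDl (mL2_mul (hm' s) (vK s)) (mL2D (hg' s) hmv) hnu).
  by move=> /eqP; rewrite addr_eq0 => /eqP ->; rewrite opprK.
apply: cvgD; first exact: (is_derive_quotient (dg _ hnu s)).
apply: (cvg_product_quotient (M := M / c) (K := K)) => //; first by move=> psi hpsi; exact: mc.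
by move=> t; case: (vK t).
Qed.

End one_parameter.

(** * Families with uniform bounds, decay and iterated derivatives *)

Section two_parameters.
Context (R : realType) (n : nat).
Local Notation MM := 'M[R[i]]_n.
Local Notation mu := (@lebesgue_measure R).
Implicit Types f g a : R -> R -> R -> MM.

Definition vanishing (F : R -> R -> R) := forall e, 0 < e -> exists r, forall x y,
  r <= `|x| \/ r <= `|y| -> F x y <= e.

(** The index counts the available weak derivatives, each with a uniform bound and decay in L2. The
    recursive form lets sums, products and solutions be treated by induction on it. *)
Fixpoint L2family (m : nat) f : Prop :=
  [/\ forall x y, mL2 (f x y), exists M, forall x y, nrm (f x y) <= M,
     vanishing (fun x y => nrm (f x y)) &
     if m is m'.+1 then exists fx fy, [/\ L2family m' fx, L2family m' fy,
       forall y, weak_derive (f ^~ y) (fx ^~ y) & forall x, weak_derive (f x) (fy x)]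
     else True].

(** The companion class for coefficients: classical derivatives at each [l], with uniform L-infinity
    bounds. *)
Fixpoint multiplier_family (m : nat) a : Prop :=
  (exists K, forall x y, multiplier K (a x y)) /\
  if m is m'.+1 then exists ax ay, [/\ multiplier_family m' ax, multiplier_family m' ay,
    forall y s l, mx_is_derive (fun s => a s y l) s (ax s y l) &
    forall x s l, mx_is_derive (fun s => a x s l) s (ay x s l)]
  else True.

Lemma L2familyP m f : L2family m f -> [/\ forall x y, mL2 (f x y),
  exists M, forall x y, nrm (f x y) <= M & vanishing (fun x y => nrm (f x y))].
Proof. by case: m => [|m] []. Qed.

Lemma multiplier_familyP m a : multiplier_family m a -> exists K, forall x y, multiplier K (a x y).
Proof. by case: m => [|m] []. Qed.

Lemma L2familyS m f : L2family m.+1 f -> L2family m f.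
Proof.
elim: m f => [|m ih] f; first by case.
case=> h1 h2 h3 [fx [fy [hx hy dx dy]]]; split => //.
by exists fx, fy; split => //; exact: ih.
Qed.

Lemma multiplier_familyS m a : multiplier_family m.+1 a -> multiplier_family m a.
Proof.
elim: m a => [|m ih] a; first by case.
case=> h1 [ax [ay [hx hy dx dy]]]; split => //.
by exists ax, ay; split => //; exact: ih.
Qed.

Lemma vanishing_le (F G : R -> R -> R) : (forall x y, F x y <= G x y) -> vanishing G -> vanishing F.
Proof.
by move=> FG h e e0; have [r hr] := h e e0; exists r => x y xy; exact: le_trans (FG x y) (hr x y xy).
Qed.

Lemma vanishingD (F G : R -> R -> R) : vanishing F -> vanishing G -> vanishing (fun x y => F x y + G x y).
Proof.
move=> hF hG e e0; have e2 : 0 < e / 2 by rewrite divr_gt0.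
have [r1 h1] := hF _ e2; have [r2 h2] := hG _ e2; exists (Num.max r1 r2) => x y.
rewrite !ge_max => -[] /andP[a b]; rewrite [e]splitr; apply: lerD.
- by apply: h1; left.
- by apply: h2; left.
- by apply: h1; right.
- by apply: h2; right.
Qed.

Lemma vanishingZ (c : R) (F : R -> R -> R) : 0 <= c -> vanishing F -> vanishing (fun x y => c * F x y).
Proof.
move=> c0 hF e e0; have c1 : 0 < c + 1 by rewrite ltr_wpDl.
have [r hr] := hF (e / (c + 1)) (divr_gt0 e0 c1); exists r => x y /hr h.
apply: le_trans (ler_wpM2l c0 h) _; rewrite mulrA ler_pdivrMr// mulrC ler_wpM2l// ?lerDl//; exact: ltW.
Qed.

Lemma L2familyD m f g : L2family m f -> L2family m g -> L2family m (fun x y l => f x y l + g x y l).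
Proof.
elim: m f g => [|m ih] f g hf hg; have [f1 [M fM] f3] := L2familyP hf; have [g1 [N gN] g3] := L2familyP hg;
  have h1 x y : mL2 (fun l => f x y l + g x y l) by [exact: mL2D];
  have h2 x y : nrm (fun l => f x y l + g x y l) <= M + N by
    [apply: le_trans (nrmD (f1 _ _) (g1 _ _)) _; exact: lerD];
  have h3 : vanishing (fun x y => nrm (fun l => f x y l + g x y l)) by
    [apply: vanishing_le (vanishingD f3 g3) => x y; exact: nrmD].
  by split => //; exists (M + N).
case: hf => _ _ _ [fx [fy [hfx hfy dfx dfy]]]; case: hg => _ _ _ [gx [gy [hgx hgy dgx dgy]]].
split => //; first by exists (M + N).
exists (fun x y l => fx x y l + gx x y l), (fun x y l => fy x y l + gy x y l).
have [fx1 _ _] := L2familyP hfx; have [fy1 _ _] := L2familyP hfy.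
have [gx1 _ _] := L2familyP hgx; have [gy1 _ _] := L2familyP hgy.
split; [exact: ih|exact: ih| |].
- move=> y phi hphi s; rewrite ipDl//.
  rewrite (_ : (fun s => _) = (fun s => ip (f s y) phi) \+ (fun s => ip (g s y) phi)).
    by apply: is_deriveD; [exact: dfx|exact: dgx].
  by apply/funext => t /=; rewrite ipDl.
- move=> x phi hphi s; rewrite ipDl//.
  rewrite (_ : (fun s => _) = (fun s => ip (f x s) phi) \+ (fun s => ip (g x s) phi)).
    by apply: is_deriveD; [exact: dfy|exact: dgy].
  by apply/funext => t /=; rewrite ipDl.
Qed.

Lemma L2family_mul m f a : L2family m f -> multiplier_family m a ->
  L2family m (fun x y l => f x y l *m a x y l).
Proof.
elim: m f a => [|m ih] f a hf ha; have [f1 [M fM] f3] := L2familyP hf;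
  have [K aK] := multiplier_familyP ha; have K0 : 0 <= K by [exact: multiplier_ge0 (aK 0 0)];
  have h1 x y : mL2 (fun l => f x y l *m a x y l) by [exact: mL2_mul (f1 _ _) (aK _ _)];
  have c0 : 0 <= n%:R ^+ 2 * K by [rewrite mulr_ge0 ?exprn_ge0];
  have h2 x y : nrm (fun l => f x y l *m a x y l) <= n%:R ^+ 2 * K * M by
    [apply: le_trans (nrm_mul (f1 _ _) (aK _ _)) _; exact: ler_wpM2l];
  have h3 : vanishing (fun x y => nrm (fun l => f x y l *m a x y l)) by
    [apply: vanishing_le (vanishingZ c0 f3) => x y; exact: nrm_mul].
  by split => //; exists (n%:R ^+ 2 * K * M).
have hf' := L2familyS hf; have ha' := multiplier_familyS ha.
case: hf => _ _ _ [fx [fy [hfx hfy dfx dfy]]]; case: ha => _ [ax [ay [hax hay dax day]]].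
split => //; first by exists (n%:R ^+ 2 * K * M).
exists (fun x y l => fx x y l *m a x y l + f x y l *m ax x y l),
  (fun x y l => fy x y l *m a x y l + f x y l *m ay x y l).
have [fx1 _ _] := L2familyP hfx; have [fy1 _ _] := L2familyP hfy.
have [Kx axK] := multiplier_familyP hax; have [Ky ayK] := multiplier_familyP hay.
split; try by [apply: L2familyD; exact: ih].
- move=> y; apply: (weak_derive_mul (M := M) (K := Num.max K Kx)) => // x.
    by apply: multiplierW (aK x y); rewrite le_max lexx.
  by apply: multiplierW (axK x y); rewrite le_max lexx orbT.
- move=> x; apply: (weak_derive_mul (M := M) (K := Num.max K Ky)) => // y.
    by apply: multiplierW (aK x y); rewrite le_max lexx.
  by apply: multiplierW (ayK x y); rewrite le_max lexx orbT.
Qed.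

(** The derivative solves the same problem with source [gx + mm vx]. By induction [mm] already has
    one derivative fewer than claimed, so this source is a family of the index to which the
    induction applies again. *)
Lemma L2family_solves m (v g mm : R -> R -> R -> MM) K c :
  (forall x y, weight K c (v x y)) -> multiplier_family m v -> L2family m g ->
  (forall x y, solves (v x y) (g x y) (mm x y)) -> L2family m mm.
Proof.
move=> wv; have c0 : 0 < c by case: (wv 0 0).
elim: m g mm => [|m ih] g mm hv hg sm; have [g1 [M gM] g3] := L2familyP hg;
  have h1 x y : mL2 (mm x y) by [case: (sm x y) => -[]];
  have h2 x y : nrm (mm x y) <= c^-1 * nrm (g x y) by
    [rewrite mulrC; exact: (solves_nrm (wv x y) (g1 x y) (sm x y))];
  have ci : 0 <= c^-1 by [rewrite invr_ge0 ltW];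
  have h2' x y : nrm (mm x y) <= c^-1 * M by [apply: le_trans (h2 _ _) _; exact: ler_wpM2l];
  have h3 : vanishing (fun x y => nrm (mm x y)) by [exact: vanishing_le h2 (vanishingZ ci g3)].
  by split => //; exists (c^-1 * M).
have hm := ih _ _ (multiplier_familyS hv) (L2familyS hg) sm.
have [Kv vK] := multiplier_familyP hv.
case: hg => _ _ _ [gx [gy [hgx hgy dgx dgy]]]; case: (hv) => _ [vx [vy [hvx hvy dvx dvy]]].
have hwx := L2familyD hgx (L2family_mul hm hvx); have hwy := L2familyD hgy (L2family_mul hm hvy).
have [hwx1 _ _] := L2familyP hwx; have [hwy1 _ _] := L2familyP hwy.
have [gx1 _ _] := L2familyP hgx; have [gy1 _ _] := L2familyP hgy.
have [Kx vxK] := multiplier_familyP hvx; have [Ky vyK] := multiplier_familyP hvy.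
(* The candidate derivative is defined as the solution of the differentiated equation and identified
   afterwards by [weak_derive_solves]. *)
pose mx x y := projT1 (cid (solves_exists (wv x y) (hwx1 x y))).
pose my x y := projT1 (cid (solves_exists (wv x y) (hwy1 x y))).
have smx x y : solves (v x y) (fun l => gx x y l + mm x y l *m vx x y l) (mx x y).
  by rewrite /mx; case: cid.
have smy x y : solves (v x y) (fun l => gy x y l + mm x y l *m vy x y l) (my x y).
  by rewrite /my; case: cid.
split => //; first by exists (c^-1 * M).
exists mx, my; split.
- exact: ih _ _ (multiplier_familyS hv) hwx smx.
- exact: ih _ _ (multiplier_familyS hv) hwy smy.
- move=> y; apply: (weak_derive_solves (M := M) (K := Num.max K Kx) (c := c)
    (v := v ^~ y) (v' := vx ^~ y) (g := g ^~ y) (g' := gx ^~ y)) => // x.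
    case: (wv x y) => a1 a2 a3 a4; split => //; apply: multiplierW a1; by rewrite le_max lexx.
  by apply: multiplierW (vxK x y); rewrite le_max lexx orbT.
- move=> x; apply: (weak_derive_solves (M := M) (K := Num.max K Ky) (c := c)
    (v := v x) (v' := vy x) (g := g x) (g' := gy x)) => // y.
    case: (wv x y) => a1 a2 a3 a4; split => //; apply: multiplierW a1; by rewrite le_max lexx.
  by apply: multiplierW (vyK x y); rewrite le_max lexx orbT.
Qed.

End two_parameters.

(** * Classical derivatives of Cauchy integrals at a fixed nonreal point *)

Section cauchy_family.
Context (R : realType) (n : nat) (z : R[i]) (z0 : complex.Im z != 0).
Local Notation MM := 'M[R[i]]_n.
Local Notation mu := (@lebesgue_measure R).
Implicit Types f g : R -> R -> R -> MM.

Lemma mx_is_deriveP (F : R -> MM) x d : mx_is_derive F x d ->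
  mx_derivable F x /\ mx_derive F x = d.
Proof.
move=> h; split=> [a b|].
  by have [[h1 _] [h2 _]] := h a b; split; [exact: h1|exact: h2].
apply/matrixP => a b; have [[h1 e1] [h2 e2]] := h a b; rewrite mxE.
by apply: complex_ext; rewrite /= derive1E.
Qed.

Lemma weak_derive_Cau (h h' : R -> R -> MM) s : (forall t, mL2 (h t)) -> (forall t, mL2 (h' t)) ->
  weak_derive h h' -> mx_is_derive (fun t => Cau (h t) z) s (Cau (h' s) z).
Proof.
move=> hh hh' dh a b; rewrite /mxRe /mxIm; split.
  rewrite Cau_re//; under eq_fun do rewrite Cau_re//.
  by apply: dh; exact: mL2_kk.
rewrite Cau_im//; under eq_fun do rewrite Cau_im//.
by apply: dh; exact: mL2_kk.
Qed.

Definition plane f := fun x y => Cau (f x y) z.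

(** The derivative is a limit of difference quotients, which are jointly measurable by separate
    continuity. *)
Lemma mx_derive_seq_measurable (F F' : R -> R -> MM) :
  (forall x y, mx_is_derive (F ^~ y) x (F' x y)) -> (forall x a b, continuous (mxRe (F x) a b)) ->
  (forall x a b, continuous (mxIm (F x) a b)) ->
  mx_measurable (fun p : R * R => F' p.1 p.2).
Proof.
move=> dF cR cI.
have key (G G' : R -> R -> R) : (forall x y, is_derive x (1 : R) (G ^~ y) (G' x y)) ->
    (forall x, continuous (G x)) -> measurable_fun setT (fun p : R * R => G' p.1 p.2).
  move=> dG cG; have cG1 y : continuous (G ^~ y) by move=> x; exact: is_derive_continuous (dG x y).
  apply: (measurable_fun_cvg (h := fun m (p : R * R) =>
    (G (p.1 + harmonic m) p.2 - G p.1 p.2) / harmonic m)).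
    move=> m; apply: measurable_funM; last exact: measurable_cst.
    apply: measurable_funB.
      apply: (@caratheodory_measurable _ (fun s l => G (s + harmonic m) l)).
        move=> l s; apply: (@cvg_comp _ _ _ (fun s => s + harmonic m) (G ^~ l) _ (nbhs (s + harmonic m))); last exact: cG1.
        by apply: cvgD; [exact: cvg_id|exact: cvg_cst].
      by move=> s; exact: continuous_measurable_fun.
    apply: (@caratheodory_measurable _ G) => // s; exact: continuous_measurable_fun.
  by move=> [x y] _ /=; exact: (cvg_difference_quotient (dG x y)).
move=> a b; split.
  by apply: (key (fun x y => mxRe (F x) a b y) (fun x y => complex.Re (F' x y a b))) => // x y; have [] := dF x y a b.
by apply: (key (fun x y => mxIm (F x) a b y) (fun x y => complex.Im (F' x y a b))) => // x y; have [] := dF x y a b.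
Qed.

Lemma mx_measurable_swap (F : R -> R -> MM) :
  mx_measurable (fun p : R * R => F p.2 p.1) -> mx_measurable (fun p : R * R => F p.1 p.2).
Proof.
move=> h a b; have [h1 h2] := h a b; split.
  exact: (measurableT_comp h1 (@measurable_swap _ _ R R)).
exact: (measurableT_comp h2 (@measurable_swap _ _ R R)).
Qed.

(** Joint measurability is delivered together with the derivatives: at index 0 it can no longer be
    deduced from further derivatives. *)
Lemma L2family_step m f : L2family m.+1 f -> exists fx fy,
  [/\ L2family m fx, L2family m fy,
     forall x y, mx_is_derive (fun s => plane f s y) x (plane fx x y),
     forall x y, mx_is_derive (plane f x) y (plane fy x y) &
     mx_measurable (fun p : R * R => plane fx p.1 p.2) /\
     mx_measurable (fun p : R * R => plane fy p.1 p.2)].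
Proof.
move=> [f1 _ _ [fx [fy [hfx hfy dx dy]]]].
have [fx1 _ _] := L2familyP hfx; have [fy1 _ _] := L2familyP hfy.
have Dx x y : mx_is_derive (fun s => plane f s y) x (plane fx x y).
  exact: (@weak_derive_Cau (f ^~ y) (fx ^~ y)).
have Dy x y : mx_is_derive (plane f x) y (plane fy x y) by exact: weak_derive_Cau.
exists fx, fy; split=> //; split.
  apply: (mx_derive_seq_measurable Dx) => x a b y; have [h1 h2] := Dy x y a b.
    exact: is_derive_continuous h1.
  exact: is_derive_continuous h2.
apply: mx_measurable_swap; apply: (mx_derive_seq_measurable (F := fun y x => plane f x y) (F' := fun y x => plane fy x y)) => [y x|x a b y|x a b y].
- exact: Dy.
- by have [h1 h2] := Dx y x a b; exact: is_derive_continuous h1.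
- by have [h1 h2] := Dx y x a b; exact: is_derive_continuous h2.
Qed.

Lemma L2family_measurable m f : L2family m.+1 f -> mx_measurable (fun p : R * R => plane f p.1 p.2).
Proof.
move=> hf; have [fx [fy [_ _ Dx Dy _]]] := L2family_step hf.
move=> a b; split.
  apply: (@caratheodory_measurable _ (fun x y => complex.Re (plane f x y a b))).
    by move=> y x; have [h _] := Dx x y a b; exact: is_derive_continuous h.
  move=> x; apply: continuous_measurable_fun => y; have [h _] := Dy x y a b.
  exact: is_derive_continuous h.
apply: (@caratheodory_measurable _ (fun x y => complex.Im (plane f x y a b))).
  by move=> y x; have [_ h] := Dx x y a b; exact: is_derive_continuous h.
move=> x; apply: continuous_measurable_fun => y; have [_ h] := Dy x y a b.
exact: is_derive_continuous h.
Qed.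

Lemma L2family_iter_y j m f : L2family (m + j) f -> mx_measurable (fun p : R * R => plane f p.1 p.2) ->
  exists g, [/\ L2family m g, iter j (@partial_y R n) (plane f) = plane g &
    mx_measurable (fun p : R * R => plane g p.1 p.2)].
Proof.
elim: j m f => [|j ih] m f; first by rewrite addn0; exists f.
rewrite addnS -addSn => hf mf; have [g [hg gE mg]] := ih _ _ hf mf.
have [gx [gy [hgx hgy _ Dy [_ My]]]] := L2family_step hg.
exists gy; split => //=; rewrite gE /partial_y; apply/funext => x; apply/funext => y.
by have [_] := mx_is_deriveP (Dy x y).
Qed.

Lemma L2family_iter_x i m f : L2family (m + i) f -> mx_measurable (fun p : R * R => plane f p.1 p.2) ->
  exists g, [/\ L2family m g, iter i (@partial_x R n) (plane f) = plane g &
    mx_measurable (fun p : R * R => plane g p.1 p.2)].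
Proof.
elim: i m f => [|j ih] m f; first by rewrite addn0; exists f.
rewrite addnS -addSn => hf mf; have [g [hg gE mg]] := ih _ _ hf mf.
have [gx [gy [hgx hgy Dx _ [Mx _]]]] := L2family_step hg.
exists gx; split => //=; rewrite gE /partial_x; apply/funext => x; apply/funext => y.
by have [_] := mx_is_deriveP (Dx x y).
Qed.

Lemma L2family_partial m f i j : L2family m.+1 f -> (i + j <= m.+1)%N ->
  has_partial i j (plane f) /\ exists g, [/\ L2family 0 g, partial i j (plane f) = plane g &
    mx_measurable (fun p : R * R => plane g p.1 p.2)].
Proof.
move=> hf ij; have mf := L2family_measurable hf; split; [split|].
- move=> l lj x y; have hl : (m.+1 = (m.+1 - l.+1).+1 + l)%N by rewrite addSn -addnS subnK// (leq_trans lj)// (leq_trans _ ij)// leq_addl.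
  move: hf; rewrite hl => /L2family_iter_y /(_ mf)[g [hg gE _]].
  have [gx [gy [_ _ _ Dy _]]] := L2family_step hg.
  by rewrite /partial /= gE; have [] := mx_is_deriveP (Dy x y).
- move=> l li x y; have hl : (m.+1 = ((m.+1 - (l.+1 + j)).+1 + l) + j)%N.
    rewrite -addnA addSn -addnS -addSn subnK// (leq_trans _ ij)// leq_add2r//.
  move: hf; rewrite hl => /L2family_iter_y /(_ mf)[g [hg gE mg]].
  have [g' [hg' gE' _]] := L2family_iter_x hg mg.
  have [gx [gy [_ _ Dx _ _]]] := L2family_step hg'.
  by rewrite /partial gE gE'; have [] := mx_is_deriveP (Dx x y).
have hl : (m.+1 = ((m.+1 - (i + j)) + i) + j)%N by rewrite -addnA subnK.
move: hf; rewrite hl => /L2family_iter_y /(_ mf)[g [hg gE mg]].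
have [g' [hg' gE' mg']] := L2family_iter_x hg mg.
exists g'; split => //; last by rewrite /partial gE gE'.
have [h1 h2 h3] := L2familyP hg'; by split.
Qed.

(** Cauchy-Schwarz against the test kernels: L2 bounds and L2 decay of densities become pointwise
    ones for fixed [z], with a constant depending only on [z]. *)
Lemma plane_frob_le f : (forall x y, mL2 (f x y)) -> exists2 C, 0 <= C &
  forall x y, mxfrob (plane f x y) <= C * nrm (f x y).
Proof.
move=> hf; pose C := \sum_(a < n) \sum_(b < n) (nrm (kk z a b (c_re R)) + nrm (kk z a b (c_im R))).
have T0 a b : 0 <= nrm (kk z a b (c_re R)) + nrm (kk z a b (c_im R)) by rewrite addr_ge0 ?nrm_ge0.
have C0 : 0 <= C by apply: sumr_ge0 => a _; apply: sumr_ge0.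
exists (n%:R * (2 * C)); first by rewrite !mulr_ge0.
move=> x y; have N0 := nrm_ge0 (f x y); rewrite -mulrA; apply: mxfrob_le_entries => [|a b].
  by rewrite !mulr_ge0.
have hC : nrm (kk z a b (c_re R)) + nrm (kk z a b (c_im R)) <= C.
  rewrite /C (bigD1 a)//= (bigD1 b)//= -addrA lerDl addr_ge0//; first exact: sumr_ge0.
  by apply: sumr_ge0 => i _; exact: sumr_ge0.
have hR : `|complex.Re (plane f x y a b)| <= C * nrm (f x y).
  rewrite Cau_re//; apply: le_trans (ip_CS (hf x y) (mL2_kk a b (c_re R) z0)) _.
  rewrite mulrC ler_wpM2r//; apply: le_trans hC; rewrite lerDl nrm_ge0//.
have hI : `|complex.Im (plane f x y a b)| <= C * nrm (f x y).
  rewrite Cau_im//; apply: le_trans (ip_CS (hf x y) (mL2_kk a b (c_im R) z0)) _.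
  rewrite mulrC ler_wpM2r//; apply: le_trans hC; rewrite lerDr nrm_ge0//.
move: hR hI; case: (plane f x y a b) => p q /= hp hq; rewrite lecR -mulrA.
have K0 : 0 <= C * nrm (f x y) by rewrite mulr_ge0.
rewrite -[leRHS]ger0_norm ?mulr_ge0// -sqrtr_sqr ler_wsqrtr//.
rewrite -(real_normK (num_real p)) -(real_normK (num_real q)).
have := normr_ge0 p; have := normr_ge0 q; nra.
Qed.

End cauchy_family.

(** * Families built from scattering data *)

Section Lnorm_conversions.
Context (R : realType) (n : nat).
Local Notation MM := 'M[R[i]]_n.
Local Notation mu := (@lebesgue_measure R).
Implicit Types f : R -> MM.

Lemma integral_frob_sq f : (\int[mu]_x `|(EFin \o (@mxfrob R n \o f)) x| `^ 2 = sqint mu (fun t => mxfrob (f t)))%E.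
Proof.
apply: eq_integral => x _.
change ((`|mxfrob (f x)| `^ 2)%:E = (mxfrob (f x) ^+ 2)%:E).
by rewrite ger0_norm ?mxfrob_ge0// powR_mulrn ?mxfrob_ge0.
Qed.

Lemma mxLnorm2_le f M : mx_Lp_le mu 2%:E M f -> mL2 f /\ nrm f <= M.
Proof.
move=> [mf fM]; have N0 : (0 <= mxLnorm mu 2%:E f)%E by exact: Lnorm_ge0.
have M0 : 0 <= M by rewrite -lee_fin; exact: le_trans fM.
have h : (sqint mu (fun t => mxfrob (f t)) <= (M ^+ 2)%:E)%E.
  rewrite -integral_frob_sq -poweR_Lnorm//.
  rewrite -[X in (_ <= X)%E]/((M ^+ 2)%:E) -powR_mulrn// -poweR_EFin.
  by apply: gt0_ler_poweR => //; rewrite in_itv /= ?leey ?andbT ?lee_fin.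
have hf : mL2 f by split => //; apply: le_lt_trans h _; rewrite ltry.
by split => //; exact: nrm_le_sqint.
Qed.

Lemma mxLnorm2_ge f M : mL2 f -> nrm f <= M -> mx_Lp_le mu 2%:E M f.
Proof.
move=> hf fM; split; first by case: hf.
have M0 : 0 <= M by exact: le_trans (nrm_ge0 _) fM.
rewrite /mxLnorm unlock /= integral_frob_sq -nrm_sqint//.
rewrite poweR_EFin lee_fin -powR_mulrn ?nrm_ge0// -powRrM mulfV// powRr1 ?nrm_ge0//.
Qed.

(** The L-infinity norm is an essential supremum only when the total mass is positive, and 0
    otherwise. *)
Lemma lebesgue_gt0 : (0 < mu [set: R])%E.
Proof.
have : (mu `[0%R, 1%R]%classic <= mu [set: R])%E by apply: le_measure; rewrite ?inE//; exact: measurable_itv.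
by apply: lt_le_trans; rewrite [X in (_ < X)%E]lebesgue_measure_itv /= lte_fin ltr01 -EFinB subr0 lte_fin.
Qed.

Lemma mxLnormoo_le f M : mx_Lp_le mu +oo M f -> multiplier M f.
Proof.
move=> [mf]; rewrite /mxLnorm unlock lebesgue_gt0 => /ess_supP h; split => //.
by apply: ae_imp h => x /=; rewrite lee_fin ger0_norm ?mxfrob_ge0.
Qed.

End Lnorm_conversions.

(** * From derivatives at each spectral point to weak derivatives in L2 *)

Section pointwise_families.
Context (R : realType) (n : nat).
Local Notation MM := 'M[R[i]]_n.
Local Notation mu := (@lebesgue_measure R).

(** Minkowski entry by entry; the L2 bound is asked only between [s] and [t], so that it may depend
    on the interval. *)
Lemma mx_increment_nrm_itv (f f' : R -> R -> MM) N K s t : s <= t ->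
  (forall s, mL2 (f s)) -> (forall s l, mx_is_derive (f ^~ l) s (f' s l)) ->
  (forall s, multiplier K (f' s)) -> (forall s, mL2 (f' s)) ->
  (forall r, s <= r <= t -> nrm (f' r) <= N) ->
  nrm (fun l => f t l - f s l) <= 2 * n%:R * N * (t - s).
Proof.
move=> st hf df f'K hf' f'N.
have N0 : 0 <= N by apply: le_trans (nrm_ge0 _) (f'N s _); rewrite lexx.
have [->|ts] := eqVneq t s.
  rewrite subrr mulr0 [X in nrm X](_ : _ = fun=> 0); last by apply/funext => l; rewrite subrr.
  by rewrite /nrm ip0l sqrtr0.
have S0 : 0 < t - s by rewrite subr_gt0 lt_neqAle eq_sym ts.
apply: nrm_le_sqint; [by rewrite !mulr_ge0// ltW|exact: mL2B|].
have e1 (h : R -> R) (h' : R -> R) x : is_derive (s + x) (1 : R) h (h' (s + x)) ->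
    is_derive x (1 : R) (fun r => h (s + r)) (h' (s + x)).
  move=> dh; have := @is_derive_affine _ h x s 1 (h' (s + x)).
  rewrite !mul1r => /(_ dh); under eq_fun do rewrite mul1r; by [].
have sqf' r a b : 0 <= r <= t - s ->
    (sqint mu (mxRe (f' (s + r)%R) a b) <= (N ^+ 2)%:E)%E /\ (sqint mu (mxIm (f' (s + r)%R) a b) <= (N ^+ 2)%:E)%E.
  move=> /andP[r0 rs]; have {}f'N : nrm (f' (s + r)) <= N by apply: f'N; rewrite lerDl r0 addrC -lerBrDr.
  move: (s + r) f'N => {r0 rs}r f'N.
  have hN : (sqint mu (fun t => mxfrob (f' r t)) <= (N ^+ 2)%:E)%E.
    by rewrite -nrm_sqint// lee_fin ler_pXn2r ?nnegrE ?nrm_ge0.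
  have mfr : measurable_fun setT (fun t => mxfrob (f' r t)) by apply: measurable_mxfrob; case: (hf' r).
  have [mR mI] := (hf' r).1 a b; split; apply: le_trans hN; apply: sqint_le => //; apply: ae_all => l.
    by rewrite [leRHS]ger0_norm ?mxfrob_ge0 ?Re_entry_le.
  by rewrite [leRHS]ger0_norm ?mxfrob_ge0 ?Im_entry_le.
have -> : (2 * n%:R * N * (t - s)) ^+ 2 = n%:R ^+ 2 * (2 * (2 * ((t - s) ^+ 2 * N ^+ 2))) by ring.
have P0 : (t - s) ^+ 2 * N ^+ 2 <= 2 * ((t - s) ^+ 2 * N ^+ 2).
  by rewrite ler_peMl ?ler1n// mulr_ge0 ?sqr_ge0.
have mR r a b : measurable_fun setT (mxRe (f r) a b) by have [/(_ a b)[]] := hf r.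
have mI r a b : measurable_fun setT (mxIm (f r) a b) by have [/(_ a b)[]] := hf r.
apply: sqint_frob_le; first by apply: mx_measurableB; [case: (hf t)|case: (hf s)].
  move=> a b; apply: (@le_trans _ _ ((t - s) ^+ 2 * N ^+ 2)%:E); last by rewrite lee_fin.
  have -> : mxRe (fun l => f t l - f s l) a b =
      fun l => complex.Re (f (s + (t - s)) l a b) - complex.Re (f (s + 0) l a b).
    by apply/funext => l; rewrite addr0 [s + _]addrC subrK /mxRe !mxE ReB.
  apply: (@family_increment_sqint _ (fun r l => complex.Re (f (s + r) l a b))
    (fun r l => complex.Re (f' (s + r) l a b)) K (N ^+ 2) (t - s) S0) => //.
  - move=> r l; apply: (e1 (mxRe (f ^~ l) a b) (fun r => complex.Re (f' r l a b))).
    by have [] := df (s + r) l a b.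
  - by move=> r; exact: mR.
  - by move=> r; apply: ae_imp (f'K (s + r)).2 => l; apply: le_trans; exact: Re_entry_le.
  - by move=> r /sqf' h; have [] := h a b.
move=> a b; apply: (@le_trans _ _ ((t - s) ^+ 2 * N ^+ 2)%:E); last by rewrite lee_fin.
have -> : mxIm (fun l => f t l - f s l) a b =
    fun l => complex.Im (f (s + (t - s)) l a b) - complex.Im (f (s + 0) l a b).
  by apply/funext => l; rewrite addr0 [s + _]addrC subrK /mxIm !mxE ImB.
apply: (@family_increment_sqint _ (fun r l => complex.Im (f (s + r) l a b))
  (fun r l => complex.Im (f' (s + r) l a b)) K (N ^+ 2) (t - s) S0) => //.
- move=> r l; apply: (e1 (mxIm (f ^~ l) a b) (fun r => complex.Im (f' r l a b))).
  by have [] := df (s + r) l a b.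
- by move=> r; exact: mI.
- by move=> r; apply: ae_imp (f'K (s + r)).2 => l; apply: le_trans; exact: Im_entry_le.
- by move=> r /sqf' h; have [] := h a b.
Qed.

Lemma mx_increment_nrm (f f' : R -> R -> MM) N K :
  (forall s, mL2 (f s)) -> (forall s l, mx_is_derive (f ^~ l) s (f' s l)) ->
  (forall s, multiplier K (f' s)) -> (forall s, mL2 (f' s)) -> (forall s, nrm (f' s) <= N) ->
  forall s t, nrm (fun l => f t l - f s l) <= 2 * n%:R * N * `|t - s|.
Proof.
move=> hf df f'K hf' f'N s t; have [st|/ltW ts] := leP s t.
  by rewrite ger0_norm ?subr_ge0//; exact: (mx_increment_nrm_itv st hf df f'K hf').
rewrite nrmBC distrC ger0_norm ?subr_ge0//; exact: (mx_increment_nrm_itv ts hf df f'K hf').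
Qed.

(** A scalar cut-off: it commutes with everything, is a multiplier, and lies in L2, so it can play
    the part of [psi] in [multiplier_seq_cvg]. *)
Let window (N : nat) (l : R) : MM := (if `|l| <= N%:R then 1 else 0)%:C%:M.

Lemma mx_measurable_window N : mx_measurable (window N).
Proof.
have mw : measurable_fun setT (fun l : R => if `|l| <= N%:R then 1 else 0 : R).
  apply: measurable_fun_ifT => //; apply: measurable_fun_ler => //; exact: measurableT_comp.
move=> a b; rewrite /mxRe /mxIm /window; split.
  under eq_fun do rewrite mxE; case: (a == b) => /=; first exact: mw.
  exact: measurable_cst.
by under eq_fun do rewrite mxE; case: (a == b); exact: measurable_cst.
Qed.

Lemma multiplier_window N : multiplier (mxfrob (1%:M : MM)) (window N).
Proof.
split; first exact: mx_measurable_window.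
apply: ae_all => l; rewrite /window; case: ifP => _; first by [].
by rewrite (_ : 0%:C%:M = 0 :> MM) ?mxfrob0 ?mxfrob_ge0// -scalemx1 scale0r.
Qed.

Lemma mL2_window N : mL2 (window N).
Proof.
have m0 := mxfrob_ge0 (1%:M : MM).
apply: (@mL2_le _ _ _ (fun l => mxfrob (1%:M : MM) * \1_(`[- N%:R, N%:R]%classic) l)).
- exact: mx_measurable_window.
- apply: sqintegrableZ; split; first exact: measurable_indic.
  rewrite /sqint (_ : (fun x => _) = (fun x => (\1_(`[- N%:R, N%:R]%classic) x)%:E)); last first.
    by apply/funext => x; rewrite indicE; case: (x \in _); rewrite ?expr1n ?expr0n.
  by rewrite integral_indic// setIT [X in (X < _)%E]lebesgue_measure_itv; case: ifP => _; rewrite ?ltry// -EFinB ltry.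
apply: ae_all => l; rewrite /window indicE mem_setE in_itv /= -ler_norml; case: ifP => _.
  by rewrite mulr1 ger0_norm.
by rewrite (_ : 0%:C%:M = 0 :> MM) ?mxfrob0// -scalemx1 scale0r.
Qed.

Lemma window_tail_cvg phi : mL2 phi -> nrm (fun l => phi l *m (window N l - 1%:M)) @[N --> \oo] --> 0.
Proof.
move=> hphi; apply: (multiplier_seq_cvg (K := mxfrob (1%:M : MM)) hphi).
- exact: multiplier_window.
- exact: multiplier_cst.
- move=> l i j; apply: (@cvg_near_cst _ _ _ (fun=> _)) => //.
  near=> N; have lN : `|l| <= N%:R by near: N; exact: nbhs_infty_ger.
  by rewrite /window lN.
- move=> l i j; apply: (@cvg_near_cst _ _ _ (fun=> _)) => //.
  near=> N; have lN : `|l| <= N%:R by near: N; exact: nbhs_infty_ger.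
  by rewrite /window lN.
Unshelve. all: by end_near.
Qed.

(* The window makes the difference quotients converge strongly, and the L2 bounds control what is left. *)
Lemma weak_derive_pointwise (f f' : R -> R -> MM) N K :
  (forall s, mL2 (f s)) -> (forall s l, mx_is_derive (f ^~ l) s (f' s l)) ->
  (forall s, multiplier K (f' s)) -> (forall s, mL2 (f' s)) -> (forall s, nrm (f' s) <= N) ->
  weak_derive f f'.
Proof.
move=> hf df f'K hf' f'N phi hphi s; apply: is_derive_seqP => u u0 uc.
have N0 : 0 <= N := le_trans (nrm_ge0 _) (f'N 0).
have K0 : 0 <= K := multiplier_ge0 (f'K 0).
pose b m l := (u m)^-1%:C *: (f (s + u m) l - f s l).
have hb m : mL2 (b m) by apply: mL2Z; exact: mL2B.
pose L := n%:R * (2 * K) + K.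
have bL m : multiplier L (b m).
  split; first by case: (hb m).
  apply: ae_imp (mx_increment_bounded (fun s => (hf s).1) df f'K s (s + u m)).2 => l.
  rewrite [s + _]addrC addrK /b mxfrobZ normfV => h; rewrite ler_pdivrMl ?normr_gt0//.
  by rewrite [s + _]addrC; apply: le_trans h _; rewrite mulrC ler_wpM2l// lerDl.
have f'L : multiplier L (f' s) by apply: multiplierW (f'K s); rewrite lerDr !mulr_ge0.
have bN m : nrm (b m) <= 2 * n%:R * N.
  rewrite nrmZ; last exact: mL2B.
  rewrite normfV ler_pdivrMl ?normr_gt0// mulrC.
  by have := mx_increment_nrm hf df f'K hf' f'N s (s + u m); rewrite [s + _]addrC addrK [_ + s]addrC.
pose e m l := b m l - f' s l.
have he m : mL2 (e m) by exact: mL2B.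
pose B := 2 * n%:R * N + N.
have B0 : 0 <= B by rewrite addr_ge0 ?mulr_ge0.
have eB m : nrm (e m) <= B by apply: le_trans (nrmB (hb m) (hf' s)) _; exact: lerD.
have strong M : nrm (fun l => window M l *m e m l) @[m --> \oo] --> 0.
  apply: (multiplier_seq_cvg (K := L) (mL2_window M) bL f'L) => l i j.
    have [/is_derive_quotient d _] := df s l i j; have := d u u0 uc.
    rewrite (_ : (fun m => complex.Re (b m l i j)) =
      fun m => (mxRe (f ^~ l) i j (s + u m) - mxRe (f ^~ l) i j s) / u m)//.
    apply/funext => m; rewrite /b /mxRe !mxE.
    by case: (f _ _ _ _) => p q; case: (f _ _ _ _) => p' q' /=; rewrite mul0r subr0 mulrC.
  have [_ /is_derive_quotient d] := df s l i j; have := d u u0 uc.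
  rewrite (_ : (fun m => complex.Im (b m l i j)) =
    fun m => (mxIm (f ^~ l) i j (s + u m) - mxIm (f ^~ l) i j s) / u m)//.
  apply/funext => m; rewrite /b /mxIm !mxE.
  by case: (f _ _ _ _) => p q; case: (f _ _ _ _) => p' q' /=; rewrite mul0r addr0 mulrC.
have E m : (ip (f (s + u m)) phi - ip (f s) phi) / u m = ip (f' s) phi + ip (e m) phi.
  by rewrite mulrC -ipBl// -ipZl//; [rewrite /e ipBl// [RHS]addrC subrK|exact: mL2B].
under eq_fun do rewrite E; apply: cvgD0; first exact: cvg_cst.
apply/cvgrPdist_le => eps eps0.
(* The window is fixed first, against the uniform bound [B] on the errors; then [m] is taken large
   inside that window. *)
have d0 : 0 < eps / 2 / (B + 1) by rewrite !divr_gt0// ltr_wpDl.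
have [M hM] : exists M, nrm (fun l => phi l *m (window M l - 1%:M)) < eps / 2 / (B + 1).
  have /cvgrPdist_lt/(_ _ d0)[M _ hM] := window_tail_cvg hphi; exists M.
  by have := hM M (leqnn _); rewrite sub0r normrN ger0_norm ?nrm_ge0.
have d1 : 0 < eps / 2 / (nrm phi + 1) by rewrite !divr_gt0// ltr_wpDl ?nrm_ge0.
have /cvgrPdist_lt/(_ _ d1) := strong M; apply: filterS => m.
rewrite !sub0r !normrN (ger0_norm (nrm_ge0 _)) => hm.
have ht : mL2 (fun l => phi l *m (window M l - 1%:M)).
  rewrite (_ : (fun l => _) = fun l => phi l *m window M l - phi l).
    exact: mL2B (mL2_mul hphi (multiplier_window M)) hphi.
  by apply/funext => l; rewrite mulmxBr mulmx1.
have hwe : mL2 (fun l => window M l *m e m l).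
  rewrite (_ : (fun l => _) = fun l => e m l *m window M l).
    exact: mL2_mul (he m) (multiplier_window M).
  by apply/funext => l; rewrite /window scalar_mxC.
have -> : ip (e m) phi = ip (fun l => window M l *m e m l) phi - ip (e m) (fun l => phi l *m (window M l - 1%:M)).
  rewrite (_ : (fun l => phi l *m (window M l - 1%:M)) = fun l => phi l *m window M l - phi l); last first.
    by apply/funext => l; rewrite mulmxBr mulmx1.
  have hpw := mL2_mul hphi (multiplier_window M).
  rewrite (ipBr hpw hphi (he m)).
  rewrite (_ : (fun l => window M l *m e m l) = fun l => e m l *m window M l); last first.
    by apply/funext => l; rewrite /window scalar_mxC.
  rewrite (ip_mull (he m) hphi (multiplier_window M)).
  rewrite (_ : (fun l => phi l *m adjmx (window M l)) = fun l => phi l *m window M l).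
    by rewrite opprB addrCA subrr addr0.
  apply/funext => l; congr (_ *m _); apply/matrixP => i j; rewrite adjmxE /window !mxE eq_sym.
  by case: ifP => _; case: (i == j) => /=; rewrite ?oppr0.
apply: le_trans (ler_normB _ _) _; rewrite [eps]splitr; apply: lerD.
  apply: le_trans (ip_CS hwe hphi) _; apply: (@le_trans _ _ (eps / 2 / (nrm phi + 1) * nrm phi)).
    by rewrite ler_wpM2r ?nrm_ge0// ltW.
  have := nrm_ge0 phi => P0; rewrite mulrAC ler_pdivrMr ?ltr_wpDl// ler_wpM2l ?lerDl//; lra.
apply: le_trans (ip_CS (he m) ht) _; apply: (@le_trans _ _ (B * (eps / 2 / (B + 1)))).
  by apply: ler_pM; rewrite ?nrm_ge0// ltW.
rewrite mulrC mulrAC ler_pdivrMr ?ltr_wpDl// ler_wpM2l ?lerDl//; lra.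
Qed.

End pointwise_families.

(** * Scattering data as families of multipliers and L2 functions *)

Section scattering_families.
Context (R : realType) (n k : nat) (v : R -> R -> R -> 'M[R[i]]_n) (hv : scattering_data k v).
Local Notation MM := 'M[R[i]]_n.
Local Notation mu := (@lebesgue_measure R).
Local Notation K := (k - 4)%N.

Lemma mx_derivableP (F : R -> MM) x : mx_derivable F x -> mx_is_derive F x (mx_derive F x).
Proof.
move=> h a b; have [h1 h2] := h a b; rewrite /mx_derive mxE /= !derive1E.
by split; [exact: (DeriveDef h1)|exact: (DeriveDef h2)].
Qed.

Lemma scattering_slice x y l : v x y l = v (x + l * y) 0 l.
Proof. by have [w h] := sd_transl hv; rewrite !h mulr0 addr0. Qed.

(** By the translation property the line y = 0 determines [v] on the whole plane, so all partial
    derivatives are expressed through this function of one real variable. *)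
Definition slice m (s l : R) : MM := partial m 0 (fun x y => v x y l - 1%:M) s 0.

Lemma slice_derive m s l : (m < K)%N -> mx_is_derive (slice m ^~ l) s (slice m.+1 s l).
Proof.
move=> mK; have h : (K + 0 <= K)%N by rewrite addn0.
by have [_ /(_ m mK s 0)] := sd_diff hv h l; exact: mx_derivableP.
Qed.

(* On functions of x + l y and l each derivative in y is l times the one in x. *)
Definition wave m j (x y l : R) : MM := (l ^+ j)%:C *: slice m (x + l * y) l.

Lemma wave0 x y l : wave 0 0 x y l = v x y l - 1%:M.
Proof. by rewrite /wave expr0 scale1r /slice /partial /= -scattering_slice. Qed.

Lemma mx_is_derive_affine (F : R -> MM) c s x d (r : R) : mx_is_derive F (c + s * x) d ->
  mx_is_derive (fun t => r%:C *: F (c + s * t)) x ((r * s)%:C *: d).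
Proof.
move=> h a b; have [h1 h2] := h a b.
have e (G : R -> R) (p : R) : is_derive (c + s * x) (1 : R) G p ->
    is_derive x (1 : R) (fun t => r * G (c + s * t)) (r * s * p).
  move=> dG; rewrite -mulrA; have := is_derive_affine dG => {}dG.
  have := @is_deriveZ _ _ _ (fun t => G (c + s * t)) r x 1 (s * p) dG.
  by [].
split.
  have -> : complex.Re (((r * s)%:C *: d) a b) = r * s * complex.Re (d a b).
    by rewrite mxE ReM /= mul0r subr0.
  rewrite (_ : mxRe _ a b = fun t => r * mxRe F a b (c + s * t)); first exact: e.
  by apply/funext => t; rewrite /mxRe mxE ReM /= mul0r subr0.
have -> : complex.Im (((r * s)%:C *: d) a b) = r * s * complex.Im (d a b).
  by rewrite mxE ImM /= mul0r addr0.
rewrite (_ : mxIm _ a b = fun t => r * mxIm F a b (c + s * t)); first exact: e.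
by apply/funext => t; rewrite /mxIm mxE ImM /= mul0r addr0.
Qed.

Lemma wave_derive_x m j x y l : (m < K)%N ->
  mx_is_derive (fun s => wave m j s y l) x (wave m.+1 j x y l).
Proof.
move=> mK; have := @mx_is_derive_affine (slice m ^~ l) (l * y) 1 x _ (l ^+ j)
  (slice_derive (l * y + 1 * x) l mK).
rewrite mulr1 mul1r [_ + x]addrC; congr (mx_is_derive _ _ _).
by apply/funext => t; rewrite /wave mul1r addrC.
Qed.

Lemma wave_derive_y m j x y l : (m < K)%N ->
  mx_is_derive (fun s => wave m j x s l) y (wave m.+1 j.+1 x y l).
Proof.
move=> mK; have := @mx_is_derive_affine (slice m ^~ l) x l y _ (l ^+ j)
  (slice_derive (x + l * y) l mK).
by rewrite -exprSr.
Qed.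

Lemma wave_partial i j l : (i + j <= K)%N ->
  partial i j (fun x y => v x y l - 1%:M) = fun x y => wave (i + j) j x y l.
Proof.
move=> ijK; rewrite /partial.
have -> : iter j (@partial_y R n) (fun x y => v x y l - 1%:M) = fun x y => wave j j x y l.
  have : (j <= K)%N by apply: leq_trans ijK; exact: leq_addl.
  elim: j {ijK} => [|j ih] jK /=; first by apply/funext => x; apply/funext => y; rewrite wave0.
  rewrite ih; last exact: ltnW.
  apply/funext => x; apply/funext => y; rewrite /partial_y.
  by have [_] := mx_is_deriveP (wave_derive_y j x y l jK).
elim: i ijK => [|i ih] ijK //=; rewrite ih; last exact: ltnW.
apply/funext => x; apply/funext => y; rewrite /partial_x.
by have [_] := mx_is_deriveP (wave_derive_x j x y l ijK).
Qed.

(** Multiplication by [l ^+ j] is unbounded; the bounds come from the hypothesis on the mixed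
    derivative with [j] derivatives in y and [m - j] in x, which equals this function. *)
Lemma wave_bounded m j : (j <= m)%N -> (m <= K)%N ->
  [/\ exists M, forall x y, multiplier M (wave m j x y), forall x y, mL2 (wave m j x y),
     exists M, forall x y, nrm (wave m j x y) <= M & vanishing (fun x y => nrm (wave m j x y))].
Proof.
move=> jm mK; have ijK : (m - j + j <= K)%N by rewrite subnK.
have E x y : (fun l => partial (m - j) j (fun x y => v x y l - 1%:M) x y) = wave m j x y.
  by apply/funext => l; rewrite wave_partial// subnK.
have [[M hM] [N hN] _] := sd_bounded hv ijK; have [_ hV _] := sd_vanish hv ijK.
have h2 x y : mL2 (wave m j x y) /\ nrm (wave m j x y) <= N by rewrite -E; exact: mxLnorm2_le.
split.
- by exists M => x y; rewrite -E; exact: mxLnormoo_le.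
- by move=> x y; have [] := h2 x y.
- by exists N => x y; have [] := h2 x y.
move=> e e0; have [r hr] := hV e e0; exists r => x y /hr; rewrite E => h.
by have [] := @mxLnorm2_le _ _ (wave m j x y) e _ => //; split=> //; case: (h2 x y) => -[].
Qed.

Lemma wave_multiplier_family d m j : (j <= m)%N -> (m + d <= K)%N -> multiplier_family d (wave m j).
Proof.
elim: d m j => [|d ih] m j jm mdK.
  by have [h _ _ _] := wave_bounded jm (leq_trans (leq_addr _ _) mdK).
have mK : (m < K)%N by apply: leq_trans mdK; rewrite addnS ltnS leq_addr.
have [h _ _ _] := wave_bounded jm (ltnW mK).
split => //; exists (wave m.+1 j), (wave m.+1 j.+1); split.
- by apply: ih; [exact: leqW|rewrite addSn -addnS].
- by apply: ih; [exact: jm|rewrite addSn -addnS].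
- by move=> y s l; exact: wave_derive_x.
- by move=> x s l; exact: wave_derive_y.
Qed.

Lemma wave_L2family d m j : (j <= m)%N -> (m + d <= K)%N -> L2family d (wave m j).
Proof.
elim: d m j => [|d ih] m j jm mdK.
  by have [_ h1 h2 h3] := wave_bounded jm (leq_trans (leq_addr _ _) mdK).
have mK : (m < K)%N by apply: leq_trans mdK; rewrite addnS ltnS leq_addr.
have [_ h1 h2 h3] := wave_bounded jm (ltnW mK).
have [[Mx hMx] hx [Nx hNx] _] := wave_bounded (leqW jm) mK.
have [[My hMy] hy [Ny hNy] _] := @wave_bounded m.+1 j.+1 jm mK.
split => //; exists (wave m.+1 j), (wave m.+1 j.+1); split.
- by apply: ih; [exact: leqW|rewrite addSn -addnS].
- by apply: ih; [exact: jm|rewrite addSn -addnS].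
- move=> y; apply: (weak_derive_pointwise (N := Nx) (K := Mx)) => // s l; exact: wave_derive_x.
- move=> x; apply: (weak_derive_pointwise (N := Ny) (K := My)) => // s l; exact: wave_derive_y.
Qed.

Lemma scattering_L2family : L2family K (fun x y l => v x y l - 1%:M).
Proof.
have := @wave_L2family K 0 0 (leqnn _); rewrite add0n => /(_ (leqnn _)).
congr (L2family _ _); apply/funext => x; apply/funext => y; apply/funext => l; exact: wave0.
Qed.

Lemma mx_is_derive_addcst (F : R -> MM) A x d : mx_is_derive F x d ->
  mx_is_derive (fun t => F t + A) x d.
Proof.
move=> h a b; have [h1 h2] := h a b; split.
  rewrite (_ : mxRe _ a b = mxRe F a b \+ cst (complex.Re (A a b))).
    by rewrite -[X in is_derive _ _ _ X]addr0; exact: is_deriveD.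
  by apply/funext => t; rewrite /mxRe /= mxE ReD.
rewrite (_ : mxIm _ a b = mxIm F a b \+ cst (complex.Im (A a b))).
  by rewrite -[X in is_derive _ _ _ X]addr0; exact: is_deriveD.
by apply/funext => t; rewrite /mxIm /= mxE ImD.
Qed.

Lemma scattering_bounded : exists M, forall x y, multiplier M (v x y).
Proof.
have [[M hM] _ _ _] := @wave_bounded 0 0 (leqnn _) (leq0n _).
exists (M + mxfrob (1%:M : MM)) => x y; have [h1 h2] := hM x y.
have E l : v x y l = wave 0 0 x y l + 1%:M by rewrite wave0 subrK.
split.
  rewrite (_ : v x y = fun l => wave 0 0 x y l + 1%:M); last by apply/funext.
  by apply: mx_measurableD => //; exact: mx_measurable_cst.
by apply: ae_imp h2 => l h; rewrite E; apply: le_trans (mxfrobD _ _) _; rewrite lerD2r.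
Qed.

Lemma scattering_multiplier_family : multiplier_family K v.
Proof.
have hb := scattering_bounded.
case Kd : K => [|d]; first by [].
have dK : (0 < K)%N by rewrite Kd.
have E : v = fun x y l => wave 0 0 x y l + 1%:M.
  by apply/funext => x; apply/funext => y; apply/funext => l; rewrite wave0 subrK.
split => //; exists (wave 1 0), (wave 1 1); split.
- by apply: wave_multiplier_family; rewrite ?Kd ?add1n.
- by apply: wave_multiplier_family; rewrite ?Kd ?add1n.
- by move=> y s l; rewrite E; apply: mx_is_derive_addcst; exact: wave_derive_x.
- by move=> x s l; rewrite E; apply: mx_is_derive_addcst; exact: wave_derive_y.
Qed.

(** One pair of constants serves the whole plane, because the coercivity constant depends only on
    the size and on the uniform bound for [v]. *)
Lemma scattering_weight : exists M c, forall x y, weight M c (v x y).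
Proof.
have [M hM] := scattering_bounded; have M0 : 0 <= M := multiplier_ge0 (hM 0 0).
exists M, (coercivity n M) => x y; split.
- exact: hM.
- by move=> t; apply: posdef_hermitian; exact: sd_pos hv x y t.
- exact: coercivity_gt0.
apply: ae_imp (hM x y).2 => t h A; apply: posdef_coercive => //; first exact: sd_pos hv x y t.
exact: sd_det hv x y t.
Qed.

End scattering_families.

(** * Continuous representatives of the boundary values *)

Lemma root_unit_interval (R : realType) (q : R) (m : nat) : (0 < m)%N -> 0 < q -> q <= 1 ->
  exists p : R, [/\ 0 < p, p <= 1 & p ^+ m = q].
Proof.
move=> m0 q0 q1; have mi : 0 <= (m%:R : R)^-1 by rewrite invr_ge0.
exists (q `^ (m%:R^-1)); split.
- exact: powR_gt0.
- have := @ge0_ler_powR R _ mi q 1; rewrite powR1; apply => //; rewrite nnegrE; exact: ltW.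
- by rewrite -powR_mulrn ?powR_ge0// -powRrM mulVf ?pnatr_eq0 -?lt0n// powRr1// ltW.
Qed.

Lemma exprn_antitone (R : realType) (x : R) (m p : nat) : 0 < x -> x <= 1 -> (m <= p)%N ->
  x ^+ p <= x ^+ m.
Proof. by move=> x0 x1 mp; apply: ler_wiXn2l => //; exact: ltW. Qed.

Lemma geometric_tail (R : realType) (u : nat -> R) (C p : R) : 0 <= p -> p < 1 ->
  (forall m, `|u m.+1 - u m| <= C * p ^+ m) ->
  exists l, forall m, `|u m - l| <= C / (1 - p) * p ^+ m.
Proof.
move=> p0 p1 h; have C0 : 0 <= C by have := h 0; rewrite expr0 mulr1; exact: le_trans.
have q0 : 0 < 1 - p by rewrite subr_gt0.
have tail m d : `|u (m + d)%N - u m| <= C / (1 - p) * (p ^+ m - p ^+ (m + d)).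
  elim: d => [|d ih]; first by rewrite addn0 !subrr normr0 mulr0.
  have -> : u (m + d.+1)%N - u m = (u (m + d).+1 - u (m + d)%N) + (u (m + d)%N - u m).
    by rewrite addnS addrA subrK.
  apply: le_trans (ler_normD _ _) _; apply: le_trans (lerD (h _) ih) _.
  rewrite addnS exprS le_eqVlt; apply/orP; left; apply/eqP.
  by field; rewrite gt_eqF.
have tail' m d : `|u (m + d)%N - u m| <= C / (1 - p) * p ^+ m.
  apply: le_trans (tail m d) _; rewrite ler_wpM2l ?divr_ge0// ?(ltW q0)//.
  by rewrite gerBl exprn_ge0.
have cu : cvgn u.
  apply: cauchy_cvg; apply/cauchy_ballP => e e0.
  have : (fun m => C / (1 - p) * p ^+ m) @ \oo --> (0 : R).
    rewrite -(mulr0 (C / (1 - p))); apply: cvgMr; apply: cvg_expr; by rewrite ger0_norm.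
  move=> /cvgrPdist_lt/(_ (e / 2)); rewrite divr_gt0// => /(_ isT)[N _ hN].
  have uN m : (N <= m)%N -> `|u m - u N| < e / 2.
    move=> Nm; have := hN N (leqnn _); rewrite /= sub0r normrN => h1.
    apply: le_lt_trans h1; rewrite -(subnKC Nm); apply: le_trans (tail' _ _) _; exact: ler_norm.
  exists ([set x | `|x - u N| < e / 2], [set x | `|x - u N| < e / 2]) => /=.
    by split; exists N.
  move=> [a b] /= [Na Nb]; rewrite /ball /=.
  have -> : a - b = (a - u N) - (b - u N) by rewrite opprB addrA subrK.
  by apply: le_lt_trans (ler_normB _ _) _; rewrite [e]splitr ltrD.
exists (limn u) => m; have c2 : `|u m - u (m + d)%N| @[d --> \oo] --> `|u m - limn u|.
  apply: cvg_norm; apply: cvgB; first exact: cvg_cst.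
  by have := cu; rewrite -(cvg_shiftn m) => {}cu; under eq_fun do rewrite addnC.
by apply: (cvgr_to_le c2); apply: nearW => d; rewrite distrC.
Qed.

Section averages.
Context (R : realType).
Local Notation mu := (@lebesgue_measure R).
Implicit Types f : R -> R.

Definition average (r : R) f (t : R) : R := r^-1 * \int[mu]_(s in `[0, r]) f (t + s).

Lemma sqintegrable_itv f (a b : R) : sqintegrable mu f -> mu.-integrable `[a, b] (EFin \o f).
Proof.
move=> hf; have h1 : sqintegrable mu (\1_(`[a, b]%classic) : R -> R).
  split; first exact: measurable_indic.
  rewrite /sqint (_ : (fun x => _) = (fun x => (\1_(`[a, b]%classic) x)%:E)); last first.
    by apply/funext => x; rewrite indicE; case: (x \in _); rewrite ?expr1n ?expr0n.
  by rewrite integral_indic// setIT [X in (X < _)%E]lebesgue_measure_itv; case: ifP => _; rewrite ?ltry// -EFinB ltry.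
have : mu.-integrable `[a, b] (EFin \o (fun x => f x * \1_(`[a, b]%classic) x)).
  by apply: (integrableS _ _ _ (sqintegrable_mul hf h1)) => //; exact: measurable_itv.
apply: eq_integrable => // x; rewrite mem_setE => xab /=.
by rewrite indicE mem_setE xab mulr1.
Qed.

Lemma sqintegrable_shiftl f t : sqintegrable mu f -> sqintegrable mu (fun s => f (t + s)).
Proof. by move=> /(@sqintegrable_shift _ _ t); under eq_fun do rewrite addrC. Qed.

(** Passing from L2 to the supremum of averages loses r^(-1/2); this loss is why an L2 modulus must
    exceed exponent 1/2. *)
Lemma average_sqr_le f r t (B : R) : 0 < r -> sqintegrable mu f -> (sqint mu f <= B%:E)%E ->
  average r f t ^+ 2 <= r^-1 * B.
Proof.
move=> r0 hf fB; have hft := sqintegrable_shiftl t hf.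
have := @sqr_le_integral_sqr _ (fun s => f (t + s)) r (r * average r f t) r0 hft.1.
rewrite /average mulVKf ?gt_eqF// => /(_ _)/wrap[].
  rewrite /Rintegral -[X in (X <= _)%E]abse_EFin fineK; last first.
    by apply: integrable_fin_num => //; exact: (sqintegrable_itv 0 r hft).
  have /integrableP[m1 _] := sqintegrable_itv 0 r hft.
  by apply: le_abse_integral => //; exact: measurable_itv.
move=> h; have {}h : (((\int[mu]_(s in `[0, r]) f (t + s)) ^+ 2)%R%:E <= (r * B)%R%:E)%E.
  apply: le_trans h _; rewrite EFinM; apply: lee_wpmul2l; first by rewrite lee_fin ltW.
  apply: le_trans fB; rewrite -(sqint_shift t hf.1).
  have -> : sqint mu (fun x => f (x + t)) = (\int[mu]_s (f (t + s) ^+ 2)%:E)%E.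
    by apply: eq_integral => s _; rewrite addrC.
  apply: ge0_subset_integral => //.
  - exact: measurable_sq hft.1.
  - by move=> s _; rewrite lee_fin sqr_ge0.
rewrite lee_fin in h.
rewrite exprMn; apply: le_trans (ler_wpM2l (sqr_ge0 _) h) _.
by rewrite expr2 -mulrA mulKf ?gt_eqF.
Qed.

Lemma averageB f r s t : sqintegrable mu f ->
  average r f (t + s) - average r f t = average r (fun x => f (x + s) - f x) t.
Proof.
move=> hf; rewrite /average -mulrBr -RintegralB//; last 2 first.
- by apply: sqintegrable_itv; exact: sqintegrable_shiftl.
- by apply: sqintegrable_itv; exact: sqintegrable_shiftl.
by congr (_ * _); apply: eq_Rintegral => x _; rewrite addrAC.
Qed.

Lemma sqintegrable_indic (a b : R) : sqintegrable mu (\1_(`[a, b]%classic) : R -> R).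
Proof.
split; first exact: measurable_indic.
rewrite /sqint (_ : (fun x => _) = (fun x => (\1_(`[a, b]%classic) x)%:E)); last first.
  by apply/funext => x; rewrite indicE; case: (x \in _); rewrite ?expr1n ?expr0n.
by rewrite integral_indic// setIT [X in (X < _)%E]lebesgue_measure_itv; case: ifP => _; rewrite ?ltry// -EFinB ltry.
Qed.

Lemma averageE f r t : average r f t = r^-1 * dotL2 mu (\1_(`[0, r]%classic) : R -> R) (fun s => f (t + s)).
Proof.
rewrite /average Rintegral_mkcond; congr (_ * _); apply: eq_Rintegral => s _.
by rewrite patchE indicE; case: (s \in _); rewrite ?mul1r ?mul0r.
Qed.

(** The two half windows overlap in one point, hence an almost everywhere identity of indicators. *)
Lemma average_half f r t : 0 < r -> sqintegrable mu f ->
  average r f t = (average (r / 2) f t + average (r / 2) f (t + r / 2)) / 2.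
Proof.
move=> r0 hf; set h := r / 2; have h0 : 0 < h by rewrite divr_gt0.
have rh : r = h + h by rewrite /h -splitr.
pose A : R -> R := \1_(`[0, h]%classic); have hA : sqintegrable mu A by exact: sqintegrable_indic.
have hAs : sqintegrable mu (fun s => A (s - h)) by exact: (sqintegrable_shift (- h) hA).
have hF := sqintegrable_shiftl t hf.
rewrite !averageE.
have -> : dotL2 mu (\1_(`[0, r]%classic) : R -> R) (fun s => f (t + s)) =
    dotL2 mu A (fun s => f (t + s)) + dotL2 mu (fun s => A (s - h)) (fun s => f (t + s)).
  rewrite -dotL2Dl//; apply: dotL2_ae => //.
  - exact: sqintegrable_indic.
  - exact: sqintegrableD.
  - have : {ae mu, forall s : R, s != h}.
      exists [set h]; split => //; first exact: lebesgue_measure_set1.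
      by move=> s /= /negP; rewrite negbK => /eqP.
    apply: ae_imp => s sh; rewrite /A !indicE !mem_setE !in_itv /= rh subr_ge0 lerBlDr.
    have [sh'|sh'] : s < h \/ h < s by move: sh; rewrite neq_lt => /orP.
      have -> : s <= h + h by lra.
      have -> : s <= h by lra.
      have -> : h <= s = false by apply/negbTE; rewrite -ltNge.
      by rewrite addr0.
    have -> : 0 <= s by lra.
    have -> : h <= s by lra.
    have -> : s <= h = false by apply/negbTE; rewrite -ltNge.
    by rewrite add0r.
  - exact: ae_all.
have -> : dotL2 mu (fun s => A (s - h)) (fun s => f (t + s)) = dotL2 mu A (fun s => f (t + h + s)).
  rewrite -(dotL2_shift h hAs hF) /dotL2; apply: eq_Rintegral => s _.
  by rewrite addrK; congr (_ * f _); ring.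
have hr : r^-1 = h^-1 / 2 by rewrite /h invf_div; field; rewrite gt_eqF.
rewrite hr; ring.
Qed.

(** The difference is the average of the increments of [f], to which Minkowski applies. *)
Lemma average_sub_sqint f r (D : R) : 0 < r -> sqintegrable mu f -> measurable_fun setT (average r f) ->
  (forall s, 0 <= s <= r -> (sqint mu (fun t => f (t + s) - f t)%R <= D%:E)%E) ->
  (sqint mu (fun t => average r f t - f t)%R <= D%:E)%E.
Proof.
move=> r0 hf mA fD; have mf := hf.1.
have key : (sqint mu (fun t => r * (average r f t - f t))%R <= (r ^+ 2 * D)%:E)%E.
  apply: (@sqint_le_of_integral_bound _ (fun s t => f (t + s) - f t)%R _ r D r0) => //.
  - apply: measurable_funB.
      apply: (measurableT_comp mf); apply: measurable_funD; [exact: measurable_snd|exact: measurable_fst].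
    by apply: (measurableT_comp mf); exact: measurable_snd.
  - by apply: measurable_funM => //; exact: measurable_funB.
  apply: ae_all => t; have hft := sqintegrable_shiftl t hf.
  have i1 := sqintegrable_itv 0 r hft.
  have i2 : mu.-integrable `[0, r] (EFin \o (fun s => f (t + s) - f t)).
    rewrite (_ : _ \o _ = ((EFin \o (fun s => f (t + s)%R)) \- (EFin \o (fun=> f t)))%E); last first.
      by apply/funext => s /=; rewrite EFinB.
    apply: integrableB => //.
    apply/integrableP; split; first exact: measurable_cst.
    rewrite integral_cst//= [X in (_ * X)%E]lebesgue_measure_itv /= lte_fin r0 sube0 -EFinM ltry//.
  have -> : r * (average r f t - f t) = \int[mu]_(s in `[0, r]) (f (t + s) - f t).
    rewrite RintegralB//; last first.
      apply/integrableP; split; first exact: measurable_cst.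
      rewrite integral_cst//= [X in (_ * X)%E]lebesgue_measure_itv /= lte_fin r0 sube0 -EFinM ltry//.
    rewrite /average mulrBr mulVKf ?gt_eqF//; congr (_ - _).
    rewrite Rintegral_cst//.
    by rewrite [X in fine X]lebesgue_measure_itv /= lte_fin r0 sube0 mulrC.
  rewrite /Rintegral -[X in (X <= _)%E]abse_EFin fineK; last exact: integrable_fin_num.
  have /integrableP[m1 _] := i2.
  by apply: le_abse_integral => //; exact: measurable_itv.
move: key; rewrite sqintZ; last exact: measurable_funB.
rewrite [X in (_ <= X)%E]EFinM lee_pmul2l// ?lte_fin ?exprn_gt0//.
Qed.

Lemma average_continuous f r : 0 < r -> sqintegrable mu f ->
  (forall e, 0 < e -> exists2 d, 0 < d & forall s, `|s| < d ->
     (sqint mu (fun t => f (t + s) - f t)%R <= e%:E)%E) ->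
  continuous (average r f).
Proof.
move=> r0 hf fc t; apply/cvgrPdist_le => e e0.
have e2 : 0 < r * e ^+ 2 by rewrite mulr_gt0 ?exprn_gt0.
have [d d0 hd] := fc _ e2; near=> x.
have xd : `|x - t| < d by rewrite distrC; near: x; apply/nbhs_ballP; exists d.
have E : average r f x = average r f (t + (x - t)) by congr (average r f _); rewrite addrC subrK.
rewrite distrC E averageB// -[leRHS]ger0_norm ?(ltW e0)//.
rewrite -ler_sqr ?nnegrE// !real_normK ?num_real//.
have h : sqintegrable mu (fun y => f (y + (x - t)) - f y).
  by apply: sqintegrableB => //; exact: sqintegrable_shift.
apply: le_trans (average_sqr_le t r0 h (hd _ xd)) _.
by rewrite mulKf ?gt_eqF.
Unshelve. all: by end_near.
Qed.

(** Averages over dyadic windows of length r change from one scale to the next by at most a constant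
    times r^(2/3) r^(-1/2) = r^(1/6). They are uniformly Cauchy, so their limit is continuous and
    bounded, and it equals [f] almost everywhere by L2 convergence. *)
Lemma continuous_representative f (B : R) : 0 <= B -> sqintegrable mu f ->
  (forall q h, 0 < q -> q <= 1 -> `|h| <= q ^+ 6 ->
     (sqint mu (fun t => f (t + h) - f t)%R <= ((B * q ^+ 4) ^+ 2)%:E)%E) ->
  exists d M, [/\ continuous d, forall t, `|d t| <= M & {ae mu, forall t, f t = d t}].
Proof.
move=> B0 hf fB.
(* Powers of [p] are the sixth roots of the dyadic lengths, hence the geometric ratio of the
   averages. *)
have [p [p0 p1 p6]] : exists p : R, [/\ 0 < p, p <= 1 & p ^+ 6 = 2^-1].
  by apply: root_unit_interval => //; rewrite ?invr_gt0 ?invf_le1 ?ltr0n ?ler1n.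
have pl1 : p < 1.
  rewrite lt_neqAle p1 andbT; apply/eqP => e; move: p6; rewrite e expr1n => h.
  have : (2 : R) = 1 by rewrite -[RHS](mulfV (x := 2)) // -h mulr1.
  by move=> /eqP; rewrite -subr_eq0 -addrA subrr addr0 oner_eq0.
pose rr m : R := (2^-1) ^+ m.
have rr0 m : 0 < rr m by rewrite exprn_gt0 // invr_gt0.
have fc e : 0 < e -> exists2 d, 0 < d & forall s, `|s| < d ->
     (sqint mu (fun t => f (t + s) - f t)%R <= e%:E)%E.
  move=> e0; pose q := Num.min 1 (Num.min 1 e / (B ^+ 2 + 1)).
  have B1 : 0 < B ^+ 2 + 1 by rewrite ltr_wpDl ?sqr_ge0.
  have m0 : 0 < Num.min 1 e by rewrite lt_min ltr01.
  have q0 : 0 < q by rewrite lt_min ltr01 divr_gt0.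
  have q1 : q <= 1 by rewrite ge_min lexx.
  exists (q ^+ 6); first by rewrite exprn_gt0.
  move=> s /ltW hs; apply: le_trans (fB q s q0 q1 hs) _; rewrite lee_fin exprMn -exprM.
  apply: (@le_trans _ _ (B ^+ 2 * q)).
    by rewrite ler_wpM2l ?sqr_ge0// -[leRHS]expr1 ler_wiXn2l// ltW.
  have qe : q * (B ^+ 2 + 1) <= e.
    rewrite -ler_pdivlMr// /q ge_min; apply/orP; right.
    by rewrite ler_pM2r ?invr_gt0// ge_min lexx orbT.
  by rewrite mulrDr mulr1 in qe; rewrite mulrC; apply: le_trans qe; rewrite lerDl ltW.
have cA m : continuous (average (rr m) f) by exact: average_continuous.
have step m t : `|average (rr m.+1) f t - average (rr m) f t| <= B * p ^+ m.
  have e2 : rr m.+1 = rr m / 2 by rewrite /rr exprSr.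
  have q0 : 0 < p ^+ m.+1 by rewrite exprn_gt0.
  have q1 : p ^+ m.+1 <= 1 by rewrite exprn_ile1// ltW.
  have e6 : (p ^+ m.+1) ^+ 6 = rr m.+1 by rewrite -exprM mulnC exprM p6.
  rewrite [average (rr m) f t](average_half t (rr0 m) hf) -e2.
  set a := average _ f t; set b := average _ f _.
  have -> : a - (a + b) / 2 = (a - b) / 2 by field.
  have hba : `|b - a| <= B * p ^+ m.+1.
    have BP : 0 <= B * p ^+ m.+1 by rewrite mulr_ge0// ltW.
    rewrite -[leRHS]ger0_norm// -ler_sqr ?nnegrE// !real_normK ?num_real//.
    rewrite /a /b averageB//.
    have h : sqintegrable mu (fun y => f (y + rr m.+1) - f y).
      by apply: sqintegrableB => //; exact: sqintegrable_shift.
    have hle : `|rr m.+1| <= (p ^+ m.+1) ^+ 6 by rewrite e6 ger0_norm// ltW.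
    apply: le_trans (average_sqr_le t (rr0 m.+1) h (fB _ _ q0 q1 hle)) _.
    rewrite -e6 [leLHS](_ : _ = (B * p ^+ m.+1) ^+ 2)//.
    by move: (p ^+ m.+1) q0 => q q0; field; rewrite gt_eqF.
  rewrite normrM distrC normfV [`|2|]ger0_norm// ler_pdivrMr//; apply: le_trans hba _.
  rewrite -mulrA ler_wpM2l// exprS mulrC ler_wpM2l ?exprn_ge0// ?(ltW p0)//; lra.
pose d t := projT1 (cid (geometric_tail (ltW p0) pl1 (step ^~ t))).
have dP t m : `|average (rr m) f t - d t| <= B / (1 - p) * p ^+ m.
  by rewrite /d; case: cid => l /= ; exact.
have q1 : 0 < 1 - p by rewrite subr_gt0.
have C0 : 0 <= B / (1 - p) by rewrite divr_ge0// ltW.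
have cp : (fun m => B / (1 - p) * p ^+ m) @ \oo --> (0 : R).
  by rewrite -(mulr0 (B / (1 - p))); apply: cvgMr; apply: cvg_expr; rewrite ger0_norm// ltW.
have [N [N0 fN]] : exists N : R, 0 <= N /\ (sqint mu f <= N%:E)%E.
  exists (fine (sqint mu f)); rewrite fine_ge0 ?sqint_ge0// fineK// ge0_fin_numE ?sqint_ge0//.
  exact: hf.2.
exists d, (N + 1 + B / (1 - p)); split.
- move=> t; apply/cvgrPdist_le => e e0; have e3 : 0 < e / 3 by rewrite divr_gt0.
  have /cvgrPdist_lt/(_ _ e3)[m _ hm] := cp.
  have {}hm : B / (1 - p) * p ^+ m <= e / 3.
    by have := hm m (leqnn _); rewrite /= sub0r normrN => /ltW; apply: le_trans; exact: ler_norm.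
  have /cvgrPdist_le/(_ _ e3) := cA m t; apply: filterS => x h1.
  have h2 := le_trans (dP t m) hm; have h3 := le_trans (dP x m) hm.
  have : `|d t - d x| <= `|average (rr m) f t - d t| + `|average (rr m) f t - average (rr m) f x| + `|average (rr m) f x - d x|.
    rewrite -[X in X + _ + _]normrN opprB; apply: le_trans (lerD (ler_normD _ _) (lexx _)).
    by rewrite addrA subrK; apply: le_trans (ler_normD _ _); rewrite addrA subrK.
  lra.
- move=> t; have h0 := dP t 0; rewrite expr0 mulr1 in h0.
  have h1 : `|average (rr 0) f t| <= N + 1.
    rewrite -[leRHS]ger0_norm ?addr_ge0// -ler_sqr ?nnegrE ?normr_ge0// !real_normK ?num_real//.
    apply: le_trans (average_sqr_le t (rr0 0) hf fN) _; rewrite /rr expr0 invr1 mul1r; nra.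
  have : `|d t| <= `|average (rr 0) f t| + `|average (rr 0) f t - d t|.
    by rewrite -[X in _ + X]normrN opprB; apply: le_trans (ler_normD _ _); rewrite addrC subrK.
  lra.
have md : measurable_fun setT d.
  apply: (measurable_fun_cvg (h := fun m => average (rr m) f)).
    by move=> m; exact: continuous_measurable_fun.
  move=> t _; apply/cvgrPdist_le => e e0; move/cvgrPdist_lt: cp => /(_ _ e0); apply: filterS => m.
  rewrite sub0r normrN distrC => /ltW h; apply: le_trans (dP t m) _; apply: le_trans h; exact: ler_norm.
have mdf : measurable_fun setT (fun t => d t - f t) by apply: measurable_funB => //; exact: hf.1.
have small (e : R) : 0 < e -> (sqint mu (fun t => d t - f t)%R <= e%:E)%E.
  move=> e0; apply: (@sqint_liminf _ _ _ mu (fun m t => average (rr m) f t - f t)) => //.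
  - by move=> m; apply: measurable_funB; [exact: continuous_measurable_fun|exact: hf.1].
  - apply: ae_all => t; apply: cvgB; last exact: cvg_cst.
    apply/cvgrPdist_le => e' e'0; move/cvgrPdist_lt: cp => /(_ _ e'0); apply: filterS => m.
    rewrite sub0r normrN distrC => /ltW h; apply: le_trans (dP t m) _; apply: le_trans h; exact: ler_norm.
  have [dl dl0 hdl] := fc e e0.
  have cr : rr m @[m --> \oo] --> (0 : R) by apply: cvg_expr; rewrite ger0_norm ?invr_ge0// invf_lt1// ltr1n.
  move/cvgrPdist_lt: cr => /(_ _ dl0); apply: filterS => m; rewrite sub0r normrN => hm.
  apply: average_sub_sqint => //; first exact: continuous_measurable_fun.
  move=> s /andP[s0 sr]; apply: hdl; apply: le_lt_trans hm; rewrite ger0_norm//.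
  by apply: le_trans sr _; exact: ler_norm.
have z : sqint mu (fun t => d t - f t)%R = 0%E.
  apply/eqP; rewrite eq_le sqint_ge0 andbT; apply/lee_addgt0Pr => e e0; rewrite add0e; exact: small.
have : ae_eq mu setT (fun t => ((d t - f t) ^+ 2)%:E) (cst 0%E).
  apply/ae_eq_integral_abs => //; first exact: measurable_sq.
  by rewrite -[RHS]z; apply: eq_integral => t _; rewrite abse_EFin ger0_norm ?sqr_ge0.
apply: ae_imp => t /(_ I) /= [] /eqP; rewrite sqrf_eq0 subr_eq0 => /eqP //.
Qed.

End averages.

Section modulus_of_continuity.
Context (R : realType) (n : nat).
Local Notation MM := 'M[R[i]]_n.
Local Notation mu := (@lebesgue_measure R).
Implicit Types f g v : R -> MM.

(* Hoelder exponent 2/3 in L2: just above the 1/2 needed for continuity, and all that the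
   interpolation for the x and y derivatives gives. Sixth powers avoid fractional ones. *)
Definition modulus f := exists2 B, 0 <= B & forall q h, 0 < q -> q <= 1 -> `|h| <= q ^+ 6 ->
  nrm (fun t => f (t + h) - f t) <= B * q ^+ 4.

Definition bounded_continuous f := exists2 d : R -> MM, {ae mu, forall t, f t = d t} &
  exists M, forall a b, [/\ continuous (mxRe d a b), continuous (mxIm d a b),
    forall t, `|mxRe d a b t| <= M & forall t, `|mxIm d a b t| <= M].

Lemma mL2_incr f (h : R) : mL2 f -> mL2 (fun t => f (t + h) - f t).
Proof. by move=> hf; apply: mL2B => //; exact: mL2_shift. Qed.

Lemma sqint_entry_le f (B : R) a b : mL2 f -> 0 <= B -> nrm f <= B ->
  (sqint mu (mxRe f a b) <= (B ^+ 2)%:E)%E /\ (sqint mu (mxIm f a b) <= (B ^+ 2)%:E)%E.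
Proof.
move=> hf B0 fB.
have hN : (sqint mu (fun t => mxfrob (f t)) <= (B ^+ 2)%:E)%E.
  by rewrite -nrm_sqint// lee_fin ler_pXn2r ?nnegrE ?nrm_ge0.
have mfr : measurable_fun setT (fun t => mxfrob (f t)) by apply: measurable_mxfrob; case: hf.
have [mR mI] := hf.1 a b; split; apply: le_trans hN; apply: sqint_le => //; apply: ae_all => l.
  by rewrite [leRHS]ger0_norm ?mxfrob_ge0 ?Re_entry_le.
by rewrite [leRHS]ger0_norm ?mxfrob_ge0 ?Im_entry_le.
Qed.

Lemma modulus_bounded_continuous f : mL2 f -> modulus f -> bounded_continuous f.
Proof.
move=> hf [B B0 fB].
have hB a b q h : 0 < q -> q <= 1 -> `|h| <= q ^+ 6 ->
    (sqint mu (fun t => mxRe f a b (t + h) - mxRe f a b t)%R <= ((B * q ^+ 4) ^+ 2)%:E)%E /\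
    (sqint mu (fun t => mxIm f a b (t + h) - mxIm f a b t)%R <= ((B * q ^+ 4) ^+ 2)%:E)%E.
  move=> q0 q1 hq; have Bq : 0 <= B * q ^+ 4 by rewrite mulr_ge0 ?exprn_ge0// ltW.
  have := sqint_entry_le a b (mL2_incr h hf) Bq (fB q h q0 q1 hq).
  rewrite (_ : mxRe _ a b = fun t => mxRe f a b (t + h) - mxRe f a b t); last first.
    by apply/funext => t; rewrite /mxRe !mxE ReB.
  rewrite (_ : mxIm _ a b = fun t => mxIm f a b (t + h) - mxIm f a b t)//.
  by apply/funext => t; rewrite /mxIm !mxE ImB.
have exR a b : exists d : R -> R, exists M, [/\ continuous d, forall t, `|d t| <= M & {ae mu, forall t, mxRe f a b t = d t}].
  apply: (continuous_representative B0 (mL2_Re a b hf)) => q h q0 q1 hq.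
  by have [] := hB a b q h q0 q1 hq.
have exI a b : exists d : R -> R, exists M, [/\ continuous d, forall t, `|d t| <= M & {ae mu, forall t, mxIm f a b t = d t}].
  apply: (continuous_representative B0 (mL2_Im a b hf)) => q h q0 q1 hq.
  by have [] := hB a b q h q0 q1 hq.
pose dR a b := projT1 (cid (exR a b)); pose dI a b := projT1 (cid (exI a b)).
have dRP a b : exists M, [/\ continuous (dR a b), forall t, `|dR a b t| <= M & {ae mu, forall t, mxRe f a b t = dR a b t}].
  exact: projT2 (cid (exR a b)).
have dIP a b : exists M, [/\ continuous (dI a b), forall t, `|dI a b t| <= M & {ae mu, forall t, mxIm f a b t = dI a b t}].
  exact: projT2 (cid (exI a b)).
pose MR a b := projT1 (cid (dRP a b)); pose MI a b := projT1 (cid (dIP a b)).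
have MRP a b : [/\ continuous (dR a b), forall t, `|dR a b t| <= MR a b & {ae mu, forall t, mxRe f a b t = dR a b t}].
  exact: projT2 (cid (dRP a b)).
have MIP a b : [/\ continuous (dI a b), forall t, `|dI a b t| <= MI a b & {ae mu, forall t, mxIm f a b t = dI a b t}].
  exact: projT2 (cid (dIP a b)).
exists (fun t => \matrix_(a, b) (dR a b t +i* dI a b t)).
  have : {ae mu, forall t, forall a b, mxRe f a b t = dR a b t /\ mxIm f a b t = dI a b t}.
    apply: filter_forall => a; apply: filter_forall => b.
    have [_ _ h1] := MRP a b; have [_ _ h2] := MIP a b.
    by apply: ae_imp2 h1 h2 => t.
  apply: ae_imp => t h; apply/matrixP => a b; rewrite mxE; have [h1 h2] := h a b.
  by apply: complex_ext.
exists (\sum_a \sum_b (`|MR a b| + `|MI a b|)) => a b.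
have le : `|MR a b| + `|MI a b| <= \sum_a \sum_b (`|MR a b| + `|MI a b|).
  rewrite (bigD1 a)//= (bigD1 b)//= -addrA lerDl addr_ge0//; apply: sumr_ge0 => i _; rewrite ?addr_ge0//.
  by apply: sumr_ge0 => j _; rewrite addr_ge0.
have [cR bR _] := MRP a b; have [cI bI _] := MIP a b.
have eR : mxRe (fun t => \matrix_(a, b) (dR a b t +i* dI a b t)) a b = dR a b.
  by apply/funext => t; rewrite /mxRe mxE.
have eI : mxIm (fun t => \matrix_(a, b) (dR a b t +i* dI a b t)) a b = dI a b.
  by apply/funext => t; rewrite /mxIm mxE.
rewrite eR eI; split => // t; apply: le_trans le.
  by apply: le_trans (bR t) _; apply: le_trans (ler_norm _) _; rewrite lerDl.
by apply: le_trans (bI t) _; apply: le_trans (ler_norm _) _; rewrite lerDr.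
Qed.

Lemma modulusD f g : mL2 f -> mL2 g -> modulus f -> modulus g -> modulus (fun t => f t + g t).
Proof.
move=> hf hg [A A0 fA] [B B0 gB]; exists (A + B); first exact: addr_ge0.
move=> q h q0 q1 hq; rewrite mulrDl.
rewrite (_ : (fun t => _) = fun t => (f (t + h) - f t) + (g (t + h) - g t)); last first.
  by apply/funext => t; rewrite opprD addrACA.
apply: le_trans (nrmD (mL2_incr h hf) (mL2_incr h hg)) _.
by apply: lerD; [exact: fA|exact: gB].
Qed.

Lemma modulus_lipschitz f V : 0 <= V -> (forall h, nrm (fun t => f (t + h) - f t) <= V * `|h|) -> modulus f.
Proof.
move=> V0 fV; exists V => // q h q0 q1 hq; apply: le_trans (fV h) _.
rewrite ler_wpM2l//; apply: le_trans hq _; exact: exprn_antitone.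
Qed.

Lemma bounded_continuous_multiplier f : mx_measurable f -> bounded_continuous f -> exists K, multiplier K f.
Proof.
move=> mf [d fd [M dM]]; exists (n%:R * (2 * `|M|)); split => //.
apply: ae_imp fd => t ->; apply: mxfrob_le_entries => [|a b]; first by rewrite mulr_ge0.
have [_ _ /(_ t) h1 /(_ t) h2] := dM a b; move: h1 h2; rewrite /mxRe /mxIm.
case: (d t a b) => p q /= hp hq; rewrite lecR.
have {}hp := le_trans hp (ler_norm M); have {}hq := le_trans hq (ler_norm M).
have K0 : 0 <= `|M| by [].
rewrite -[leRHS]ger0_norm ?mulr_ge0// -sqrtr_sqr ler_wsqrtr//.
rewrite -(real_normK (num_real p)) -(real_normK (num_real q)).
have := normr_ge0 p; have := normr_ge0 q; nra.
Qed.

Lemma multiplier_shift K v h : multiplier K v -> multiplier K (fun t => v (t + h)).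
Proof.
move=> [mv vK]; split; first by move=> a b; have [h1 h2] := mv a b; split; [exact: (measurable_comp_shift h h1)|exact: (measurable_comp_shift h h2)].
have : {ae mu, forall t, mxfrob (v t) <= K} by [].
move=> [N [mN N0 hN]]; exists ((fun t => t + h) @^-1` N); split.
- by rewrite -[X in measurable X]setTI; exact: (@measurable_shift R h).
- by have := lebesgue_measure_shift h mN; rewrite [X in _ = X -> _]N0.
- by move=> t /= ht; apply: hN.
Qed.

Lemma mL2_adj f : mL2 f -> mL2 (fun t => adjmx (f t)).
Proof.
move=> [mf sf]; split; first exact: mx_measurable_adj.
by under eq_fun do rewrite mxfrob_adj.
Qed.

Lemma nrm_adj f : nrm (fun t => adjmx (f t)) = nrm f.
Proof.
have E : ip (fun t => adjmx (f t)) (fun t => adjmx (f t)) = ip f f.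
  by rewrite !ipE; apply: eq_Rintegral => t _; rewrite !rdot_frob mxfrob_adj.
by rewrite /nrm E.
Qed.

Lemma mul_left_adj f g : (fun t => f t *m g t) = fun t => adjmx (adjmx (g t) *m adjmx (f t)).
Proof. by apply/funext => t; rewrite adjmxM !adjmxK. Qed.

Lemma mL2_mul_left K f g : multiplier K f -> mL2 g -> mL2 (fun t => f t *m g t).
Proof. by move=> fK hg; rewrite mul_left_adj; exact: mL2_adj (mL2_mul (mL2_adj hg) (multiplier_adj fK)). Qed.

Lemma nrm_mul_left K f g : multiplier K f -> mL2 g ->
  nrm (fun t => f t *m g t) <= n%:R ^+ 2 * K * nrm g.
Proof.
move=> fK hg; rewrite mul_left_adj nrm_adj -(nrm_adj g).
exact: nrm_mul (mL2_adj hg) (multiplier_adj fK).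
Qed.

Lemma modulus_mul f v K L : mL2 f -> multiplier K f -> mL2 v -> multiplier L v ->
  modulus f -> modulus v -> modulus (fun t => f t *m v t).
Proof.
move=> hf fK hv vL [A A0 fA] [B B0 gB].
have K0 := multiplier_ge0 fK; have L0 := multiplier_ge0 vL.
exists (n%:R ^+ 2 * K * B + n%:R ^+ 2 * L * A); first by rewrite addr_ge0// !mulr_ge0// exprn_ge0.
move=> q h q0 q1 hq; rewrite mulrDl.
have fKs := multiplier_shift h fK.
rewrite (_ : (fun t => _) = fun t => f (t + h) *m (v (t + h) - v t) + (f (t + h) - f t) *m v t); last first.
  by apply/funext => t; rewrite mulmxBr mulmxBl addrA subrK.
have hf1 := mL2_incr h hf; have hv1 := mL2_incr h hv.
apply: le_trans (nrmD (mL2_mul_left fKs hv1) (mL2_mul hf1 vL)) _; apply: lerD.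
  apply: le_trans (nrm_mul_left fKs hv1) _; rewrite -[leRHS]mulrA ler_wpM2l ?gB//.
  by rewrite mulr_ge0// exprn_ge0.
apply: le_trans (nrm_mul hf1 vL) _; rewrite -[leRHS]mulrA ler_wpM2l ?fA//.
by rewrite mulr_ge0// exprn_ge0.
Qed.

Lemma solves_shift K c v g m h : weight K c v -> mL2 g -> solves v g m ->
  solves (fun t => v (t + h)) (fun t => g (t + h)) (fun t => m (t + h)).
Proof.
move=> [vK _ _ _] hg [Hmm sm]; split; first exact: Hm_shift.
move=> p hp; have hps := Hm_shift (- h) hp.
have hF : mL2 (fun t => m t *m v t + g t) by apply: mL2D => //; exact: mL2_mul Hmm.1 vK.
have := ip_shift h hF hps.1; rewrite sm// => <-.
by congr ip; apply/funext => t; rewrite addrK.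
Qed.

(** Subtract the translated problem, keeping the weight in place: the whole change of weight moves
    into the source, multiplied by the translated solution. *)
Lemma solves_incr K c v g m h : weight K c v -> mL2 g -> solves v g m ->
  solves v (fun t => (g (t + h) - g t) + m (t + h) *m (v (t + h) - v t)) (fun t => m (t + h) - m t).
Proof.
move=> wv hg sm; have [H1 e1] := solves_shift h wv hg sm; have [H0 e0] := sm.
have vK : multiplier K v by case: wv.
split; first exact: HmB.
move=> p hp; rewrite (_ : (fun t => _) = fun t =>
    (m (t + h) *m v (t + h) + g (t + h)) - (m t *m v t + g t)).
  have h1 : mL2 (fun t => m (t + h) *m v (t + h) + g (t + h)).
    by apply: mL2D; [exact: mL2_mul H1.1 (multiplier_shift h vK)|exact: mL2_shift].
  have h0 : mL2 (fun t => m t *m v t + g t) by exact: (mL2D (mL2_mul H0.1 vK) hg).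
  by rewrite (ipBl h1 h0 hp.1) e1// e0// subr0.
apply/funext => t; rewrite mulmxBl mulmxBr.
move: (m (t + h) *m v (t + h)) (m (t + h) *m v t) (m t *m v t) (g (t + h)) (g t) => a b d e f.
by rewrite opprD !addrA; apply/matrixP => i j; rewrite !mxE; ring.
Qed.

Lemma nrm_entries f (D : R) : mL2 f -> 0 <= D ->
  (forall a b, (sqint mu (mxRe f a b) <= (D ^+ 2)%:E)%E) ->
  (forall a b, (sqint mu (mxIm f a b) <= (D ^+ 2)%:E)%E) -> nrm f <= 2 * n%:R * D.
Proof.
move=> hf D0 fR fI; apply: nrm_le_sqint; rewrite ?mulr_ge0//.
apply: le_trans (sqint_frob_le hf.1 fR fI) _; rewrite lee_fin.
have -> : (2 * n%:R * D) ^+ 2 = n%:R ^+ 2 * (2 * (2 * D ^+ 2)) by ring.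
by rewrite ler_wpM2l ?exprn_ge0// ler_wpM2l// ler_peMl ?ler1n// sqr_ge0.
Qed.

Lemma mxfrob_entries (A : MM) (K : R) : 0 <= K -> (forall a b, `|complex.Re (A a b)| <= K) ->
  (forall a b, `|complex.Im (A a b)| <= K) -> mxfrob A <= n%:R * (2 * K).
Proof.
move=> K0 hR hI; apply: mxfrob_le_entries => [|a b]; first by rewrite mulr_ge0.
have := hR a b; have := hI a b; case: (A a b) => p q /= hq hp; rewrite lecR.
rewrite -[leRHS]ger0_norm ?mulr_ge0// -sqrtr_sqr ler_wsqrtr//.
rewrite -(real_normK (num_real p)) -(real_normK (num_real q)).
have := normr_ge0 p; have := normr_ge0 q; nra.
Qed.

(* Splitting the shifted solution into its average over a window of length q^2 and the rest
   raises the L2 exponent from 1/2 (direct coercivity estimate) to 2/3. *)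
Lemma modulus_solves K c v g m C V : weight K c v -> mL2 g -> modulus g -> solves v g m ->
  0 <= C -> 0 <= V ->
  (forall h, mL2 (fun t => v (t + h) - v t)) ->
  (forall h, nrm (fun t => v (t + h) - v t) <= V * `|h|) ->
  (forall q h, 0 < q -> q <= 1 -> `|h| <= q ^+ 6 -> multiplier (C * q ^+ 3) (fun t => v (t + h) - v t)) ->
  modulus m.
Proof.
move=> wv hg [B B0 gB] sm C0 V0 hv vV vC; have c0 : 0 < c by case: wv.
have hm : mL2 m by case: sm => -[].
have n0 : 0 <= n%:R ^+ 2 :> R by rewrite exprn_ge0.
have N0 := nrm_ge0 m.
have hmv h q : 0 < q -> q <= 1 -> `|h| <= q ^+ 6 -> mL2 (fun t => m (t + h) *m (v (t + h) - v t)).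
  by move=> q0 q1 hq; exact: mL2_mul (mL2_shift h hm) (vC q h q0 q1 hq).
have base h q : 0 < q -> q <= 1 -> `|h| <= q ^+ 6 -> nrm (fun t => m (t + h) - m t) <=
    (B * q ^+ 4 + nrm (fun t => m (t + h) *m (v (t + h) - v t))) / c.
  move=> q0 q1 hq; have hmv' := hmv h q q0 q1 hq; have hg1 := mL2_incr h hg.
  apply: le_trans (solves_nrm wv (mL2D hg1 hmv') (solves_incr h wv hg sm)) _.
  rewrite ler_pM2r ?invr_gt0//; apply: le_trans (nrmD hg1 hmv') _.
  by rewrite lerD2r; exact: gB.
pose C1 := (B + n%:R ^+ 2 * C * nrm m) / c.
have C10 : 0 <= C1 by rewrite divr_ge0 ?(ltW c0)// addr_ge0// !mulr_ge0.
(* Exponent 1/2: the increment of [v] is bounded in the supremum norm by |h|^(1/2), while [m]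
   contributes only its L2 norm. *)
have half h p : 0 < p -> p <= 1 -> `|h| <= p ^+ 6 -> nrm (fun t => m (t + h) - m t) <= C1 * p ^+ 3.
  move=> p0 p1 hp; apply: le_trans (base h p p0 p1 hp) _.
  rewrite /C1 mulrAC ler_pM2r ?invr_gt0// mulrDl; apply: lerD.
    by rewrite ler_wpM2l//; exact: exprn_antitone.
  apply: le_trans (nrm_mul (mL2_shift h hm) (vC p h p0 p1 hp)) _.
  by rewrite nrm_shift// [leRHS](_ : _ = n%:R ^+ 2 * (C * p ^+ 3) * nrm m)//; ring.
move: C1 C10 half => C1 C10 half.
have mcont a b : (forall e, 0 < e -> exists2 d, 0 < d & forall s, `|s| < d ->
     (sqint mu (fun t => mxRe m a b (t + s) - mxRe m a b t)%R <= e%:E)%E /\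
     (sqint mu (fun t => mxIm m a b (t + s) - mxIm m a b t)%R <= e%:E)%E).
  move=> e e0; have m0 : 0 < Num.min 1 e by rewrite lt_min ltr01.
  have B1 : 0 < C1 ^+ 2 + 1 by rewrite ltr_wpDl ?sqr_ge0.
  pose q := Num.min 1 (Num.min 1 e / (C1 ^+ 2 + 1)).
  have q0 : 0 < q by rewrite lt_min ltr01 divr_gt0.
  have q1 : q <= 1 by rewrite ge_min lexx.
  exists (q ^+ 6); first by rewrite exprn_gt0.
  move=> s /ltW hs; have Cq : 0 <= C1 * q ^+ 3 by rewrite mulr_ge0 ?exprn_ge0// ltW.
  have := sqint_entry_le a b (mL2_incr s hm) Cq (half s q q0 q1 hs).
  rewrite (_ : mxRe _ a b = fun t => mxRe m a b (t + s) - mxRe m a b t); last first.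
    by apply/funext => t; rewrite /mxRe !mxE ReB.
  rewrite (_ : mxIm _ a b = fun t => mxIm m a b (t + s) - mxIm m a b t); last first.
    by apply/funext => t; rewrite /mxIm !mxE ImB.
  have le : (C1 * q ^+ 3) ^+ 2 <= e.
    rewrite exprMn -exprM; apply: (@le_trans _ _ (C1 ^+ 2 * q)).
      by rewrite ler_wpM2l ?sqr_ge0// -[leRHS]expr1; exact: exprn_antitone.
    have qe : q * (C1 ^+ 2 + 1) <= e.
      rewrite -ler_pdivlMr// /q ge_min; apply/orP; right.
      by rewrite ler_pM2r ?invr_gt0// ge_min lexx orbT.
    by rewrite mulrDr mulr1 in qe; rewrite mulrC; apply: le_trans qe; rewrite lerDl ltW.
  by move=> [h1 h2]; split; [apply: le_trans h1 _|apply: le_trans h2 _]; rewrite lee_fin.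
exists ((B + (2 * n%:R ^+ 3 * nrm m * V + 2 * n%:R ^+ 3 * C * C1)) / c).
  by rewrite divr_ge0 ?(ltW c0)// !addr_ge0// !mulr_ge0 ?exprn_ge0.
move=> q h q0 q1 hq; apply: le_trans (base h q q0 q1 hq) _.
rewrite [leRHS]mulrAC ler_pM2r ?invr_gt0// mulrDl lerD2l.
(* At the window length q^2 = p^6 the exponent 1/2 estimate gives [C1 * q] for the distance of [m]
   to its average. *)
have [p [p0 p1 pq]] : exists p : R, [/\ 0 < p, p <= 1 & p ^+ 3 = q] by exact: root_unit_interval.
pose r := q ^+ 2; have r0 : 0 < r by rewrite exprn_gt0.
have rp : r = p ^+ 6 by rewrite /r -pq -exprM.
pose A t : MM := \matrix_(a, b) (average r (mxRe m a b) t +i* average r (mxIm m a b) t).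
have AR a b : mxRe A a b = average r (mxRe m a b) by apply/funext => t; rewrite /mxRe mxE.
have AI a b : mxIm A a b = average r (mxIm m a b) by apply/funext => t; rewrite /mxIm mxE.
have mAR a b : measurable_fun setT (average r (mxRe m a b)).
  apply: continuous_measurable_fun; apply: average_continuous => //; first exact: mL2_Re.
  by move=> e e0; have [d d0 hd] := mcont a b e e0; exists d => // s /hd[].
have mAI a b : measurable_fun setT (average r (mxIm m a b)).
  apply: continuous_measurable_fun; apply: average_continuous => //; first exact: mL2_Im.
  by move=> e e0; have [d d0 hd] := mcont a b e e0; exists d => // s /hd[].
have mA : mx_measurable A by move=> a b; rewrite AR AI; split.
have Nq : 0 <= nrm m / q by rewrite divr_ge0// ltW.
(* The loss r^(-1/2) is 1 / q for r = q^2. *)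
have avle (f : R -> R) t : sqintegrable mu f -> (sqint mu f <= (nrm m ^+ 2)%:E)%E -> `|average r f t| <= nrm m / q.
  move=> hf fN; rewrite -[leRHS]ger0_norm// -ler_sqr ?nnegrE// !real_normK ?num_real//.
  apply: le_trans (average_sqr_le t r0 hf fN) _.
  by rewrite /r exprMn exprVn mulrC.
pose KA := n%:R * (2 * (nrm m / q)).
have KA0 : 0 <= KA by apply: mulr_ge0 => //; exact: mulr_ge0.
have AK : multiplier KA A.
  split => //; apply: ae_all => t; apply: mxfrob_entries => // a b; rewrite mxE /=.
    by apply: avle; [exact: mL2_Re|have [] := sqint_entry_le a b hm N0 (lexx _)].
  by apply: avle; [exact: mL2_Im|have [] := sqint_entry_le a b hm N0 (lexx _)].
have Cq : 0 <= C1 * q by rewrite mulr_ge0// ltW.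
have subR a b : (sqint mu (fun t => average r (mxRe m a b) t - mxRe m a b t)%R <= ((C1 * q) ^+ 2)%:E)%E /\
    (sqint mu (fun t => average r (mxIm m a b) t - mxIm m a b t)%R <= ((C1 * q) ^+ 2)%:E)%E.
  have key s : 0 <= s <= r -> (sqint mu (fun t => mxRe m a b (t + s) - mxRe m a b t)%R <= ((C1 * q) ^+ 2)%:E)%E /\
      (sqint mu (fun t => mxIm m a b (t + s) - mxIm m a b t)%R <= ((C1 * q) ^+ 2)%:E)%E.
    move=> /andP[s0 sr]; have hs : `|s| <= p ^+ 6 by rewrite ger0_norm// -rp.
    have h1 := half s p p0 p1 hs; rewrite pq in h1.
    have := sqint_entry_le a b (mL2_incr s hm) Cq h1.
    rewrite (_ : mxRe _ a b = fun t => mxRe m a b (t + s) - mxRe m a b t); last first.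
      by apply/funext => t; rewrite /mxRe !mxE ReB.
    by rewrite (_ : mxIm _ a b = fun t => mxIm m a b (t + s) - mxIm m a b t)//;
      apply/funext => t; rewrite /mxIm !mxE ImB.
  split; apply: average_sub_sqint => //.
  - exact: mL2_Re.
  - by move=> s /key[].
  - exact: mL2_Im.
  - by move=> s /key[].
have sR a b : sqintegrable mu (fun t => average r (mxRe m a b) t - mxRe m a b t).
  split; last by apply: le_lt_trans (subR a b).1 _; rewrite ltry.
  apply: measurable_funB; [exact: mAR|exact: (hm.1 a b).1].
have sI a b : sqintegrable mu (fun t => average r (mxIm m a b) t - mxIm m a b t).
  split; last by apply: le_lt_trans (subR a b).2 _; rewrite ltry.
  apply: measurable_funB; [exact: mAI|exact: (hm.1 a b).2].
have eR a b : mxRe (fun t => A t - m t) a b = fun t => average r (mxRe m a b) t - mxRe m a b t.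
  by apply/funext => t; rewrite /mxRe !mxE ReB.
have eI a b : mxIm (fun t => A t - m t) a b = fun t => average r (mxIm m a b) t - mxIm m a b t.
  by apply/funext => t; rewrite /mxIm !mxE ImB.
have hAm : mL2 (fun t => A t - m t) by apply: mL2_entries => a b; rewrite ?eR ?eI.
have Am : nrm (fun t => A t - m t) <= 2 * n%:R * (C1 * q).
  by apply: nrm_entries => // a b; rewrite ?eR ?eI; have [] := subR a b.
have As := multiplier_shift h AK.
(* The averaged part costs (1 / q) q^6, with the L2 Lipschitz bound of [v]; the remainder costs q
   q^3, with its supremum bound. Both are at most a multiple of q^4. *)
rewrite (_ : (fun t => m (t + h) *m _) = fun t => A (t + h) *m (v (t + h) - v t) -
    (A (t + h) - m (t + h)) *m (v (t + h) - v t)); last first.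
  by apply/funext => t; rewrite mulmxBl opprB addrCA subrr addr0.
have hAs := mL2_shift h hAm; have vCh := vC q h q0 q1 hq.
apply: le_trans (nrmB (mL2_mul_left As (hv h)) (mL2_mul hAs vCh)) _; rewrite mulrDl; apply: lerD.
  apply: le_trans (nrm_mul_left As (hv h)) _.
  apply: (@le_trans _ _ (n%:R ^+ 2 * KA * (V * q ^+ 6))).
    apply: ler_wpM2l; first exact: mulr_ge0.
    by apply: le_trans (vV h) _; exact: ler_wpM2l.
  rewrite [leLHS](_ : _ = 2 * n%:R ^+ 3 * nrm m * V * q ^+ 5); last first.
    by rewrite /KA; field; rewrite gt_eqF.
  apply: ler_wpM2l; last exact: exprn_antitone.
  apply: mulr_ge0 => //; apply: mulr_ge0 => //; apply: mulr_ge0 => //; exact: exprn_ge0.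
apply: le_trans (nrm_mul hAs vCh) _.
have -> : nrm (fun t => A (t + h) - m (t + h)) = nrm (fun t => A t - m t) by exact: (nrm_shift h hAm).
apply: (@le_trans _ _ (n%:R ^+ 2 * (C * q ^+ 3) * (2 * n%:R * (C1 * q)))).
  apply: ler_wpM2l => //; apply: mulr_ge0 => //; apply: mulr_ge0 => //.
  by apply: exprn_ge0; exact: ltW.
by rewrite le_eqVlt; apply/orP; left; apply/eqP; ring.
Qed.

End modulus_of_continuity.

(** * Increments of primitives of L2 functions, and Landau interpolation *)

Section absolutely_continuous.
Context (R : realType) (n : nat).
Local Notation MM := 'M[R[i]]_n.
Local Notation mu := (@lebesgue_measure R).

Lemma primitive_increment (u du : R -> R) : sqintegrable mu du ->
  (forall a b, a <= b -> u b - u a = \int[mu]_(x in `[a, b]) du x) ->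
  forall h t, 0 < h -> u (t + h) - u t = h * average h du t.
Proof.
move=> hd ac h t h0; rewrite ac ?lerDl ?ltW// averageE mulVKf ?gt_eqF//.
pose g x : R := \1_(`[t, t + h]%classic) x * du x.
have mg : measurable_fun setT g by apply: measurable_funM; [exact: measurable_indic|exact: hd.1].
have -> : dotL2 mu (\1_(`[0, h]%classic) : R -> R) (fun s => du (t + s)) = \int[mu]_x g x.
  rewrite -(Rintegral_shift t mg); apply: eq_Rintegral => s _.
  by rewrite /g [s + t]addrC !indicE !mem_setE !in_itv /= lerDl lerD2l.
rewrite Rintegral_mkcond; apply: eq_Rintegral => s _.
by rewrite patchE /g indicE; case: (s \in _); rewrite ?mul1r ?mul0r.
Qed.

(** The increment is [h] times an average of the derivative: the pointwise bound for averages gives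
    exponent 1/2 in the supremum norm, Minkowski gives exponent 1 in L2. *)
Lemma primitive_increment_bounds (u du : R -> R) (V : R) : sqintegrable mu du -> measurable_fun setT u ->
  (forall a b, a <= b -> u b - u a = \int[mu]_(x in `[a, b]) du x) ->
  0 <= V -> (sqint mu du <= (V ^+ 2)%:E)%E -> forall h, 0 < h ->
  (forall t, `|u (t + h) - u t| <= V * Num.sqrt h) /\
  (sqint mu (fun t => u (t + h) - u t)%R <= ((h * V) ^+ 2)%:E)%E.
Proof.
move=> hd mu_ ac V0 dV h h0; have E := primitive_increment hd ac _ h0.
have s0 : 0 <= Num.sqrt h by exact: sqrtr_ge0.
split.
  move=> t; have VS : 0 <= V * Num.sqrt h by exact: mulr_ge0.
  rewrite -[leRHS]ger0_norm// -ler_sqr ?nnegrE// !real_normK ?num_real// E exprMn.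
  apply: le_trans (ler_wpM2l (sqr_ge0 h) (average_sqr_le t h0 hd dV)) _.
  rewrite [leRHS]exprMn sqr_sqrtr ?(ltW h0)// mulrA expr2 mulfK ?gt_eqF// mulrC//.
rewrite exprMn; apply: (@sqint_le_of_integral_bound _ (fun s t => du (t + s)) _ h (V ^+ 2) h0).
- apply: (measurableT_comp hd.1); apply: measurable_funD; [exact: measurable_snd|exact: measurable_fst].
- by apply: measurable_funB => //; exact: measurable_comp_shift.
- by move=> s _; rewrite sqint_shift//; exact: hd.1.
apply: ae_all => t; rewrite E /average mulVKf ?gt_eqF//.
have i1 := sqintegrable_itv 0 h (sqintegrable_shiftl t hd).
rewrite /Rintegral -[X in (X <= _)%E]abse_EFin fineK; last exact: integrable_fin_num.
have /integrableP[m1 _] := i1.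
by apply: le_abse_integral => //; exact: measurable_itv.
Qed.

Lemma ac_increment (v dv : R -> MM) V : mx_measurable v -> ac_deriv v dv -> mL2 dv -> nrm dv <= V ->
  forall h, [/\ mL2 (fun t => v (t + h) - v t), nrm (fun t => v (t + h) - v t) <= 2 * n%:R * V * `|h| &
    forall t, mxfrob (v (t + h) - v t) <= n%:R * (2 * V) * Num.sqrt `|h|].
Proof.
move=> mv ac hd dV; have V0 : 0 <= V := le_trans (nrm_ge0 _) dV.
have acR a b x y : x <= y -> mxRe v a b y - mxRe v a b x = \int[mu]_(t in `[x, y]) mxRe dv a b t.
  by move=> /ac[_] /matrixP/(_ a b); rewrite !mxE => /(congr1 (@complex.Re R)); rewrite ReB.
have acI a b x y : x <= y -> mxIm v a b y - mxIm v a b x = \int[mu]_(t in `[x, y]) mxIm dv a b t.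
  by move=> /ac[_] /matrixP/(_ a b); rewrite !mxE => /(congr1 (@complex.Im R)); rewrite ImB.
have pos h : 0 < h -> [/\ mL2 (fun t => v (t + h) - v t), nrm (fun t => v (t + h) - v t) <= 2 * n%:R * V * `|h| &
    forall t, mxfrob (v (t + h) - v t) <= n%:R * (2 * V) * Num.sqrt `|h|].
  move=> h0; rewrite (ger0_norm (ltW h0)).
  have bR a b := primitive_increment_bounds (mL2_Re a b hd) (mv a b).1 (acR a b) V0 (sqint_entry_le a b hd V0 dV).1 h0.
  have bI a b := primitive_increment_bounds (mL2_Im a b hd) (mv a b).2 (acI a b) V0 (sqint_entry_le a b hd V0 dV).2 h0.
  have eR a b : mxRe (fun t => v (t + h) - v t) a b = fun t => mxRe v a b (t + h) - mxRe v a b t.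
    by apply/funext => t; rewrite /mxRe !mxE ReB.
  have eI a b : mxIm (fun t => v (t + h) - v t) a b = fun t => mxIm v a b (t + h) - mxIm v a b t.
    by apply/funext => t; rewrite /mxIm !mxE ImB.
  have hm : mL2 (fun t => v (t + h) - v t).
    apply: mL2_entries => a b; rewrite ?eR ?eI; split.
    - by apply: measurable_funB; [apply: measurable_comp_shift|]; exact: (mv a b).1.
    - by apply: le_lt_trans (bR a b).2 _; rewrite ltry.
    - by apply: measurable_funB; [apply: measurable_comp_shift|]; exact: (mv a b).2.
    - by apply: le_lt_trans (bI a b).2 _; rewrite ltry.
  split=> //.
    rewrite -mulrA [V * h]mulrC; apply: nrm_entries => // [|a b|a b]; rewrite ?eR ?eI.
    - by rewrite mulr_ge0// ltW.
    - by have [] := bR a b.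
    - by have [] := bI a b.
  move=> t; rewrite -!mulrA; apply: mxfrob_entries; first by rewrite mulr_ge0.
    by move=> a b; have := (bR a b).1 t; rewrite !mxE ReB.
  by move=> a b; have := (bI a b).1 t; rewrite !mxE ImB.
(* A negative step is the opposite of the positive one taken from the translated point. *)
move=> h; have [h0|h0|<-] := ltgtP 0 h; first exact: pos.
  have h1 : 0 < - h by rewrite oppr_gt0.
  have [p1 p2 p3] := pos _ h1; rewrite normrN in p2 p3.
  have E : (fun t => v (t + h) - v t) = fun t => (0 - (v (t + h - h) - v (t + h))).
    by apply/funext => t; rewrite addrK sub0r opprB.
  have p1s := mL2_shift h p1.
  split.
  - by rewrite E; exact: (mL2B (mL2_0 R n) p1s).
  - rewrite nrmBC (_ : (fun t => _) = fun t => (fun t => v (t - h) - v t) (t + h)); last first.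
      by apply/funext => t; rewrite addrK.
    by have -> : nrm (fun t => v (t + h - h) - v (t + h)) = nrm (fun t => v (t - h) - v t) by exact: (nrm_shift h p1).
  - by move=> t; have := p3 (t + h); rewrite addrK -mxfrobN opprB.
have Z : (fun t => v (t + 0) - v t) = fun=> 0 by apply/funext => t; rewrite addr0 subrr.
split; first by rewrite Z; exact: mL2_0.
  by rewrite Z normr0 mulr0 /nrm ip0l sqrtr0.
by move=> t; rewrite addr0 subrr mxfrob0 normr0 sqrtr0 mulr0.
Qed.

Lemma mx_is_deriveD (F G : R -> MM) x d e : mx_is_derive F x d -> mx_is_derive G x e ->
  mx_is_derive (fun t => F t + G t) x (d + e).
Proof.
move=> hF hG a b; have [f1 f2] := hF a b; have [g1 g2] := hG a b; rewrite mxE ReD ImD; split.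
  rewrite (_ : mxRe _ a b = mxRe F a b \+ mxRe G a b); first exact: is_deriveD.
  by apply/funext => t; rewrite /mxRe /= mxE ReD.
rewrite (_ : mxIm _ a b = mxIm F a b \+ mxIm G a b); first exact: is_deriveD.
by apply/funext => t; rewrite /mxIm /= mxE ImD.
Qed.

Lemma mx_is_derive_linear (A : MM) x : mx_is_derive (fun s => s%:C *: A) x A.
Proof.
have key (c : R) : is_derive x (1 : R) (fun s => s * c) c.
  apply/is_derive1P => e e0; exists 1 => // y _.
  by rewrite -mulrBl [c * _]mulrC subrr normr0 mulr_ge0// ltW.
move=> a b; split.
  rewrite (_ : mxRe _ a b = fun s => s * complex.Re (A a b)); first exact: key.
  by apply/funext => s; rewrite /mxRe mxE ReM /= mul0r subr0.
rewrite (_ : mxIm _ a b = fun s => s * complex.Im (A a b)); first exact: key.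
by apply/funext => s; rewrite /mxIm mxE ImM /= mul0r addr0.
Qed.

Lemma multiplierD K L (f g : R -> MM) : multiplier K f -> multiplier L g ->
  multiplier (K + L) (fun t => f t + g t).
Proof.
move=> [mf fK] [mg gL]; split; first exact: mx_measurableD.
by apply: ae_imp2 fK gL => t h1 h2; apply: le_trans (mxfrobD _ _) _; exact: lerD.
Qed.

Lemma multiplierZ K (c : R) (f : R -> MM) : multiplier K f -> multiplier (`|c| * K) (fun t => c%:C *: f t).
Proof.
move=> [mf fK]; split; first exact: mx_measurableZ.
by apply: ae_imp fK => t h; rewrite mxfrobZ ler_wpM2l.
Qed.

(* Landau: the symmetric difference quotient of step q^2 approximates the derivative to order q^4. *)
Lemma interpolated_modulus (f0 f1 f2 f3 : R -> R -> MM) K N V :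
  (forall s, mL2 (f0 s)) -> (forall s, mL2 (f1 s)) -> (forall s, mL2 (f2 s)) -> (forall s, mL2 (f3 s)) ->
  (forall s, multiplier K (f1 s)) -> (forall s, multiplier K (f2 s)) -> (forall s, multiplier K (f3 s)) ->
  (forall s l, mx_is_derive (f0 ^~ l) s (f1 s l)) -> (forall s l, mx_is_derive (f1 ^~ l) s (f2 s l)) ->
  (forall s l, mx_is_derive (f2 ^~ l) s (f3 s l)) ->
  (forall s, nrm (f3 s) <= N) -> 0 <= V ->
  (forall s h, `|s| <= 1 -> nrm (fun t => f0 s (t + h) - f0 s t) <= V * `|h|) ->
  modulus (f1 0).
Proof.
move=> h0 h1 h2 h3 K1 K2 K3 d0 d1 d2 fN V0 fV.
have N0 : 0 <= N := le_trans (nrm_ge0 _) (fN 0).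
(* The remainder f0(s) - f0(-s) - 2 s f1(0), written in the shape that the affine chain rule
   produces; [R1] and [R2] are its derivatives. All three vanish at 0, so the bound on [f3]
   integrates to orders S, S^2 and S^3. *)
pose R0 s l := f0 s l + (-1)%:C *: f0 (0 + -1 * s) l + s%:C *: ((-2)%:C *: f1 0 l).
pose R1 s l := f1 s l + (-1 * -1)%:C *: f1 (0 + -1 * s) l + (-2)%:C *: f1 0 l.
pose R2 s l := f2 s l + (-1 * -1 * -1)%:C *: f2 (0 + -1 * s) l.
have hR0 s : mL2 (R0 s) by apply: mL2D; [apply: mL2D => //|]; apply: mL2Z => //; exact: mL2Z.
have hR1 s : mL2 (R1 s) by apply: mL2D; [apply: mL2D => //|]; exact: mL2Z.
have hR2 s : mL2 (R2 s) by apply: mL2D => //; exact: mL2Z.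
have dR0 s l : mx_is_derive (R0 ^~ l) s (R1 s l).
  apply: mx_is_deriveD; last exact: mx_is_derive_linear.
  by apply: mx_is_deriveD => //; exact: (@mx_is_derive_affine _ _ (f0 ^~ l)).
have dR1 s l : mx_is_derive (R1 ^~ l) s (R2 s l).
  apply: mx_is_derive_addcst; apply: mx_is_deriveD => //.
  exact: (@mx_is_derive_affine _ _ (f1 ^~ l)).
have KR1 s : multiplier (K + `|-1 * -1 : R| * K + `|-2 : R| * K) (R1 s).
  by apply: multiplierD; [apply: multiplierD => //|]; exact: multiplierZ.
have KR2 s : multiplier (K + `|-1 * -1 * -1 : R| * K) (R2 s) by apply: multiplierD => //; exact: multiplierZ.
have b2 S r : 0 <= r <= S -> nrm (R2 r) <= 4 * n%:R * N * S.
  move=> /andP[r0 rS]; have := mx_increment_nrm h2 d2 K3 h3 fN (- r) r.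
  rewrite opprK (ger0_norm (addr_ge0 r0 r0)) => h.
  rewrite (_ : R2 r = fun l => f2 r l - f2 (- r) l); last first.
    by apply/funext => l; rewrite /R2 add0r mulN1r mulrNN mulr1 mulN1r rmorphN scaleN1r.
  apply: le_trans h _; rewrite (_ : 4 * n%:R * N * S = 2 * n%:R * N * (S + S)); last by ring.
  by rewrite ler_wpM2l ?mulr_ge0// lerD.
have b1 S r : 0 <= r <= S -> nrm (R1 r) <= 8 * n%:R ^+ 2 * N * S ^+ 2.
  move=> /andP[r0 rS]; have S0 := le_trans r0 rS.
  have := @mx_increment_nrm_itv _ _ R1 R2 (4 * n%:R * N * S) _ 0 r r0 hR1 dR1 KR2 hR2.
  rewrite subr0 (_ : (fun l => R1 r l - R1 0 l) = R1 r); last first.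
    apply/funext => l; rewrite [R1 0 l](_ : _ = 0) ?subr0// /R1 mulr0 addr0 mulrNN mulr1.
    rewrite -[X in X + _ + _]scale1r -!scalerDl (_ : _ + _ = 0) ?scale0r//.
    by apply: complex_ext => /=; ring.
  move=> /(_ _)/le_trans; apply; first by move=> s /andP[s0 sr]; apply: b2; rewrite s0 (le_trans sr).
  rewrite [leRHS](_ : _ = 2 * n%:R * (4 * n%:R * N * S) * S); last by ring.
  by rewrite ler_wpM2l// !mulr_ge0.
have b0 S : 0 <= S -> nrm (R0 S) <= 16 * n%:R ^+ 3 * N * S ^+ 3.
  move=> S0; have := @mx_increment_nrm_itv _ _ R0 R1 (8 * n%:R ^+ 2 * N * S ^+ 2) _ 0 S S0 hR0 dR0 KR1 hR1.
  rewrite subr0 (_ : (fun l => R0 S l - R0 0 l) = R0 S); last first.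
    apply/funext => l; rewrite [R0 0 l](_ : _ = 0) ?subr0// /R0 mulr0 addr0 scale0r addr0.
    by rewrite rmorphN scaleN1r subrr.
  move=> /(_ _)/le_trans; apply; first by move=> s hs; exact: b1.
  by rewrite le_eqVlt; apply/orP; left; apply/eqP; ring.
exists (V + 16 * n%:R ^+ 3 * N); first by rewrite addr_ge0// !mulr_ge0// exprn_ge0.
move=> q h q0 q1 hq; pose S := q ^+ 2; have S0 : 0 < S by rewrite exprn_gt0.
have S1 : S <= 1 by rewrite exprn_ile1// ltW.
(* With S = q^2, dividing by 2 S turns both the Lipschitz increments of [f0], of size q^6, and the
   remainder, of size S^3, into q^4. *)
have E : f1 0 = fun l => ((2 * S)^-1)%:C *: (f0 S l - f0 (- S) l - R0 S l).
  apply/funext => l; rewrite /R0 add0r mulN1r rmorphN scaleN1r opprD addrA subrr add0r.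
  rewrite scalerN !scalerA -scaleNr; rewrite -[LHS]scale1r; congr (_ *: _).
  by apply: complex_ext; rewrite /= ; field; rewrite gt_eqF.
rewrite {1 2}E.
have hS := h0 S; have hSN := h0 (- S).
have hsum := mL2B (mL2B (mL2_incr h hS) (mL2_incr h hSN)) (mL2_incr h (hR0 S)).
rewrite (_ : (fun t => _) = fun t => ((2 * S)^-1)%:C *:
    ((f0 S (t + h) - f0 S t) - (f0 (- S) (t + h) - f0 (- S) t) - (R0 S (t + h) - R0 S t))); last first.
  apply/funext => t; rewrite -scalerBr; congr (_ *: _).
  by apply/matrixP => a b; rewrite !mxE; ring.
have S2 : 0 < 2 * S by rewrite mulr_gt0.
rewrite (nrmZ _ hsum) ger0_norm ?invr_ge0 ?(ltW S2)// ler_pdivrMl//.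
apply: le_trans (nrmB (mL2B (mL2_incr h hS) (mL2_incr h hSN)) (mL2_incr h (hR0 S))) _.
apply: (@le_trans _ _ (V * `|h| + V * `|h| + (16 * n%:R ^+ 3 * N * S ^+ 3 + 16 * n%:R ^+ 3 * N * S ^+ 3))).
  apply: lerD.
    apply: le_trans (nrmB (mL2_incr h hS) (mL2_incr h hSN)) _; apply: lerD; apply: fV.
      by rewrite ger0_norm// ltW.
    by rewrite normrN ger0_norm// ltW.
  apply: le_trans (nrmB (mL2_shift h (hR0 S)) (hR0 S)) _.
  have -> : nrm (fun t => R0 S (t + h)) = nrm (R0 S) by exact: (nrm_shift h (hR0 S)).
  by apply: lerD; exact: b0 (ltW S0).
have -> : 2 * S * ((V + 16 * n%:R ^+ 3 * N) * q ^+ 4) =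
    V * q ^+ 6 + V * q ^+ 6 + (16 * n%:R ^+ 3 * N * S ^+ 3 + 16 * n%:R ^+ 3 * N * S ^+ 3).
  by rewrite /S; ring.
by rewrite lerD2r lerD// ler_wpM2l.
Qed.

End absolutely_continuous.

(** * Moduli of continuity in the spectral variable for the scattering data *)

Section scattering_regularity.
Context (R : realType) (n k : nat) (hk : (7 <= k)%N) (v : R -> R -> R -> 'M[R[i]]_n)
  (hv : scattering_data k v).
Local Notation MM := 'M[R[i]]_n.
Local Notation mu := (@lebesgue_measure R).

(** One function of [(x, y)] controls both kinds of increment; its continuity is all that the
    hypothesis on the lambda derivative provides. *)
Lemma scattering_increment : exists V : R -> R -> R,
  [/\ forall x y, 0 <= V x y,
      forall x y h, [/\ mL2 (fun t => v x y (t + h) - v x y t),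
        nrm (fun t => v x y (t + h) - v x y t) <= V x y * `|h| &
        forall t, mxfrob (v x y (t + h) - v x y t) <= V x y * Num.sqrt `|h|] &
      continuous (fun p : R * R => V p.1 p.2)].
Proof.
have [dv [ac dL cV]] := sd_lambda hv.
have [M hM] := scattering_bounded hv.
pose W x y := fine (mxLnorm mu 2%:E (dv x y)).
have hW x y : mL2 (dv x y) /\ nrm (dv x y) <= W x y.
  apply: mxLnorm2_le; split; first by case: (dL x y).
  rewrite /W fineK// ge0_fin_numE; first by case: (dL x y).
  exact: Lnorm_ge0.
have W0 x y : 0 <= W x y := le_trans (nrm_ge0 _) (hW x y).2.
exists (fun x y => 2 * n%:R * W x y); split.
- by move=> x y; rewrite !mulr_ge0.
- move=> x y h; have [i1 i2 i3] := ac_increment (hM x y).1 (ac x y) (hW x y).1 (hW x y).2 h.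
  by split => // t; apply: le_trans (i3 t) _; rewrite mulrA [n%:R * 2]mulrC.
- by move=> p; apply: cvgMr; exact: cV.
Qed.

Lemma scattering_modulus x y : modulus (fun l => v x y l - 1%:M).
Proof.
have [V [V0 hV _]] := scattering_increment; apply: (modulus_lipschitz (V0 x y)) => h.
rewrite (_ : (fun t => _) = fun t => v x y (t + h) - v x y t); first by have [] := hV x y h.
by apply/funext => t; rewrite opprB addrA subrK.
Qed.

Lemma mx_is_derive_translate (F : R -> MM) c x d : mx_is_derive F (c + x) d ->
  mx_is_derive (fun t => F (c + t)) x d.
Proof.
move=> h; have := @mx_is_derive_affine _ _ F c 1 x d 1; rewrite !mul1r scale1r => /(_ h).
by congr (mx_is_derive _ _ _); apply/funext => t; rewrite scale1r mul1r.
Qed.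

Let three_le : (3 <= k - 4)%N.
Proof. by rewrite -(leq_add2r 4) subnK// (leq_trans _ hk). Qed.

(** The Lipschitz constant in lambda is not uniform over the plane; the interpolation only visits
    parameters in a compact segment. *)
Lemma line_bounded (V : R -> R) : continuous V -> exists M, forall s, `|s| <= 1 -> V s <= M.
Proof.
move=> cV; have [c _ hc] := @EVT_max R V (-1) 1 (ltW (lt_trans (ltrN10 R) ltr01)) (continuous_subspaceT cV).
by exists (V c) => s; rewrite ler_norml => hs; apply: hc; rewrite in_itv /=.
Qed.

(* [j] is 0 for the derivative in x and the order itself for the one in y. *)
Lemma wave_modulus (dir : bool) x y : modulus (wave v 1 (if dir then 0 else 1)%N x y).
Proof.
have [V [V0 hV cV]] := scattering_increment.
pose px (s : R) : R := if dir then x + s else x; pose py (s : R) : R := if dir then y else y + s.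
pose jj (m : nat) := if dir then 0%N else m.
have jm m : (jj m <= m)%N by rewrite /jj; case: (dir).
have [M hM] : exists M, forall s, `|s| <= 1 -> V (px s) (py s) <= M.
  apply: (line_bounded (V := fun s => V (px s) (py s))) => s.
  apply: (@continuous_comp _ _ _ (fun s => (px s, py s)) (fun p : R * R => V p.1 p.2)); last exact: cV.
  have c1 (c : R) : continuous (fun s => c + s).
    by move=> t; apply: cvgD; [exact: cvg_cst|exact: cvg_id].
  have cx : continuous px by rewrite /px; case: (dir); [exact: c1|move=> t; exact: cvg_cst].
  have cy : continuous py by rewrite /py; case: (dir); [move=> t; exact: cvg_cst|exact: c1].
  exact: (cvg_pair (cx s) (cy s)).
have wb m (mK : (m <= 3)%N) := wave_bounded hv (jm m) (leq_trans mK three_le).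
have [[K1 hK1] h1 _ _] := wb 1 isT; have [[K2 hK2] h2 _ _] := wb 2 isT.
have [[K3 hK3] h3 [N3 hN3] _] := wb 3 (leqnn _); have [_ h0 _ _] := wb 0 isT.
pose K := Num.max K1 (Num.max K2 K3).
have dw m s l : (m < 3)%N -> mx_is_derive (fun s => wave v m (jj m) (px s) (py s) l) s
    (wave v m.+1 (jj m.+1) (px s) (py s) l).
  move=> m3; have mK := leq_trans m3 three_le; rewrite /jj /px /py; case: (dir).
    by apply: (mx_is_derive_translate (F := fun t => wave v m 0 t y l)); exact: (wave_derive_x hv 0 (x + s) y l mK).
  by apply: (mx_is_derive_translate (F := fun t => wave v m m x t l)); exact: (wave_derive_y hv m x (y + s) l mK).
have := @interpolated_modulus _ _ (fun s => wave v 0 (jj 0) (px s) (py s))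
  (fun s => wave v 1 (jj 1) (px s) (py s)) (fun s => wave v 2 (jj 2) (px s) (py s))
  (fun s => wave v 3 (jj 3) (px s) (py s)) K N3 `|M|.
have -> : wave v 1 (jj 1) (px 0) (py 0) = wave v 1 (if dir then 0 else 1)%N x y.
  by rewrite /px /py /jj; case: (dir); rewrite addr0.
apply => //.
- by move=> s; apply: multiplierW (hK1 _ _); rewrite /K le_max lexx.
- by move=> s; apply: multiplierW (hK2 _ _); rewrite /K !le_max lexx orbT.
- by move=> s; apply: multiplierW (hK3 _ _); rewrite /K !le_max lexx !orbT.
- by move=> s l; exact: dw.
- by move=> s l; exact: dw.
- by move=> s l; exact: dw.
move=> s h s1; rewrite (_ : (fun t => _) = fun t => v (px s) (py s) (t + h) - v (px s) (py s) t); last first.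
  apply/funext => t; have -> : jj 0 = 0%N by rewrite /jj; case: (dir).
  by rewrite !(wave0 hv) opprB addrA subrK.
have [_ h4 _] := hV (px s) (py s) h; apply: le_trans h4 _; rewrite ler_wpM2r//.
by apply: le_trans (hM s s1) _; exact: ler_norm.
Qed.

Lemma scattering_modulus_solves x y K c g m : weight K c (v x y) -> mL2 g -> modulus g ->
  solves (v x y) g m -> modulus m.
Proof.
move=> wv hg mg sm; have [V [V0 hV _]] := scattering_increment.
apply: (modulus_solves wv hg mg sm (V0 x y) (V0 x y)) => [h|h|q h q0 q1 hq].
- by have [] := hV x y h.
- by have [] := hV x y h.
have [h1 _ h3] := hV x y h; split; first by case: h1.
apply: ae_all => t; apply: le_trans (h3 t) _; rewrite ler_wpM2l//.
apply: (@le_trans _ _ (Num.sqrt ((q ^+ 3) ^+ 2))); first by rewrite ler_wsqrtr// -exprM.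
by rewrite sqrtr_sqr ger0_norm// exprn_ge0// ltW.
Qed.

End scattering_regularity.

(** * The Riemann-Hilbert problem *)

Section boundary_values.
Context (R : realType) (n : nat).
Local Notation MM := 'M[R[i]]_n.
Local Notation C := R[i].
Local Notation mu := (@lebesgue_measure R).

Lemma normc_le_ReIm (z : C) (e : R) : `|complex.Re z| <= e -> `|complex.Im z| <= e -> `|z| <= (2 * e)%:C.
Proof.
case: z => p q /= hp hq; have e0 : 0 <= e := le_trans (normr_ge0 _) hp.
rewrite lecR -[leRHS]ger0_norm ?mulr_ge0// -sqrtr_sqr ler_wsqrtr//.
rewrite -(real_normK (num_real p)) -(real_normK (num_real q)).
have := normr_ge0 p; have := normr_ge0 q; nra.
Qed.

Lemma ReIm_le_normc (z : C) (e : R) : `|z| < e%:C -> `|complex.Re z| < e /\ `|complex.Im z| < e.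
Proof.
case: z => p q /=; rewrite ltcR => h; split; apply: le_lt_trans h; rewrite -sqrtr_sqr ler_wsqrtr//.
  by rewrite lerDl sqr_ge0.
by rewrite lerDr sqr_ge0.
Qed.

(** Positive elements of [R[i]] are real, so convergence in [R[i]] reduces to real estimates on
    squares. *)
Lemma cvg_within_complex (D : set (C^o)) (F : C -> C) (l : R) (w : C) :
  (forall e, 0 < e -> exists2 r, 0 < r & forall z : C, D z -> `|complex.Re z - l| < r ->
     `|complex.Im z| < r -> `|complex.Re (F z) - complex.Re w| <= e /\ `|complex.Im (F z) - complex.Im w| <= e) ->
  (fun z : C^o => F z : C^o) @ within D (nbhs (l%:C : C^o)) --> (w : C^o).
Proof.
move=> h; apply/cvgrPdist_le => e e0.
have eE : e = (complex.Re e)%:C.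
  by move: e0; rewrite ltcE /= => /andP[/eqP im0 _]; apply: complex_ext => //=.
have er0 : 0 < complex.Re e by move: e0; rewrite eE ltcR.
have e2 : 0 < complex.Re e / 2 by rewrite divr_gt0.
have [r r0 hr] := h _ e2; rewrite near_withinE; apply/nbhs_ballP.
exists (r%:C); first by rewrite /= ltcR.
move=> z /= hz Dz; have [] := @ReIm_le_normc (z - l%:C) r.
  by rewrite distrC; exact: hz.
rewrite ReB ImB /= subr0 => h1 h2; have [h3 h4] := hr z Dz h1 h2.
rewrite eE; have -> : complex.Re e = 2 * (complex.Re e / 2) by field.
by rewrite distrC; apply: normc_le_ReIm; rewrite ?ReB ?ImB.
Qed.

(** On each side the Cauchy integral is the Poisson integral of one of the two parts, which may be
    replaced by its continuous representative; the limit then exists at every real point. *)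
Lemma Cau_boundary (F G m Gd md : R -> MM) : mL2 G -> Hm m -> (forall p, Hm p -> ip G p = 0) ->
  (forall t, F t = G t - m t) -> {ae mu, forall t, G t = Gd t} -> {ae mu, forall t, m t = md t} ->
  (exists M, forall a b, [/\ continuous (mxRe Gd a b), continuous (mxIm Gd a b),
    forall t, `|mxRe Gd a b t| <= M & forall t, `|mxIm Gd a b t| <= M]) ->
  (exists M, forall a b, [/\ continuous (mxRe md a b), continuous (mxIm md a b),
    forall t, `|mxRe md a b t| <= M & forall t, `|mxIm md a b t| <= M]) ->
  boundary_values (Cau F) Gd md /\ (mL2 Gd /\ nrm Gd = nrm G) /\ (mL2 md /\ nrm md = nrm m).
Proof.
move=> hG hm Gp FE GE mE [M1 h1] [M2 h2].
have mm : mx_measurable md by move=> a b; have [c1 c2 _ _] := h2 a b; split; exact: continuous_measurable_fun.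
have mG : mx_measurable Gd by move=> a b; have [c1 c2 _ _] := h1 a b; split; exact: continuous_measurable_fun.
have hmd := mL2_ae hm.1 mm mE; have hGd := mL2_ae hG mG GE.
split; last by rewrite (nrm_ae hG hGd GE) (nrm_ae hm.1 hmd mE).
have aeR (f g : R -> MM) a b : {ae mu, forall t, f t = g t} -> {ae mu, forall t, mxRe f a b t = mxRe g a b t}.
  by apply: ae_imp => t; rewrite /mxRe => ->.
have aeI (f g : R -> MM) a b : {ae mu, forall t, f t = g t} -> {ae mu, forall t, mxIm f a b t = mxIm g a b t}.
  by apply: ae_imp => t; rewrite /mxIm => ->.
move=> l a b; have [c1 c2 b1 b2] := h1 a b; have [c3 c4 b3 b4] := h2 a b.
split; apply: cvg_within_complex => e e0.
  have [r1 r10 hr1] := poisson_cvg l c1 b1 e0; have [r2 r20 hr2] := poisson_cvg l c2 b2 e0.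
  exists (Num.min r1 r2); first by rewrite lt_min r10.
  move=> [x y] /= y0; rewrite !lt_min => /andP[x1 x2]; rewrite (ger0_norm (ltW y0)) => /andP[y1 y2].
  have [e1 e2 _ _] := Cau_poisson x a b y0 hG hm Gp FE.
  have E1 := etrans e1 (poisson_ae x y0 (mL2_Re a b hG) (mL2_Re a b hGd) (aeR _ _ a b GE)).
  have E2 := etrans e2 (poisson_ae x y0 (mL2_Im a b hG) (mL2_Im a b hGd) (aeI _ _ a b GE)).
  split; first by have := hr1 x y x1 y0 y1; rewrite -E1; exact.
  by have := hr2 x y x2 y0 y2; rewrite -E2; exact.
have [r1 r10 hr1] := poisson_cvg l c3 b3 e0; have [r2 r20 hr2] := poisson_cvg l c4 b4 e0.
exists (Num.min r1 r2); first by rewrite lt_min r10.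
move=> [x y] /= y0; rewrite !lt_min => /andP[x1 x2]; rewrite (ltr0_norm y0) => /andP[y1 y2].
have yn : 0 < - y by rewrite oppr_gt0.
have [_ _ e1 e2] := Cau_poisson x a b yn hG hm Gp FE; rewrite opprK in e1 e2.
have E1 := etrans e1 (poisson_ae x yn (mL2_Re a b hm.1) (mL2_Re a b hmd) (aeR _ _ a b mE)).
have E2 := etrans e2 (poisson_ae x yn (mL2_Im a b hm.1) (mL2_Im a b hmd) (aeI _ _ a b mE)).
split; first by have := hr1 x _ x1 yn y1; rewrite -E1; exact.
by have := hr2 x _ x2 yn y2; rewrite -E2; exact.
Qed.

Lemma bounded_continuousD (f g : R -> MM) : bounded_continuous f -> bounded_continuous g ->
  bounded_continuous (fun t => f t + g t).
Proof.
move=> [d fd [M dM]] [e ge [N eN]]; exists (fun t => d t + e t).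
  by apply: ae_imp2 fd ge => t -> ->.
exists (M + N) => a b; have [c1 c2 b1 b2] := dM a b; have [c3 c4 b3 b4] := eN a b.
have eR : mxRe (fun t => d t + e t) a b = mxRe d a b \+ mxRe e a b.
  by apply/funext => t; rewrite /mxRe /= mxE ReD.
have eI : mxIm (fun t => d t + e t) a b = mxIm d a b \+ mxIm e a b.
  by apply/funext => t; rewrite /mxIm /= mxE ImD.
rewrite eR eI; split.
- by move=> t; apply: cvgD; [exact: c1|exact: c3].
- by move=> t; apply: cvgD; [exact: c2|exact: c4].
- by move=> t; apply: le_trans (ler_normD _ _) _; exact: lerD.
- by move=> t; apply: le_trans (ler_normD _ _) _; exact: lerD.
Qed.

Lemma bounded_continuous_mul (f g : R -> MM) : bounded_continuous f -> bounded_continuous g ->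
  bounded_continuous (fun t => f t *m g t).
Proof.
move=> [d fd [M dM]] [e ge [N eN]]; exists (fun t => d t *m e t).
  by apply: ae_imp2 fd ge => t -> ->.
exists (n%:R * (2 * (`|M| * `|N|))) => a b.
have eR : mxRe (fun t => d t *m e t) a b =
    fun t => \sum_j (mxRe d a j t * mxRe e j b t - mxIm d a j t * mxIm e j b t).
  by apply/funext => t; rewrite /mxRe mxE Re_sum; apply: eq_bigr => j _; rewrite ReM.
have eI : mxIm (fun t => d t *m e t) a b =
    fun t => \sum_j (mxRe d a j t * mxIm e j b t + mxIm d a j t * mxRe e j b t).
  by apply/funext => t; rewrite /mxIm mxE Im_sum; apply: eq_bigr => j _; rewrite ImM.
have bound (u w : R) : `|u| <= M -> `|w| <= N -> `|u * w| <= `|M| * `|N|.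
  by move=> hu hw; rewrite normrM; apply: ler_pM => //; apply: le_trans (ler_norm _).
have sumb (u : 'I_n -> R) : (forall j, `|u j| <= 2 * (`|M| * `|N|)) -> `|\sum_j u j| <= n%:R * (2 * (`|M| * `|N|)).
  move=> hu; apply: le_trans (ler_norm_sum _ _ _) _; apply: le_trans (ler_sum _ (fun j _ => hu j)) _.
  by rewrite sumr_const card_ord -[leLHS]mulr_natl.
rewrite eR eI; split.
- move=> t; apply: cvg_big => [|j _]; first exact: add_continuous.
  have [c1 c2 _ _] := dM a j; have [c3 c4 _ _] := eN j b.
  by apply: cvgB; apply: cvgM; [exact: c1|exact: c3|exact: c2|exact: c4].
- move=> t; apply: cvg_big => [|j _]; first exact: add_continuous.
  have [c1 c2 _ _] := dM a j; have [c3 c4 _ _] := eN j b.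
  by apply: cvgD; apply: cvgM; [exact: c1|exact: c4|exact: c2|exact: c3].
- move=> t; apply: sumb => j; have [_ _ b1 b2] := dM a j; have [_ _ b3 b4] := eN j b.
  by rewrite mulr_natl mulr2n; apply: le_trans (ler_normB _ _) _; apply: lerD; exact: bound.
- move=> t; apply: sumb => j; have [_ _ b1 b2] := dM a j; have [_ _ b3 b4] := eN j b.
  by rewrite mulr_natl mulr2n; apply: le_trans (ler_normD _ _) _; apply: lerD; exact: bound.
Qed.

End boundary_values.

Section one_parameter_derivative.
Context (R : realType) (n : nat).
Local Notation MM := 'M[R[i]]_n.

(** Product rule with three inputs: [v - 1] is differentiated pointwise, [m] through its equation,
    and their product by weak times strong convergence. *)
Lemma weak_derive_density (v w m m' : R -> R -> MM) K c N M :
  (forall s, weight K c (v s)) -> (forall s l, mx_is_derive (fun s => v s l - 1%:M) s (w s l)) ->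
  (forall s, multiplier K (w s)) -> (forall s, mL2 (w s)) -> (forall s, nrm (w s) <= N) ->
  (forall s, mL2 (fun l => v s l - 1%:M)) -> (forall s, nrm (fun l => v s l - 1%:M) <= M) ->
  (forall s, solves (v s) (fun l => v s l - 1%:M) (m s)) ->
  (forall s, solves (v s) (fun l => w s l + m s l *m w s l) (m' s)) ->
  weak_derive (fun s l => (v s l - 1%:M) + m s l *m (v s l - 1%:M))
    (fun s l => w s l + (m' s l *m (v s l - 1%:M) + m s l *m w s l)).
Proof.
move=> wv dv wK hw wN hg gM sm sm'; have c0 : 0 < c by case: (wv 0).
have dg : weak_derive (fun s l => v s l - 1%:M) w by exact: weak_derive_pointwise hg dv wK hw wN.
have dv' s l : mx_is_derive (v ^~ l) s (w s l).
  have := mx_is_derive_addcst 1%:M (dv s l); congr (mx_is_derive _ _ _).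
  by apply/funext => t; rewrite subrK.
have dm := weak_derive_solves wv dv' wK hg hw gM dg sm sm'.
have hm s : mL2 (m s) by case: (sm s) => -[].
have hm' s : mL2 (m' s) by case: (sm' s) => -[].
have vK s : multiplier K (v s) by case: (wv s).
have gK s : multiplier (K + mxfrob (1%:M : MM)) (fun l => v s l - 1%:M).
  have [mv bv] := vK s; split; first by apply: mx_measurableB => //; exact: mx_measurable_cst.
  by apply: ae_imp bv => l h; apply: le_trans (mxfrobD _ _) _; rewrite mxfrobN lerD2r.
have K1 : K <= K + mxfrob (1%:M : MM) by rewrite lerDl mxfrob_ge0.
have mM s : nrm (m s) <= M / c.
  by apply: le_trans (solves_nrm (wv s) (hg s) (sm s)) _; rewrite ler_pM2r ?invr_gt0.
have dmg := @weak_derive_mul _ _ m m' (fun s l => v s l - 1%:M) w (M / c) (K + mxfrob (1%:M : MM)) hm hm' mM dm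
  gK dv (fun s => multiplierW K1 (wK s)).
have h1 s : mL2 (fun l => m s l *m (v s l - 1%:M)) by exact: mL2_mul (hm s) (gK s).
have h2 s : mL2 (fun l => m' s l *m (v s l - 1%:M) + m s l *m w s l).
  by apply: mL2D; [exact: mL2_mul (hm' s) (gK s)|exact: mL2_mul (hm s) (wK s)].
move=> phi hphi s; rewrite (ipDl (hw s) (h2 s) hphi).
rewrite (_ : (fun s => _) = (fun s => ip (fun l => v s l - 1%:M) phi) \+
    (fun s => ip (fun l => m s l *m (v s l - 1%:M)) phi)).
  by apply: is_deriveD; [exact: dg|exact: dmg].
by apply/funext => t /=; rewrite ipDl.
Qed.

End one_parameter_derivative.

(** * Existence, uniqueness, derivatives and decay of the solution *)

Section riemann_hilbert.
Context (R : realType) (n k : nat) (hk : (7 <= k)%N) (v : R -> R -> R -> 'M[R[i]]_n)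
  (hv : scattering_data k v).
Local Notation MM := 'M[R[i]]_n.
Local Notation C := R[i].
Local Notation mu := (@lebesgue_measure R).
Local Notation K := (k - 4)%N.
Local Notation g := (fun x y l => v x y l - 1%:M).

Lemma order_gt0 : (0 < K)%N.
Proof. by rewrite subn_gt0 (leq_trans _ hk). Qed.

Lemma density_L2 x y : mL2 (g x y).
Proof. by have [h _ _] := L2familyP (scattering_L2family hv). Qed.

Lemma wave10_L2 x y : mL2 (wave v 1 0 x y).
Proof. by have [_ h _ _] := wave_bounded hv (leq0n 1) order_gt0. Qed.

Lemma wave11_L2 x y : mL2 (wave v 1 1 x y).
Proof. by have [_ h _ _] := wave_bounded hv (leqnn 1) order_gt0. Qed.

Lemma density_derive_x y s l : mx_is_derive (fun s => g s y l) s (wave v 1 0 s y l).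
Proof.
have := wave_derive_x hv 0 s y l order_gt0; congr (mx_is_derive _ _ _).
by apply/funext => t; rewrite (wave0 hv).
Qed.

Lemma density_derive_y x s l : mx_is_derive (fun s => g x s l) s (wave v 1 1 x s l).
Proof.
have := wave_derive_y hv 0 x s l order_gt0; congr (mx_is_derive _ _ _).
by apply/funext => t; rewrite (wave0 hv).
Qed.

Let wex := cid (scattering_weight hv).
Let Mw := projT1 wex.
Let cex := cid (projT2 wex).
Let cw := projT1 cex.
Let wv : forall x y, weight Mw cw (v x y) := projT2 cex.
Let vK x y : multiplier Mw (v x y). Proof. by case: (wv x y). Qed.
Let cw0 : 0 < cw. Proof. by case: (wv 0 0). Qed.
Definition sol x y : R -> MM := projT1 (cid (solves_exists (wv x y) (density_L2 x y))).

Lemma solP x y : solves (v x y) (g x y) (sol x y).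
Proof. by rewrite /sol; case: cid. Qed.

Lemma sol_L2 x y : mL2 (sol x y).
Proof. by case: (solP x y) => -[]. Qed.

Lemma source_L2 (w : R -> MM) x y M : mL2 w -> multiplier M w ->
  mL2 (fun l => w l + sol x y l *m w l).
Proof. by move=> hw wM; apply: mL2D => //; exact: mL2_mul (sol_L2 x y) wM. Qed.

Let w10 := cid (let: And4 h _ _ _ := wave_bounded hv (leq0n 1) order_gt0 in h).
Let w11 := cid (let: And4 h _ _ _ := wave_bounded hv (leqnn 1) order_gt0 in h).

(** Introduced as the solution of the differentiated equation, so that the regularity and boundary
    lemmas for solutions apply to it; that it is the weak derivative of [sol] enters through
    [weak_derive_density]. *)
Definition sol_x x y : R -> MM :=
  projT1 (cid (solves_exists (wv x y) (source_L2 x y (wave10_L2 x y) (projT2 w10 x y)))).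
Definition sol_y x y : R -> MM :=
  projT1 (cid (solves_exists (wv x y) (source_L2 x y (wave11_L2 x y) (projT2 w11 x y)))).

Lemma sol_xP x y : solves (v x y) (fun l => wave v 1 0 x y l + sol x y l *m wave v 1 0 x y l) (sol_x x y).
Proof. by rewrite /sol_x; case: cid. Qed.

Lemma sol_yP x y : solves (v x y) (fun l => wave v 1 1 x y l + sol x y l *m wave v 1 1 x y l) (sol_y x y).
Proof. by rewrite /sol_y; case: cid. Qed.

(** The density Psi_- (v - 1) of the integral equation, with Psi_- = 1 + [sol]. *)
Definition density x y l := g x y l + sol x y l *m g x y l.

Lemma sol_family : L2family K sol.
Proof.
apply: (L2family_solves wv (scattering_multiplier_family hv) (scattering_L2family hv)) => x y.
exact: solP.
Qed.

Lemma density_family : L2family K density.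
Proof.
apply: L2familyD; first exact: scattering_L2family.
apply: L2family_mul; first exact: sol_family.
have := @wave_multiplier_family _ _ _ _ hv K 0 0 (leqnn _); rewrite add0n => /(_ (leqnn _)).
by congr (multiplier_family _ _); apply/funext => x; apply/funext => y; apply/funext => l; rewrite (wave0 hv).
Qed.

Definition RHsol x y (z : C) : MM := 1%:M + Cau (density x y) z.

(* The density w + m g is (m v + w) - m, with m in H- and m v + w orthogonal to H-: its Cauchy
   integral has these two as boundary values. *)
Lemma family_boundary (m w : R -> R -> R -> MM) (M : R) :
  (forall x y, solves (v x y) (w x y) (m x y)) -> (forall x y, mL2 (w x y)) ->
  (forall x y, nrm (w x y) <= M) ->
  (forall x y, bounded_continuous (m x y)) -> (forall x y, bounded_continuous (w x y)) ->
  boundary_bounded_L2 (fun x y z => Cau (fun l => w x y l + m x y l *m g x y l) z) /\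
  forall x y, exists Fp Fm, [/\ boundary_values (Cau (fun l => w x y l + m x y l *m g x y l)) Fp Fm,
    mL2 Fm & {ae mu, forall t, m x y t = Fm t}].
Proof.
move=> sm hw wM bm bw.
have hm x y : mL2 (m x y) by case: (sm x y) => -[].
have hmv x y : mL2 (fun l => m x y l *m v x y l) by exact: mL2_mul (hm x y) (vK x y).
pose G x y l := m x y l *m v x y l + w x y l.
have hG x y : mL2 (G x y) by exact: mL2D.
have Gp x y p : Hm p -> ip (G x y) p = 0 by case: (sm x y) => _; exact.
have FE x y t : w x y t + m x y t *m g x y t = G x y t - m x y t.
  by rewrite /G mulmxBr mulmx1 addrA [w x y t + _]addrC.
have M0 : 0 <= M := le_trans (nrm_ge0 _) (wM 0 0).
have mM x y : nrm (m x y) <= M / cw.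
  by apply: le_trans (solves_nrm (wv x y) (hw x y) (sm x y)) _; rewrite ler_pM2r ?invr_gt0.
have Mw0 : 0 <= Mw := multiplier_ge0 (vK 0 0).
have GM x y : nrm (G x y) <= n%:R ^+ 2 * Mw * (M / cw) + M.
  apply: le_trans (nrmD (hmv x y) (hw x y)) _; apply: lerD => //.
  apply: le_trans (nrm_mul (hm x y) (vK x y)) _.
  by apply: ler_wpM2l => //; apply: mulr_ge0 => //; exact: exprn_ge0.
have bv x y : bounded_continuous (v x y).
  have b1 : bounded_continuous (g x y).
    by apply: modulus_bounded_continuous; [exact: density_L2|exact: (scattering_modulus hv)].
  have b2 : bounded_continuous (fun=> 1%:M : MM).
    exists (fun=> 1%:M); first exact: ae_all.
    exists 1 => a b; split.
    - by move=> t; exact: cvg_cst.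
    - by move=> t; exact: cvg_cst.
    - by move=> t; rewrite /mxRe mxE; case: (a == b); rewrite /= ?normr1 ?normr0.
    - by move=> t; rewrite /mxIm mxE; case: (a == b); rewrite /= ?normr0.
  have := bounded_continuousD b1 b2; congr bounded_continuous.
  by apply/funext => l; rewrite subrK.
have bG x y : bounded_continuous (G x y) by apply: bounded_continuousD => //; exact: bounded_continuous_mul.
have key x y : exists FF : (R -> MM) * (R -> MM), [/\
    boundary_values (Cau (fun l => w x y l + m x y l *m g x y l)) FF.1 FF.2,
    mx_Lp_le mu 2%:E (n%:R ^+ 2 * Mw * (M / cw) + M) FF.1,
    mx_Lp_le mu 2%:E (M / cw) FF.2 & mL2 FF.2 /\ {ae mu, forall t, m x y t = FF.2 t}].
  have [Gd GE Gb] := bG x y; have [md mE mb] := bm x y.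
  have [h1 [[h2 h3] [h4 h5]]] := Cau_boundary (hG x y) (sm x y).1 (@Gp x y) (FE x y) GE mE Gb mb.
  exists (Gd, md); split => //.
    by apply: mxLnorm2_ge => //; rewrite h3.
  by apply: mxLnorm2_ge => //; rewrite h5.
split; last by move=> x y; have [[Fp Fm] [h1 _ _ [h2 h3]]] := key x y; exists Fp, Fm.
exists (fun x y => (projT1 (cid (key x y))).1), (fun x y => (projT1 (cid (key x y))).2); split.
- by move=> x y; case: cid => FF [].
- by exists (n%:R ^+ 2 * Mw * (M / cw) + M) => x y; case: cid => FF [].
- by exists (M / cw) => x y; case: cid => FF [].
Qed.

Lemma wave_bounded_continuous dir x y : bounded_continuous (wave v 1 (if dir then 0 else 1)%N x y).
Proof.
apply: modulus_bounded_continuous; last exact: (wave_modulus hk hv).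
by case: dir; [exact: wave10_L2|exact: wave11_L2].
Qed.

Lemma sol_modulus x y : modulus (sol x y).
Proof.
exact: (scattering_modulus_solves hv (wv x y) (density_L2 x y) (scattering_modulus hv x y) (solP x y)).
Qed.

Lemma sol_bounded_continuous x y : bounded_continuous (sol x y).
Proof. by apply: modulus_bounded_continuous; [exact: sol_L2|exact: sol_modulus]. Qed.

Lemma source_modulus (w : R -> MM) x y M : mL2 w -> multiplier M w -> modulus w ->
  modulus (fun l => w l + sol x y l *m w l).
Proof.
move=> hw wM mw; apply: modulusD => //; first exact: mL2_mul (sol_L2 x y) wM.
have [L sL] := bounded_continuous_multiplier (sol_L2 x y).1 (sol_bounded_continuous x y).
exact: modulus_mul (sol_L2 x y) sL hw wM (sol_modulus x y) mw.
Qed.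

Lemma source_bounded_continuous (w : R -> MM) x y : bounded_continuous w ->
  bounded_continuous (fun l => w l + sol x y l *m w l).
Proof.
move=> bw; apply: bounded_continuousD => //; apply: bounded_continuous_mul => //.
exact: sol_bounded_continuous.
Qed.

Lemma sol_x_bounded_continuous x y : bounded_continuous (sol_x x y).
Proof.
apply: modulus_bounded_continuous; first by case: (sol_xP x y) => -[].
have hs := source_L2 x y (wave10_L2 x y) (projT2 w10 x y).
apply: (scattering_modulus_solves hv (wv x y) hs _ (sol_xP x y)).
apply: source_modulus; [exact: wave10_L2|exact: (projT2 w10 x y)|exact: (wave_modulus hk hv true)].
Qed.

Lemma sol_y_bounded_continuous x y : bounded_continuous (sol_y x y).
Proof.
apply: modulus_bounded_continuous; first by case: (sol_yP x y) => -[].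
have hs := source_L2 x y (wave11_L2 x y) (projT2 w11 x y).
apply: (scattering_modulus_solves hv (wv x y) hs _ (sol_yP x y)).
apply: source_modulus; [exact: wave11_L2|exact: (projT2 w11 x y)|exact: (wave_modulus hk hv false)].
Qed.

Definition density_x x y l := (wave v 1 0 x y l + sol x y l *m wave v 1 0 x y l) + sol_x x y l *m g x y l.
Definition density_y x y l := (wave v 1 1 x y l + sol x y l *m wave v 1 1 x y l) + sol_y x y l *m g x y l.

Let g_bound : exists M, forall x y, nrm (g x y) <= M.
Proof. by have [_ h _] := L2familyP (scattering_L2family hv). Qed.

Lemma multiplier_density x y : multiplier (Mw + mxfrob (1%:M : MM)) (g x y).
Proof.
have [mv bv] := vK x y; split; first by apply: mx_measurableB => //; exact: mx_measurable_cst.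
by apply: ae_imp bv => l h; apply: le_trans (mxfrobD _ _) _; rewrite mxfrobN lerD2r.
Qed.

Lemma density_x_L2 x y : mL2 (density_x x y).
Proof.
apply: mL2D; first exact: (source_L2 x y (wave10_L2 x y) (projT2 w10 x y)).
by case: (sol_xP x y) => -[h _ _]; exact: mL2_mul h (multiplier_density x y).
Qed.

Lemma density_y_L2 x y : mL2 (density_y x y).
Proof.
apply: mL2D; first exact: (source_L2 x y (wave11_L2 x y) (projT2 w11 x y)).
by case: (sol_yP x y) => -[h _ _]; exact: mL2_mul h (multiplier_density x y).
Qed.

Lemma density_is_L2 x y : mL2 (density x y).
Proof. by have [h _ _] := L2familyP density_family. Qed.

Lemma RHsol_derive_x x y z : complex.Im z != 0 ->
  mx_is_derive (fun s => RHsol s y z) x (Cau (density_x x y) z).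
Proof.
move=> z0; have [M gM] := g_bound; have [_ h1 [N hN] _] := wave_bounded hv (leq0n 1) order_gt0.
pose L := Num.max Mw (projT1 w10).
have wvL s : weight L cw (v s y).
  by case: (wv s y) => a1 a2 a3 a4; split => //; apply: multiplierW a1; rewrite le_max lexx.
have wL s : multiplier L (wave v 1 0 s y) by apply: multiplierW (projT2 w10 s y); rewrite le_max lexx orbT.
have d := weak_derive_density (v := v ^~ y) (w := wave v 1 0 ^~ y) (m := sol ^~ y) (m' := sol_x ^~ y)
  wvL (density_derive_x y) wL (h1 ^~ y) (hN ^~ y) (density_L2 ^~ y) (gM ^~ y) (solP ^~ y) (sol_xP ^~ y).
have E s : density_x s y = fun l => wave v 1 0 s y l + (sol_x s y l *m g s y l + sol s y l *m wave v 1 0 s y l).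
  by apply/funext => l; rewrite /density_x -addrA [X in _ + X]addrC.
have d' : weak_derive (density ^~ y) (density_x ^~ y).
  rewrite (_ : density_x ^~ y = fun s l => wave v 1 0 s y l +
    (sol_x s y l *m g s y l + sol s y l *m wave v 1 0 s y l)); first exact: d.
  by apply/funext => s; exact: E.
rewrite (_ : (fun s => _) = fun s => Cau (density s y) z + 1%:M); last first.
  by apply/funext => s; rewrite /RHsol addrC.
apply: mx_is_derive_addcst.
exact: (@weak_derive_Cau _ _ z z0 (density ^~ y) (density_x ^~ y) x (density_is_L2 ^~ y) (density_x_L2 ^~ y) d').
Qed.

Lemma RHsol_derive_y x y z : complex.Im z != 0 ->
  mx_is_derive (fun s => RHsol x s z) y (Cau (density_y x y) z).
Proof.
move=> z0; have [M gM] := g_bound; have [_ h1 [N hN] _] := wave_bounded hv (leqnn 1) order_gt0.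
pose L := Num.max Mw (projT1 w11).
have wvL s : weight L cw (v x s).
  by case: (wv x s) => a1 a2 a3 a4; split => //; apply: multiplierW a1; rewrite le_max lexx.
have wL s : multiplier L (wave v 1 1 x s) by apply: multiplierW (projT2 w11 x s); rewrite le_max lexx orbT.
have d := weak_derive_density (v := v x) (w := wave v 1 1 x) (m := sol x) (m' := sol_y x)
  wvL (density_derive_y x) wL (h1 x) (hN x) (density_L2 x) (gM x) (solP x) (sol_yP x).
have E s : density_y x s = fun l => wave v 1 1 x s l + (sol_y x s l *m g x s l + sol x s l *m wave v 1 1 x s l).
  by apply/funext => l; rewrite /density_y -addrA [X in _ + X]addrC.
have d' : weak_derive (density x) (density_y x).
  rewrite (_ : density_y x = fun s l => wave v 1 1 x s l +
    (sol_y x s l *m g x s l + sol x s l *m wave v 1 1 x s l)); first exact: d.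
  by apply/funext => s; exact: E.
rewrite (_ : (fun s => _) = fun s => Cau (density x s) z + 1%:M); last first.
  by apply/funext => s; rewrite /RHsol addrC.
apply: mx_is_derive_addcst.
exact: (@weak_derive_Cau _ _ z z0 (density x) (density_y x) y (density_is_L2 x) (density_y_L2 x) d').
Qed.

(** The formulas for the derivatives of the solution hold off the real line, and boundary limits see
    nothing else. *)
Lemma boundary_values_ext (F G : C -> MM) Fp Fm : (forall z, complex.Im z != 0 -> F z = G z) ->
  boundary_values F Fp Fm -> boundary_values G Fp Fm.
Proof.
move=> FG h l a b; have [h1 h2] := h l a b; split.
  apply: cvg_trans h1; apply: near_eq_cvg; rewrite near_withinE; apply: nearW => z /= z0.
  by rewrite FG// gt_eqF.
apply: cvg_trans h2; apply: near_eq_cvg; rewrite near_withinE; apply: nearW => z /= z0.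
by rewrite FG// lt_eqF.
Qed.

Lemma boundary_values_addcst (A : MM) (F : C -> MM) Fp Fm : boundary_values F Fp Fm ->
  boundary_values (fun z => A + F z) (fun t => A + Fp t) (fun t => A + Fm t).
Proof.
move=> h l a b; have [h1 h2] := h l a b; rewrite !mxE.
have E : (fun z : C^o => (A + F z) a b) = fun z : C^o => A a b + F z a b by apply/funext => z; rewrite mxE.
rewrite E; split; first exact: (@cvgD C C^o _ _ _ (fun=> A a b) (fun z => F z a b) _ _ (cvg_cst _) h1).
exact: (@cvgD C C^o _ _ _ (fun=> A a b) (fun z => F z a b) _ _ (cvg_cst _) h2).
Qed.

Lemma Cau_ae (f h : R -> MM) z : mL2 f -> mL2 h -> {ae mu, forall t, f t = h t} -> complex.Im z != 0 ->
  Cau f z = Cau h z.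
Proof.
move=> hf hh fh z0; apply/matrixP => a b; apply: complex_ext.
  by rewrite !Cau_re// (ip_ae hf hh (mL2_kk _ _ _ z0) fh).
by rewrite !Cau_im// (ip_ae hf hh (mL2_kk _ _ _ z0) fh).
Qed.

Let source_bound (w : R -> R -> R -> MM) N (wK : {K0 | forall x y, multiplier K0 (w x y)}) :
  (forall x y, mL2 (w x y)) -> (forall x y, nrm (w x y) <= N) ->
  exists M, forall x y, nrm (fun l => w x y l + sol x y l *m w x y l) <= M.
Proof.
move=> hw wN; have [K0 hK] := wK; have [_ [Ms sM] _] := L2familyP sol_family.
exists (N + n%:R ^+ 2 * K0 * Ms) => x y.
apply: le_trans (nrmD (hw x y) (mL2_mul (sol_L2 x y) (hK x y))) _; apply: lerD => //.
apply: le_trans (nrm_mul (sol_L2 x y) (hK x y)) _; apply: ler_wpM2l => //.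
by apply: mulr_ge0; [exact: exprn_ge0|exact: multiplier_ge0 (hK x y)].
Qed.

Lemma RHsol_family : bounded_rh_family v RHsol.
Proof.
have [M gM] := g_bound.
have bg x y : bounded_continuous (g x y).
  by apply: modulus_bounded_continuous; [exact: density_L2|exact: (scattering_modulus hv)].
have [b1 b2] := family_boundary solP density_L2 gM sol_bounded_continuous bg.
split.
- move=> x y; have [Fp [Fm [h1 h2 h3]]] := b2 x y.
  exists (fun t => 1%:M + Fp t), (fun t => 1%:M + Fm t); split; first exact: boundary_values_addcst.
  (* The integral equation involves the boundary value at each real point, whereas the density was
     built from [sol]; they agree almost everywhere and give the same Cauchy integral. *)
  move=> z z0; pose F t := (1%:M + Fm t) *m g x y t.
  have FE : F = fun t => g x y t + Fm t *m g x y t by apply/funext => t; rewrite /F mulmxDl mul1mx.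
  have hF : mL2 F by rewrite FE; apply: mL2D; [exact: density_L2|exact: mL2_mul h2 (multiplier_density x y)].
  split; first exact: (mx_integrable_kr hF z0).
  have e : Cau (density x y) z = Cau F z.
    apply: (Cau_ae (density_is_L2 x y) hF _ z0).
    by apply: ae_imp h3 => t e; rewrite FE /density e.
  by rewrite /RHsol e.
- move=> z z0; split; split => // l.
  + by case: l => // _ x y; have [] := mx_is_deriveP (RHsol_derive_x x y z0).
  + by case: l => // _ x y; have [] := mx_is_deriveP (RHsol_derive_y x y z0).
- have -> : (fun x y z => RHsol x y z - 1%:M) = fun x y z => Cau (density x y) z.
    by apply/funext => x; apply/funext => y; apply/funext => z; rewrite /RHsol addrC addKr.
  exact: b1.
- have [_ h1 [N hN] _] := wave_bounded hv (leq0n 1) order_gt0.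
  have [Ns hNs] := source_bound w10 h1 hN.
  have [[Fp [Fm [c1 c2 c3]]] _] := family_boundary sol_xP (fun x y => source_L2 x y (h1 x y) (projT2 w10 x y)) hNs
    sol_x_bounded_continuous (fun x y => source_bounded_continuous x y (wave_bounded_continuous true x y)).
  exists Fp, Fm; split => // x y; apply: boundary_values_ext (c1 x y) => z z0.
  by have [_] := mx_is_deriveP (RHsol_derive_x x y z0).
- have [_ h1 [N hN] _] := wave_bounded hv (leqnn 1) order_gt0.
  have [Ns hNs] := source_bound w11 h1 hN.
  have [[Fp [Fm [c1 c2 c3]]] _] := family_boundary sol_yP (fun x y => source_L2 x y (h1 x y) (projT2 w11 x y)) hNs
    sol_y_bounded_continuous (fun x y => source_bounded_continuous x y (wave_bounded_continuous false x y)).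
  exists Fp, Fm; split => // x y; apply: boundary_values_ext (c1 x y) => z z0.
  by have [_] := mx_is_deriveP (RHsol_derive_y x y z0).
Qed.

Lemma boundary_lower_cvg (F : C -> MM) Fp Fm l a b : boundary_values F Fp Fm -> forall e : R, 0 < e ->
  exists2 r, 0 < r & forall x y, `|x - l| < r -> 0 < y -> y < r ->
    `|complex.Re (F (x +i* (- y)) a b) - complex.Re (Fm l a b)| <= e /\
    `|complex.Im (F (x +i* (- y)) a b) - complex.Im (Fm l a b)| <= e.
Proof.
move=> h e e0; have [_ h2] := h l a b.
have eC : 0 < e%:C by rewrite ltcR.
move/cvgrPdist_lt: h2 => /(_ _ eC); rewrite near_withinE => /nbhs_ballP[d /= d0 hd].
have dE : d = (complex.Re d)%:C.
  by move: d0; rewrite ltcE /= => /andP[/eqP im0 _]; apply: complex_ext.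
have dr0 : 0 < complex.Re d by move: d0; rewrite dE ltcR.
(* A third leaves room for the strict inequality: a point with both coordinates within d / 3 has
   modulus at most 2 d / 3. *)
exists (complex.Re d / 3); first by rewrite divr_gt0.
move=> x y xl y0 yd; have := hd (x +i* (- y)); rewrite /= oppr_lt0 => /(_ _ y0) H.
have /H : ball (l%:C : C^o) d (x +i* (- y)).
  rewrite /ball /= dE; apply: (@le_lt_trans _ _ (2 * (complex.Re d / 3))%:C); last first.
    rewrite ltcR; lra.
  apply: normc_le_ReIm; rewrite ?ReB ?ImB /=; first by rewrite distrC ltW.
  by rewrite sub0r opprK ger0_norm ltW.
move=> /ReIm_le_normc[]; rewrite ReB ImB => h3 h4.
by split; rewrite distrC ltW.
Qed.

(** It links the lower boundary value in the integral equation of Psi to the one known to be in L2,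
    which belongs to Psi - 1. *)
Lemma boundary_lower_unique (A : MM) (F G : C -> MM) Fp Fm Gp Gm : boundary_values F Fp Fm -> boundary_values G Gp Gm ->
  (forall z, F z = A + G z) -> Fm = fun t => A + Gm t.
Proof.
move=> hF hG FG; apply/funext => l; apply/matrixP => a b.
have key (u w : R) : (forall e : R, 0 < e -> `|u - w| <= e + e) -> u = w.
  move=> h; apply/eqP; rewrite -subr_eq0 -normr_le0; apply/ler_addgt0Pr => e e0; rewrite add0r.
  by rewrite [e]splitr; apply: h; rewrite divr_gt0.
have both e : 0 < e -> `|complex.Re (Fm l a b) - complex.Re ((A + Gm l) a b)| <= e + e /\
    `|complex.Im (Fm l a b) - complex.Im ((A + Gm l) a b)| <= e + e.
  move=> e0; have [r1 r10 h1] := boundary_lower_cvg l a b hF e0; have [r2 r20 h2] := boundary_lower_cvg l a b hG e0.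
  pose r := Num.min r1 r2 / 2; have r0 : 0 < r by rewrite divr_gt0 ?lt_min ?r10.
  have : r < Num.min r1 r2 by rewrite ltr_pdivrMr// ltr_pMr ?ltr1n// lt_min r10.
  rewrite lt_min => /andP[rr1 rr2].
  have := h1 l r; have := h2 l r; rewrite subrr normr0 => /(_ r20 r0 rr2)[g1 g2] /(_ r10 r0 rr1).
  rewrite FG !mxE !ReD !ImD => -[g3 g4].
  move: g1 g2 g3 g4; rewrite !ler_norml => /andP[??] /andP[??] /andP[??] /andP[??].
  by split; apply/andP; split; lra.
by apply: complex_ext; apply: key => e /both[].
Qed.

(** The lower boundary value [m] of Psi - 1 is shown to lie in H- and to solve the weak problem;
    uniqueness there fixes the density, hence Psi off the real line. *)
Lemma RHsol_unique (Psi : R -> R -> C -> MM) : bounded_rh_family v Psi ->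
  forall x y z, complex.Im z != 0 -> Psi x y z = RHsol x y z.
Proof.
move=> [rh _ [Gp [Gm [bG _ [M GmM]]]] _ _] x y z z0.
have [Pp [Pm [bP PE]]] := rh x y.
have PmE := boundary_lower_unique bP (bG x y) (A := 1%:M) (fun z => esym (subrKC 1%:M (Psi x y z))).
have [hm _] := mxLnorm2_le (GmM x y); set m := Gm x y in hm PmE *.
pose h t := g x y t + m t *m g x y t.
have hh : mL2 h by apply: mL2D; [exact: density_L2|exact: mL2_mul hm (multiplier_density x y)].
have PsiE w : complex.Im w != 0 -> Psi x y w = 1%:M + Cau h w.
  move=> w0; have [_ ->] := PE w w0; rewrite PmE.
  have -> : h = fun t => (1%:M + m t) *m g x y t by apply/funext => t; rewrite mulmxDl mul1mx.
  by [].
have PsiC w : complex.Im w != 0 -> Psi x y w - 1%:M = Cau h w by move=> w0; rewrite PsiE// addrC addKr.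
(* Membership of [m] in H- is not known yet. The density is split by orthogonal projection as
   [G - a], and below the line its Cauchy integral is the Poisson integral of [a], which converges
   to [m]. *)
have w1 := weight1 R n; have [a [Ha sa]] := solves_exists w1 hh.
pose G t := a t + h t; have hG : mL2 G by exact: mL2D Ha.1 hh.
have Gp0 p : Hm p -> ip G p = 0.
  by move=> /sa <-; congr ip; apply/funext => t; rewrite mulmx1.
have hE t : h t = G t - a t by rewrite /G addrAC subrr add0r.
have lim (A B : 'I_n) : {ae mu, forall t, mxRe a A B t = mxRe m A B t} /\ {ae mu, forall t, mxIm a A B t = mxIm m A B t}.
  split; apply: poisson_identification; [exact: mL2_Re A B Ha.1| |exact: mL2_Im A B Ha.1|] => l e e0;
    have [r r0 hr] := boundary_lower_cvg l A B (bG x y) e0; exists r => // s t sl t0 tr;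
    have [h1 h2] := hr s t sl t0 tr; have [_ _ e1 e2] := Cau_poisson s A B t0 hG (conj Ha.1 Ha.2) Gp0 hE;
    have q0 : complex.Im (s +i* (- t)) != 0 by [rewrite /= oppr_eq0 gt_eqF];
    rewrite PsiC// in h1 h2.
    by rewrite -e1.
  by rewrite -e2.
have am : {ae mu, forall t, a t = m t}.
  have : {ae mu, forall t, forall A B, mxRe a A B t = mxRe m A B t /\ mxIm a A B t = mxIm m A B t}.
    apply: filter_forall => A; apply: filter_forall => B; have [h1 h2] := lim A B.
    by apply: ae_imp2 h1 h2 => t.
  by apply: ae_imp => t h1; apply/matrixP => A B; have [h2 h3] := h1 A B; exact: complex_ext.
have Hmm : Hm m by exact: Hm_ae (conj Ha.1 Ha.2) hm.1 am.
(* With [a] equal to [m], the part [G] orthogonal to H- is [m v + (v - 1)]. *)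
have sm : solves (v x y) (g x y) m.
  split=> // p hp; have := Gp0 p hp => <-.
  have hvm : mL2 (fun t => m t *m v x y t + g x y t).
    by apply: mL2D; [exact: mL2_mul hm (vK x y)|exact: density_L2].
  apply: (ip_ae hvm hG hp.1).
  by apply: ae_imp am => t e; rewrite /G /h e mulmxBr mulmx1; apply/matrixP => i j; move: (m t *m v x y t) => A; rewrite !mxE; ring.
have ms := solves_unique (wv x y) (density_L2 x y) sm (solP x y).
rewrite (PsiE _ z0).
have e3 : Cau h z = Cau (density x y) z.
  apply: (Cau_ae hh (density_is_L2 x y) _ z0).
  by apply: ae_imp ms => t e; rewrite /h /density e.
exact: (congr1 (fun A => 1%:M + A) e3).
Qed.

(** The constant cancels in every difference quotient, so the values of the total operator agree
    even at points where no derivative is known to exist. *)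
Lemma mx_derive_addcst (A : MM) (F : R -> MM) x :
  (mx_derivable F x -> mx_derivable (fun s => A + F s) x) /\
  mx_derive (fun s => A + F s) x = mx_derive F x.
Proof.
have key (c : R) (f : R -> R) : (fun h => h^-1 *: ((c + f (h + x)) - (c + f x))) = fun h => h^-1 *: (f (h + x) - f x).
  by apply/funext => h; rewrite opprD addrACA subrr add0r.
have eR a b : mxRe (fun s => A + F s) a b = fun s => complex.Re (A a b) + mxRe F a b s.
  by apply/funext => s; rewrite /mxRe mxE ReD.
have eI a b : mxIm (fun s => A + F s) a b = fun s => complex.Im (A a b) + mxIm F a b s.
  by apply/funext => s; rewrite /mxIm mxE ImD.
split.
  move=> h a b; rewrite eR eI; have [h1 h2] := h a b; split.
    exact: (derivableD (derivable_cst _ _ _) h1).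
  exact: (derivableD (derivable_cst _ _ _) h2).
by apply/matrixP => a b; rewrite !mxE eR eI /derive1 !key.
Qed.

(** The constant 1 survives only when [i] and [j] are both 0; any derivative removes it, hence the
    two alternatives. *)
Lemma RHsol_partial i j z : complex.Im z != 0 -> (i + j <= K)%N ->
  has_partial i j (fun x y => RHsol x y z) /\
  (partial i j (fun x y => RHsol x y z) = partial i j (plane z density) \/
   partial i j (fun x y => RHsol x y z) = fun x y => 1%:M + partial i j (plane z density) x y).
Proof.
move=> z0 ijK; have fam := density_family.
have hasP i' j' : (i' + j' <= K)%N -> has_partial i' j' (plane z density).
  by move: fam; case: K => [|m] fam ij; [move: ij; rewrite leqn0 addn_eq0 => /andP[/eqP -> /eqP ->]; split|
    have [] := L2family_partial z0 fam ij].
have ys l : (0 < l)%N -> partial 0 l (fun x y => RHsol x y z) = partial 0 l (plane z density).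
  case: l => // l _; elim: l => [|l ih]; last by rewrite /partial /= in ih *; rewrite ih.
  apply/funext => x; apply/funext => y.
  exact: (mx_derive_addcst 1%:M (plane z density x) y).2.
have xs l : (0 < l)%N -> partial l 0 (fun x y => RHsol x y z) = partial l 0 (plane z density).
  case: l => // l _; elim: l => [|l ih]; last by rewrite /partial /= in ih *; rewrite ih.
  apply/funext => x; apply/funext => y.
  exact: (mx_derive_addcst 1%:M (fun s => plane z density s y) x).2.
have [h1 h2] := hasP i j ijK.
split; last first.
  case: j ijK h1 h2 => [|j] ijK h1 h2.
    by case: i ijK h1 h2 => [|i] ijK h1 h2; [right|left; exact: xs].
  left; rewrite /partial; have := ys j.+1 isT; rewrite /partial /= => ->.
  by [].
split.
  case=> [|l] lj x y; last by rewrite ys//; exact: h1.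
  by apply: (mx_derive_addcst 1%:M (plane z density x) y).1; exact: (h1 0%N lj x y).
move=> l li x y; case: j ijK h1 h2 => [|j] ijK h1 h2.
  case: l li => [|l] li; last by rewrite xs//; exact: h2.
  by apply: (mx_derive_addcst 1%:M (fun s => plane z density s y) x).1; exact: (h2 0%N li x y).
have E : partial l j.+1 (fun x y => RHsol x y z) = partial l j.+1 (plane z density).
  by have := ys j.+1 isT; rewrite /partial /= => ->.
by rewrite E; exact: h2.
Qed.

(** Nonnegativity of [M] settles the branch in which the norm is 0 by default. *)
Lemma plane_Loo_le (f : R * R -> MM) M : 0 <= M -> (forall p, mxfrob (f p) <= M) ->
  (mxLnorm (mu \x mu)%E +oo f <= M%:E)%E.
Proof.
move=> M0 fM; rewrite /mxLnorm unlock; case: ifP => _; last by rewrite lee_fin.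
apply/ess_supP; apply: ae_all => p /=; rewrite lee_fin ger0_norm ?mxfrob_ge0//.
Qed.

Lemma RHsol_plane i j z : complex.Im z != 0 -> (i + j <= K)%N ->
  [/\ has_partial i j (fun x y => RHsol x y z),
     in_Loo_plane (partial i j (fun x y => RHsol x y z)) &
     vanish_Loo_plane (partial i j (fun x y => RHsol x y z - 1%:M))].
Proof.
move=> z0 ijK; have [h1 h2] := RHsol_partial z0 ijK.
have [G [hG GE mG]] : exists G, [/\ L2family 0 G, partial i j (plane z density) = plane z G &
    mx_measurable (fun p : R * R => plane z G p.1 p.2)].
  move: density_family order_gt0; case: K ijK => // m ijK fam _.
  by have [_] := L2family_partial z0 fam ijK.
have [G1 [M GM] G3] := L2familyP hG.
have [B B0 hB] := plane_frob_le z0 G1.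
have M0 : 0 <= M := le_trans (nrm_ge0 _) (GM 0 0).
have GB x y : mxfrob (plane z G x y) <= B * M by apply: le_trans (hB x y) _; exact: ler_wpM2l.
split => //.
(* Both alternatives at once: [A] is 1 for the function itself and 0 for its derivatives. *)
- have main (A : MM) : partial i j (fun x y => RHsol x y z) = (fun x y => A + plane z G x y) ->
      in_Loo_plane (partial i j (fun x y => RHsol x y z)).
    move=> ->; split.
      move=> a b; have [m1 m2] := mG a b; split.
        rewrite (_ : mxRe _ a b = fun p => complex.Re (A a b) + mxRe (fun p : R * R => plane z G p.1 p.2) a b p).
          exact: measurable_funD.
        by apply/funext => p; rewrite /mxRe mxE ReD.
      rewrite (_ : mxIm _ a b = fun p => complex.Im (A a b) + mxIm (fun p : R * R => plane z G p.1 p.2) a b p).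
        exact: measurable_funD.
      by apply/funext => p; rewrite /mxIm mxE ImD.
    apply: (@le_lt_trans _ _ (mxfrob A + B * M)%:E); last exact: ltry.
    apply: plane_Loo_le => [|p]; first by apply: addr_ge0; [exact: mxfrob_ge0|exact: mulr_ge0].
    by apply: le_trans (mxfrobD _ _) _; rewrite lerD2l.
  rewrite GE in h2; case: h2 => h2; last exact: main h2.
  by apply: (main 0); rewrite h2; apply/funext => x; apply/funext => y; rewrite add0r.
have -> : (fun x y => RHsol x y z - 1%:M) = plane z density.
  by apply/funext => x; apply/funext => y; rewrite /RHsol addrC addKr.
rewrite GE => e e0; have B1 : 0 < B + 1 by rewrite ltr_wpDl.
have [r hr] := G3 (e / (B + 1)) (divr_gt0 e0 B1); exists r => /=.
apply: plane_Loo_le => [|p]; first exact: ltW.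
rewrite /patch; case: ifPn => [|_]; last by rewrite mxfrob0 ltW.
rewrite inE /= => /hr h; apply: le_trans (hB _ _) _.
apply: le_trans (ler_wpM2l B0 h) _; rewrite mulrCA ler_piMr ?(ltW e0)//.
by rewrite ler_pdivrMr// mul1r lerDl.
Qed.

End riemann_hilbert.

Theorem theorem1p3 (R : realType) (n k : nat) (hn : (1 <= n)%N)
    (hk : (7 <= k)%N) (v : R -> R -> R -> 'M[R[i]]_n)
    (hv : scattering_data k v) :
  exists Psi : R -> R -> R[i] -> 'M[R[i]]_n,
    [/\ bounded_rh_family v Psi,
        forall Psi' : R -> R -> R[i] -> 'M[R[i]]_n,
          bounded_rh_family v Psi' ->
          forall (x y : R) (z : R[i]), complex.Im z != 0 ->
            Psi' x y z = Psi x y z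
      & forall z : R[i], complex.Im z != 0 ->
        forall i j : nat, (i + j <= k - 4)%N ->
          [/\ has_partial i j (fun x y => Psi x y z),
              in_Loo_plane (partial i j (fun x y => Psi x y z))
            & vanish_Loo_plane
                (partial i j (fun x y => Psi x y z - 1%:M))]].
Proof.
exists (RHsol hv); split.
- exact: (RHsol_family hk hv).
- by move=> Psi' h x y z z0; exact: RHsol_unique.
- by move=> z z0 i j ij; exact: (RHsol_plane hk hv z0 ij).
Qed.
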